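(* Let $B<0$, $\gamma\ge0$ and $q>0$. Let $\{\psi_n\}$ be a minimizing sequence for $$I_q:=\inf\{E(\psi):\ \psi\in\dot H^1(\mathbb{R};\mathbb{C})\cap L^4(\mathbb{R};\mathbb{C})\ \text{and}\ Q(\psi)=q\},$$ with $E$ and $Q$ as defined in the context. Then there exist $\psi\in\dot H^1(\mathbb{R};\mathbb{C})\cap L^4(\mathbb{R};\mathbb{C})$ and $\{y_n\}\subset\mathbb{R}$ such that, up to a subsequence, $$\psi_n(\cdot+y_n)\to\psi\quad\text{strongly in }\dot H^1(\mathbb{R};\mathbb{C})\cap L^4(\mathbb{R};\mathbb{C}).$$ Moreover, $\psi$ is a minimizer for $I_q$. Hence $\psi$ solves $$-\psi''+A|\psi|^2\psi+B|\psi|^4\psi+\gamma\psi\,(\mathcal{H}(|\psi|^2))'=0$$ in $\dot H^1(\mathbb{R};\mathbb{C})\cap L^4(\mathbb{R};\mathbb{C})$ (i.e. weakly, tested against all functions of this space), where $A=-\mu$ and $\mu=\mu(B,\gamma,q)\in\mathbb{R}$ is the Lagrange multiplier.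
   Context: $\mathcal{H}$ is the Hilbert transform on $\mathbb{R}$, $\mathcal{H}f(x)=\frac1\pi\,\mathrm{p.v.}\int_{\mathbb{R}}\frac{f(y)}{x-y}\,dy$ (Fourier symbol $-i\,\mathrm{sgn}\,\xi$); $|D|=\partial_x\mathcal{H}$, and $|D|^{1/2}$ is its nonnegative square root. $\dot H^1\cap L^4$ consists of the $f\in L^4$ with weak derivative $f'\in L^2$, normed by $|f|_{\dot H^1}+\|f\|_{L^4}$, where $|f|_{\dot H^1}$ is (a constant multiple of) $\|f'\|_{L^2}$. For $\psi\in\dot H^1\cap L^4$, $$E(\psi):=\int_{\mathbb{R}}\Big(\tfrac12|\psi'|^2+\tfrac B6|\psi|^6+\tfrac\gamma4\big(|D|^{1/2}|\psi|^2\big)^2\Big)dx,\qquad Q(\psi):=\tfrac14\int_{\mathbb{R}}|\psi|^4dx.$$ A minimizing sequence satisfies $Q(\psi_n)=q$ and $E(\psi_n)\to I_q$; a minimizer satisfies $Q(\psi)=q$, $E(\psi)=I_q$. The Lagrange multiplier is the number $\mu$ with $E'(\psi)=\mu Q'(\psi)$. *)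

(* Defs.v *)
From HB Require Import structures.
From mathcomp Require Export all_boot all_order all_algebra.
From mathcomp Require Export all_classical all_reals all_analysis.
From mathcomp Require Export complex.

Set Implicit Arguments.
Unset Strict Implicit.
Unset Printing Implicit Defensive.

Import Order.TTheory GRing.Theory Num.Theory.
Import numFieldNormedType.Exports.
Import ComplexField.Normc.

Local Open Scope classical_set_scope.
Local Open Scope ring_scope.
Local Open Scope complex_scope.

Section Defs.
Context {R : realType}.
Local Notation mu := (@lebesgue_measure R).

(* Functions are everywhere-defined Borel representatives; no quotient by
   almost-everywhere equality is taken. *)

Definition cintegral (D : set R) (f : R -> R[i]) : R[i] :=
  (\int[mu]_(x in D) complex.Re (f x)) +i* (\int[mu]_(x in D) complex.Im (f x)).

Definition cLnorm (p : \bar R) (f : R -> R[i]) : \bar R :=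
  Lnorm mu p (fun x => (normc (f x))%:E).

Definition cLp (p : \bar R) (f : R -> R[i]) : Prop :=
  [/\ measurable_fun setT (fun x => complex.Re (f x)),
      measurable_fun setT (fun x => complex.Im (f x)) &
      (cLnorm p f < +oo)%E].

Definition test_function (phi : R -> R) : Prop :=
  [/\ forall x, derivable phi x 1,
      continuous (derive1 phi) &
      exists M : R, forall x, M <= `|x| -> phi x = 0].

(* The one-dimensional convention with test functions in C^1_c; it defines the
   same derivative as C^oo_c. *)
Definition is_weak_derivative (f g : R -> R) : Prop :=
  [/\ locally_integrable setT f, locally_integrable setT g &
      forall phi, test_function phi ->
        \int[mu]_x (f x * derive1 phi x) = - \int[mu]_x (g x * phi x)].

(* The zero function when [f] is not weakly differentiable. *)
Definition weak_derivative (f : R -> R) : R -> R :=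
  xget (fun=> 0) [set g | is_weak_derivative f g].

Definition is_cweak_derivative (f g : R -> R[i]) : Prop :=
  is_weak_derivative (fun x => complex.Re (f x)) (fun x => complex.Re (g x)) /\
  is_weak_derivative (fun x => complex.Im (f x)) (fun x => complex.Im (g x)).

Definition cweak_derivative (f : R -> R[i]) : R -> R[i] := fun x =>
  weak_derivative (fun y => complex.Re (f y)) x +i*
  weak_derivative (fun y => complex.Im (f y)) x.

(* No truncation at infinity: for [f] in L^2 the integrand is integrable on
   [e < |x - y|]. *)
Definition hilbert (f : R -> R) : R -> R := fun x =>
  pi^-1 * lim ((fun e : R =>
    \int[mu]_(y in [set y | e < `|x - y|]) (f y / (x - y))) @ 0^'+).

Definition truncated_fourier (n : nat) (f : R -> R[i]) : R -> R[i] := fun xi =>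
  cintegral `[- n%:R, n%:R]
    (fun x => (cos (x * xi) -i* sin (x * xi)) * f x).

(* [F] is the L^2 (Plancherel) Fourier transform of [f], normalised as
   the integral of [exp (- i x xi) f x]. *)
Definition is_fourier (f F : R -> R[i]) : Prop :=
  [/\ cLp 2%:E f, cLp 2%:E F &
      (fun n => cLnorm 2%:E (fun xi => truncated_fourier n f xi - F xi))
        @ \oo --> 0%E].

(* [g = |D|^(1/2) f]: the Hilbert transform has symbol [-i sgn xi], hence
   [|D| = d/dx o hilbert] has symbol [|xi|] and its nonnegative square root is
   the multiplier [|xi|^(1/2)], which preserves real-valued functions. *)
Definition is_half_derivative (f g : R -> R) : Prop :=
  exists F : R -> R[i],
    is_fourier (fun x => (f x)%:C) F /\
    is_fourier (fun x => (g x)%:C) (fun xi => (Num.sqrt `|xi|)%:C * F xi).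

(* The zero function when [f] is not in the domain of [|D|^(1/2)]. *)
Definition half_derivative (f : R -> R) : R -> R :=
  xget (fun=> 0) [set g | is_half_derivative f g].

Definition spaceX (psi : R -> R[i]) : Prop :=
  cLp 4%:E psi /\
  exists dpsi, is_cweak_derivative psi dpsi /\ cLp 2%:E dpsi.

Definition normX (psi : R -> R[i]) : \bar R :=
  (cLnorm 2%:E (cweak_derivative psi) + cLnorm 4%:E psi)%E.

Definition density (psi : R -> R[i]) : R -> R := fun x => normc (psi x) ^+ 2.

Definition energy (B gamma : R) (psi : R -> R[i]) : R :=
  \int[mu]_x (2^-1 * normc (cweak_derivative psi x) ^+ 2
              + B / 6 * normc (psi x) ^+ 6
              + gamma / 4 * half_derivative (density psi) x ^+ 2).

Definition charge4 (psi : R -> R[i]) : R :=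
  4^-1 * \int[mu]_x (normc (psi x) ^+ 4).

Definition inf_energy (B gamma q : R) : \bar R :=
  ereal_inf [set (energy B gamma psi)%:E | psi in
               [set psi | spaceX psi /\ charge4 psi = q]].

Definition minimizing_sequence (B gamma q : R) (psi_ : nat -> R -> R[i]) : Prop :=
  (forall n, spaceX (psi_ n) /\ charge4 (psi_ n) = q) /\
  (fun n => (energy B gamma (psi_ n))%:E) @ \oo --> inf_energy B gamma q.

Definition minimizer (B gamma q : R) (psi : R -> R[i]) : Prop :=
  [/\ spaceX psi, charge4 psi = q &
      (energy B gamma psi)%:E = inf_energy B gamma q].

(* [L] is the Frechet derivative at [psi] of [F], over the real normed space
   of the functions satisfying [spaceX]. *)
Definition frechet_derivative (F : (R -> R[i]) -> R) (psi : R -> R[i])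
    (L : (R -> R[i]) -> R) : Prop :=
  [/\ forall (a : R) phi chi, spaceX phi -> spaceX chi ->
        L (fun x => a%:C * phi x + chi x) = a * L phi + L chi,
      exists C : R, forall phi, spaceX phi ->
        (`|L phi|%:E <= C%:E * normX phi)%E &
      forall eps : R, 0 < eps -> exists2 delta : R, 0 < delta &
        forall phi, spaceX phi -> (normX phi < delta%:E)%E ->
          (`|F (psi \+ phi) - F psi - L phi|%:E <= eps%:E * normX phi)%E].

Definition lagrange_multiplier (B gamma : R) (psi : R -> R[i]) (m : R) : Prop :=
  exists dE dQ : (R -> R[i]) -> R,
    [/\ frechet_derivative (energy B gamma) psi dE,
        frechet_derivative charge4 psi dQ &
        forall phi, spaceX phi -> dE phi = m * dQ phi].

Definition weak_solution (A B gamma : R) (psi : R -> R[i]) : Prop :=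
  exists w : R -> R,
    [/\ is_weak_derivative (hilbert (density psi)) w,
        w \in Lfun mu 2%:E &
        forall phi, spaceX phi ->
          cintegral setT (fun x =>
            cweak_derivative psi x * conjc (cweak_derivative phi x)
            + (A * normc (psi x) ^+ 2 + B * normc (psi x) ^+ 4
               + gamma * w x)%:C * psi x * conjc (phi x)) = 0].

End Defs.

(* Main.v *)
(** Scaling [psi] to [sqrt s * psi (s x)] gives [I_(s q) = s^2 I_q], with
    [I_q < 0], so that the functional [J = E - (I_q / q^2) Q^2] is nonnegative
    on the whole space and vanishes exactly at the minimizers; differentiating
    [J] at a minimizer yields the Lagrange multiplier [m = 2 I_q / q].

    Compactness: negativity of [I_q] prevents vanishing, so after translation
    the minimizing sequence has a nonzero locally uniform limit [psi] along a
    subsequence.  The energy and the charge split asymptotically between [psi]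
    and the remainder [r_n] (Brezis-Lieb), and [J >= 0] applied to both gives
    [theta^2 + (q - theta)^2 >= q^2] for [theta = Q(psi)], hence
    [theta = q] and [E(r_n) -> 0], [Q(r_n) -> 0], which is strong convergence.

    The nonlocal term is handled through the Hartley transform, the real
    symmetric form of the Fourier transform with kernel [cos + sin]: Plancherel
    follows from the Poisson kernel, and the Hilbert transform of an [H^1]
    function is the limit of its conjugate Poisson integrals, whose spectral
    form identifies its weak derivative with [|D|]. *)
Require Import Defs.
From mathcomp Require Import measurable_realfun ring lra.

Set Implicit Arguments.
Unset Strict Implicit.
Unset Printing Implicit Defensive.

Import Order.TTheory GRing.Theory Num.Theory.
Import numFieldNormedType.Exports.
Import ComplexField.Normc.

Local Open Scope classical_set_scope.
Local Open Scope ring_scope.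
Local Open Scope complex_scope.

(** * Integrals of real functions on the line *)

Section Integrals.
Context {R : realType}.
Local Notation mu := (@lebesgue_measure R).
Implicit Types f g h : R -> R.

(** A function of the space need not be in L^2, so Fourier analysis is applied only to its density
    [rho]: this is in L^2 because the function is in L^4, and its derivative is in L^2 because the
    function is bounded. The nonlocal energy is then the quadratic form of [Dabs] on H^1, and the
    Hilbert transform of [rho] is an absolutely convergent integral. Adding [r] to [p] changes the
    density by [2 * crs p r + rho r], with [crs p r ^+ 2 <= rho p * rho r] pointwise. This
    inequality serves twice: it makes the increment of order [nrm r], which gives the
    differentiability of both functionals, and it turns the weak decay of [rho (r n)] into strong
    decay of [crs p (r n)], which gives the splitting. Under the scaling of the overview the
    kinetic, sextic and nonlocal terms all acquire the same factor [s^2]. This is why [E] is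
    compared with [Q^2], why splitting the charge strictly costs energy, and why the multiplier
    depends on [B], [gamma] and [q] alone, so that it can be fixed before the sequence. *)

Definition integr f := mu.-integrable setT (EFin \o f).

Definition aeq f g := {ae mu, forall x : measurableTypeR R, f x = g x}.

Lemma integr_meas f : integr f -> measurable_fun setT f.
Proof. by move/integrableP => [/measurable_EFinP]. Qed.

Lemma integrP f : measurable_fun setT f ->
  (\int[mu]_x `|f x|%:E < +oo)%E -> integr f.
Proof. by move=> mf fi; apply/integrableP; split => //; exact/measurable_EFinP. Qed.

Lemma le_integr f g : measurable_fun setT f -> (forall x, `|f x| <= g x) ->
  integr g -> integr f.
Proof.
move=> mf fg; apply: le_integrable => //; first exact/measurable_EFinP.
by move=> x _ /=; rewrite lee_fin (le_trans (fg x))// ler_norm.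
Qed.

Lemma integrD f g : integr f -> integr g -> integr (fun x => f x + g x).
Proof. by move=> fi gi; have := integrableD measurableT fi gi. Qed.

Lemma integrB f g : integr f -> integr g -> integr (fun x => f x - g x).
Proof. by move=> fi gi; have := integrableB measurableT fi gi. Qed.

Lemma integrZ c f : integr f -> integr (fun x => c * f x).
Proof. by move=> fi; have := integrableZl measurableT c fi. Qed.

Lemma integrN f : integr f -> integr (fun x => - f x).
Proof. by move=> fi; have := integrableN fi. Qed.

Lemma integr_norm f : integr f -> integr (fun x => `|f x|).
Proof. exact: integrable_norm. Qed.

Lemma integr0 : integr (fun=> 0).
Proof. exact: integrable0. Qed.

Lemma eq_integr f g : f =1 g -> integr f -> integr g.
Proof. by move=> /funext ->. Qed.

Lemma IntD f g : integr f -> integr g ->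
  \int[mu]_x (f x + g x) = \int[mu]_x f x + \int[mu]_x g x.
Proof. exact: RintegralD. Qed.

Lemma IntB f g : integr f -> integr g ->
  \int[mu]_x (f x - g x) = \int[mu]_x f x - \int[mu]_x g x.
Proof. exact: RintegralB. Qed.

Lemma IntZ c f : integr f -> \int[mu]_x (c * f x) = c * \int[mu]_x f x.
Proof. exact: RintegralZl. Qed.

Lemma IntN f : integr f -> \int[mu]_x (- f x) = - \int[mu]_x f x.
Proof.
move=> fi; rewrite -mulN1r -IntZ//.
by apply: eq_Rintegral => x _; rewrite mulN1r.
Qed.

Lemma eq_Int f g : f =1 g -> \int[mu]_x f x = \int[mu]_x g x.
Proof. by move=> /funext ->. Qed.

Lemma Int0 : \int[mu]_x 0 = 0 :> R.
Proof. by rewrite /Rintegral integral0. Qed.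

Lemma le_Int f g : integr f -> integr g -> (forall x, f x <= g x) ->
  \int[mu]_x f x <= \int[mu]_x g x.
Proof. by move=> fi gi fg; exact: le_Rintegral. Qed.

Lemma norm_Int f : integr f -> `|\int[mu]_x f x| <= \int[mu]_x `|f x|.
Proof. exact: le_normr_Rintegral. Qed.

Lemma EFin_Int f : integr f -> (\int[mu]_x (f x)%:E)%E = (\int[mu]_x f x)%:E.
Proof. by move=> fi; rewrite fineK//; exact: integrable_fin_num. Qed.

Lemma Int_ge0 f : (forall x, 0 <= f x) -> 0 <= \int[mu]_x f x.
Proof. by move=> f0; exact: Rintegral_ge0. Qed.

Lemma aeq_refl f : aeq f f. Proof. exact: aeW. Qed.

Lemma aeq_sym f g : aeq f g -> aeq g f.
Proof. by move=> fg; apply: filterS fg => x ->. Qed.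

Lemma aeq_trans f g h : aeq f g -> aeq g h -> aeq f h.
Proof. by move=> fg gh; apply: filterS2 fg gh => x -> ->. Qed.

Lemma aeq_Int f g : measurable_fun setT f -> measurable_fun setT g -> aeq f g ->
  \int[mu]_x f x = \int[mu]_x g x.
Proof.
move=> mf mg fg; congr fine; apply: ae_eq_integral => //.
- exact/measurable_EFinP.
- exact/measurable_EFinP.
- by apply: filterS fg => x -> _.
Qed.

Lemma aeq_integr f g : measurable_fun setT g -> aeq f g -> integr f -> integr g.
Proof.
move=> mg fg fi; apply: integrP => //.
rewrite (_ : integral _ _ _ = \int[mu]_x `|f x|%:E)%E.
  by case/integrableP: fi.
apply: ae_eq_integral => //.
- exact/measurable_EFinP/measurableT_comp.
- by apply/measurable_EFinP/measurableT_comp => //; exact: integr_meas.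
- by apply: filterS fg => x -> _.
Qed.

Lemma Int_eq0 f : integr f -> (forall x, 0 <= f x) -> \int[mu]_x f x = 0 ->
  aeq f (fun=> 0).
Proof.
move=> fi f0 If0.
have : (\int[mu]_(x in setT) `|(EFin \o f) x| = 0)%E.
  rewrite (_ : integral _ _ _ = \int[mu]_x (f x)%:E)%E; last first.
    by apply: eq_integral => x _ /=; rewrite ger0_norm.
  by rewrite EFin_Int// If0.
move/(ae_eq_integral_abs mu measurableT (measurable_int _ fi)).
by move=> H; apply: filterS H => x /= /(_ Logic.I)[].
Qed.

End Integrals.

Arguments aeq {R}.

(** * Square-integrable functions *)

Section L2.
Context {R : realType}.
Local Notation mu := (@lebesgue_measure R).
Implicit Types f g h : R -> R.

Definition L2 f := measurable_fun setT f /\ integr (fun x => f x ^+ 2).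

Definition ip f g : R := \int[mu]_x (f x * g x).

Definition n2 f : R := Num.sqrt (ip f f).

Lemma L2_meas f : L2 f -> measurable_fun setT f. Proof. by case. Qed.

Lemma L2M f g : L2 f -> L2 g -> integr (fun x => f x * g x).
Proof.
move=> [mf fi] [mg gi].
apply: (@le_integr _ _ (fun x => f x ^+ 2 + g x ^+ 2)).
- exact: measurable_funM.
- move=> x; rewrite normrM -(normr_id (f x)) -(normr_id (g x)).
  rewrite -[X in _ <= X + _]real_normK ?num_real// -[X in _ <= _ + X]real_normK ?num_real//.
  rewrite !normr_id.
  set a := `|f x|; set b := `|g x|; nra.
- exact: integrD.
Qed.

Lemma L2D f g : L2 f -> L2 g -> L2 (fun x => f x + g x).
Proof.
move=> Lf Lg; have [mf fi] := Lf; have [mg gi] := Lg.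
split; first exact: measurable_funD.
apply: (@eq_integr _ (fun x => (f x ^+ 2 + 2 * (f x * g x)) + g x ^+ 2)).
  by move=> x; ring.
by apply: integrD => //; apply: integrD => //; apply: integrZ; exact: L2M.
Qed.

Lemma L2Z c f : L2 f -> L2 (fun x => c * f x).
Proof.
move=> [mf fi]; split; first exact: measurable_funM.
apply: (@eq_integr _ (fun x => c ^+ 2 * f x ^+ 2)); last exact: integrZ.
by move=> x; ring.
Qed.

Lemma L2N f : L2 f -> L2 (fun x => - f x).
Proof. by move=> /(L2Z (-1)); under eq_fun do rewrite mulN1r. Qed.

Lemma L2B f g : L2 f -> L2 g -> L2 (fun x => f x - g x).
Proof. by move=> Lf Lg; apply: L2D => //; exact: L2N. Qed.

Lemma L20 : L2 (fun=> 0).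
Proof. by split => //; under eq_fun do rewrite expr0n/=; exact: integr0. Qed.

Lemma L2_le f g : measurable_fun setT f -> (forall x, `|f x| <= `|g x|) ->
  L2 g -> L2 f.
Proof.
move=> mf fg [mg gi]; split => //; apply: le_integr gi.
  exact: measurable_funX.
by move=> x; rewrite normrX -[leRHS]real_normK ?num_real// lerXn2r// nnegrE.
Qed.

Lemma L2_norm f : L2 f -> L2 (fun x => `|f x|).
Proof.
move=> Lf; apply: L2_le (Lf); last by move=> x; rewrite normr_id.
by apply: measurableT_comp => //; exact: L2_meas.
Qed.

Lemma L2_Ml c h f : measurable_fun setT h -> (forall x, `|h x| <= c) -> L2 f ->
  L2 (fun x => h x * f x).
Proof.
move=> mh hc Lf; apply: L2_le (L2Z c Lf).
  by apply: measurable_funM => //; exact: L2_meas.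
by move=> x; rewrite !normrM ler_wpM2r// (le_trans (hc x))// ler_norm.
Qed.

Lemma aeq_L2 f g : measurable_fun setT g -> aeq f g -> L2 f -> L2 g.
Proof.
move=> mg fg [mf fi]; split => //; apply: aeq_integr fi.
  exact: measurable_funX.
by apply: filterS fg => x ->.
Qed.

Lemma ipC f g : ip f g = ip g f.
Proof. by apply: eq_Int => x; rewrite mulrC. Qed.

Lemma ipDl f g h : L2 f -> L2 g -> L2 h ->
  ip (fun x => f x + g x) h = ip f h + ip g h.
Proof.
move=> Lf Lg Lh; rewrite /ip -IntD; [|exact: L2M|exact: L2M].
by apply: eq_Int => x; rewrite mulrDl.
Qed.

Lemma ipZl c f h : L2 f -> L2 h -> ip (fun x => c * f x) h = c * ip f h.
Proof.
move=> Lf Lh; rewrite /ip -IntZ; last exact: L2M.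
by apply: eq_Int => x; rewrite mulrA.
Qed.

Lemma ipNl f h : L2 f -> L2 h -> ip (fun x => - f x) h = - ip f h.
Proof.
by move=> Lf Lh; rewrite -mulN1r -ipZl//; apply: eq_Int => x; rewrite mulN1r.
Qed.

Lemma ipBl f g h : L2 f -> L2 g -> L2 h ->
  ip (fun x => f x - g x) h = ip f h - ip g h.
Proof. by move=> Lf Lg Lh; rewrite ipDl ?ipNl//; exact: L2N. Qed.

Lemma ipDr f g h : L2 f -> L2 g -> L2 h ->
  ip h (fun x => f x + g x) = ip h f + ip h g.
Proof. by move=> *; rewrite !(ipC h) ipDl. Qed.

Lemma ipBr f g h : L2 f -> L2 g -> L2 h ->
  ip h (fun x => f x - g x) = ip h f - ip h g.
Proof. by move=> *; rewrite !(ipC h) ipBl. Qed.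

Lemma ipZr c f h : L2 f -> L2 h -> ip h (fun x => c * f x) = c * ip h f.
Proof. by move=> *; rewrite !(ipC h) ipZl. Qed.

Lemma ipNr f h : L2 f -> L2 h -> ip h (fun x => - f x) = - ip h f.
Proof. by move=> *; rewrite !(ipC h) ipNl. Qed.

Lemma ip0l h : ip (fun=> 0) h = 0.
Proof. by rewrite /ip; under eq_Rintegral do rewrite mul0r; exact: Int0. Qed.

Lemma ip_ge0 f : 0 <= ip f f.
Proof. by apply: Int_ge0 => x; rewrite -expr2 sqr_ge0. Qed.

Lemma n2_ge0 f : 0 <= n2 f. Proof. exact: sqrtr_ge0. Qed.

Lemma n2_sqr f : n2 f ^+ 2 = ip f f.
Proof. by rewrite sqr_sqrtr// ip_ge0. Qed.

Lemma eq_ip f f' g g' : f =1 f' -> g =1 g' -> ip f g = ip f' g'.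
Proof. by move=> /funext -> /funext ->. Qed.

Lemma aeq_ip f f' g g' : measurable_fun setT f -> measurable_fun setT f' ->
  measurable_fun setT g -> measurable_fun setT g' ->
  aeq f f' -> aeq g g' -> ip f g = ip f' g'.
Proof.
move=> mf mf' mg mg' ff gg; apply: aeq_Int; try exact: measurable_funM.
by apply: filterS2 ff gg => x -> ->.
Qed.

Lemma aeq_n2 f f' : measurable_fun setT f -> measurable_fun setT f' ->
  aeq f f' -> n2 f = n2 f'.
Proof. by move=> mf mf' ff; rewrite /n2 (@aeq_ip f f' f f'). Qed.

Lemma n2N f : n2 (fun x => - f x) = n2 f.
Proof. by congr Num.sqrt; apply: eq_Int => x; rewrite mulrNN. Qed.

Lemma n2BC f g : n2 (fun x => f x - g x) = n2 (fun x => g x - f x).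
Proof. by rewrite -n2N; congr n2; apply/funext => x; rewrite opprB. Qed.

Lemma n2Z c f : L2 f -> n2 (fun x => c * f x) = `|c| * n2 f.
Proof.
move=> Lf; rewrite /n2 ipZl//; last exact: L2Z.
by rewrite ipZr// mulrA -expr2 sqrtrM ?sqr_ge0// sqrtr_sqr.
Qed.

Lemma ip_sqr_le f g : L2 f -> L2 g -> ip f g ^+ 2 <= ip f f * ip g g.
Proof.
move=> Lf Lg.
have H t : 0 <= ip f f - 2 * t * ip f g + t ^+ 2 * ip g g.
  have := ip_ge0 (fun x => f x - t * g x).
  have Lt := L2Z t Lg; have Lft := L2B Lf Lt.
  rewrite ipBl// !ipBr// !ipZl// !ipZr// (ipC g f) => H.
  by rewrite (_ : _ + _ = ip f f - t * ip f g - (t * ip f g - t * (t * ip g g)))//; ring.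
have [g0|g0] := eqVneq (ip g g) 0.
  rewrite g0 mulr0; have [->|n0] := eqVneq (ip f g) 0; first by rewrite expr0n.
  (* When [ip g g = 0] the quadratic degenerates to an affine function of [t]; at this [t] it equals
     [-1]. *)
  have := H ((ip f f + 1) / (2 * ip f g)).
  rewrite g0 mulr0 addr0 (_ : 2 * _ * _ = ip f f + 1); first lra.
  by field.
have gp : 0 < ip g g by rewrite lt_def g0 ip_ge0.
have := H (ip f g / ip g g).
rewrite (_ : _ + _ = ip f f - ip f g ^+ 2 / ip g g); last by field.
by rewrite subr_ge0 ler_pdivrMr.
Qed.

Lemma ip_le f g : L2 f -> L2 g -> `|ip f g| <= n2 f * n2 g.
Proof.
move=> Lf Lg; rewrite -sqrtr_sqr -sqrtrM ?ip_ge0// ler_wsqrtr//.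
exact: ip_sqr_le.
Qed.

Lemma n2_le f g : L2 f -> L2 g -> (forall x, `|f x| <= `|g x|) -> n2 f <= n2 g.
Proof.
move=> [mf fi] [mg gi] fg; apply: ler_wsqrtr; apply: le_Int.
- exact: fi.
- exact: gi.
- move=> x; rewrite -!expr2 -[leRHS]real_normK ?num_real//.
  by rewrite -[leLHS]real_normK ?num_real// lerXn2r// nnegrE.
Qed.

Lemma n2D f g : L2 f -> L2 g -> n2 (fun x => f x + g x) <= n2 f + n2 g.
Proof.
move=> Lf Lg; rewrite -(@ler_pXn2r _ 2)// ?nnegrE ?addr_ge0 ?n2_ge0//.
have Lfg := L2D Lf Lg.
rewrite n2_sqr ipDl// !ipDr// (ipC g f) sqrrD !n2_sqr.
have := ip_le Lf Lg; rewrite ler_norml => /andP[_]; lra.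
Qed.

Lemma n2B f g : L2 f -> L2 g -> n2 (fun x => f x - g x) <= n2 f + n2 g.
Proof. by move=> Lf Lg; rewrite -(n2N g); apply: n2D => //; exact: L2N. Qed.

Lemma n2_triangle f g h : L2 f -> L2 g -> L2 h ->
  n2 (fun x => f x - h x) <= n2 (fun x => f x - g x) + n2 (fun x => g x - h x).
Proof.
move=> Lf Lg Lh.
rewrite (_ : (fun x => f x - h x) = (fun x => (f x - g x) + (g x - h x))).
  by apply: n2D; exact: L2B.
by apply/funext => x; ring.
Qed.

Lemma n2_dist f g : L2 f -> L2 g -> `|n2 f - n2 g| <= n2 (fun x => f x - g x).
Proof.
move=> Lf Lg; have H a b : L2 a -> L2 b -> n2 a <= n2 (fun x => a x - b x) + n2 b.
  move=> La Lb; have := n2D (L2B La Lb) Lb.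
  by rewrite (_ : (fun x => _) = a)//; apply/funext => x; rewrite subrK.
have := H _ _ Lf Lg; have := H _ _ Lg Lf; rewrite (n2BC g f) => H1 H2.
by rewrite ler_norml; apply/andP; split; lra.
Qed.

Lemma n2_eq0 f : L2 f -> n2 f = 0 -> aeq f (fun=> 0).
Proof.
move=> [mf fi] f0.
have : aeq (fun x => f x ^+ 2) (fun=> 0).
  apply: Int_eq0 => //; first by move=> x; exact: sqr_ge0.
  by have := n2_sqr f; rewrite f0 expr0n.
by move=> H; apply: filterS H => x /eqP; rewrite sqrf_eq0 => /eqP.
Qed.

Lemma ip_orth_eq0 f : L2 f -> (forall g, L2 g -> ip f g = 0) -> aeq f (fun=> 0).
Proof. by move=> Lf H; apply: n2_eq0 => //; rewrite /n2 H// sqrtr0. Qed.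

Lemma aeqB f g : aeq (fun x => f x - g x) (fun=> 0) -> aeq f g.
Proof. by move=> H; apply: filterS H => x /eqP; rewrite subr_eq0 => /eqP. Qed.

End L2.

(** * Fatou, dominated convergence and completeness of L^2 *)

Section Limits.
Context {R : realType}.
Local Notation mu := (@lebesgue_measure R).
Implicit Types f g h : R -> R.

Lemma fatou_integr (h : nat -> R -> R) f C :
  (forall k, integr (h k)) -> (forall k x, 0 <= h k x) ->
  measurable_fun setT f -> (forall x, 0 <= f x) ->
  {ae mu, forall x : measurableTypeR R, h ^~ x @ \oo --> f x} ->
  (forall k, \int[mu]_x h k x <= C) ->
  integr f /\ \int[mu]_x f x <= C.
Proof.
move=> hi h0 mf f0 hf hC.
have mh k : measurable_fun setT (EFin \o h k).
  by apply/measurable_EFinP; exact: integr_meas.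
have E : (\int[mu]_x (f x)%:E = \int[mu]_x limn_einf (fun k => (h k x)%:E))%E.
  apply: ae_eq_integral => //.
  - exact/measurable_EFinP.
  - rewrite (_ : (fun x => _) = (fun x => - limn_esup (fun k => - (h k x)%:E))%E).
      apply: measurableT_comp => //; apply: measurable_fun_limn_esup => k.
      exact: (measurableT_comp _ (mh k)).
    apply/funext => x; rewrite -[LHS]oppeK -limn_esupN.
    by congr (- limn_esup _)%E.
  - apply: filterS hf => x hx _; have hx' : (h k x)%:E @[k --> \oo] --> (f x)%:E.
      by apply: cvg_EFin => //; exact: nearW.
    by case: (cvg_limn_einf_sup hx').
have L : (\int[mu]_x (f x)%:E <= C%:E)%E.
  rewrite E; apply: (le_trans (fatou mu measurableT mh _)).
    by move=> n x _; rewrite lee_fin.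
  rewrite limn_einf_lim; apply: lime_le.
    by apply: is_cvg_einfs.
  apply: nearW => n; apply: (@le_trans _ _ (\int[mu]_x (h n x)%:E)%E).
    by apply: ereal_inf_lbound; exists n => /=.
  by rewrite EFin_Int// lee_fin.
have fi : integr f.
  apply: integrP => //; under eq_integral do rewrite ger0_norm//.
  by rewrite (le_lt_trans L)// ltry.
by split => //; rewrite -lee_fin -EFin_Int.
Qed.

Lemma L2_fatou (h : nat -> R -> R) f C :
  (forall k, L2 (h k)) -> measurable_fun setT f ->
  {ae mu, forall x : measurableTypeR R, h ^~ x @ \oo --> f x} -> 0 <= C ->
  (forall k, n2 (h k) <= C) -> L2 f /\ n2 f <= C.
Proof.
move=> Lh mf hf C0 hC.
have [] := @fatou_integr (fun k x => h k x ^+ 2) (fun x => f x ^+ 2) (C ^+ 2).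
- by move=> k; case: (Lh k).
- by move=> k x; exact: sqr_ge0.
- exact: measurable_funX.
- by move=> x; exact: sqr_ge0.
- by apply: filterS hf => x hx; apply: (cvgM hx hx).
- move=> k; rewrite -[leLHS]n2_sqr.
  by rewrite lerXn2r ?nnegrE ?n2_ge0.
move=> fi fC; split => //.
by rewrite -(@ler_pXn2r _ 2)// ?nnegrE ?n2_ge0// n2_sqr.
Qed.

Lemma dct (h : nat -> R -> R) f g :
  (forall k, measurable_fun setT (h k)) -> measurable_fun setT f -> integr g ->
  {ae mu, forall x : measurableTypeR R, h ^~ x @ \oo --> f x} ->
  (forall k x, `|h k x| <= g x) ->
  integr f /\ \int[mu]_x h k x @[k --> \oo] --> \int[mu]_x f x.
Proof.
move=> mh mf gi hf hg.
have hi k : integr (h k) by apply: le_integr gi => //; exact: hg.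
have [] := @dominated_convergence _ _ _ mu setT measurableT
  (fun k x => (h k x)%:E) (EFin \o f) (EFin \o g).
- by move=> k; apply/measurable_EFinP; exact: mh.
- exact/measurable_EFinP.
- apply: filterS hf => x hx _ /=.
  by apply: cvg_EFin => //; exact: nearW.
- exact: gi.
- by apply: aeW => x k _ /=; rewrite lee_fin.
move=> fi _ cv; split => //.
have := fine_cvg; move/(_ _ _ (\oo : set_system nat) _
   (fun n => \int[mu]_x (h n x)%:E)%E (\int[mu]_x f x)); apply.
by rewrite -EFin_Int.
Qed.

Lemma L2_ip_small (f_ : nat -> R -> R) f g : (forall n, L2 (f_ n)) -> L2 f -> L2 g ->
  n2 (fun x => f_ n x - f x) @[n --> \oo] --> (0 : R) ->
  ip (f_ n) g @[n --> \oo] --> ip f g.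
Proof.
move=> Lf_ Lf Lg cv; apply/cvgrPdist_le => e e0.
have : n2 (fun x => f_ n x - f x) * n2 g @[n --> \oo] --> 0 * n2 g.
  by apply: cvgM => //; exact: cvg_cst.
rewrite mul0r => /cvgrPdist_le/(_ _ e0); apply: filterS => n.
rewrite sub0r normrN ger0_norm ?mulr_ge0 ?n2_ge0//.
apply: le_trans; rewrite distrC -ipBl//.
by apply: ip_le => //; exact: L2B.
Qed.

Lemma L2_complete (f : nat -> R -> R) : (forall n, L2 (f n)) ->
  (forall e : R, 0 < e -> exists N, forall m n, (N <= m)%N -> (N <= n)%N ->
    n2 (fun x => f m x - f n x) <= e) ->
  exists2 g, L2 g & n2 (fun x => f n x - g x) @[n --> \oo] --> (0 : R).
Proof.
move=> Lf Cf.
have {}Cf k : exists N, forall m n, (N <= m)%N -> (N <= n)%N ->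
    n2 (fun x => f m x - f n x) <= 4^-1 ^+ k.
  by apply: Cf; rewrite exprn_gt0.
have [N HN] := choice Cf.
pose phi k := (\sum_(j < k.+1) N j)%N.
have Nphi k : (N k <= phi k)%N by rewrite /phi big_ord_recr/= leq_addl.
have phiS k : (phi k <= phi k.+1)%N by rewrite /phi [leqRHS]big_ord_recr/= leq_addr.
pose h k := f (phi k).
have hN k : n2 (fun x => h k.+1 x - h k x) <= 4^-1 ^+ k.
  by apply: HN; rewrite ?Nphi// (leq_trans (Nphi k)).
(* The weight is chosen for [|a| <= 2^-k + 2^k * a^2]: summability of [d k x] over [k] gives
   absolute summability of the increments at [x], while the integrals stay geometric, since
   [2^k * 16^-k = 8^-k]. *)
pose d k x := 2 ^+ k * (h k.+1 x - h k x) ^+ 2.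
have d0 k x : 0 <= d k x by rewrite mulr_ge0 ?sqr_ge0 ?exprn_ge0.
have di k : integr (d k) by apply: integrZ; exact: (L2B (Lf _) (Lf _)).2.
have dI k : \int[mu]_x d k x <= 8^-1 ^+ k.
  rewrite /d IntZ; last exact: (L2B (Lf _) (Lf _)).2.
  rewrite -[X in _ * X]n2_sqr.
  apply: (@le_trans _ _ (2 ^+ k * (4^-1 ^+ k) ^+ 2)).
    by rewrite ler_wpM2l ?exprn_ge0// lerXn2r ?nnegrE ?n2_ge0// exprn_ge0.
  by rewrite -!exprM mulnC exprM -exprMn (_ : 2 * _ = 8^-1)//; field.
have md k : measurable_fun setT (EFin \o d k).
  by apply/measurable_EFinP; exact: integr_meas.
pose S x : \bar R := (\sum_(k <oo) (d k x)%:E)%E.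
have S0 x : (0 <= S x)%E by apply: nneseries_ge0 => k _ _; rewrite lee_fin.
have mS : measurable_fun setT S.
  by apply: ge0_emeasurable_sum => [k x _ _|k _]; [by rewrite lee_fin|exact: md].
have iS : mu.-integrable setT S.
  apply/integrableP; split => //.
  under eq_integral do rewrite gee0_abs//.
  rewrite /S integral_nneseries//; last by move=> k x _; rewrite lee_fin.
  (* The bound [8^-k] is weakened to [2^-k], written as [2 / 2^(k+1)] to match a series of known
     sum. *)
  apply: (@le_lt_trans _ _ (\sum_(k <oo) (2 / (2 ^ (k + 1))%:R)%:E)%E).
    apply: lee_nneseries => [k _ _|k _].
      by apply: integral_ge0 => x _; rewrite lee_fin.
    rewrite EFin_Int// lee_fin (le_trans (dI k))// addn1 expnS natrM.
    rewrite invfM mulrA mulfV// mul1r natrX -exprVn.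
    by rewrite lerXn2r ?nnegrE// lef_pV2 ?posrE// ler_nat.
  by rewrite (cvg_lim _ (@cvg_geometric_eseries_half R 2 0%N))// ltry.
have Sfin := integrable_ae measurableT iS.
have hcvg : {ae mu, forall x : measurableTypeR R, cvgn (h ^~ x)}.
  apply: filterS Sfin => x /(_ Logic.I) Sx.
  have cd : cvgn (series (fun k => d k x)).
    apply: nondecreasing_is_cvgn.
      apply/nondecreasing_seqP => n; rewrite /series/= big_nat_recr//=.
      by rewrite lerDl.
    exists (fine (S x)) => _ [n _ <-].
    rewrite -lee_fin fineK// /series/= -sumEFin.
    by apply: (nneseries_lim_ge n) => k _; rewrite lee_fin.
  have cv : cvgn (series (telescope (h ^~ x))).
    apply: normed_cvg.
    apply: (@series_le_cvg _ _ (fun k => 1 * 2^-1 ^+ k + d k x)).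
    - by move=> n /=.
    - by move=> n; rewrite addr_ge0// mulr_ge0// exprn_ge0// invr_ge0.
    - move=> n; rewrite /telescope /= /d mul1r.
      set a := h n.+1 x - h n x; rewrite exprVn.
      have p0 : (0 : R) < 2 ^+ n by rewrite exprn_gt0.
      rewrite -(ler_pM2l p0) mulrDr mulfV ?gt_eqF//.
      rewrite -[X in _ + 2 ^+ n * (_ * X)]real_normK ?num_real// mulrA -expr2 -exprMn.
      set b := 2 ^+ n * `|a|; nra.
    - rewrite (_ : series _ = (fun n => series (geometric 1 2^-1) n + series (fun k => d k x) n)).
        apply: is_cvgD => //.
        by apply: is_cvg_geometric_series; rewrite ger0_norm ?invf_lt1 ?ltr1n.
      by apply/funext => n; rewrite /series/= big_split.
  have := cv; rewrite telescopeK => cv'.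
  have : cvgn (fun n => (h n x - h 0%N x) + h 0%N x).
    by apply: is_cvgD cv' _; exact: is_cvg_cst.
  by under eq_fun do rewrite subrK.
have [A [mA A0 hA]] := hcvg.
(* Both the sequence and its limit are set to 0 on the measurable null set [A], so that [g] is an
   everywhere limit of measurable functions. *)
pose g x := if x \in A then 0 else limn (h ^~ x).
pose hh k x := if x \in A then 0 else h k x.
have hg x : hh ^~ x @ \oo --> g x.
  rewrite /hh /g; case: ifPn => xA; first exact: cvg_cst.
  apply: contrapT => nc; move/negP : xA; apply; rewrite inE; apply: hA.
  by move=> cv; apply: nc; exact: cv.
have mhh k : measurable_fun setT (hh k).
  rewrite (_ : hh k = (h k \_ (~` A))).
    apply/(measurable_restrictT _ _).1; first exact: measurableC.
    by apply: measurable_funS (L2_meas (Lf _)).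
  by apply/funext => x; rewrite /hh patchE in_setC; case: (x \in A).
have mg : measurable_fun setT g.
  by apply: (measurable_fun_cvg mhh) => x _; exact: hg.
have hgae : {ae mu, forall x : measurableTypeR R, h ^~ x @ \oo --> g x}.
  exists A; split => // x /= nx; apply: contrapT => xA; apply: nx.
  have xA' : (x \in A) = false by apply/negP; rewrite inE.
  by have := hg x; rewrite /hh; under eq_fun do rewrite xA'.
(* Fatou in the second index with the first one frozen: a bound on [f n - h (k + j)] uniform in [j]
   survives as a bound on [f n - g]. *)
have key k n : (N k <= n)%N -> L2 (fun x => f n x - g x) /\
    n2 (fun x => f n x - g x) <= 4^-1 ^+ k.
  move=> kn; apply: (@L2_fatou (fun j x => f n x - h (k + j)%N x)).
  - move=> j; exact: (L2B (Lf n) (Lf _)).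
  - apply: measurable_funB; [exact: L2_meas (Lf n)|exact: mg].
  - apply: filterS hgae => x hx; apply: cvgB; first exact: cvg_cst.
    move: hx; rewrite -(cvg_shiftn k)/=.
    by under eq_fun do rewrite addnC.
  - by rewrite exprn_ge0.
  - move=> j; apply: HN => //; apply: (leq_trans (Nphi k)).
    by elim: j => [|j IH]; rewrite ?addn0// addnS (leq_trans IH).
have Lg : L2 g.
  have [Lfg _] := key _ _ (leqnn (N 0%N)).
  have := L2B (Lf (N 0%N)) Lfg.
  by rewrite (_ : (fun x => _) = g)//; apply/funext => x; ring.
exists g => //; apply/cvgrPdist_le => e e0.
have [k ke] : exists k, 4^-1 ^+ k <= e.
  have : @GRing.exp R 4^-1 n @[n --> \oo] --> 0.
    by apply: cvg_expr; rewrite ger0_norm ?invf_lt1 ?ltr1n.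
  move/cvgrPdist_le => /(_ e e0)[k _ /(_ k (leqnn k))].
  by rewrite sub0r normrN ger0_norm ?exprn_ge0//; exists k.
exists (N k) => // n /= kn; rewrite sub0r normrN ger0_norm ?n2_ge0//.
by apply: le_trans ke; case: (key _ _ kn).
Qed.

End Limits.

(** * Riesz representation on a subspace of L^2 *)

Section Riesz.
Context {R : realType}.
Implicit Types f g h : R -> R.

Lemma cvg_harmonic_bound (u : nat -> R) (c : R) :
  (forall n, 0 <= u n <= c / n.+1%:R) -> u @ \oo --> (0 : R).
Proof.
move=> uc; apply: (@squeeze_cvgr _ _ _ _ (fun=> 0) (fun n => c / n.+1%:R)).
- exact: nearW.
- exact: cvg_cst.
- rewrite -[X in _ --> X](mulr0 c); apply: cvgM; first exact: cvg_cst.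
  exact: cvg_harmonic.
Qed.

Lemma le_discr_eq0 (a b : R) : 0 <= b ->
  (forall t, 0 <= 2 * t * a + t ^+ 2 * b) -> a = 0.
Proof.
move=> b0 H; have := H (- a / (b + 1)); have b1 : 0 < b + 1 by lra.
have -> : 2 * (- a / (b + 1)) * a + (- a / (b + 1)) ^+ 2 * b =
   - (a ^+ 2 * (b + 2) / (b + 1) ^+ 2) by field; rewrite gt_eqF.
rewrite oppr_ge0 pmulr_lle0 ?invr_gt0 ?exprn_gt0// => H1.
have : a ^+ 2 <= 0 by rewrite -(@pmulr_lle0 _ (b + 2)) 1?mulrC//; lra.
by rewrite le_eqVlt ltNge sqr_ge0 orbF sqrf_eq0 => /eqP.
Qed.

(** Minimizing [J f = |f|^2 - 2 l f] over [V] produces the representing function; [par] is the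
    parallelogram identity, which makes a minimizing sequence Cauchy. As [V] need not be closed, the
    minimizer lies only in its closure, and the approximating sequence is kept in the conclusion: it
    is what yields the density of test functions. *)
Lemma riesz (V : (R -> R) -> Prop) (l : (R -> R) -> R) (C : R) :
  V (fun=> 0) -> (forall f, V f -> L2 f) ->
  (forall c f g, V f -> V g -> V (fun x => c * f x + g x)) ->
  (forall c f g, V f -> V g -> l (fun x => c * f x + g x) = c * l f + l g) ->
  (forall f, V f -> `|l f| <= C * n2 f) ->
  exists g, [/\ L2 g, forall f, V f -> l f = ip g f &
    exists2 v, forall n, V (v n) & n2 (fun x => v n x - g x) @[n --> \oo] --> (0 : R)].
Proof.
move=> V0 VL VD lD lC.
pose J f := ip f f - 2 * l f.
have J_ge f : V f -> - C ^+ 2 <= J f.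
  move=> Vf; have := lC _ Vf; rewrite ler_norml /J -n2_sqr => /andP[_ H].
  have := sqr_ge0 (n2 f - C); rewrite sqrrB; nra.
pose S := [set J f | f in V].
have S0 : S !=set0 by exists (J (fun=> 0)); exists (fun=> 0).
have hS : has_inf S.
  by split => //; exists (- C ^+ 2) => _ [f Vf <-]; exact: J_ge.
pose m := inf S.
have mJ f : V f -> m <= J f by move=> Vf; apply: ge_inf; [exact: hS.2|exists f].
have Hex (n : nat) : exists f : R -> R, V f /\ J f < m + n.+1%:R^-1.
  have [_ [f Vf <-] Jf] : exists2 x, S x & x < m + n.+1%:R^-1.
    by apply: inf_adherent => //; rewrite invr_gt0.
  by exists f.
have [v Hv] := choice Hex.
have Vv n := (Hv n).1; have Jv n := (Hv n).2; have Lv n := VL _ (Vv n).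
have lZ c f : V f -> l (fun x => c * f x) = c * l f.
  move=> Vf; have := lD c f _ Vf V0; under [X in l X]eq_fun do rewrite addr0.
  move=> ->; have := lC _ V0; rewrite /n2 ip0l sqrtr0 mulr0 normr_le0 => /eqP ->.
  by rewrite addr0.
have par f g : V f -> V g ->
    ip (fun x => f x - g x) (fun x => f x - g x) <= 2 * (J f - m) + 2 * (J g - m).
  move=> Vf Vg; have Lf := VL _ Vf; have Lg := VL _ Vg.
  pose k x := 1 * f x + g x; have Vk : V k by exact: VD.
  have Vh : V (fun x => 2^-1 * k x + 0) by apply: VD.
  have := mJ _ Vh; rewrite /J.
  rewrite (lD _ _ (fun=> 0))// [in l k]/k lD//.
  have -> : l (fun=> 0) = 0.
    by have := lC _ V0; rewrite /n2 ip0l sqrtr0 mulr0 normr_le0 => /eqP.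
  under [X in ip X _]eq_fun do rewrite addr0.
  under [X in ip _ X]eq_fun do rewrite addr0.
  have Lk := VL _ Vk.
  rewrite ipZl; [|exact: Lk|exact: (L2Z _ Lk)].
  rewrite ipZr; [|exact: Lk|exact: Lk]; rewrite /k.
  under [X in ip X _]eq_fun do rewrite mul1r.
  under [X in ip _ X]eq_fun do rewrite mul1r.
  rewrite (ipDl Lf Lg (L2D Lf Lg)) (ipDr Lf Lg Lf) (ipDr Lf Lg Lg).
  by rewrite (ipBl Lf Lg (L2B Lf Lg)) (ipBr Lf Lg Lf) (ipBr Lf Lg Lg) (ipC g f); lra.
have [g Lg vg] : exists2 g, L2 g & n2 (fun x => v n x - g x) @[n --> \oo] --> (0 : R).
  apply: L2_complete => // e e0.
  have [N _ HN] : \forall n \near \oo, n.+1%:R^-1 <= e ^+ 2 / 4.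
    have := @cvg_harmonic R => /cvgrPdist_le/(_ (e ^+ 2 / 4)).
    rewrite divr_gt0 ?exprn_gt0// => /(_ isT); apply: filterS => n.
    by rewrite sub0r normrN ger0_norm ?invr_ge0.
  exists N => p q Np Nq.
  rewrite -(@ler_pXn2r _ 2)// ?nnegrE ?n2_ge0//; last exact: ltW.
  rewrite n2_sqr (le_trans (par _ _ _ _))//.
  move: (HN p Np) (HN q Nq) (Jv p) (Jv q) => /=.
  move: (p.+1%:R^-1) (q.+1%:R^-1) (J (v p)) (J (v q)) => a b c d; lra.
exists g; split => //; last by exists v.
move=> f Vf; have Lf := VL _ Vf; apply/esym/eqP; rewrite -subr_eq0; apply/eqP.
apply: (@le_discr_eq0 _ (ip f f)); first exact: ip_ge0.
move=> t.
(* First variation at almost-minimizers: comparing [J (t f + v n) >= m] with [J (v n) < m + 1/(n+1)]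
   gives a quadratic inequality in [t] with error [1/(n+1)], which vanishes in the limit. *)
have cv : 2 * t * (ip (v n) f - l f) + t ^+ 2 * ip f f + n.+1%:R^-1 @[n --> \oo] -->
    2 * t * (ip g f - l f) + t ^+ 2 * ip f f + 0.
  apply: cvgD; last exact: cvg_harmonic.
  apply: cvgD; last exact: cvg_cst.
  apply: cvgM; first exact: cvg_cst.
  by apply: cvgB; [exact: L2_ip_small|exact: cvg_cst].
rewrite addr0 in cv; apply: (cvgr_to_ge cv); apply: nearW => n.
have Ltf := L2Z t Lf.
have arith (a b c' d e' f' r : R) : d - 2 * f' < r + a ->
    r <= t * (t * b) + t * c' + (t * c' + d) - 2 * (t * e' + f') ->
    0 <= 2 * t * (c' - e') + t ^+ 2 * b + a by nra.
apply: arith (Jv n) _.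
have := mJ _ (VD t _ _ Vf (Vv n)); rewrite /J lD//.
rewrite (ipDl Ltf (Lv n) (L2D Ltf (Lv n))) (ipDr Ltf (Lv n) Ltf) (ipDr Ltf (Lv n) (Lv n)).
rewrite (ipZl _ Lf Ltf) (ipZr _ Lf Lf) (ipZl _ Lf (Lv n)) (ipZr _ Lf (Lv n)).
by rewrite (ipC f (v n)).
Qed.

End Riesz.

(** * Affine changes of variables *)

Section ChangeOfVariables.
Context {R : realType}.
Local Notation mu := (@lebesgue_measure R).
Implicit Types f g h : R -> R.

Lemma measurable_affine (a b : R) :
  measurable_fun setT (fun x : measurableTypeR R => (a * x + b : measurableTypeR R)).
Proof.
apply: continuous_measurable_fun => x; apply: cvgD; last exact: cvg_cst.
by apply: cvgM; [exact: cvg_cst|exact: cvg_id].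
Qed.

Lemma measurable_comp_affine f (a b : R) : measurable_fun setT f ->
  measurable_fun setT (fun x => f (a * x + b)).
Proof.
move=> mf; apply: (measurableT_comp mf); exact: measurable_affine.
Qed.

(** By uniqueness of Lebesgue measure only half-open intervals have to be tested; a negative [a]
    turns them into intervals open on the other side, of the same length. *)
Lemma pushforward_affine (a b : R) (A : set (measurableTypeR R)) : a != 0 -> measurable A ->
  mu A = (`|a|%:E * pushforward mu (fun x : measurableTypeR R => (a * x + b)%R : measurableTypeR R) A)%E.
Proof.
move=> a0 mA.
pose phi := (fun x : measurableTypeR R => (a * x + b : measurableTypeR R)).
have mphi : measurable_fun setT phi by exact: measurable_affine.
change (mu A = pushforward (mscale (NngNum (normr_ge0 a)) mu) phi A).
apply: lebesgue_measure_unique => // _ [[c d]] _ <-.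
rewrite /= /pushforward /mscale /=.
have -> : phi @^-1` `]c, d] = if 0 < a then `](c - b) / a, (d - b) / a]%classic
    else `[(d - b) / a, (c - b) / a[%classic.
  apply/seteqP; split => x /=; rewrite /phi !in_itv/=;
  case: ifPn => a1 /=; rewrite !in_itv/=.
  - by rewrite ltr_pdivrMr// ler_pdivlMr// ltrBlDr lerBrDr mulrC.
  - have {}a1 : a < 0 by rewrite lt_neqAle a0 leNgt.
    by rewrite ltr_ndivlMr// ler_ndivrMr// ltrBlDr lerBrDr mulrC andbC.
  - by rewrite ltr_pdivrMr// ler_pdivlMr// ltrBlDr lerBrDr mulrC.
  - have {}a1 : a < 0 by rewrite lt_neqAle a0 leNgt.
    by rewrite ltr_ndivlMr// ler_ndivrMr// ltrBlDr lerBrDr mulrC andbC.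
have [a1|a1] := ltP 0 a.
  rewrite !lebesgue_measure_itv/= !lte_fin ltr_pM2r ?invr_gt0// ltrD2r.
  case: ifPn => cd; last by rewrite mule0.
  rewrite gtr0_norm// -!EFinD -EFinM; congr EFin.
  by field; rewrite gt_eqF.
have {}a1 : a < 0 by rewrite lt_neqAle a0.
rewrite !lebesgue_measure_itv/= !lte_fin ltr_nM2r ?invr_lt0// ltrD2r.
case: ifPn => cd; last by rewrite mule0.
rewrite ltr0_norm// -!EFinD -EFinM; congr EFin.
by field; rewrite lt_eqF.
Qed.

Lemma ge0_integral_affine (f : R -> \bar R) (a b : R) : a != 0 ->
  measurable_fun setT f -> (forall x, 0 <= f x)%E ->
  (\int[mu]_x f x = `|a|%:E * \int[mu]_x f (a * x + b)%R)%E.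
Proof.
move=> a0 mf f0.
pose phi := (fun x : measurableTypeR R => (a * x + b : measurableTypeR R)).
have mphi : measurable_fun setT phi by exact: measurable_affine.
have mfphi : measurable_fun setT (fun x : measurableTypeR R => f (a * x + b)%R).
  exact: (measurableT_comp mf mphi).
rewrite -[RHS](@ge0_integral_mscale _ _ _ mu _ measurableT (NngNum (normr_ge0 a)))//.
rewrite -[RHS](@ge0_integral_pushforward _ _ _ _ _ phi mphi _ setT f)//.
apply: eq_measure_integral => A mA _.
exact: pushforward_affine.
Qed.

Lemma integr_affine f (a b : R) : a != 0 -> integr f ->
  integr (fun x => f (a * x + b)).
Proof.
move=> a0 fi; apply: integrP.
  by apply: measurable_comp_affine; exact: integr_meas.
have mf : measurable_fun setT (fun x : measurableTypeR R => `|f x|%:E).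
  by apply/measurable_EFinP/measurableT_comp => //; exact: integr_meas.
have oo : (\int[mu]_x `|f x|%:E < +oo)%E by case/integrableP: fi.
move: oo; rewrite (@ge0_integral_affine _ a b a0 mf)//.
rewrite !ltey; apply: contraNneq => ->.
by rewrite mulry gtr0_sg ?mul1e// normr_gt0.
Qed.

Lemma Int_affine f (a b : R) : a != 0 -> integr f ->
  \int[mu]_x f x = `|a| * \int[mu]_x f (a * x + b).
Proof.
move=> a0.
have nn g : integr g -> (forall x, 0 <= g x) ->
    \int[mu]_x g x = `|a| * \int[mu]_x g (a * x + b).
  move=> gi g0; apply: EFin_inj; rewrite EFinM -EFin_Int// -EFin_Int; last first.
    exact: integr_affine.
  apply: (@ge0_integral_affine (EFin \o g)) => //.
  by apply/measurable_EFinP; exact: integr_meas.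
move=> fi.
(* The signed case follows by subtraction, since [|f| + f] and [|f|] are both nonnegative. *)
have pi : integr (fun x => `|f x| + f x) by apply: integrD => //; exact: integr_norm.
have := nn _ pi; rewrite IntD//; last exact: integr_norm.
have fi' : integr (fun x => f (a * x + b)) by exact: integr_affine.
have ni' : integr (fun x => `|f (a * x + b)|) by exact: integr_norm.
rewrite IntD// mulrDr -(nn _ (integr_norm fi))//.
move=> H; apply: addrI (H _) => x.
by have := ler_norm (- f x); rewrite normrN; lra.
Qed.

End ChangeOfVariables.

(** * Fubini for real-valued integrals *)

Section Fubini.
Context {R : realType}.
Local Notation mu := (@lebesgue_measure R).
Local Notation RR := (measurableTypeR R).
Implicit Types (f g : R -> R) (F : RR * RR -> R).

(** The real integral is [fine] of the difference of the Tonelli integrals of the positive and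
    negative parts. This is measurable in [x] even where the slice is not integrable and the value
    is a default. *)
Lemma measurable_Int1 F : measurable_fun setT F ->
  measurable_fun setT (fun x : RR => \int[mu]_y F (x, y)).
Proof.
move=> mF.
have mE : measurable_fun setT (EFin \o F) by exact/measurable_EFinP.
rewrite (_ : (fun x => _) = fine \o (fun x : RR => \int[mu]_y ((EFin \o F)^\+ (x, y)) -
   \int[mu]_y ((EFin \o F)^\- (x, y)))%E); last first.
  apply/funext => x; rewrite /= /Rintegral integralE; congr (fine (_ - _)%E);
    by apply: eq_integral => y _; rewrite ?funeposE ?funenegE.
apply: measurableT_comp => //; apply: emeasurable_funB.
- apply: (@measurable_fun_fubini_tonelli_F _ _ _ _ _ mu (EFin \o F)^\+%E) => //.
  exact: measurable_funepos.
- apply: (@measurable_fun_fubini_tonelli_F _ _ _ _ _ mu (EFin \o F)^\-%E) => //.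
  exact: measurable_funeneg.
Qed.

Lemma Int_fubini F : measurable_fun setT F ->
  (\int[mu]_x \int[mu]_y `|F (x, y)|%:E < +oo)%E ->
  integr (fun x => \int[mu]_y F (x, y)) /\
  \int[mu]_x \int[mu]_y F (x, y) = \int[mu]_y \int[mu]_x F (x, y).
Proof.
move=> mF oo.
have mE : measurable_fun setT (EFin \o F) by exact/measurable_EFinP.
have iF : (mu \x mu)%E.-integrable setT (EFin \o F) by apply/integrable12ltyP.
have E1 : ae_eq mu setT (fun x : RR => (\int[mu]_y F (x, y))%:E)
    (fun x : RR => \int[mu]_y (F (x, y))%:E)%E.
  apply: filterS (ae_integrable1 iF) => x xi _.
  by rewrite fineK//; exact: integrable_fin_num.
have E2 : ae_eq mu setT (fun y : RR => (\int[mu]_x F (x, y))%:E)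
    (fun y : RR => \int[mu]_x (F (x, y))%:E)%E.
  apply: filterS (ae_integrable2 iF) => x xi _.
  by rewrite fineK//; exact: integrable_fin_num.
have m1 := measurable_Int1 mF.
have m2 : measurable_fun setT (fun y : RR => \int[mu]_x F (x, y)).
  apply: (@measurable_Int1 (F \o (fun z : RR * RR => (z.2, z.1)))).
  by apply: measurableT_comp => //; apply: measurable_fun_pair; [exact: measurable_snd|exact: measurable_fst].
split.
  have i1 := integrable_fubini_F iF.
  apply: integrP => //; case/integrableP: i1 => mi1 oo1.
  rewrite (_ : integral _ _ _ = \int[mu]_x `|\int[mu]_y (F (x, y))%:E|)%E//.
  apply: ae_eq_integral => //.
  - by apply/measurable_EFinP/measurableT_comp.
  - exact: measurableT_comp.
  - by apply: filterS E1 => x /(_ Logic.I) <-.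
rewrite {1}/Rintegral [RHS]/Rintegral; congr fine.
transitivity (\int[mu]_x \int[mu]_y (F (x, y))%:E)%E.
  apply: ae_eq_integral => //; first exact/measurable_EFinP.
  exact: (measurable_fubini_F iF).
transitivity (\int[mu]_y \int[mu]_x (F (x, y))%:E)%E; first exact: (Fubini iF).
apply/esym; apply: ae_eq_integral => //; first exact/measurable_EFinP.
exact: (measurable_fubini_G iF).
Qed.

(** Boundedness of the kernel and integrability of [a] and [b] make the double integral absolutely
    convergent. The kernels are a step function for the product rule and [cas] kernels for the
    Hartley transform. *)
Lemma Int_kernelC (k : RR * RR -> R) (a b : R -> R) (c : R) :
  measurable_fun setT k -> (forall z, `|k z| <= c) -> integr a -> integr b ->
  integr (fun x => a x * \int[mu]_y (b y * k (x, y))) /\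
  \int[mu]_x (a x * \int[mu]_y (b y * k (x, y))) =
  \int[mu]_y (b y * \int[mu]_x (a x * k (x, y))).
Proof.
move=> mk kc ai bi.
have ma := integr_meas ai; have mb := integr_meas bi.
have c0 : 0 <= c by apply: le_trans (kc (0, 0)).
have mbk x : measurable_fun setT (fun y : RR => b y * k (x, y)).
  by apply: measurable_funM => //; apply: measurableT_comp => //; exact: measurable_pair1.
have mak y : measurable_fun setT (fun x : RR => a x * k (x, y)).
  by apply: measurable_funM => //; apply: measurableT_comp => //; exact: measurable_pair2.
have ibk x : integr (fun y => b y * k (x, y)).
  apply: le_integr (integrZ c (integr_norm bi)); [exact: mbk|move=> y].
  by rewrite normrM mulrC ler_wpM2r.
have iak y : integr (fun x => a x * k (x, y)).
  apply: le_integr (integrZ c (integr_norm ai)); [exact: mak|move=> x].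
  by rewrite normrM mulrC ler_wpM2r.
pose F := fun z : RR * RR => a z.1 * (b z.2 * k z).
have mF : measurable_fun setT F.
  apply: measurable_funM.
    by apply: (measurableT_comp ma); exact: measurable_fst.
  apply: measurable_funM => //.
  by apply: (measurableT_comp mb); exact: measurable_snd.
have oo : (\int[mu]_x \int[mu]_y `|F (x, y)|%:E < +oo)%E.
  apply: (@le_lt_trans _ _ (\int[mu]_x (`|a x| * (c * \int[mu]_y `|b y|))%:E)%E).
    apply: ge0_le_integral => //.
    - by move=> x _; exact: integral_ge0.
    - apply: (@measurable_fun_fubini_tonelli_F _ _ _ _ _ mu (fun z => `|F z|%:E)) => //.
      by apply/measurable_EFinP/measurableT_comp.
    - apply/measurable_EFinP; apply: measurable_funM => //.
      exact: measurableT_comp.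
    move=> x _; rewrite EFin_Int; last first.
      by apply: integr_norm; exact: (integrZ (a x) (ibk x)).
    rewrite lee_fin -IntZ; last exact: integr_norm.
    rewrite -IntZ; last by apply: integrZ; exact: integr_norm.
    apply: le_Int.
    - by apply: integr_norm; exact: (integrZ (a x) (ibk x)).
    - by do 2 apply: integrZ; exact: integr_norm.
    - by move=> y; rewrite /F/= !normrM [c * _]mulrC; do 2 apply: ler_wpM2l => //.
  have iB : integr (fun x => `|a x| * (c * \int[mu]_y `|b y|)).
    by under eq_fun do rewrite mulrC; apply: integrZ; exact: integr_norm.
  by rewrite EFin_Int// ltry.
have [iF EF] := Int_fubini mF oo.
have F1 x : \int[mu]_y F (x, y) = a x * \int[mu]_y (b y * k (x, y)) by rewrite -IntZ.
have F2 y : \int[mu]_x F (x, y) = b y * \int[mu]_x (a x * k (x, y)).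
  by rewrite -IntZ//; apply: eq_Int => x; rewrite /F/= mulrCA.
split; first by apply: eq_integr iF.
by rewrite -(eq_Int F1) -(eq_Int F2).
Qed.

End Fubini.

(** * Absolutely continuous functions and weak derivatives *)

Section AbsolutelyContinuous.
Context {R : realType}.
Local Notation mu := (@lebesgue_measure R).
Implicit Types (f g h u v : R -> R) (a b : R).

(* Signed indicator of the interval between [a] and [b], so that
   [ip f (chi a b)] is the oriented integral of [f] from [a] to [b]. *)
Definition chi a b : R -> R := fun t => (t <= b)%R%:R - (t <= a)%R%:R.

Lemma chiN a b t : chi a b t = - chi b a t.
Proof. by rewrite /chi opprB. Qed.

Lemma chi_in a b t : a < t <= b -> chi a b t = 1.
Proof. by move=> /andP[at_ tb]; rewrite /chi tb leNgt at_ subr0. Qed.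

Lemma chi_out a b t : a <= b -> ~~ (a < t <= b) -> chi a b t = 0.
Proof.
move=> ab; rewrite negb_and -leNgt -ltNge /chi => /orP[ta|bt].
  by rewrite ta (le_trans ta ab) subrr.
by rewrite leNgt bt/= leNgt (le_lt_trans ab bt) subrr.
Qed.

Lemma chi_itv a b : a <= b -> chi a b = \1_(`]a, b]).
Proof.
move=> ab; apply/funext => t; rewrite indicE.
case: (boolP (a < t <= b)) => H.
  by rewrite chi_in// mem_set//= in_itv/= H.
by rewrite chi_out// memNset//= in_itv/=; apply/negP.
Qed.

Lemma chi_sqr a b t : chi a b t ^+ 2 = chi (Num.min a b) (Num.max a b) t.
Proof.
case: (leP a b) => ab.
  by case: (boolP (a < t <= b)) => H; rewrite ?(chi_in H) ?(chi_out ab H) ?expr1n ?expr0n.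
rewrite chiN sqrrN; case: (boolP (b < t <= a)) => H;
by rewrite ?(chi_in H) ?(chi_out (ltW ab) H) ?expr1n ?expr0n.
Qed.

Lemma measurable_chi a b : measurable_fun setT (chi a b).
Proof.
wlog ab : a b / a <= b.
  move=> H; have [/H//|/ltW/H mba] := leP a b.
  by rewrite (_ : chi a b = \- chi b a); [exact: measurableT_comp|
    apply/funext => t; rewrite chiN].
by rewrite chi_itv//; exact: measurable_indic.
Qed.

Lemma integr_chi a b : integr (chi a b).
Proof.
wlog ab : a b / a <= b.
  move=> H; have [/H//|/ltW/H mba] := leP a b.
  by apply: eq_integr (integrN mba) => t; rewrite chiN opprK.
by rewrite chi_itv//; exact: integrable_indic_itv.
Qed.

Lemma Int_chi a b : \int[mu]_x chi a b x = b - a.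
Proof.
wlog ab : a b / a <= b.
  move=> H; have [/H//|/ltW/H mba] := leP a b.
  rewrite (eq_Int (chiN a b)) IntN ?mba ?opprB//; exact: integr_chi.
rewrite chi_itv// /Rintegral integral_indic// setIT.
transitivity (fine (lebesgue_measure (`]a, b]%classic : set R))); first by [].
rewrite lebesgue_measure_itv/= lte_fin; case: ltP => //= ba.
by rewrite (@le_anti _ _ a b) ?subrr// ab ba.
Qed.

Lemma L2_chi a b : L2 (chi a b).
Proof.
split; first exact: measurable_chi.
by apply: eq_integr (integr_chi _ _) => t; rewrite chi_sqr.
Qed.

Lemma n2_chi a b : n2 (chi a b) = Num.sqrt `|b - a|.
Proof.
rewrite /n2 /ip; congr Num.sqrt; under eq_Rintegral do rewrite -expr2 chi_sqr.
rewrite Int_chi; case: (leP a b) => ab; first by rewrite ger0_norm// subr_ge0.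
by rewrite distrC gtr0_norm// subr_gt0.
Qed.

(** Absolute continuity with square-integrable derivative, encoded by the fundamental theorem of
    calculus. Here [u] is a genuine continuous function, whereas [du] matters only up to null
    sets. *)
Definition AC u du := L2 du /\ forall a b, u b - u a = ip du (chi a b).

Lemma AC_holder u du a b : AC u du -> `|u b - u a| <= n2 du * Num.sqrt `|b - a|.
Proof. by case=> Ld ->; rewrite -n2_chi; apply: ip_le => //; exact: L2_chi. Qed.

Lemma AC_continuous u du : AC u du -> continuous u.
Proof.
move=> Hu x; apply/cvgrPdist_le => e e0.
have c : n2 du * Num.sqrt `|x - y| @[y --> x] --> n2 du * Num.sqrt `|x - x|.
  apply: cvgM; first exact: cvg_cst.
  apply: (@continuous_comp _ _ _ (fun y => `|x - y|) Num.sqrt).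
    by apply: cvg_norm; apply: cvgB; [exact: cvg_cst|exact: cvg_id].
  exact: sqrt_continuous.
rewrite subrr normr0 sqrtr0 mulr0 in c.
move/cvgrPdist_le: c => /(_ e e0); apply: filterS => y.
rewrite sub0r normrN ger0_norm ?mulr_ge0 ?n2_ge0 ?sqrtr_ge0//.
by apply: le_trans; exact: AC_holder.
Qed.

Lemma AC_meas u du : AC u du -> measurable_fun setT u.
Proof. by move=> /AC_continuous; exact: continuous_measurable_fun. Qed.

Lemma eq_AC u u' du du' : u =1 u' -> du =1 du' -> AC u du -> AC u' du'.
Proof. by move=> /funext -> /funext ->. Qed.

Lemma AC_cst c : AC (fun=> c) (fun=> 0).
Proof. by split; [exact: L20|move=> a b; rewrite subrr ip0l]. Qed.

Lemma ACD u du v dv : AC u du -> AC v dv ->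
  AC (fun x => u x + v x) (fun x => du x + dv x).
Proof.
move=> [Lu Hu] [Lv Hv]; split; first exact: L2D.
move=> a b; rewrite ipDl//; last exact: L2_chi.
by rewrite -Hu -Hv opprD addrACA.
Qed.

Lemma ACZ c u du : AC u du -> AC (fun x => c * u x) (fun x => c * du x).
Proof.
move=> [Lu Hu]; split; first exact: L2Z.
move=> a b; rewrite ipZl//; last exact: L2_chi.
by rewrite -Hu mulrBr.
Qed.

Lemma ACN u du : AC u du -> AC (fun x => - u x) (fun x => - du x).
Proof. by move=> /(ACZ (-1)); apply: eq_AC => x; rewrite mulN1r. Qed.

Lemma AC_affine u du c d : 0 < c -> AC u du ->
  AC (fun x => u (c * x + d)) (fun x => c * du (c * x + d)).
Proof.
move=> cp [[mu_ iu] Hu]; have c0 : c != 0 by rewrite gt_eqF.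
have Ld : L2 (fun x => du (c * x + d)).
  split; first exact: measurable_comp_affine.
  exact: (@integr_affine _ (fun x => du x ^+ 2)).
split; first exact: L2Z.
move=> a b; rewrite Hu ipZl//; last exact: L2_chi.
rewrite /ip (@Int_affine _ _ c d c0); last first.
  by apply: L2M; [split|exact: L2_chi].
rewrite gtr0_norm//; congr (_ * _); apply: eq_Int => x.
by rewrite /chi !lerD2r !ler_pM2l.
Qed.

Lemma L2_integr_loc du a b : L2 du -> integr (fun x => du x * chi a b x).
Proof. by move=> Ld; apply: L2M => //; exact: L2_chi. Qed.

(** Fubini on the triangle [y <= x] of the square over []a, b]]: integrating [du y * dv x] first in
    [y] gives [u x - u a], first in [x] gives [v b - v y], and equating the two is the formula. The
    integrability of the two products is read off from the same exchange. *)
Lemma AC_prod_loc u du v dv a b : AC u du -> AC v dv -> a <= b ->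
  [/\ integr (fun x => du x * chi a b x * v x),
      integr (fun x => dv x * chi a b x * u x) &
  u b * v b - u a * v a =
    \int[mu]_x (du x * chi a b x * v x) + \int[mu]_x (dv x * chi a b x * u x)].
Proof.
move=> Hu Hv ab; have [Lu Iu] := Hu; have [Lv Iv] := Hv.
pose A x := du x * chi a b x; pose B x := dv x * chi a b x.
have iA : integr A by exact: L2_integr_loc.
have iB : integr B by exact: L2_integr_loc.
pose k := fun z : measurableTypeR R * measurableTypeR R => (z.2 <= z.1)%R%:R : R.
have mk : measurable_fun setT k.
  rewrite (_ : k = fun z => if z.2 <= z.1 then 1 else 0).
    apply: measurable_fun_ifT => //.
    exact: (measurable_fun_ler measurable_snd measurable_fst).
  by apply/funext => z; rewrite /k; case: (z.2 <= z.1).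
have kb z : `|k z| <= 1 by rewrite /k; case: (z.2 <= z.1); rewrite ?normr1 ?normr0.
have kAC w dw x : AC w dw -> a < x <= b ->
    \int[mu]_y (dw y * chi a b y * k (x, y)) = w x - w a.
  move=> [_ ->] xab; apply: eq_Int => y; rewrite -mulrA; congr (_ * _).
  move: xab => /andP[ax xb]; rewrite /k/= /chi.
  case: (leP y x) => yx; last by rewrite mulr0 leNgt (lt_trans ax yx) subrr.
  by rewrite mulr1 (le_trans yx xb).
have kAC' w dw x : AC w dw -> a < x <= b ->
    \int[mu]_y (dw y * chi a b y * k (y, x)) = w b - w x.
  move=> Hw; have [[mw _] ->] := Hw => xab; apply: aeq_Int.
  - apply: measurable_funM; first by apply: measurable_funM => //; exact: measurable_chi.
    by apply: measurableT_comp => //; exact: measurable_pair2.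
  - by apply: measurable_funM => //; exact: measurable_chi.
  (* The diagonal point belongs to both closed halves, so on this side the identity fails at [y = x]
     and holds only almost everywhere. *)
  exists [set x]; split => //; first exact: lebesgue_measure_set1.
  move=> y /=; apply: contra_notP => /eqP yx; rewrite -mulrA; congr (_ * _).
  move: xab => /andP[ax xb]; rewrite /k/= /chi.
  case: (ltgtP x y) yx => // xy _; last by rewrite mulr0 (le_trans (ltW xy) xb) subrr.
  by rewrite mulr1 (leNgt y a) (lt_trans ax xy).
have out x : ~~ (a < x <= b) -> A x = 0 /\ B x = 0.
  by move=> H; rewrite /A /B chi_out// !mulr0.
have [iAB E] := Int_kernelC mk kb iB iA.
have [iBA _] := Int_kernelC (k := fun z => k (z.2, z.1)) (c := 1)
  ltac:(by apply: measurableT_comp => //; apply: measurable_fun_pair;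
        [exact: measurable_snd|exact: measurable_fst]) ltac:(by move=> z; exact: kb) iA iB.
have iBu : integr (fun x => B x * u x).
  have := integrD iAB (integrZ (u a) iB); apply: eq_integr => x.
  have [xab|/out[_ ->]] := boolP (a < x <= b); last by rewrite !mul0r mulr0 addr0.
  by rewrite (kAC u)//; ring.
have iAv : integr (fun x => A x * v x).
  have := integrB (integrZ (v b) iA) iBA; apply: eq_integr => x.
  have [xab|/out[-> _]] := boolP (a < x <= b); last by rewrite !mul0r mulr0 subr0.
  by rewrite (kAC' v)//; ring.
split => //.
have E1 : \int[mu]_x (B x * \int[mu]_y (A y * k (x, y))) =
    \int[mu]_x (B x * u x) - u a * (v b - v a).
  rewrite Iv -(IntZ (u a) iB) -(IntB iBu (integrZ (u a) iB)).
  apply: eq_Int => x; rewrite -/(B x).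
  have [xab|/out[_ ->]] := boolP (a < x <= b); last by rewrite !mul0r mulr0 subr0.
  by rewrite (kAC u)//; ring.
have E2 : \int[mu]_y (A y * \int[mu]_x (B x * k (x, y))) =
    v b * (u b - u a) - \int[mu]_x (A x * v x).
  rewrite Iu -(IntZ (v b) iA) -(IntB (integrZ (v b) iA) iAv).
  apply: eq_Int => x; rewrite -/(A x).
  have [xab|/out[-> _]] := boolP (a < x <= b); last by rewrite !mul0r mulr0 subr0.
  by rewrite (kAC' v)//; ring.
by move: E; rewrite E1 E2; lra.
Qed.

Lemma ACM u du v dv M N : AC u du -> AC v dv ->
  (forall x, `|u x| <= M) -> (forall x, `|v x| <= N) ->
  AC (fun x => u x * v x) (fun x => v x * du x + u x * dv x).
Proof.
move=> Hu Hv uM vN.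
have L1 : L2 (fun x => v x * du x) by apply: L2_Ml vN Hu.1; exact: AC_meas Hv.
have L2' : L2 (fun x => u x * dv x) by apply: L2_Ml uM Hv.1; exact: AC_meas Hu.
split; first exact: L2D.
have main a b : a <= b -> u b * v b - u a * v a =
    ip (fun x => v x * du x + u x * dv x) (chi a b).
  move=> ab; have [_ _ ->] := AC_prod_loc Hu Hv ab.
  rewrite ipDl//; last exact: L2_chi.
  by congr (_ + _); apply: eq_Int => x; ring.
move=> a b; have [/main//|/ltW/main H] := leP a b.
rewrite -opprB H -ipNr; [|exact: L2_chi|exact: L2D].
by congr ip; apply/funext => x; rewrite [RHS]chiN.
Qed.

End AbsolutelyContinuous.

(** * Test functions and weak derivatives *)

Section TestFunctions.
Context {R : realType}.
Local Notation mu := (@lebesgue_measure R).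
Implicit Types (f g u v phi psi : R -> R) (a b h : R).

Definition supp_in (M : R) f := forall x, M <= `|x| -> f x = 0.

Lemma supp_chi M f x : supp_in M f -> f x * chi (- M) M x = f x.
Proof.
move=> sf; have [|xM] := boolP (- M < x <= M); first by move=> /chi_in ->; rewrite mulr1.
rewrite (sf x) ?mul0r//; rewrite negb_and -leNgt -ltNge in xM.
case/orP: xM => H; last exact: le_trans (ltW H) (ler_norm x).
by rewrite -normrN (le_trans _ (ler_norm _))// lerNr.
Qed.

Lemma bounded_supp_integr M C f : measurable_fun setT f -> supp_in M f ->
  (forall x, `|f x| <= C) -> integr f.
Proof.
move=> mf sf fC; apply: (@le_integr _ _ (fun x => C * `|chi (- M) M x|)) => //.
  move=> x; rewrite -(supp_chi x sf) normrM ler_wpM2r//.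
by apply: integrZ; apply: integr_norm; exact: integr_chi.
Qed.

Lemma bounded_supp_L2 M C f : measurable_fun setT f -> supp_in M f ->
  (forall x, `|f x| <= C) -> L2 f.
Proof.
move=> mf sf fC; split => //; apply: (@bounded_supp_integr M (C ^+ 2)).
- exact: measurable_funX.
- by move=> x /sf ->; rewrite expr0n.
- by move=> x; rewrite normrX lerXn2r ?nnegrE// (le_trans _ (fC x)).
Qed.

Lemma continuous_bounded f a b : continuous f -> exists C, forall x, a <= x <= b -> `|f x| <= C.
Proof.
move=> cf; have [ab|ba] := leP a b; last first.
  by exists 0 => x /andP[ax xb]; move: ba; rewrite ltNge (le_trans ax xb).
have cw : {within `[a, b], continuous (fun x => `|f x|)}.
  apply: continuous_subspaceT => x; apply: (@continuous_comp _ _ _ f (fun x => `|x|)).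
    exact: cf.
  exact: norm_continuous.
have [c _ H] := EVT_max ab cw; exists `|f c| => x xab; apply: H.
by rewrite in_itv.
Qed.

Lemma continuous_supp_bounded M f : continuous f -> supp_in M f ->
  exists C, forall x, `|f x| <= C.
Proof.
move=> cf sf; have [C HC] := continuous_bounded (- M) M cf.
exists (Num.max C 0) => x; rewrite le_max; have [xM|xM] := leP M `|x|.
  by rewrite sf// normr0 lexx orbT.
by rewrite HC// -ler_norml ltW.
Qed.

Lemma test_continuous phi : test_function phi -> continuous phi.
Proof.
by case=> d _ _ x; apply: differentiable_continuous; apply/derivable1_diffP.
Qed.

(** The margin 1 leaves room for a two-sided difference quotient inside the region where [phi]
    vanishes. *)
Lemma derive_supp M phi : supp_in M phi -> supp_in (M + 1) (derive1 phi).
Proof.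
move=> s x xM; rewrite /derive1; apply: cvg_lim => //.
apply: (@cvg_trans _ ((fun=> 0 : R) @ (0 : R)^')); last exact: cvg_cst.
apply: near_eq_cvg; near=> h.
have h1 : `|h| <= 1 by near: h; exact: dnbhs0_le.
rewrite !s ?subrr ?scaler0//; first lra.
by have := ler_normB (h + x) h; rewrite addrC addKr; lra.
Unshelve. all: by end_near. Qed.

Lemma test_supp phi : test_function phi -> exists M : R, [/\ 0 <= M, supp_in M phi & supp_in M (derive1 phi)].
Proof.
case=> _ _ [M sM]; exists (`|M| + 1); split.
- by rewrite addr_ge0.
- by move=> x H; apply: sM; apply: le_trans H; have := ler_norm M; lra.
- by apply: derive_supp => x H; apply: sM; apply: le_trans H; exact: ler_norm.
Qed.

Lemma test_L2 phi : test_function phi -> L2 phi.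
Proof.
move=> t; have [M [_ s _]] := test_supp t; have c := test_continuous t.
have [C HC] := continuous_supp_bounded c s.
by apply: (bounded_supp_L2 _ s HC); exact: continuous_measurable_fun.
Qed.

Lemma test_dL2 phi : test_function phi -> L2 (derive1 phi).
Proof.
move=> t; have [M [_ _ s]] := test_supp t; have [_ c _] := t.
have [C HC] := continuous_supp_bounded c s.
by apply: (bounded_supp_L2 _ s HC); exact: continuous_measurable_fun.
Qed.

Lemma test_integr phi : test_function phi -> integr phi.
Proof.
move=> t; have [M [_ s _]] := test_supp t; have c := test_continuous t.
have [C HC] := continuous_supp_bounded c s.
by apply: (bounded_supp_integr _ s HC); exact: continuous_measurable_fun.
Qed.

Lemma C1_ftc (F : R -> R) a b : (forall x, derivable F x 1) -> continuous (derive1 F) -> a <= b ->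
  integr (fun x => derive1 F x * chi a b x) /\
  F b - F a = \int[mu]_x (derive1 F x * chi a b x).
Proof.
move=> d c ab.
have mF : measurable_fun setT (derive1 F) by exact: continuous_measurable_fun.
have cF : continuous F.
  by move=> x; apply: differentiable_continuous; apply/derivable1_diffP.
have [C HC] := continuous_bounded a b c.
have i : integr (fun x => derive1 F x * chi a b x).
  apply: (@le_integr _ _ (fun x => `|C| * chi a b x)).
  - by apply: measurable_funM => //; exact: measurable_chi.
  - move=> x; have [xab|xab] := boolP (a < x <= b).
      rewrite chi_in// !mulr1 (le_trans _ (ler_norm _))// HC//.
      by case/andP: xab => /ltW -> ->.
    by rewrite chi_out// !mulr0 normr0.
  - by apply: integrZ; exact: integr_chi.
split => //; move: ab; rewrite le_eqVlt => /orP[/eqP <-|ab].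
  by under eq_Int do rewrite /chi subrr mulr0; rewrite Int0 subrr.
apply: EFin_inj; rewrite EFinB -EFin_Int//.
have dF : derivable_oo_LRcontinuous F a b.
  split; first by move=> x _; exact: d.
    by apply: cvg_at_right_filter; exact: cF.
  by apply: cvg_at_left_filter; exact: cF.
have cw : {within `[a, b], continuous (derive1 F)} by exact: continuous_subspaceT.
have E := @continuous_FTC2 R (derive1 F) F a b ab cw dF (fun x _ => erefl).
apply: (etrans (esym E)); rewrite -integral_itv_obnd_cbnd; last first.
  by apply/measurable_EFinP; apply: measurable_funTS.
rewrite integral_mkcond; apply: eq_integral => x _.
by rewrite patchE chi_itv ?(ltW ab)// indicE; case: (x \in _); rewrite ?mulr1 ?mulr0.
Qed.

Lemma test_AC phi : test_function phi -> AC phi (derive1 phi).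
Proof.
move=> t; split; first exact: test_dL2.
have [d c _] := t; have main a b : a <= b -> phi b - phi a = ip (derive1 phi) (chi a b).
  by move=> ab; case: (C1_ftc d c ab).
move=> a b; have [/main//|/ltW/main H] := leP a b.
rewrite -opprB H -ipNr; [|exact: L2_chi|exact: test_dL2].
by congr ip; apply/funext => x; rewrite [RHS]chiN.
Qed.

Lemma test0 : test_function (fun=> 0 : R).
Proof.
split; first by move=> x; exact: derivable_cst.
- rewrite (_ : derive1 _ = fun=> 0); first by move=> x; exact: cvg_cst.
  by apply/funext => x; rewrite derive1E derive_cst.
- by exists 0.
Qed.

Lemma derive1_lin phi psi c : test_function phi -> test_function psi ->
  derive1 (fun x => c * phi x + psi x) = (fun x => c * (derive1 phi) x + (derive1 psi) x).
Proof.
move=> [dp _ _] [dq _ _]; apply/funext => x; rewrite !derive1E.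
rewrite deriveD//; last exact: derivableZ.
by rewrite deriveZ.
Qed.

Lemma testD phi psi c : test_function phi -> test_function psi ->
  test_function (fun x => c * phi x + psi x).
Proof.
move=> t1 t2; have [dp cp [M sM]] := t1; have [dq cq [N sN]] := t2; split.
- by move=> x; apply: derivableD => //; exact: derivableZ.
- rewrite derive1_lin// => x; apply: cvgD; last exact: cq.
  by apply: cvgM; [exact: cvg_cst|exact: cp].
- exists (Num.max M N) => x; rewrite ge_max => /andP[Mx Nx].
  by rewrite sM// sN// mulr0 addr0.
Qed.

(** The primitive from minus infinity vanishes to the left of the support by construction, and to
    the right of it because the total integral is zero. *)
Lemma test_primitive f M : continuous f -> supp_in M f -> \int[mu]_x f x = 0 ->
  exists2 phi, test_function phi & (derive1 phi) = f.
Proof.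
move=> cf sf f0; have [C HC] := continuous_supp_bounded cf sf.
have mf : measurable_fun setT f by exact: continuous_measurable_fun.
have fi := bounded_supp_integr mf sf HC.
have fiy y : mu.-integrable `]-oo, y] (EFin \o f).
  by apply: integrableS fi.
pose F x := \int[mu]_(t in `]-oo, x]) f t.
have HF (x : R) : derivable F x 1 /\ derive1 F x = f x.
  have xx : x < x + 1 by rewrite ltrDl.
  have [d1 d2] := @continuous_FTC1 R f -oo%O x (x + 1) xx (fiy (x + 1)) ltac:(by rewrite ltNyr) (cf x).
  split; first by move: d1; congr (derivable _ x 1).
  by move: d2; congr (derive1 _ x = _).
have FE (x : R) : F x = \int[mu]_y (f y * (y <= x)%R%:R) :> R.
  rewrite /F Rintegral_mkcond; apply: eq_Rintegral => y _; rewrite patchE.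
  by rewrite mem_setE in_itv/=; case: (y <= x); rewrite ?mulr1 ?mulr0.
have F' : derive1 F = f by apply/funext => x; case: (HF x).
clearbody F; exists F => //; split; first by move=> x; case: (HF x).
  by rewrite F'.
exists (`|M| + 1) => x xM; have xM' : `|M| < `|x| by lra.
have [x0|x0] := leP 0 x.
  rewrite (ger0_norm x0) in xM'; rewrite FE -[RHS]f0; apply: eq_Int => y.
  have [yx|xy] := leP y x; first by rewrite mulr1.
  by rewrite sf ?mul0r//; have := ler_norm M; have := ler_norm y; lra.
rewrite (ltr0_norm x0) in xM'; rewrite FE -[RHS]Int0; apply: eq_Int => y.
have [yx|xy] := leP y x; last by rewrite mulr0.
by rewrite sf ?mul0r//; have := ler_norm M; have := ler_norm (- y); rewrite normrN; lra.
Qed.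

Definition possq (y : R) : R := Num.max 0 y ^+ 2.

Lemma possq_ge0 y : 0 <= possq y. Proof. exact: sqr_ge0. Qed.

Lemma possq_eq0 y : y <= 0 -> possq y = 0.
Proof. by move=> y0; rewrite /possq max_l// expr0n. Qed.

Lemma is_derive_possq (y : R) : is_derive y (1 : R) possq (2 * Num.max 0 y).
Proof.
have H : h^-1 *: (possq (h *: (1 : R) + y) - possq y) @[h --> 0^'] --> 2 * Num.max 0 y.
  apply/cvgrPdist_le => e e0; near=> h.
  have h0 : h != 0 by near: h; exact: nbhs_dnbhs_neq.
  have he : `|h| <= e by near: h; exact: dnbhs0_le.
  rewrite (le_trans _ he)// -(@ler_pM2r _ `|h|) ?normr_gt0// -normrM mulrBl.
  rewrite [X in _ - X]mulrC /GRing.scale/= mulrA mulfV// mul1r mulr1 -expr2.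
  rewrite real_normK ?num_real// /possq.
  have [y0|y0] := leP 0 y; have [z0|z0] := leP 0 (h + y);
    rewrite ler_norml; apply/andP; split; nra.
have dp : derivable possq y 1 by apply/cvg_ex; exists (2 * Num.max 0 y).
by apply: DeriveDef => //; exact/cvg_lim.
Unshelve. all: by end_near. Qed.

Lemma max0_lipschitz (x y : R) : `|Num.max 0 x - Num.max 0 y| <= `|x - y|.
Proof.
have [x0|x0] := leP 0 x; have [y0|y0] := leP 0 y; rewrite ?subr0 ?sub0r ?subrr ?normr0//.
- by rewrite ger0_norm// ger0_norm; lra.
- by rewrite normrN ger0_norm// distrC ger0_norm; lra.
Qed.

Lemma continuous_max0 : continuous (fun x : R => Num.max 0 x).
Proof.
move=> x; apply/cvgrPdist_le => e e0.
have := @cvg_id _ (nbhs x); move/cvgrPdist_le => /(_ e e0); apply: filterS => y.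
by apply: le_trans; exact: max0_lipschitz.
Qed.

Definition paraboloid a h (x : R) : R := 1 - ((x - a) / h) ^+ 2.

Lemma is_derive_paraboloid a h (x : R) : h != 0 ->
  is_derive x (1 : R) (paraboloid a h) (- (2 * (x - a) / h ^+ 2)).
Proof.
move=> h0.
have H : t^-1 *: (paraboloid a h (t *: (1 : R) + x) - paraboloid a h x) @[t --> 0^'] -->
    - (2 * (x - a) / h ^+ 2).
  apply: (@cvg_trans _ ((fun t => - (2 * (x - a) / h ^+ 2) - t / h ^+ 2) @ 0^')).
    apply: near_eq_cvg; near=> t.
    have t0 : t != 0 by near: t; exact: nbhs_dnbhs_neq.
    by rewrite /paraboloid /GRing.scale/= mulr1; field; rewrite t0 h0.
  have K : (fun t => - (2 * (x - a) / h ^+ 2) - t / h ^+ 2) @ (0 : R)^' -->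
      - (2 * (x - a) / h ^+ 2) - 0 / h ^+ 2.
    apply: cvgB; first exact: cvg_cst.
    apply: cvgM; last exact: cvg_cst.
    apply/cvgrPdist_le => e e0; near=> t; rewrite sub0r normrN; near: t.
    exact: dnbhs0_le.
  by rewrite mul0r subr0 in K.
have dp : derivable (paraboloid a h) x 1 by apply/cvg_ex; eexists; exact: H.
by apply: DeriveDef => //; exact/cvg_lim.
Unshelve. all: by end_near. Qed.

(** An explicit C^1 bump supported in [[a - h, a + h]]: squaring the positive part of a concave
    parabola removes the corners at the endpoints. *)
Definition eta a h (x : R) : R := possq (paraboloid a h x).

Lemma is_derive_eta a h (x : R) : h != 0 -> is_derive x (1 : R) (eta a h)
  (2 * Num.max 0 (paraboloid a h x) * - (2 * (x - a) / h ^+ 2)).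
Proof.
move=> h0; apply: (@is_derive1_comp _ possq (paraboloid a h)).
  exact: is_derive_possq.
exact: is_derive_paraboloid.
Qed.

Lemma eta_out a h x : 0 < h -> h <= `|x - a| -> eta a h x = 0.
Proof.
move=> h0 hx; apply: possq_eq0; rewrite /paraboloid subr_le0.
rewrite -[leRHS]real_normK ?num_real// expr_ge1// normf_div (gtr0_norm h0).
by rewrite ler_pdivlMr// mul1r.
Qed.

Lemma eta_test a h : 0 < h -> test_function (eta a h).
Proof.
move=> h0; have hn0 : h != 0 by rewrite gt_eqF.
split.
- by move=> x; case: (is_derive_eta a x hn0).
- rewrite (_ : derive1 _ = fun x => 2 * Num.max 0 (paraboloid a h x) * - (2 * (x - a) / h ^+ 2)).
    move=> x; apply: cvgM.
      apply: cvgM; first exact: cvg_cst.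
      apply: (@continuous_comp _ _ _ (paraboloid a h) (fun x => Num.max 0 x)).
        apply: differentiable_continuous; apply/derivable1_diffP.
        by case: (is_derive_paraboloid a x hn0).
      exact: continuous_max0.
    apply: cvgN; apply: cvgM; last exact: cvg_cst.
    apply: cvgM; first exact: cvg_cst.
    by apply: cvgB; [exact: cvg_id|exact: cvg_cst].
  apply/funext => x; rewrite derive1E; exact: (@derive_val _ _ _ _ _ _ _ (is_derive_eta a x hn0)).
- exists (`|a| + h) => x xM; apply: eta_out => //.
  by have := ler_normB x a; have := lerB_dist x a; lra.
Qed.

Lemma eta_ge0 a h x : 0 <= eta a h x. Proof. exact: possq_ge0. Qed.

Lemma eta_le1 a h x : eta a h x <= 1.
Proof.
rewrite /eta /possq; have := sqr_ge0 ((x - a) / h); rewrite /paraboloid.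
by case: (leP 0 (1 - _)) => H K; rewrite ?expr0n ?ler01// expr_le1//; lra.
Qed.

Lemma eta_in a h x : 0 < h -> `|x - a| <= h / 2 -> 2^-1 <= eta a h x.
Proof.
move=> h0 hx; have K : ((x - a) / h) ^+ 2 <= 4^-1.
  rewrite -[leLHS]real_normK ?num_real// normf_div (gtr0_norm h0).
  have -> : 4^-1 = 2^-1 ^+ 2 :> R by field.
  by rewrite lerXn2r ?nnegrE ?divr_ge0// ?(ltW h0)// ler_pdivrMr// mulrC.
rewrite /eta /possq /paraboloid.
have H : 3 / 4 <= 1 - ((x - a) / h) ^+ 2 by lra.
rewrite max_r; last lra.
by move: (1 - _) H => z H; nra.
Qed.

Lemma Int_eta_ge a h : 0 < h -> h / 2 <= \int[mu]_x eta a h x.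
Proof.
move=> h0; have -> : h / 2 = \int[mu]_x (2^-1 * chi (a - h / 2) (a + h / 2) x).
  by rewrite IntZ ?Int_chi; [field|exact: integr_chi].
apply: le_Int.
- by apply: integrZ; exact: integr_chi.
- by apply: test_integr; exact: eta_test.
move=> x; have [H|H] := boolP (a - h / 2 < x <= a + h / 2).
  rewrite chi_in// mulr1; apply: eta_in => //.
  by case/andP: H => H1 H2; rewrite ler_norml; apply/andP; split; lra.
by rewrite chi_out// ?mulr0 ?eta_ge0//; lra.
Qed.

Lemma locally_integrable_mul f phi M C : locally_integrable setT f ->
  measurable_fun setT phi -> supp_in M phi -> (forall x, `|phi x| <= C) ->
  integr (fun x => f x * phi x).
Proof.
move=> [mf _ H] mphi sphi pC.
have H' := H (`[- M, M]%classic : set R) (@subsetT _ _) (@segment_compact _ _ _).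
have fi : mu.-integrable `[- M, M] (EFin \o f).
  by apply/integrableP; split => //; apply/measurable_EFinP; exact: measurable_funTS.
have fi' : integr (f \_ `[- M, M]).
  by have := (integrable_mkcond _ _).1 fi; rewrite /integr restrict_EFin; apply.
apply: (le_integr _ _ (integrZ C (integr_norm fi'))).
  exact: measurable_funM.
move=> x; rewrite normrM mulrC patchE; case: ifPn => xM.
  exact: ler_wpM2r.
rewrite normr0 mulr0 sphi ?normr0 ?mul0r//.
move: xM; rewrite notin_setE/= in_itv/= => /negP; rewrite negb_and -!ltNge.
case/orP => K; last exact: le_trans (ltW K) (ler_norm _).
by rewrite -normrN (le_trans _ (ler_norm _))// lerNr ltW.
Qed.

Lemma test_locint_mul f phi : locally_integrable setT f -> test_function phi ->
  integr (fun x => f x * phi x).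
Proof.
move=> lf t; have [M [_ s _]] := test_supp t; have c := test_continuous t.
have [C HC] := continuous_supp_bounded c s.
by apply: (locally_integrable_mul lf _ s HC); exact: continuous_measurable_fun.
Qed.

Lemma test_locint_dmul f phi : locally_integrable setT f -> test_function phi ->
  integr (fun x => f x * derive1 phi x).
Proof.
move=> lf t; have [M [_ _ s]] := test_supp t; have [_ c _] := t.
have [C HC] := continuous_supp_bounded c s.
by apply: (locally_integrable_mul lf _ s HC); exact: continuous_measurable_fun.
Qed.

(** The bump is at most 1 and vanishes outside the ball. At a Lebesgue point the right-hand side is
    [o(h)] while the mass of [eta a h] is at least [h / 2], so integrals against bumps recover
    [f a]. *)
Lemma eta_approx f a h : locally_integrable setT f -> 0 < h ->
  (`|\int[mu]_x (f x * eta a h x) - f a * \int[mu]_x eta a h x|%:E <=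
   \int[mu]_(x in ball a h) `|f x - f a|%:E)%E.
Proof.
move=> lf h0; have t := eta_test a h0.
have i1 := test_locint_mul lf t; have i2 := integrZ (f a) (test_integr t).
have [mf _ _] := lf.
have me : measurable_fun setT (eta a h).
  by apply: continuous_measurable_fun; exact: test_continuous.
rewrite -(IntZ (f a) (test_integr t)) -(IntB i1 i2).
apply: (@le_trans _ _ (\int[mu]_x `|f x * eta a h x - f a * eta a h x|)%:E).
  by rewrite lee_fin; apply: norm_Int; exact: integrB.
rewrite -EFin_Int; last by apply: integr_norm; exact: integrB.
rewrite [leRHS]integral_mkcond; apply: ge0_le_integral => //.
- apply/measurable_EFinP/measurableT_comp => //.
  by apply: measurable_funB; apply: measurable_funM.
- apply/(measurable_restrictT _ _).1; first exact: measurable_ball.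
  apply/measurable_EFinP/measurableT_comp => //.
  by apply: measurable_funTS; exact: measurable_funB.
- move=> x _; rewrite -mulrBl normrM (ger0_norm (eta_ge0 _ _ _)) patchE.
  case: ifPn => [_|]; first by rewrite lee_fin ler_piMr// eta_le1.
  rewrite notin_setE /ball/= => /negP; rewrite -leNgt => xh.
  by rewrite eta_out// ?mulr0// distrC.
Qed.

Lemma lebesgue_pt_small f a (e : R) : lebesgue_pt f a -> 0 < e ->
  \forall h \near (0 : R)^'+, (\int[mu]_(x in ball a h) `|f x - f a|%:E <= (e * h)%:E)%E.
Proof.
move=> /fine_cvgP[fin /cvgrPdist_le/(_ (e / 2))] + e0.
rewrite divr_gt0// => /(_ isT) cv; near=> h.
have h0 : 0 < h by near: h; exact: nbhs_right_gt.
have hfin : davg f a h \is a fin_num by near: h.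
have : `|0 - fine (davg f a h)| <= e / 2 by near: h.
rewrite sub0r normrN ger0_norm ?fine_ge0 ?davg_ge0// -lee_fin fineK//.
rewrite /davg /iavg lebesgue_measure_ball ?(ltW h0)// inver mulrn_eq0/= gt_eqF//.
rewrite lee_pdivrMl ?mulrn_wgt0// -EFinM => H; apply: le_trans H _.
by rewrite lee_fin mulr2n; lra.
Unshelve. all: by end_near. Qed.

Lemma aeq_of_lebesgue_pt f g : locally_integrable setT f ->
  (forall x, lebesgue_pt f x -> f x = g x) -> aeq f g.
Proof.
move=> lf H; have L : {ae mu, forall x : measurableTypeR R, lebesgue_pt f x}.
  exact: lebesgue_differentiation.
apply: (@filterS _ _ (ae_filter_ringOfSetsType mu) _ _ _ L) => x; exact: H.
Qed.

Lemma eq0_of_small (x : R) : (forall e : R, 0 < e -> `|x| <= e) -> x = 0.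
Proof.
move=> H; apply/eqP; rewrite -normr_le0; apply/ler_addgt0Pr => e e0.
by rewrite add0r H.
Qed.

Lemma fundamental_lemma f : locally_integrable setT f ->
  (forall phi, test_function phi -> \int[mu]_x (f x * phi x) = 0) -> aeq f (fun=> 0).
Proof.
move=> lf H; apply: aeq_of_lebesgue_pt => // a fa.
apply: eq0_of_small => e e0.
near (0 : R)^'+ => h.
have h0 : 0 < h by near: h; exact: nbhs_right_gt.
have S : (\int[mu]_(x in ball a h) `|f x - f a|%:E <= (e / 2 * h)%:E)%E.
  by near: h; apply: lebesgue_pt_small => //; rewrite divr_gt0.
have := le_trans (eta_approx a lf h0) S.
rewrite (H _ (eta_test a h0)) sub0r normrN normrM lee_fin.
have I := Int_eta_ge a h0; rewrite (ger0_norm (le_trans _ I)); last by rewrite divr_ge0 ?ltW.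
move: (\int[mu]_x eta a h x) I => I I1 I2; have f0 := normr_ge0 (f a).
have : `|f a| * (h / 2) <= e / 2 * h by apply: le_trans I2; rewrite ler_wpM2l.
by move=> K; rewrite -(@ler_pM2r _ (h / 2)) ?divr_gt0//; lra.
Unshelve. all: by end_near. Qed.

(** The difference of two translates of a bump has zero mean, hence is the derivative of a test
    function. The bump integrals at two Lebesgue points therefore coincide at every scale, and so do
    the values of [f] there. *)
Lemma du_bois_reymond f : locally_integrable setT f ->
  (forall phi, test_function phi -> \int[mu]_x (f x * derive1 phi x) = 0) ->
  exists c, aeq f (fun=> c).
Proof.
move=> lf H.
have key a b : lebesgue_pt f a -> lebesgue_pt f b -> f b = f a.
  move=> fa fb; apply/eqP; rewrite -subr_eq0; apply/eqP.
  apply: eq0_of_small => e e0.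
  near (0 : R)^'+ => h.
  have h0 : 0 < h by near: h; exact: nbhs_right_gt.
  have e4 : 0 < e / 4 by rewrite divr_gt0.
  have Sa : (\int[mu]_(x in ball a h) `|f x - f a|%:E <= (e / 4 * h)%:E)%E.
    by near: h; apply: lebesgue_pt_small => //; rewrite divr_gt0.
  have Sb : (\int[mu]_(x in ball b h) `|f x - f b|%:E <= (e / 4 * h)%:E)%E.
    by near: h; apply: lebesgue_pt_small => //; rewrite divr_gt0.
  have := le_trans (eta_approx a lf h0) Sa; have := le_trans (eta_approx b lf h0) Sb.
  rewrite !lee_fin => Eb Ea.
  have ta := eta_test a h0; have tb := eta_test b h0.
  have Iab : \int[mu]_x eta a h x = \int[mu]_x eta b h x.
    rewrite [RHS](@Int_affine _ _ 1 (b - a))//; last exact: test_integr.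
    rewrite normr1 mul1r; apply: eq_Int => x; rewrite /eta /paraboloid mul1r.
    by congr (possq (1 - (_ / _) ^+ 2)); ring.
  pose g x := eta b h x - eta a h x.
  have cg : continuous g.
    by move=> x; apply: cvgB; [exact: (test_continuous tb)|exact: (test_continuous ta)].
  have [Ma [_ sa _]] := test_supp ta; have [Mb [_ sb _]] := test_supp tb.
  have sg : supp_in (Num.max Ma Mb) g.
    by move=> x; rewrite ge_max /g => /andP[/sa -> /sb ->]; rewrite subrr.
  have g0 : \int[mu]_x g x = 0.
    by rewrite /g IntB ?Iab ?subrr//; exact: test_integr.
  have [phi tphi dphi] := test_primitive cg sg g0.
  have := H _ tphi; rewrite dphi.
  rewrite (_ : \int[mu]_x _ = \int[mu]_x (f x * eta b h x) - \int[mu]_x (f x * eta a h x)); last first.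
    rewrite -IntB; [|exact: test_locint_mul|exact: test_locint_mul].
    by apply: eq_Int => x; rewrite /g mulrBr.
  have I := Int_eta_ge b h0.
  have arith (J A B x y : R) : h / 2 <= J -> `|A - x * J| <= e / 4 * h ->
      `|B - y * J| <= e / 4 * h -> B - A = 0 -> `|y - x| <= e.
    move=> hJ HA HB BA.
    have J0 : 0 < J by apply: lt_le_trans hJ; rewrite divr_gt0.
    have : `|y - x| * J <= e / 2 * h.
      rewrite -{1}(gtr0_norm J0) -normrM.
      have -> : (y - x) * J = (A - x * J) - (B - y * J) by lra.
      by rewrite (le_trans (ler_normB _ _))//; lra.
    move=> H1; have : `|y - x| * (h / 2) <= e / 2 * h.
      by apply: le_trans H1; rewrite ler_wpM2l.
    by move=> K; rewrite -(@ler_pM2r _ (h / 2)) ?divr_gt0//; lra.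
  by rewrite Iab in Ea; exact: arith I Ea Eb.
have [[a fa]|nofa] := pselect (exists a, lebesgue_pt f a).
  by exists (f a); apply: aeq_of_lebesgue_pt => // b fb; exact: key.
by exists 0; apply: aeq_of_lebesgue_pt => // b fb; exfalso; apply: nofa; exists b.
Unshelve. all: by end_near. Qed.

Lemma L2_locint f : L2 f -> locally_integrable setT f.
Proof.
move=> Lf; split; [exact: L2_meas|exact: openT|move=> K _ cK].
have [M [_ HM]] := compact_bounded cK.
have [N N0 KN] : exists2 N : R, 0 < N & forall x, K x -> `|x| < N.
  exists (`|M| + 2); first by rewrite ltr_wpDl.
  move=> x Kx; have := HM (`|M| + 1) _ x Kx.
  by have := ler_norm M; move=> ?; rewrite /= => /(_ ltac:(lra)); lra.
have Lc := L2_integr_loc (- N) N Lf.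
apply: (@le_lt_trans _ _ (\int[mu]_x `|f x * chi (- N) N x|%:E)%E); last first.
  by case/integrableP: Lc.
rewrite [leLHS]integral_mkcond; apply: ge0_le_integral => //.
- by move=> x _; rewrite patchE; case: ifPn.
- apply/(measurable_restrictT _ _).1; first exact: compact_measurable.
  apply/measurable_EFinP/measurableT_comp => //.
  by apply: measurable_funTS; exact: L2_meas.
- apply/measurable_EFinP/measurableT_comp => //.
  by apply: measurable_funM; [exact: L2_meas|exact: measurable_chi].
- move=> x _; rewrite patchE; case: ifPn => [/set_mem/KN|_]; last by rewrite lee_fin.
  by rewrite ltr_norml => /andP[H1 H2]; rewrite chi_in ?mulr1// H1 ltW.
Qed.

Lemma continuous_locint f : continuous f -> locally_integrable setT f.
Proof.
move=> cf; split; [exact: continuous_measurable_fun|exact: openT|move=> K _ cK].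
have : mu.-integrable K (EFin \o f).
  by apply: continuous_compact_integrable => //; exact: continuous_subspaceT.
by case/integrableP.
Qed.

Lemma AC_locint u du : AC u du -> locally_integrable setT u.
Proof. by move=> /AC_continuous; exact: continuous_locint. Qed.

Lemma AC_parts u du phi : AC u du -> test_function phi ->
  \int[mu]_x (u x * derive1 phi x) = - \int[mu]_x (du x * phi x).
Proof.
move=> Hu t; have [M [M0 s ds]] := test_supp t; have Ht := test_AC t.
have MM : - M <= M by lra.
have [_ _] := AC_prod_loc Hu Ht MM.
rewrite (s M) ?(s (- M)) ?normrN ?ler_norm// !mulr0 subrr => E.
have E1 : \int[mu]_x (u x * derive1 phi x) = \int[mu]_x (derive1 phi x * chi (- M) M x * u x).
  by apply: eq_Int => x; rewrite (supp_chi x ds) mulrC.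
have E2 : \int[mu]_x (du x * phi x) = \int[mu]_x (du x * chi (- M) M x * phi x).
  by apply: eq_Int => x; rewrite -{1}(supp_chi x s); ring.
by rewrite E1 E2; lra.
Qed.

Lemma AC_weak u du : AC u du -> is_weak_derivative u du.
Proof.
move=> Hu; split; [exact: AC_locint Hu|exact: L2_locint Hu.1|].
by move=> phi; exact: AC_parts.
Qed.

Lemma aeq_locint f g : measurable_fun setT g -> aeq f g ->
  locally_integrable setT f -> locally_integrable setT g.
Proof.
move=> mg fg [mf oT H]; split => // K KT cK; have := H K KT cK.
rewrite (_ : integral _ _ _ = \int[mu]_(x in K) `|g x|%:E)%E//.
have mK := compact_measurable cK.
apply: ae_eq_integral => //.
- by apply/measurable_EFinP/measurableT_comp => //; exact: measurable_funTS.
- by apply/measurable_EFinP/measurableT_comp => //; exact: measurable_funTS.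
- by apply: filterS fg => x ->.
Qed.

Lemma aeq_weak u u' du du' : measurable_fun setT u' -> measurable_fun setT du' ->
  aeq u u' -> aeq du du' -> is_weak_derivative u du -> is_weak_derivative u' du'.
Proof.
move=> mu' mdu' Eu Edu [lu ldu H]; split.
- exact: aeq_locint lu.
- exact: aeq_locint ldu.
move=> phi t; have [mu_ _ _] := lu; have [mdu _ _] := ldu; have [_ c _] := t.
have mphi := L2_meas (test_L2 t); have mdphi := L2_meas (test_dL2 t).
rewrite (@aeq_Int _ _ (fun x => u x * derive1 phi x)).
- rewrite H//; congr (- _); apply: aeq_Int; try exact: measurable_funM.
  by apply: filterS Edu => x ->.
- exact: measurable_funM.
- exact: measurable_funM.
- by apply: filterS Eu => x ->.
Qed.

Lemma weak_unique u g g' : is_weak_derivative u g -> is_weak_derivative u g' -> aeq g g'.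
Proof.
move=> [_ lg H] [_ lg' H']; apply: aeqB; apply: fundamental_lemma.
  exact: locally_integrableB.
move=> phi t; rewrite (_ : \int[mu]_x _ = \int[mu]_x (g x * phi x) - \int[mu]_x (g' x * phi x)).
  by apply/eqP; rewrite subr_eq0 -(inj_eq oppr_inj) -H// -H'.
rewrite -IntB; [|exact: test_locint_mul|exact: test_locint_mul].
by apply: eq_Int => x; rewrite mulrBl.
Qed.

(** The oriented integral [G] of [du] from 0 has the same weak derivative as [u], so [u - G] is
    almost everywhere constant. *)
Lemma weak_AC u du : is_weak_derivative u du -> L2 du ->
  exists2 v, AC v du & aeq u v.
Proof.
move=> [lu ldu H] Ldu; pose G x := ip du (chi 0 x).
have HG : AC G du.
  split => // a b; rewrite /G -ipBr //; [|exact: L2_chi|exact: L2_chi].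
  by congr ip; apply/funext => t; rewrite /chi; lra.
have lG := AC_locint HG.
have [c Hc] : exists c, aeq (fun x => u x - G x) (fun=> c).
  apply: du_bois_reymond; first exact: locally_integrableB.
  move=> phi t.
  rewrite (_ : \int[mu]_x _ = \int[mu]_x (u x * derive1 phi x) - \int[mu]_x (G x * derive1 phi x)).
    by rewrite H// (AC_parts HG t) subrr.
  rewrite -IntB; [|exact: test_locint_dmul|exact: test_locint_dmul].
  by apply: eq_Int => x; rewrite mulrBl.
exists (fun x => c + G x).
  by have := ACD (AC_cst c) HG; apply: eq_AC => x; rewrite ?add0r.
by apply: filterS Hc => x <-; rewrite subrK.
Qed.

(** The functional [ip f] on test functions is represented by some [g] in their L^2 closure; then
    [f - g] is orthogonal to all test functions, and [f = g] almost everywhere. *)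
Lemma test_dense f : L2 f -> exists2 v : nat -> R -> R, forall n, test_function (v n) &
  n2 (fun x => v n x - f x) @[n --> \oo] --> (0 : R).
Proof.
move=> Lf.
have [g [Lg Hg [v tv cv]]] := @riesz R test_function (ip f) (n2 f) test0
  (fun phi t => test_L2 t) (fun c p q tp tq => testD c tp tq)
  ltac:(by move=> c p q tp tq; rewrite ipDr ?ipZr//; try exact: test_L2; apply: L2Z; exact: test_L2)
  ltac:(by move=> p tp; apply: ip_le => //; exact: test_L2).
exists v => //.
have fg : aeq (fun x => f x - g x) (fun=> 0).
  apply: fundamental_lemma; first by apply: L2_locint; exact: L2B.
  move=> phi t; have Lp := test_L2 t.
  by rewrite -[LHS]/(ip (fun x => f x - g x) phi) ipBl// Hg// subrr.
rewrite (_ : (fun n => _) = (fun n => n2 (fun x => v n x - g x)))//.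
apply/funext => n; apply: aeq_n2.
- by apply: measurable_funB; apply: L2_meas => //; exact: test_L2.
- by apply: measurable_funB; apply: L2_meas => //; exact: test_L2.
- by apply: filterS fg => x /eqP; rewrite subr_eq0 => /eqP ->.
Qed.

Lemma aeq_test f g : L2 f -> L2 g ->
  (forall phi, test_function phi -> ip f phi = ip g phi) -> aeq f g.
Proof.
move=> Lf Lg H; apply: aeqB; apply: fundamental_lemma.
  by apply: L2_locint; exact: L2B.
move=> phi t; rewrite -[LHS]/(ip (fun x => f x - g x) phi) ipBl ?H ?subrr//.
exact: test_L2.
Qed.

End TestFunctions.

(** * Poisson and conjugate Poisson kernels *)

Section HalfLine.
Context {R : realType}.
Local Notation mu := (@lebesgue_measure R).
Implicit Types (f g F : R -> R) (a b e l C : R).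

Definition pos01 (x : R) : R := (0 < x)%R%:R.

Lemma measurable_pos01 : measurable_fun setT pos01.
Proof.
rewrite (_ : pos01 = fun x => if 0 < x then 1 else 0).
  apply: measurable_fun_ifT => //.
  exact: measurable_fun_ltr.
by apply/funext => x; rewrite /pos01; case: (0 < x).
Qed.

Lemma nat_ub (x : R) : exists N : nat, forall n, (N <= n)%N -> x <= n%:R.
Proof.
exists (Num.truncn `|x|).+1 => n Nn.
by rewrite (le_trans (ler_norm x))// ltW// (lt_le_trans (truncnS_gt _))// ler_nat.
Qed.

Lemma chi0n_cvg (x : R) : chi 0 n%:R x @[n --> \oo] --> pos01 x.
Proof.
have [N HN] := nat_ub x; apply: (@cvg_trans _ ((fun=> pos01 x) @ \oo)); last exact: cvg_cst.
apply: near_eq_cvg; exists N => // n /= /HN xn.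
by rewrite /chi /pos01 xn; case: (ltP 0 x); rewrite ?subr0 ?subrr.
Qed.

Lemma half_ftc f F l : (forall x : R, is_derive x (1 : R) F (f x)) -> continuous f ->
  integr (fun x => f x * pos01 x) -> F n%:R @[n --> \oo] --> l ->
  \int[mu]_x (f x * pos01 x) = l - F 0.
Proof.
move=> dF cf fi Fl.
have d x : derivable F x 1 by case: (dF x).
have F' : derive1 F = f.
  by apply/funext => x; rewrite derive1E; exact: (@derive_val _ _ _ _ _ _ _ (dF x)).
have E n : F n%:R - F 0 = \int[mu]_x (f x * chi 0 n%:R x).
  have c' : continuous (derive1 F) by rewrite F'.
  by have [_ ->] := C1_ftc d c' (ler0n R n); rewrite F'.
have mf : measurable_fun setT f by exact: continuous_measurable_fun.
have chib (n : nat) x : `|chi 0 n%:R x| <= `|pos01 x|.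
  rewrite /chi /pos01; case: (ltP 0 x) => x0.
    by rewrite subr0; case: (x <= n%:R); rewrite ?normr1 ?normr0.
  by rewrite (le_trans x0 (ler0n _ n)) subrr normr0.
have cv : \int[mu]_x (f x * chi 0 n%:R x) @[n --> \oo] --> \int[mu]_x (f x * pos01 x).
  apply: (dct _ _ (integr_norm fi) _ _).2.
  - by move=> n; apply: measurable_funM => //; exact: measurable_chi.
  - exact: integr_meas.
  - by apply: aeW => x; apply: cvgM; [exact: cvg_cst|exact: chi0n_cvg].
  - by move=> n x; rewrite !normrM ler_wpM2l.
have cv' : F n%:R - F 0 @[n --> \oo] --> l - F 0 by apply: cvgB => //; exact: cvg_cst.
rewrite (_ : (fun n => F n%:R - F 0) = (fun n => \int[mu]_x (f x * chi 0 n%:R x))) in cv'.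
  by rewrite -(cvg_lim (@Rhausdorff R) cv) -(cvg_lim (@Rhausdorff R) cv').
by apply/funext => n; exact: E.
Qed.

Lemma half_ftc_ge0 f F l C : (forall x : R, is_derive x (1 : R) F (f x)) -> continuous f ->
  (forall x, 0 <= f x) -> (forall n : nat, F n%:R <= C) -> F n%:R @[n --> \oo] --> l ->
  integr (fun x => f x * pos01 x) /\ \int[mu]_x (f x * pos01 x) = l - F 0.
Proof.
move=> dF cf f0 FC Fl.
have d x : derivable F x 1 by case: (dF x).
have F' : derive1 F = f.
  by apply/funext => x; rewrite derive1E; exact: (@derive_val _ _ _ _ _ _ _ (dF x)).
have c' : continuous (derive1 F) by rewrite F'.
have mf : measurable_fun setT f by exact: continuous_measurable_fun.
have c0 (n : nat) (x : R) : 0 <= chi 0 n%:R x.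
  rewrite /chi; case: (leP x 0) => x0; last by rewrite subr0.
  by rewrite (le_trans x0 (ler0n _ n)) subrr.
have [fi _] : integr (fun x => f x * pos01 x) /\ \int[mu]_x (f x * pos01 x) <= C - F 0.
  apply: (@fatou_integr R (fun n x => f x * chi 0 n%:R x)).
  - by move=> n; have [+ _] := C1_ftc d c' (ler0n R n); rewrite F'.
  - by move=> n x; rewrite mulr_ge0.
  - by apply: measurable_funM => //; exact: measurable_pos01.
  - by move=> x; rewrite mulr_ge0// /pos01.
  - by apply: aeW => x; apply: cvgM; [exact: cvg_cst|exact: chi0n_cvg].
  - by move=> n; have [_] := C1_ftc d c' (ler0n R n); rewrite F' => <-; rewrite lerD2r.
by split => //; exact: half_ftc.
Qed.

Lemma integr_reflect f : integr f -> integr (fun x => f (- x)).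
Proof.
move=> fi; have := @integr_affine _ f (-1) 0 _ fi; rewrite oppr_eq0 oner_eq0 => /(_ isT).
by under eq_fun do rewrite mulN1r addr0.
Qed.

Lemma Int_reflect f : integr f -> \int[mu]_x f (- x) = \int[mu]_x f x.
Proof.
move=> fi; rewrite (@Int_affine _ f (-1) 0) ?oppr_eq0 ?oner_eq0//.
by rewrite normrN normr1 mul1r; apply: eq_Int => x; rewrite mulN1r addr0.
Qed.

Lemma Int_odd f : integr f -> (forall x, f (- x) = - f x) -> \int[mu]_x f x = 0.
Proof.
by move=> fi fo; have := Int_reflect fi; rewrite (eq_Int fo) IntN//; lra.
Qed.

Lemma aeq_ne0 f g : (forall x, x != 0 -> f x = g x) -> aeq f g.
Proof.
move=> H; exists [set 0]; split => //; first exact: lebesgue_measure_set1.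
by move=> x /=; apply: contra_notP => /eqP /H.
Qed.

Lemma Int_even f : measurable_fun setT f -> (forall x, f (- x) = f x) ->
  integr (fun x => f x * pos01 x) ->
  integr f /\ \int[mu]_x f x = 2 * \int[mu]_x (f x * pos01 x).
Proof.
move=> mf fe fi; have fi' := integr_reflect fi.
have E : aeq (fun x => f x * pos01 x + f (- x) * pos01 (- x)) f.
  apply: aeq_ne0 => x x0; rewrite fe /pos01 oppr_gt0.
  by case: (ltgtP x 0) x0 => // _ _; rewrite mulr1 mulr0 ?addr0 ?add0r.
have i2 := integrD fi fi'.
split; first exact: aeq_integr i2.
rewrite -(aeq_Int (integr_meas i2) mf E) IntD// (Int_reflect fi); lra.
Qed.

Lemma is_derive_lin (c x : R) : is_derive x (1 : R) (fun y => c * y) c.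
Proof.
apply: (@is_derive_eq _ _ _ (c *: id)).
by rewrite /GRing.scale/= mulr1.
Qed.

Lemma is_derive_expR_lin (c x : R) :
  is_derive x (1 : R) (fun y => expR (c * y)) (expR (c * x) * c).
Proof.
exact: (@is_derive1_comp _ expR (fun y => c * y) x _ _ (is_derive_expR _) (is_derive_lin c x)).
Qed.

Lemma is_derive_exp_trig (c a A B x : R) :
  is_derive x (1 : R) (fun y => expR (c * y) * (A * sin (a * y) + B * cos (a * y)))
   (expR (c * x) * ((c * A - a * B) * sin (a * x) + (c * B + a * A) * cos (a * x))).
Proof.
have ds := @is_derive1_comp _ sin (fun y => a * y) x _ _ (is_derive_sin _) (is_derive_lin a x).
have dc := @is_derive1_comp _ cos (fun y => a * y) x _ _ (is_derive_cos _) (is_derive_lin a x).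
have d1 := is_deriveD (is_deriveZ A ds) (is_deriveZ B dc).
have d2 := is_deriveM (is_derive_expR_lin c x) d1.
apply: (is_derive_eq d2).
change (expR (c * x) * (A * (cos (a * x) * a) + B * (- sin (a * x) * a)) +
  (A * sin (a * x) + B * cos (a * x)) * (expR (c * x) * c) =
  expR (c * x) * ((c * A - a * B) * sin (a * x) + (c * B + a * A) * cos (a * x))); ring.
Qed.

Lemma continuous_lin (c : R) : continuous (fun y : R => c * y).
Proof. by move=> x; apply: cvgM; [exact: cvg_cst|exact: cvg_id]. Qed.

Lemma continuous_expR_lin (c : R) : continuous (fun y : R => expR (c * y)).
Proof.
move=> x; apply: (@continuous_comp _ _ _ (fun y => c * y) expR); first exact: continuous_lin.
exact: continuous_expR.
Qed.

Lemma continuous_sin_lin (c : R) : continuous (fun y : R => sin (c * y)).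
Proof.
move=> x; apply: (@continuous_comp _ _ _ (fun y => c * y) sin); first exact: continuous_lin.
exact: continuous_sin.
Qed.

Lemma continuous_cos_lin (c : R) : continuous (fun y : R => cos (c * y)).
Proof.
move=> x; apply: (@continuous_comp _ _ _ (fun y => c * y) cos); first exact: continuous_lin.
exact: continuous_cos.
Qed.

Lemma cvg_expR_nat e : 0 < e -> expR (- e * n%:R) @[n --> \oo] --> (0 : R).
Proof.
move=> e0; have : expR (- e) ^+ n @[n --> \oo] --> (0 : R).
  by apply: cvg_expr; rewrite ger0_norm ?expR_ge0// expR_lt1 oppr_lt0.
by under eq_fun do rewrite -expRM_natr.
Qed.

Lemma half_exp_integr e : 0 < e -> integr (fun x => expR (- e * x) * pos01 x).
Proof.
move=> e0; have [] := @half_ftc_ge0 (fun x => expR (- e * x))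
  (fun x => - e^-1 * expR (- e * x)) 0 0.
- move=> x; apply: (is_derive_eq (is_deriveZ (- e^-1) (is_derive_expR_lin (- e) x))).
  by rewrite /GRing.scale/=; field; rewrite gt_eqF.
- exact: continuous_expR_lin.
- by move=> x; exact: expR_ge0.
- by move=> n; rewrite mulNr oppr_le0 mulr_ge0 ?expR_ge0// invr_ge0 ltW.
- by rewrite -(mulr0 (- e^-1)); apply: cvgM; [exact: cvg_cst|exact: cvg_expR_nat].
by [].
Qed.

(** The integrand is the derivative of [expR (- e x) * (A sin (a x) + B cos (a x))]. Solving a
    linear system for [A] and [B] isolates the cosine or the sine, which gives the two Laplace
    transforms that follow. *)
Lemma half_exp_trig (e a A B : R) : 0 < e ->
  integr (fun x => expR (- e * x) *
    ((- e * A - a * B) * sin (a * x) + (- e * B + a * A) * cos (a * x)) * pos01 x) /\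
  \int[mu]_x (expR (- e * x) *
    ((- e * A - a * B) * sin (a * x) + (- e * B + a * A) * cos (a * x)) * pos01 x) = - B.
Proof.
move=> e0; set f := (fun x => expR (- e * x) *
    ((- e * A - a * B) * sin (a * x) + (- e * B + a * A) * cos (a * x))).
have cf : continuous f.
  move=> x; apply: cvgM; first exact: continuous_expR_lin.
  apply: cvgD; (apply: cvgM; first exact: cvg_cst).
    exact: continuous_sin_lin.
  exact: continuous_cos_lin.
have bnd u v (t : R) : `|u * sin t + v * cos t| <= `|u| + `|v|.
  apply: (le_trans (ler_normD _ _)); rewrite !normrM; apply: lerD.
    by rewrite ler_piMr// ler_norml sin_geN1 sin_le1.
  by rewrite ler_piMr// ler_norml cos_geN1 cos_le1.
have fi : integr (fun x => f x * pos01 x).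
  have := half_exp_integr e0 => /(integrZ (`|- e * A - a * B| + `|- e * B + a * A|)).
  apply: le_integr.
    by apply: measurable_funM measurable_pos01; exact: continuous_measurable_fun.
  move=> x; rewrite mulrA !normrM ler_pM ?mulr_ge0//.
    by rewrite [leRHS]mulrC ger0_norm ?expR_ge0//; apply: ler_wpM2l; rewrite ?expR_ge0.
  by rewrite /pos01 ger0_norm.
split => //.
have K : expR (- e * n%:R) * (A * sin (a * n%:R) + B * cos (a * n%:R)) @[n --> \oo] --> (0 : R).
  have K : expR (- e * n%:R) * (`|A| + `|B|) @[n --> \oo] --> 0 * (`|A| + `|B|).
    by apply: cvgM; [exact: cvg_expR_nat|exact: cvg_cst].
  rewrite mul0r in K; apply/norm_cvg0P.
  apply: (squeeze_cvgr _ (@cvg_cst _ _ _ _ _) K); apply: nearW => n.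
  by rewrite normr_ge0/= normrM ger0_norm ?expR_ge0// ler_wpM2l ?expR_ge0.
have -> := half_ftc (fun x => is_derive_exp_trig (- e) a A B x) cf fi K.
by rewrite !mulr0 expR0 sin0 cos0; ring.
Qed.

Lemma half_exp_cos (e a : R) : 0 < e ->
  integr (fun x => expR (- e * x) * cos (a * x) * pos01 x) /\
  \int[mu]_x (expR (- e * x) * cos (a * x) * pos01 x) = e / (e ^+ 2 + a ^+ 2).
Proof.
move=> e0; have D : e ^+ 2 + a ^+ 2 != 0 by rewrite gt_eqF// ltr_pwDl ?exprn_gt0 ?sqr_ge0.
have [i I] := half_exp_trig a (a / (e ^+ 2 + a ^+ 2)) (- e / (e ^+ 2 + a ^+ 2)) e0.
rewrite -[RHS]opprK -[in RHS]mulNr -I; split; last apply: eq_Int => x.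
  apply: eq_integr i => x; congr (_ * _ * _).
  by rewrite [X in X * sin _](_ : _ = 0) ?mul0r ?add0r ?[X in X * cos _](_ : _ = 1) ?mul1r//; field.
congr (_ * _ * _).
by rewrite [X in X * sin _](_ : _ = 0) ?mul0r ?add0r ?[X in X * cos _](_ : _ = 1) ?mul1r//; field.
Qed.

Lemma half_exp_sin (e a : R) : 0 < e ->
  integr (fun x => expR (- e * x) * sin (a * x) * pos01 x) /\
  \int[mu]_x (expR (- e * x) * sin (a * x) * pos01 x) = a / (e ^+ 2 + a ^+ 2).
Proof.
move=> e0; have D : e ^+ 2 + a ^+ 2 != 0 by rewrite gt_eqF// ltr_pwDl ?exprn_gt0 ?sqr_ge0.
have [i I] := half_exp_trig a (- e / (e ^+ 2 + a ^+ 2)) (- a / (e ^+ 2 + a ^+ 2)) e0.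
rewrite -[RHS]opprK -[in RHS]mulNr -I; split; last apply: eq_Int => x.
  apply: eq_integr i => x; congr (_ * _ * _).
  by rewrite [X in X * cos _](_ : _ = 0) ?mul0r ?addr0 ?[X in X * sin _](_ : _ = 1) ?mul1r//; field.
congr (_ * _ * _).
by rewrite [X in X * cos _](_ : _ = 0) ?mul0r ?addr0 ?[X in X * sin _](_ : _ = 1) ?mul1r//; field.
Qed.

(** The Abel summation weight. Its transform is the Poisson kernel, and with the extra factor [sgw]
    it is the conjugate Poisson kernel. *)
Definition ew (e x : R) : R := expR (- e * `|x|).

Lemma ew_even e x : ew e (- x) = ew e x. Proof. by rewrite /ew normrN. Qed.

Lemma ew_ge0 e x : 0 <= ew e x. Proof. exact: expR_ge0. Qed.

Lemma ew_le1 e x : 0 <= e -> ew e x <= 1.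
Proof. by move=> e0; rewrite /ew expR_le1 mulNr oppr_le0 mulr_ge0. Qed.

Lemma measurable_ew e : measurable_fun setT (ew e).
Proof.
apply: continuous_measurable_fun => x; rewrite /ew.
apply: (@continuous_comp _ _ _ (fun y : R => `|y|) (fun y => expR (- e * y))).
  exact: norm_continuous.
exact: continuous_expR_lin.
Qed.

Lemma ew_pos01 e x : ew e x * pos01 x = expR (- e * x) * pos01 x.
Proof. by rewrite /ew /pos01; case: (ltP 0 x) => x0; rewrite ?mulr0// gtr0_norm. Qed.

Lemma ew_integr e : 0 < e -> integr (ew e).
Proof.
move=> e0; have [] := @Int_even (ew e) (measurable_ew e) (ew_even e) _ => //.
by apply: eq_integr (half_exp_integr e0) => x; rewrite ew_pos01.
Qed.

Lemma Int_ew_cos e a : 0 < e ->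
  \int[mu]_x (ew e x * cos (a * x)) = 2 * e / (e ^+ 2 + a ^+ 2).
Proof.
move=> e0; have [i I] := half_exp_cos a e0.
have E x : expR (- e * x) * cos (a * x) * pos01 x = ew e x * cos (a * x) * pos01 x.
  by rewrite -!mulrA ![cos _ * _]mulrC !mulrA ew_pos01.
have [] := @Int_even (fun x => ew e x * cos (a * x)) _ _ (eq_integr E i).
- apply: measurable_funM; first exact: measurable_ew.
  by apply: continuous_measurable_fun; exact: continuous_cos_lin.
- by move=> x; rewrite ew_even mulrN cosN.
by move=> _ ->; rewrite -(eq_Int E) I mulrA.
Qed.

Definition sgw (x : R) : R := (0 < x)%R%:R - (x < 0)%R%:R.

Lemma sgw_odd x : sgw (- x) = - sgw x.
Proof. by rewrite /sgw oppr_gt0 oppr_lt0 opprB. Qed.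

Lemma sgw_bnd x : `|sgw x| <= 1.
Proof.
rewrite /sgw; case: (ltgtP x 0) => _; rewrite ?sub0r ?subr0 ?normrN ?normr1//.
by rewrite normr0.
Qed.

Lemma sgwM x : sgw x * x = `|x|.
Proof.
rewrite /sgw; case: (ltgtP x 0) => [x0|x0|->].
- by rewrite sub0r mulN1r ltr0_norm.
- by rewrite subr0 mul1r gtr0_norm.
- by rewrite mulr0 normr0.
Qed.

Lemma measurable_sgw : measurable_fun setT sgw.
Proof.
rewrite (_ : sgw = fun x => pos01 x - pos01 (- x)).
  apply: measurable_funB; first exact: measurable_pos01.
  exact: (measurableT_comp measurable_pos01).
by apply/funext => x; rewrite /sgw /pos01 oppr_gt0.
Qed.

Lemma Int_ew_sin e a : 0 < e ->
  \int[mu]_x (ew e x * sgw x * sin (a * x)) = 2 * a / (e ^+ 2 + a ^+ 2).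
Proof.
move=> e0; have [i I] := half_exp_sin a e0.
have E x : expR (- e * x) * sin (a * x) * pos01 x = ew e x * sgw x * sin (a * x) * pos01 x.
  rewrite /ew /sgw /pos01; case: (ltgtP x 0) => x0; rewrite ?mulr0// gtr0_norm//.
  by rewrite mulr1n mulr0n subr0 !mulr1.
have [] := @Int_even (fun x => ew e x * sgw x * sin (a * x)) _ _ (eq_integr E i).
- apply: measurable_funM; first by apply: measurable_funM; [exact: measurable_ew|exact: measurable_sgw].
  by apply: continuous_measurable_fun; exact: continuous_sin_lin.
- by move=> x; rewrite ew_even sgw_odd (mulrN a) sinN mulrN mulrN mulNr opprK.
by move=> _ ->; rewrite -(eq_Int E) I mulrA.
Qed.

(** The Poisson kernel at height 1 multiplied by [2 * pi]; its mass [2 * pi] is the origin of the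
    Plancherel constant. *)
Definition pker (x : R) : R := 2 / (1 + x ^+ 2).

Lemma pker_ge0 x : 0 <= pker x.
Proof. by rewrite divr_ge0// addr_ge0// sqr_ge0. Qed.

Lemma continuous_pker : continuous pker.
Proof.
move=> x; apply: cvgM; first exact: cvg_cst.
by apply: continuous_oneDsqrV.
Qed.

Lemma pker_Int : integr pker /\ \int[mu]_x pker x = 2 * pi.
Proof.
have cp := continuous_pker.
have [] := @half_ftc_ge0 pker (fun x => 2 * atan x) pi pi.
- exact: cp.
- exact: pker_ge0.
- by move=> n; have := atan_ltpi2 (n%:R : R); lra.
- have -> : pi = 2 * (pi / 2) :> R by lra.
  apply: cvgM; first exact: cvg_cst.
  exact: (cvg_comp _ _ (@cvgr_idn R) (@cvgy_atan R)).
move=> i I; have [i' I'] := Int_even (continuous_measurable_fun cp)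
  (fun x => ltac:(by rewrite /pker sqrrN)) i.
by split => //; rewrite I' I atan0 mulr0 subr0.
Qed.

End HalfLine.

(** * The Hartley transform *)

Section Hartley.
Context {R : realType}.
Local Notation mu := (@lebesgue_measure R).
Local Notation RR := (measurableTypeR R).
Implicit Types (f g m phi : R -> R) (a b e x y z xi : R).

Definition cas x : R := cos x + sin x.

Lemma cas_bnd x : `|cas x| <= 2.
Proof.
rewrite (le_trans (ler_normD _ _))// [leRHS](_ : _ = 1 + 1)//.
by apply: lerD; rewrite ler_norml ?cos_geN1 ?cos_le1 ?sin_geN1 ?sin_le1.
Qed.

(** Under an even weight the sine integrates to zero and a function of [x - y] remains, so that a
    double transform is a convolution. Under an odd weight the cosine disappears and a function of
    [x + y] remains, so that the convolution comes with a reflection. *)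
Lemma casM x y : cas x * cas y = cos (x - y) + sin (x + y).
Proof. by rewrite /cas cosB sinD; ring. Qed.

Lemma continuous_cas : continuous cas.
Proof. by move=> x; apply: cvgD; [exact: continuous_cos|exact: continuous_sin]. Qed.

Lemma measurable_cas_lin x : measurable_fun setT (fun y => cas (x * y)).
Proof.
apply: continuous_measurable_fun => y.
apply: (@continuous_comp _ _ _ (fun y => x * y) cas); first exact: continuous_lin.
exact: continuous_cas.
Qed.

Definition casker (z : RR * RR) : R := cas (z.1 * z.2).

Lemma measurable_casker : measurable_fun setT casker.
Proof.
apply: (measurableT_comp (continuous_measurable_fun continuous_cas)).
by apply: measurable_funM; [exact: measurable_fst|exact: measurable_snd].
Qed.

Lemma casker_bnd (z : RR * RR) : `|casker z| <= 2. Proof. exact: cas_bnd. Qed.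

(* The Hartley transform: a real, symmetric variant of the Fourier transform,
   whose even and odd parts are the real and minus the imaginary part of it. *)
Definition Ha f xi : R := \int[mu]_x (f x * cas (xi * x)).

Lemma integr_cas f xi : integr f -> integr (fun x => f x * cas (xi * x)).
Proof.
move=> fi; apply: le_integr (integrZ 2 (integr_norm fi)).
  by apply: measurable_funM; [exact: integr_meas|exact: measurable_cas_lin].
by move=> x; rewrite normrM mulrC ler_wpM2r// cas_bnd.
Qed.

Lemma HaD f g xi : integr f -> integr g -> Ha (fun x => f x + g x) xi = Ha f xi + Ha g xi.
Proof.
move=> fi gi; rewrite /Ha -IntD; [|exact: integr_cas|exact: integr_cas].
by apply: eq_Int => x; rewrite mulrDl.
Qed.

Lemma HaB f g xi : integr f -> integr g -> Ha (fun x => f x - g x) xi = Ha f xi - Ha g xi.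
Proof.
move=> fi gi; rewrite /Ha -IntB; [|exact: integr_cas|exact: integr_cas].
by apply: eq_Int => x; rewrite mulrBl.
Qed.

Lemma Ha_bnd f xi : integr f -> `|Ha f xi| <= 2 * \int[mu]_x `|f x|.
Proof.
move=> fi; have ci := integr_cas xi fi.
rewrite -IntZ; last exact: integr_norm.
apply: (le_trans (norm_Int ci)); apply: le_Int.
- exact: integr_norm.
- by apply: integrZ; exact: integr_norm.
- by move=> x; rewrite normrM mulrC ler_wpM2r// cas_bnd.
Qed.

Lemma Ha_meas f : measurable_fun setT f -> measurable_fun setT (Ha f).
Proof.
move=> mf; apply: (@measurable_Int1 R (fun z : RR * RR => f z.2 * casker z)).
by apply: measurable_funM measurable_casker; exact: (measurableT_comp mf measurable_snd).
Qed.

Lemma Ha_sym f g : integr f -> integr g ->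
  integr (fun x => f x * Ha g x) /\
  \int[mu]_x (f x * Ha g x) = \int[mu]_x (g x * Ha f x).
Proof.
move=> fi gi; have [i E] := Int_kernelC measurable_casker casker_bnd fi gi.
split; first exact: i.
rewrite [LHS]E; apply: eq_Int => x; congr (_ * _); apply: eq_Int => y.
by rewrite /casker/= [y * x]mulrC.
Qed.

Lemma HaHa m f y : integr m -> integr f ->
  Ha (fun xi => m xi * Ha f xi) y =
  \int[mu]_x (f x * \int[mu]_xi (m xi * cas (y * xi) * cas (x * xi))).
Proof.
move=> mi fi; have [_ E] := Int_kernelC measurable_casker casker_bnd
  (integr_cas y mi) fi.
transitivity (\int[mu]_x ((m x * cas (y * x)) * Ha f x)).
  by apply: eq_Int => x; rewrite mulrAC.
rewrite [LHS]E; apply: eq_Int => x; congr (_ * _); apply: eq_Int => xi.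
by rewrite /casker/= [x * xi]mulrC.
Qed.

Lemma integr_bndM m (h : R -> R) (C : R) : integr m -> measurable_fun setT h -> (forall x, `|h x| <= C) ->
  integr (fun x => m x * h x).
Proof.
move=> mi mh hC; apply: le_integr (integrZ C (integr_norm mi)).
  by apply: measurable_funM => //; exact: integr_meas.
by move=> x; rewrite normrM mulrC ler_wpM2r.
Qed.

Lemma cos_bnd x : `|cos x| <= 1.
Proof. by rewrite ler_norml cos_geN1 cos_le1. Qed.

Lemma sin_bnd x : `|sin x| <= 1.
Proof. by rewrite ler_norml sin_geN1 sin_le1. Qed.

Lemma Int_casM m x y : integr m ->
  \int[mu]_xi (m xi * cas (y * xi) * cas (x * xi)) =
  \int[mu]_xi (m xi * cos ((y - x) * xi)) + \int[mu]_xi (m xi * sin ((y + x) * xi)).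
Proof.
move=> mi; rewrite -IntD.
- by apply: eq_Int => xi; rewrite -mulrA casM mulrDr mulrBl mulrDl.
- apply: (integr_bndM mi) (fun x => cos_bnd _).
  by apply: continuous_measurable_fun; exact: continuous_cos_lin.
- apply: (integr_bndM mi) (fun x => sin_bnd _).
  by apply: continuous_measurable_fun; exact: continuous_sin_lin.
Qed.

Lemma Poisson_kernel e x y : 0 < e ->
  \int[mu]_xi (ew e xi * cas (y * xi) * cas (x * xi)) = 2 * e / (e ^+ 2 + (y - x) ^+ 2).
Proof.
move=> e0; rewrite Int_casM; last exact: ew_integr.
rewrite Int_ew_cos// Int_odd ?addr0//.
- apply: (integr_bndM (ew_integr e0)) (fun x => sin_bnd _).
  by apply: continuous_measurable_fun; exact: continuous_sin_lin.
- by move=> xi; rewrite ew_even mulrN sinN mulrN.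
Qed.

Lemma sgew_integr e : 0 < e -> integr (fun xi => ew e xi * sgw xi).
Proof.
by move=> e0; apply: (integr_bndM (ew_integr e0) measurable_sgw) => x; exact: sgw_bnd.
Qed.

Lemma conj_Poisson_kernel e x y : 0 < e ->
  \int[mu]_xi (ew e xi * sgw xi * cas (y * xi) * cas (x * xi)) =
  2 * (y + x) / (e ^+ 2 + (y + x) ^+ 2).
Proof.
move=> e0; have mi := sgew_integr e0.
rewrite Int_casM// Int_odd ?add0r ?Int_ew_sin//.
- apply: (integr_bndM mi) (fun x => cos_bnd _).
  by apply: continuous_measurable_fun; exact: continuous_cos_lin.
- by move=> xi; rewrite ew_even sgw_odd (mulrN (y - x)) cosN mulrN mulNr.
Qed.

Definition tau z f := fun x : R => f (x + z).

Lemma tauE z f : tau z f = (fun x => f (1 * x + z)).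
Proof. by apply/funext => x; rewrite mul1r. Qed.

Lemma integr_tau z f : integr f -> integr (tau z f).
Proof. by move=> fi; rewrite tauE; apply: integr_affine fi; exact: oner_neq0. Qed.

Lemma Int_tau z f : integr f -> \int[mu]_x f (x + z) = \int[mu]_x f x.
Proof.
move=> fi; rewrite [RHS](@Int_affine _ f 1 z) ?oner_neq0// normr1 mul1r.
by apply: eq_Int => x; rewrite mul1r.
Qed.

Lemma L2_tau z f : L2 f -> L2 (tau z f).
Proof.
move=> [mf fi]; split; last exact: (integr_tau z fi).
by rewrite tauE; exact: measurable_comp_affine.
Qed.

Lemma ip_tau z f g : L2 f -> L2 g -> ip (tau z f) (tau z g) = ip f g.
Proof. by move=> Lf Lg; exact: (@Int_tau z (fun x => f x * g x) (L2M Lf Lg)). Qed.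

Lemma n2_tau z f : L2 f -> n2 (tau z f) = n2 f.
Proof. by move=> Lf; rewrite /n2 ip_tau. Qed.

Lemma n2_small f e : L2 f -> 0 < e ->
  exists2 phi, test_function phi & n2 (fun x => f x - phi x) <= e.
Proof.
move=> Lf e0; have [v tv cv] := test_dense Lf.
move/cvgrPdist_le: cv => /(_ _ e0)[N _ HN]; exists (v N) => //.
by have := HN N (leqnn N); rewrite /= sub0r normrN ger0_norm ?n2_ge0// n2BC.
Qed.

(** Continuity of translations in L^2, in the only form used, that of the autocorrelation: it is
    transferred from a nearby test function, whose translates are controlled by Hölder
    continuity. *)
Lemma tau_continuous f e : L2 f -> 0 < e ->
  exists2 d : R, 0 < d & forall z, `|z| <= d -> `|ip f (tau z f) - ip f f| <= e.
Proof.
move=> Lf e0; pose K := n2 f + 1.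
have K0 : 0 < K by rewrite ltr_wpDl ?n2_ge0.
(* The bound [1] keeps [n2 phi <= K]; the bound [e / (8 * K)] makes each of the four cross terms at
   most [e / 8], which leaves room for [e / 4] in the term with [phi] alone. *)
have d0 : 0 < Num.min 1 (e / (8 * K)) by rewrite lt_min ltr01 divr_gt0// mulr_gt0.
have [phi tphi Hphi] := n2_small Lf d0.
have Lp := test_L2 tphi; have Ap := test_AC tphi.
move: Hphi; rewrite le_min; set h := fun x => f x - phi x => /andP[h1 h2].
have Lh : L2 h by exact: L2B.
have npK : n2 phi <= K.
  have := n2B Lf Lh; rewrite (_ : (fun x => f x - h x) = phi); last first.
    by apply/funext => x; rewrite /h; ring.
  by rewrite /K; lra.
(* By Hölder continuity of exponent 1/2 the autocorrelation of [phi] moves by at most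
   [D * sqrt |z|], hence the square in the admissible radius. *)
pose D := n2 (derive1 phi) * \int[mu]_x `|phi x|.
have D0 : 0 <= D by rewrite mulr_ge0 ?n2_ge0// Int_ge0.
have sq0 : 0 < (e / (4 * (D + 1))) ^+ 2 by rewrite exprn_gt0// divr_gt0// mulr_gt0// ltr_wpDl.
exists ((e / (4 * (D + 1))) ^+ 2) => // z zd.
have Lt := L2_tau z Lf; have Lpt := L2_tau z Lp; have Lht := L2_tau z Lh.
have E1 : ip f (tau z f) = ip phi (tau z phi) + ip h (tau z f) + ip phi (tau z h).
  have -> : tau z f = (fun x => tau z phi x + tau z h x).
    by apply/funext => x; rewrite /tau /h; ring.
  have Lth := L2D Lpt Lht.
  have -> : ip f (fun x => tau z phi x + tau z h x) =
      ip (fun x => phi x + h x) (fun x => tau z phi x + tau z h x).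
    by apply: eq_ip => // x; rewrite /h; ring.
  rewrite (ipDl Lp Lh Lth) (ipDr Lpt Lht Lp); lra.
have E2 : ip f f = ip phi phi + ip h f + ip phi h.
  have -> : ip f f = ip (fun x => phi x + h x) f by apply: eq_ip => // x; rewrite /h; ring.
  rewrite (ipDl Lp Lh Lf).
  have -> : ip phi f = ip phi (fun x => phi x + h x) by apply: eq_ip => // x; rewrite /h; ring.
  by rewrite (ipDr Lp Lh Lp); lra.
have B1 : `|ip h (tau z f)| <= e / 8.
  apply: (le_trans (ip_le Lh Lt)); rewrite n2_tau//.
  apply: (@le_trans _ _ (e / (8 * K) * K)).
    by apply: ler_pM; rewrite ?n2_ge0// /K lerDl.
  by rewrite le_eqVlt; apply/orP; left; apply/eqP; field; rewrite gt_eqF.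
have B2 : `|ip phi (tau z h)| <= e / 8.
  apply: (le_trans (ip_le Lp Lht)); rewrite n2_tau// mulrC.
  apply: (@le_trans _ _ (e / (8 * K) * K)); first by apply: ler_pM; rewrite ?n2_ge0.
  by rewrite le_eqVlt; apply/orP; left; apply/eqP; field; rewrite gt_eqF.
have B3 : `|ip h f| <= e / 8.
  apply: (le_trans (ip_le Lh Lf)); apply: (@le_trans _ _ (e / (8 * K) * K)).
    by apply: ler_pM; rewrite ?n2_ge0// /K lerDl.
  by rewrite le_eqVlt; apply/orP; left; apply/eqP; field; rewrite gt_eqF.
have B4 : `|ip phi h| <= e / 8.
  apply: (le_trans (ip_le Lp Lh)); rewrite mulrC.
  apply: (@le_trans _ _ (e / (8 * K) * K)); first by apply: ler_pM; rewrite ?n2_ge0.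
  by rewrite le_eqVlt; apply/orP; left; apply/eqP; field; rewrite gt_eqF.
have B5 : `|ip phi (tau z phi) - ip phi phi| <= e / 4.
  rewrite -ipBr//.
  have i1 : integr (fun x => phi x * (tau z phi x - phi x)) by apply: L2M => //; exact: L2B.
  have i2 : integr (fun x => n2 (derive1 phi) * Num.sqrt `|z| * `|phi x|).
    by apply: integrZ; apply: integr_norm; exact: test_integr.
  apply: (le_trans (norm_Int i1)).
  apply: (@le_trans _ _ (\int[mu]_x (n2 (derive1 phi) * Num.sqrt `|z| * `|phi x|))).
    apply: le_Int => //; first exact: integr_norm.
    move=> x; rewrite normrM mulrC ler_wpM2r//.
    by have := AC_holder x (x + z) Ap; rewrite [x + z - x]addrC addKr.
  rewrite IntZ; last by apply: integr_norm; exact: test_integr.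
  rewrite mulrAC -/D.
  apply: (@le_trans _ _ (D * (e / (4 * (D + 1))))).
    rewrite ler_wpM2l// -[leRHS]ger0_norm; last by rewrite divr_ge0 ?ltW// mulr_gt0// ltr_wpDl.
    by rewrite -(sqrtr_sqr (e / (4 * (D + 1)))); exact: ler_wsqrtr.
  rewrite mulrA ler_pdivrMr ?mulr_gt0 ?ltr_wpDl// mulrCA.
  have -> : 4 * (e / 4 * (D + 1)) = D * e + e by field.
  by lra.
rewrite E1 E2 ler_norml; move: B1 B2 B3 B4 B5; rewrite !ler_norml.
move=> /andP[? ?] /andP[? ?] /andP[? ?] /andP[? ?] /andP[? ?].
by apply/andP; split; lra.
Qed.

(** [Pe] and [Qe] are the Poisson and conjugate Poisson kernels at height [e], both multiplied by
    [2 * pi]. *)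
Definition Pe e z : R := 2 * e / (e ^+ 2 + z ^+ 2).

Definition Qe e z : R := 2 * z / (e ^+ 2 + z ^+ 2).

Lemma PQ_denom e z : 0 < e -> 0 < e ^+ 2 + z ^+ 2.
Proof. by move=> e0; rewrite ltr_pwDl ?exprn_gt0 ?sqr_ge0. Qed.

Lemma continuous_PQ_denom e : 0 < e -> continuous (fun z : R => (e ^+ 2 + z ^+ 2)^-1).
Proof.
move=> e0 z; apply: cvgV; first by rewrite gt_eqF// PQ_denom.
by apply: cvgD; [exact: cvg_cst|exact: exprn_continuous].
Qed.

Lemma continuous_Pe e : 0 < e -> continuous (Pe e).
Proof. by move=> e0 z; apply: cvgM; [exact: cvg_cst|exact: continuous_PQ_denom]. Qed.

Lemma continuous_Qe e : 0 < e -> continuous (Qe e).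
Proof. by move=> e0 z; apply: cvgM; [exact: continuous_lin|exact: continuous_PQ_denom]. Qed.

Lemma Pe_bnd e z : 0 < e -> `|Pe e z| <= 2 / e.
Proof.
move=> e0; have D := PQ_denom z e0.
have P : 0 <= Pe e z by apply: divr_ge0; [apply: mulr_ge0|]; rewrite ?ltW.
rewrite (ger0_norm P) /Pe ler_pdivrMr// mulrAC ler_pdivlMr//.
by have := sqr_ge0 z; nra.
Qed.

Lemma Qe_bnd e z : 0 < e -> `|Qe e z| <= 1 / e.
Proof.
move=> e0; have D := PQ_denom z e0.
rewrite /Qe normrM normfV (gtr0_norm D) ler_pdivrMr// mulrAC ler_pdivlMr// mul1r.
rewrite -[X in _ <= _ + X]real_normK ?num_real// normrM ger0_norm//.
by have := sqr_ge0 (e - `|z|); nra.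
Qed.

Lemma measurable_conv_ker (k : R -> R) y : continuous k -> measurable_fun setT (fun x => k (y - x)).
Proof.
move=> ck; have := measurable_comp_affine (-1) y (continuous_measurable_fun ck).
by under eq_fun do rewrite mulN1r addrC.
Qed.

Lemma Poisson_conv e f y : 0 < e -> integr f ->
  Ha (fun xi => ew e xi * Ha f xi) y = \int[mu]_x (f x * Pe e (y - x)).
Proof.
move=> e0 fi; rewrite HaHa//; last exact: ew_integr.
by apply: eq_Int => x; rewrite Poisson_kernel.
Qed.

Lemma Poisson_shift e f y : 0 < e -> integr f ->
  Ha (fun xi => ew e xi * Ha f xi) y = \int[mu]_u (f (e * u + y) * pker u).
Proof.
move=> e0 fi; rewrite Poisson_conv//.
have e1 : e != 0 by rewrite gt_eqF.
have i : integr (fun x => f x * Pe e (y - x)).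
  apply: (integr_bndM fi) (fun x => Pe_bnd _ e0).
  by apply: measurable_conv_ker; exact: continuous_Pe.
rewrite (Int_affine y e1 i) gtr0_norm// -IntZ; last exact: (integr_affine y e1 i).
apply: eq_Int => u; rewrite /pker /Pe mulrCA; congr (_ * _).
have D : 1 + u ^+ 2 != 0 by rewrite gt_eqF// ltr_pwDl ?sqr_ge0.
have D' : e ^+ 2 + (e * u) ^+ 2 != 0 by rewrite gt_eqF// PQ_denom.
rewrite (_ : y - (e * u + y) = - (e * u)); last by ring.
by rewrite sqrrN; field; rewrite D D'.
Qed.

Lemma ip_tau_bnd f z : L2 f -> `|ip f (tau z f)| <= ip f f.
Proof.
move=> Lf; apply: (le_trans (ip_le Lf (L2_tau z Lf))).
by rewrite n2_tau// -expr2 n2_sqr.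
Qed.

Lemma pker_bnd (u : R) : `|pker u| <= 2.
Proof.
have D : 0 < 1 + u ^+ 2 by rewrite ltr_pwDl ?sqr_ge0.
rewrite (ger0_norm (pker_ge0 u)) /pker ler_pdivrMr//.
by have := sqr_ge0 u; lra.
Qed.

(** In the other order of integration, Cauchy-Schwarz bounds the inner integral by [ip f f * pker u]
    whatever the translation, and only the mass of [pker] is left. *)
Lemma Poisson_energy_lty e f : 0 < e -> L2 f ->
  (\int[mu]_y \int[mu]_u `|f y * (f (e * u + y) * pker u)|%:E < +oo)%E.
Proof.
move=> e0 Lf; have [mf _] := Lf; have Ln := L2_norm Lf.
pose F (z : RR * RR) : R := `|f z.1 * (f (e * z.2 + z.1) * pker z.2)|.
have mF : measurable_fun setT F.
  apply: measurableT_comp => //; apply: measurable_funM.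
    exact: (measurableT_comp mf measurable_fst).
  apply: measurable_funM.
    apply: (measurableT_comp mf); apply: measurable_funD; last exact: measurable_fst.
    by apply: measurable_funM => //; exact: measurable_snd.
  apply: (measurableT_comp _ measurable_snd).
  exact: (continuous_measurable_fun continuous_pker).
have mE : measurable_fun setT (EFin \o F) by exact/measurable_EFinP.
have /(_ mE) := @fubini_tonelli _ _ _ _ _ mu mu (EFin \o F).
rewrite /fubini_F /fubini_G /= => ->; last by move=> z; rewrite lee_fin normr_ge0.
apply: (@le_lt_trans _ _ (\int[mu]_u (ip f f * pker u)%:E)%E); last first.
  by rewrite EFin_Int ?ltry//; exact: (integrZ (ip f f) (pker_Int (R := R)).1).
apply: ge0_le_integral => //.
- by move=> u _; apply: integral_ge0 => y _; rewrite lee_fin normr_ge0.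
- have := @measurable_fun_fubini_tonelli_G _ _ RR RR R mu (EFin \o F).
  by apply => // z; rewrite lee_fin /F.
- apply/measurable_EFinP; apply: measurable_funM => //.
  exact: (continuous_measurable_fun continuous_pker).
move=> u _; have Lt := L2_tau (e * u) Lf; have Lnt := L2_norm Lt.
have E y : F (y, u) = pker u * (`|f y| * `|tau (e * u) f y|).
  by rewrite /F/= (normrM (f y)) (normrM _ (pker u)) (ger0_norm (pker_ge0 u)) /tau [y + _]addrC; ring.
under eq_integral do rewrite E.
rewrite EFin_Int; last by apply: integrZ; exact: L2M.
rewrite IntZ; last exact: L2M.
rewrite lee_fin mulrC ler_wpM2r ?pker_ge0//.
have := ip_le Ln Lnt; have nn (g : R -> R) : L2 g -> n2 (fun x => `|g x|) = n2 g.
  move=> Lg; congr Num.sqrt; apply: eq_Int => x.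
  by rewrite -expr2 real_normK ?num_real// expr2.
rewrite (nn f Lf) (nn _ Lt) n2_tau// -expr2 n2_sqr; apply: le_trans.
exact: ler_norm.
Qed.

(** Symmetry of [Ha] moves one of the two transforms onto the weighted one, which becomes a Poisson
    integral of [f]. The spectral energy is thereby expressed on the physical side, where continuity
    of translations applies. *)
Lemma Poisson_energy e f : 0 < e -> integr f -> L2 f ->
  integr (fun xi => ew e xi * Ha f xi ^+ 2) /\
  \int[mu]_xi (ew e xi * Ha f xi ^+ 2) = \int[mu]_u (pker u * ip f (tau (e * u) f)).
Proof.
move=> e0 fi Lf; have [mf _] := Lf.
have mHa := Ha_meas mf.
have Hb xi := Ha_bnd xi fi.
have i1 : integr (fun xi => ew e xi * Ha f xi) by exact: (integr_bndM (ew_integr e0) mHa Hb).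
have i2 : integr (fun xi => ew e xi * Ha f xi ^+ 2).
  by apply: eq_integr (integr_bndM i1 mHa Hb) => xi; rewrite expr2 mulrA.
split => //.
have -> : \int[mu]_xi (ew e xi * Ha f xi ^+ 2) = \int[mu]_xi (ew e xi * Ha f xi * Ha f xi).
  by apply: eq_Int => xi; rewrite expr2 mulrA.
rewrite (Ha_sym i1 fi).2.
pose F (z : RR * RR) : R := f z.1 * (f (e * z.2 + z.1) * pker z.2).
have mF : measurable_fun setT F.
  apply: measurable_funM; first exact: (measurableT_comp mf measurable_fst).
  apply: measurable_funM.
    apply: (measurableT_comp mf); apply: measurable_funD; last exact: measurable_fst.
    by apply: measurable_funM => //; exact: measurable_snd.
  apply: (measurableT_comp _ measurable_snd).
  exact: (continuous_measurable_fun continuous_pker).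
have [_ E] := Int_fubini mF (Poisson_energy_lty e0 Lf).
transitivity (\int[mu]_y \int[mu]_u F (y, u)).
  apply: eq_Int => y; rewrite (Poisson_shift _ e0 fi) -IntZ; first by [].
  have e1 : e != 0 by rewrite gt_eqF.
  exact: (integr_bndM (integr_affine y e1 fi) (continuous_measurable_fun continuous_pker) pker_bnd).
rewrite E; apply: eq_Int => u; rewrite /ip -IntZ; last exact: (L2M Lf (L2_tau (e * u) Lf)).
by apply: eq_Int => y; rewrite /F/= /tau [y + _]addrC; ring.
Qed.

Lemma ew_cvg xi : ew n.+1%:R^-1 xi @[n --> \oo] --> (1 : R).
Proof.
have K : - n.+1%:R^-1 * `|xi| @[n --> \oo] --> - (0 : R) * `|xi|.
  by apply: cvgM; [apply: cvgN; exact: cvg_harmonic|exact: cvg_cst].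
rewrite oppr0 mul0r in K; have C := @continuous_expR R 0.
have := cvg_comp _ _ K C; rewrite expR0; exact.
Qed.

(** The Abel-weighted energy is an average of the autocorrelation of [f] against [pker]. As the
    weight tends to 1 the translations tend to the identity, and the mass of [pker] comes out as the
    constant. *)
Lemma Plancherel_integr f : integr f -> L2 f ->
  L2 (Ha f) /\ ip (Ha f) (Ha f) = 2 * pi * ip f f.
Proof.
move=> fi Lf; have [mf _] := Lf; have mHa := Ha_meas mf.
have [pi_i pi_I] := @pker_Int R.
have mp : measurable_fun setT (@pker R) by exact: (continuous_measurable_fun continuous_pker).
pose en n : R := n.+1%:R^-1; have en0 n : 0 < en n by rewrite invr_gt0.
have EE n := Poisson_energy (en0 n) fi Lf.
have mIp c : measurable_fun setT (fun u => pker u * ip f (tau (c * u) f)).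
  apply: measurable_funM => //.
  apply: (@measurable_Int1 R (fun z : RR * RR => f z.2 * f (z.2 + c * z.1))).
  apply: measurable_funM; first exact: (measurableT_comp mf measurable_snd).
  apply: (measurableT_comp mf); apply: measurable_funD; first exact: measurable_snd.
  by apply: measurable_funM => //; exact: measurable_fst.
have bIp c u : `|pker u * ip f (tau (c * u) f)| <= ip f f * pker u.
  rewrite normrM (ger0_norm (pker_ge0 u)) mulrC ler_wpM2r ?pker_ge0//.
  exact: ip_tau_bnd.
have cvI : \int[mu]_u (pker u * ip f (tau (en n * u) f)) @[n --> \oo] -->
    \int[mu]_u (pker u * ip f f).
  apply: (dct _ _ (integrZ (ip f f) pi_i) _ _).2.
  - by move=> n; exact: mIp.
  - by apply: measurable_funM.
  - apply: aeW => u; apply: cvgM; first exact: cvg_cst.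
    apply/cvgrPdist_le => e e0; have [d d0 Hd] := tau_continuous Lf e0.
    have K : en n * u @[n --> \oo] --> 0 * u by apply: cvgM; [exact: cvg_harmonic|exact: cvg_cst].
    rewrite mul0r in K; move/cvgrPdist_le: K => /(_ _ d0); apply: filterS => n.
    by rewrite sub0r normrN distrC => /Hd.
  - by move=> n u; exact: bIp.
have lim : \int[mu]_u (pker u * ip f f) = 2 * pi * ip f f.
  by under eq_Int do rewrite mulrC; rewrite IntZ// pi_I mulrC.
rewrite lim in cvI.
pose h n xi := ew (en n) xi * Ha f xi ^+ 2.
have cvh : {ae mu, forall x : RR, h ^~ x @ \oo --> Ha f x ^+ 2}.
  apply: aeW => xi; rewrite -[X in _ --> X]mul1r.
  by apply: cvgM; [exact: ew_cvg|exact: cvg_cst].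
have mh2 : measurable_fun setT (fun xi => Ha f xi ^+ 2) by exact: measurable_funX.
have [i2 _] : integr (fun xi => Ha f xi ^+ 2) /\ \int[mu]_xi Ha f xi ^+ 2 <= 2 * pi * ip f f.
  apply: (@fatou_integr R h) => //.
  - by move=> n; exact: (EE n).1.
  - by move=> n xi; rewrite mulr_ge0 ?ew_ge0 ?sqr_ge0.
  - by move=> xi; exact: sqr_ge0.
  - move=> n; rewrite (EE n).2 -lim.
    have -> : \int[mu]_u (pker u * ip f f) = \int[mu]_u (ip f f * pker u).
      by apply: eq_Int => u; rewrite mulrC.
    apply: le_Int.
    + apply: le_integr (integrZ (ip f f) pi_i); first exact: mIp.
      by move=> u; exact: bIp.
    + exact: integrZ.
    + by move=> u; apply: (le_trans (ler_norm _)); exact: bIp.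
have LHa : L2 (Ha f) by split => //; apply: eq_integr i2 => x; rewrite expr2.
split; first exact: LHa.
(* Fatou has just made [Ha f ^+ 2] integrable; it can now serve as the majorant, which upgrades the
   inequality to an equality. *)
have c2 : \int[mu]_xi h n xi @[n --> \oo] --> \int[mu]_xi Ha f xi ^+ 2.
  apply: (dct _ mh2 i2 cvh _).2.
  - by move=> n; exact: (integr_meas (EE n).1).
  - move=> n xi; rewrite ger0_norm; last by rewrite mulr_ge0 ?ew_ge0 ?sqr_ge0.
    by rewrite ler_piMl ?sqr_ge0// ew_le1// ltW.
have c3 : \int[mu]_xi h n xi @[n --> \oo] --> 2 * pi * ip f f.
  by under eq_fun do rewrite (EE _).2.
have -> : ip (Ha f) (Ha f) = \int[mu]_xi Ha f xi ^+ 2.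
  by apply: eq_Int => x; rewrite expr2.
by rewrite -(cvg_lim (@Rhausdorff R) c2) (cvg_lim (@Rhausdorff R) c3).
Qed.

End Hartley.

(** * The Hartley transform on L^2 *)

Section HartleyL2.
Context {R : realType}.
Local Notation mu := (@lebesgue_measure R).
Local Notation RR := (measurableTypeR R).
Implicit Types (f g m phi : R -> R) (a b e x y z xi : R).

Lemma L2_lim_unique (h : nat -> R -> R) f g : (forall n, L2 (h n)) -> L2 f -> L2 g ->
  n2 (fun x => h n x - f x) @[n --> \oo] --> (0 : R) ->
  n2 (fun x => h n x - g x) @[n --> \oo] --> (0 : R) -> aeq f g.
Proof.
move=> Lh Lf Lg cf cg; apply: aeqB; apply: n2_eq0; first exact: L2B.
apply/eqP; rewrite eq_le n2_ge0 andbT.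
have C : n2 (fun x => h n x - f x) + n2 (fun x => h n x - g x) @[n --> \oo] --> (0 : R).
  by rewrite -[X in _ --> X]addr0; apply: cvgD.
apply: (@cvgr_to_ge _ _ _ _ _ _ _ C); apply: nearW => n.
by rewrite (n2BC (h n) f); exact: (n2_triangle Lf (Lh n) Lg).
Qed.

Lemma ip_cvg (f_ g_ : nat -> R -> R) f g : (forall n, L2 (f_ n)) -> (forall n, L2 (g_ n)) ->
  L2 f -> L2 g ->
  n2 (fun x => f_ n x - f x) @[n --> \oo] --> (0 : R) ->
  n2 (fun x => g_ n x - g x) @[n --> \oo] --> (0 : R) ->
  ip (f_ n) (g_ n) @[n --> \oo] --> ip f g.
Proof.
move=> Lf_ Lg_ Lf Lg cf cg.
have C : n2 (fun x => f_ n x - f x) * (n2 (fun x => g_ n x - g x) + n2 g) +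
   n2 f * n2 (fun x => g_ n x - g x) @[n --> \oo] --> (0 : R).
  have -> : (0 : R) = 0 * (0 + n2 g) + n2 f * 0 by ring.
  apply: cvgD; last by apply: cvgM => //; exact: cvg_cst.
  by apply: cvgM => //; apply: cvgD => //; exact: cvg_cst.
apply/cvgrPdist_le => e e0; move/cvgrPdist_le: C => /(_ _ e0); apply: filterS => n.
rewrite sub0r normrN => H; apply: le_trans H; apply: le_trans (ler_norm _).
have Ld := L2B (Lf_ n) Lf; have Le := L2B (Lg_ n) Lg.
have -> : ip f g - ip (f_ n) (g_ n) = - (ip (fun x => f_ n x - f x) (g_ n) + ip f (fun x => g_ n x - g x)).
  by rewrite ipBl// ipBr//; ring.
rewrite normrN (le_trans (ler_normD _ _))// lerD//; last exact: ip_le.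
apply: (le_trans (ip_le Ld (Lg_ n))); rewrite ler_wpM2l ?n2_ge0//.
have := n2_dist (Lg_ n) Lg; rewrite ler_norml => /andP[_].
by rewrite lerBlDr.
Qed.

Definition tr (n : nat) f x : R := f x * (`|x| <= n%:R)%R%:R.

Lemma measurable_tr01 (M : R) : measurable_fun setT (fun x : RR => (`|x| <= M)%R%:R : R).
Proof.
apply: (measurableT_comp (f := fun b : bool => b%:R : R)) => //.
by apply: measurable_fun_ler => //; exact: measurableT_comp.
Qed.

Lemma tr_le n f x : `|tr n f x| <= `|f x|.
Proof. by rewrite /tr normrM ler_piMr//; case: (_ <= n%:R); rewrite ?normr1 ?normr0. Qed.

Lemma tr_meas n f : measurable_fun setT f -> measurable_fun setT (tr n f).
Proof. by move=> mf; apply: measurable_funM => //; exact: measurable_tr01. Qed.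

Lemma tr_L2 n f : L2 f -> L2 (tr n f).
Proof. by move=> Lf; apply: L2_le (Lf) => [|x]; [exact: tr_meas (L2_meas Lf)|exact: tr_le]. Qed.

Lemma tr01_chi n x : (`|x| <= n%:R)%R%:R = (`|x| <= n%:R)%R%:R * chi (- n.+1%:R) n%:R x.
Proof.
case: (boolP (`|x| <= n%:R)) => [|_]; last by rewrite mul0r.
rewrite ler_norml => /andP[h1 h2]; rewrite chi_in ?mulr1// h2 andbT.
by rewrite (lt_le_trans _ h1)// ltrN2 ltr_nat.
Qed.

Lemma tr_integr n f : L2 f -> integr (tr n f).
Proof.
move=> Lf; apply: eq_integr (L2M (tr_L2 n Lf) (L2_chi (- n.+1%:R) n%:R)) => x.
by rewrite /tr [RHS]/= -mulrA -tr01_chi.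
Qed.

Lemma tr_cvg_pt f x : tr n f x @[n --> \oo] --> f x.
Proof.
have [N HN] := nat_ub `|x|.
by apply: cvg_near_cst; exists N => // n /= /HN H; rewrite /tr H mulr1.
Qed.

Lemma tr_cvg f : L2 f -> n2 (fun x => tr n f x - f x) @[n --> \oo] --> (0 : R).
Proof.
move=> Lf; have [mf fi] := Lf.
have C : \int[mu]_x ((tr n f x - f x) * (tr n f x - f x)) @[n --> \oo] --> \int[mu]_x (0 : R).
  apply: (dct _ _ fi _ _).2 => //.
  - by move=> n; apply: measurable_funM; apply: measurable_funB => //; exact: tr_meas.
  - apply: aeW => x; rewrite (_ : 0 = (f x - f x) * (f x - f x)); last by rewrite subrr mulr0.
    by apply: cvgM; apply: cvgB; [exact: tr_cvg_pt|exact: cvg_cst|exact: tr_cvg_pt|exact: cvg_cst].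
  - move=> n x; rewrite /tr; case: (_ <= n%:R); rewrite ?mulr1 ?subrr ?mulr0 ?normr0 ?sqr_ge0//.
    by rewrite sub0r mulrNN -expr2 ger0_norm ?sqr_ge0.
rewrite Int0 in C; rewrite /n2 -sqrtr0.
by apply: (cvg_comp _ _ C); exact: sqrt_continuous.
Qed.

Lemma Ha_polar f g : integr f -> L2 f -> integr g -> L2 g ->
  ip (Ha f) (Ha g) = 2 * pi * ip f g.
Proof.
move=> fi Lf gi Lg; have [Lhf Ef] := Plancherel_integr fi Lf.
have [Lhg Eg] := Plancherel_integr gi Lg.
have [_ ] := Plancherel_integr (integrD fi gi) (L2D Lf Lg).
have E : Ha (fun x => f x + g x) = (fun x => Ha f x + Ha g x).
  by apply/funext => x; exact: HaD.
have Ls := L2D Lhf Lhg; have Lt := L2D Lf Lg.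
rewrite E (ipDl Lf Lg Lt) (ipDr Lf Lg Lf) (ipDr Lf Lg Lg).
rewrite (ipDl Lhf Lhg Ls) (ipDr Lhf Lhg Lhf) (ipDr Lhf Lhg Lhg) Ef Eg.
rewrite (ipC (Ha g)) (ipC g f).
move: (ip (Ha f) (Ha f)) (ip (Ha f) (Ha g)) (ip (Ha g) (Ha g)) (ip f f) (ip f g) (ip g g) => a c d e h k; lra.
Qed.

Lemma n2_Ha f : integr f -> L2 f -> n2 (Ha f) = Num.sqrt (2 * pi) * n2 f.
Proof.
move=> fi Lf; rewrite /n2 (Plancherel_integr fi Lf).2 sqrtrM//.
by rewrite mulr_ge0// pi_ge0.
Qed.

Definition is_hartley f F := L2 F /\ n2 (fun x => Ha (tr n f) x - F x) @[n --> \oo] --> (0 : R).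

Lemma Ha_tr_L2 n f : L2 f -> L2 (Ha (tr n f)).
Proof. by move=> Lf; exact: (Plancherel_integr (tr_integr n Lf) (tr_L2 n Lf)).1. Qed.

(* The Hartley transform on L^2, as a limit of truncations; opaque, to keep
   unification from unfolding it. *)
Lemma Hartley_ex : {T : (R -> R) -> R -> R | forall f, L2 f -> is_hartley f (T f)}.
Proof.
suff H f : L2 f -> exists F, is_hartley f F.
  exists (fun f => xget (fun=> 0) [set F | is_hartley f F]) => f /H[F LF].
  exact: (@xgetPex _ (fun=> 0) [set F | is_hartley f F] (ex_intro _ F LF)).
move=> Lf.
have [|F LF HF] := @L2_complete R (fun n => Ha (tr n f)) (fun n => Ha_tr_L2 n Lf); last by exists F.
move=> e e0; pose c : R := Num.sqrt (2 * pi).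
have c0 : 0 < c by rewrite sqrtr_gt0 mulr_gt0// pi_gt0.
have /cvgrPdist_le/(_ (e / c / 2)) [|N _ HN] := tr_cvg Lf; first by rewrite !divr_gt0.
have H n : (N <= n)%N -> n2 (fun x => tr n f x - f x) <= e / c / 2.
  by move=> /HN /=; rewrite sub0r normrN ger0_norm ?n2_ge0.
exists N => m n Nm Nn; have Lm := tr_L2 m Lf; have Ln := tr_L2 n Lf.
have -> : (fun x => Ha (tr m f) x - Ha (tr n f) x) = Ha (fun x => tr m f x - tr n f x).
  by apply/funext => x; rewrite HaB//; exact: tr_integr.
rewrite n2_Ha; [|by apply: integrB; exact: tr_integr|exact: L2B].
rewrite -/c mulrC -ler_pdivlMr// (le_trans (n2_triangle Lm Lf Ln))//.
have := H _ Nm; have := H _ Nn; rewrite (n2BC f); lra.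
Qed.

Definition T := sval Hartley_ex.

Lemma T_spec f : L2 f -> is_hartley f (T f). Proof. exact: (svalP Hartley_ex). Qed.

Lemma T_L2 f : L2 f -> L2 (T f). Proof. by move=> /T_spec[]. Qed.

Lemma T_cvg f : L2 f -> n2 (fun x => Ha (tr n f) x - T f x) @[n --> \oo] --> (0 : R).
Proof. by move=> /T_spec[]. Qed.

Lemma T_polar f g : L2 f -> L2 g -> ip (T f) (T g) = 2 * pi * ip f g.
Proof.
move=> Lf Lg.
have C1 := ip_cvg (fun n => Ha_tr_L2 n Lf) (fun n => Ha_tr_L2 n Lg) (T_L2 Lf) (T_L2 Lg) (T_cvg Lf) (T_cvg Lg).
have C2 := ip_cvg (fun n => tr_L2 n Lf) (fun n => tr_L2 n Lg) Lf Lg (tr_cvg Lf) (tr_cvg Lg).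
have C3 : ip (Ha (tr n f)) (Ha (tr n g)) @[n --> \oo] --> 2 * pi * ip f g.
  under eq_fun do rewrite (Ha_polar (tr_integr _ Lf) (tr_L2 _ Lf) (tr_integr _ Lg) (tr_L2 _ Lg)).
  by apply: cvgM => //; exact: cvg_cst.
by rewrite -(cvg_lim (@Rhausdorff R) C1) (cvg_lim (@Rhausdorff R) C3).
Qed.

Lemma T_sym f g : L2 f -> L2 g -> ip (T f) g = ip f (T g).
Proof.
move=> Lf Lg.
have C1 := ip_cvg (fun n => Ha_tr_L2 n Lf) (fun n => tr_L2 n Lg) (T_L2 Lf) Lg (T_cvg Lf) (tr_cvg Lg).
have C2 := ip_cvg (fun n => tr_L2 n Lf) (fun n => Ha_tr_L2 n Lg) Lf (T_L2 Lg) (tr_cvg Lf) (T_cvg Lg).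
have C3 : ip (Ha (tr n f)) (tr n g) @[n --> \oo] --> ip f (T g).
  rewrite (_ : (fun n => _) = (fun n => ip (tr n f) (Ha (tr n g))))//.
  apply/funext => n; rewrite ipC /ip.
  exact: (Ha_sym (tr_integr n Lg) (tr_integr n Lf)).2.
by rewrite -(cvg_lim (@Rhausdorff R) C1) (cvg_lim (@Rhausdorff R) C3).
Qed.

Lemma aeq_ip_orth f g : L2 f -> L2 g -> (forall h, L2 h -> ip f h = ip g h) -> aeq f g.
Proof.
move=> Lf Lg H; apply: aeqB; apply: ip_orth_eq0; first exact: L2B.
by move=> h Lh; rewrite ipBl// H// subrr.
Qed.

(** Symmetry combined with Plancherel: since [T] is its own adjoint, the isometry identity is
    already the inversion formula. *)
Lemma TT f : L2 f -> aeq (T (T f)) (fun x => 2 * pi * f x).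
Proof.
move=> Lf; apply: aeq_ip_orth; [by do 2 apply: T_L2|exact: L2Z|].
by move=> h Lh; rewrite (T_sym (T_L2 Lf) Lh) (T_polar Lf Lh) (ipZl _ Lf Lh).
Qed.

Lemma T_lin c f g : L2 f -> L2 g -> aeq (T (fun x => c * f x + g x)) (fun x => c * T f x + T g x).
Proof.
move=> Lf Lg; have Lc := L2Z c Lf; have LTf := T_L2 Lf; have LTg := T_L2 Lg.
have LcT := L2Z c LTf.
apply: aeq_ip_orth; [by apply: T_L2; exact: L2D|exact: L2D|].
move=> h Lh; have LTh := T_L2 Lh; rewrite T_sym//; last exact: L2D.
by rewrite (ipDl Lc Lg LTh) (ipZl c Lf LTh) (ipDl LcT LTg Lh) (ipZl c LTf Lh) (T_sym Lf Lh) (T_sym Lg Lh).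
Qed.

Lemma T_aeq f g : L2 f -> L2 g -> aeq f g -> aeq (T f) (T g).
Proof.
move=> Lf Lg fg; apply: aeq_ip_orth; try exact: T_L2.
move=> h Lh; rewrite (T_sym Lf Lh) (T_sym Lg Lh); have LT := T_L2 Lh; apply: aeq_ip fg (aeq_refl _); exact: L2_meas.
Qed.

Lemma T_Ha f : integr f -> L2 f -> aeq (T f) (Ha f).
Proof.
move=> fi Lf; apply: (L2_lim_unique (fun n => Ha_tr_L2 n Lf) (T_L2 Lf)).
- exact: (Plancherel_integr fi Lf).1.
- exact: T_cvg.
have -> : (fun n => n2 (fun x => Ha (tr n f) x - Ha f x)) =
    (fun n => Num.sqrt (2 * pi) * n2 (fun x => tr n f x - f x)).
  apply/funext => n; rewrite -n2_Ha; last by apply: L2B => //; exact: tr_L2.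
    by congr n2; apply/funext => x; rewrite HaB//; exact: tr_integr.
  by apply: integrB => //; exact: tr_integr.
rewrite -[X in _ --> X](mulr0 (Num.sqrt (2 * pi))).
by apply: cvgM; [exact: cvg_cst|exact: tr_cvg].
Qed.

Lemma T_test f phi : L2 f -> test_function phi -> ip (T f) phi = ip f (Ha phi).
Proof.
move=> Lf tp; have Lp := test_L2 tp; rewrite (T_sym Lf Lp).
have LH := (Plancherel_integr (test_integr tp) Lp).1.
apply: aeq_ip (aeq_refl _) (T_Ha (test_integr tp) Lp); try exact: L2_meas; exact: (L2_meas (T_L2 Lp)).
Qed.

Definition refl f x : R := f (- x).

Lemma reflE f : refl f = (fun x => f (-1 * x + 0)).
Proof. by apply/funext => x; rewrite /refl mulN1r addr0. Qed.

Lemma N1_neq0 : (-1 : R) != 0. Proof. by rewrite oppr_eq0 oner_neq0. Qed.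

Lemma refl_integr f : integr f -> integr (refl f).
Proof. by move=> fi; rewrite reflE; apply: integr_affine fi; exact: N1_neq0. Qed.

Lemma refl_meas f : measurable_fun setT f -> measurable_fun setT (refl f).
Proof. by move=> mf; rewrite reflE; exact: measurable_comp_affine. Qed.

Lemma refl_L2 f : L2 f -> L2 (refl f).
Proof. by move=> [mf fi]; split; [exact: refl_meas|exact: (refl_integr fi)]. Qed.

Lemma ip_refl f g : L2 f -> L2 g -> ip (refl f) g = ip f (refl g).
Proof.
move=> Lf Lg; rewrite /ip (Int_affine 0 N1_neq0 (L2M (refl_L2 Lf) Lg)) normrN1 mul1r.
by apply: eq_Int => x; rewrite /refl mulN1r addr0 opprK.
Qed.

Lemma Ha_refl f : integr f -> Ha (refl f) = refl (Ha f).
Proof.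
move=> fi; apply/funext => x; rewrite /Ha /refl.
rewrite (Int_affine 0 N1_neq0 (integr_cas x (refl_integr fi))) normrN1 mul1r.
by apply: eq_Int => y; rewrite /refl mulN1r addr0 opprK mulrN mulNr.
Qed.

Lemma refl_test phi : test_function phi -> L2 (refl phi) /\ integr (refl phi).
Proof. by move=> tp; split; [exact/refl_L2/test_L2|exact/refl_integr/test_integr]. Qed.

(** The change of variables in the L^2 norm of [f - g] replaces any discussion of preimages of null
    sets. *)
Lemma aeq_affine f g a b : a != 0 -> L2 f -> L2 g -> aeq f g ->
  aeq (fun x => f (a * x + b)) (fun x => g (a * x + b)).
Proof.
move=> a0 Lf Lg fg; apply: aeqB.
have La h : L2 h -> L2 (fun x => h (a * x + b)).
  by move=> [mh hi]; split; [exact: measurable_comp_affine|exact: (integr_affine b a0 hi)].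
apply: n2_eq0; first by apply: L2B; exact: La.
have Ld := L2B Lf Lg.
have : ip (fun x => f x - g x) (fun x => f x - g x) = 0.
  rewrite (aeq_ip (f' := fun=> 0) (g' := fun=> 0)) ?ip0l//; try exact: L2_meas Ld.
    by apply: filterS fg => x ->; rewrite subrr.
  by apply: filterS fg => x ->; rewrite subrr.
rewrite /ip (Int_affine b a0 (L2M Ld Ld)) => /eqP; rewrite mulf_eq0 normr_eq0 (negbTE a0)/=.
by move=> /eqP E; rewrite /n2 /ip E sqrtr0.
Qed.

Lemma refl_aeq f g : L2 f -> L2 g -> aeq f g -> aeq (refl f) (refl g).
Proof. by move=> Lf Lg; rewrite !reflE; apply: aeq_affine => //; exact: N1_neq0. Qed.

Lemma T_refl f : L2 f -> aeq (T (refl f)) (refl (T f)).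
Proof.
move=> Lf; have LT := T_L2 Lf; have Lr := refl_L2 Lf.
apply: aeq_test; [exact: T_L2|exact: refl_L2|move=> phi tp].
have Lp := test_L2 tp; have [Lpr ipr] := refl_test tp.
have LH := (Plancherel_integr (test_integr tp) Lp).1.
rewrite (T_test Lr tp) (ip_refl Lf LH) -(Ha_refl (test_integr tp)).
rewrite (ip_refl LT Lp) (T_sym Lf Lpr); apply: aeq_ip (aeq_refl _) _; try exact: L2_meas.
- by rewrite Ha_refl; [exact: L2_meas (refl_L2 LH)|exact: test_integr].
- exact: (L2_meas (T_L2 Lpr)).
- by apply: aeq_sym; exact: T_Ha.
Qed.

End HartleyL2.

(** * Derivatives under the Hartley transform *)

Section HartleyDerivative.
Context {R : realType}.
Local Notation mu := (@lebesgue_measure R).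
Local Notation RR := (measurableTypeR R).
Implicit Types (f g m phi u du v dv : R -> R) (a b e x y z xi : R).

Lemma measurable_oppR : measurable_fun setT (fun x : RR => - x : RR).
Proof. exact: (@refl_meas R id (@measurable_id _ _ _)). Qed.

(** Average over [t] in []x, x + 1]] of [u x ^+ 2 <= 2 * u t ^+ 2 + 2 * (u x - u t) ^+ 2], the last
    increment being at most [n2 du] by Hölder continuity. *)
Lemma H1_bound u du : AC u du -> L2 u -> forall x, `|u x| <= Num.sqrt (2 * (ip u u + ip du du)).
Proof.
move=> A Lu x; have Ldu := A.1.
suff H : u x ^+ 2 <= 2 * (ip u u + ip du du) by rewrite -sqrtr_sqr; exact: ler_wsqrtr.
have -> : u x ^+ 2 = \int[mu]_t (u x ^+ 2 * chi x (x + 1) t).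
  by rewrite IntZ ?Int_chi; [ring|exact: integr_chi].
have c0 (t : R) : 0 <= chi x (x + 1) t.
  by rewrite chi_itv ?lerDl.
have i1 : integr (fun t => 2 * (u t * u t)) by apply: integrZ; exact: L2M.
have i2 : integr (fun t => 2 * ip du du * chi x (x + 1) t) by apply: integrZ; exact: integr_chi.
apply: (@le_trans _ _ (\int[mu]_t (2 * (u t * u t) + 2 * ip du du * chi x (x + 1) t))).
  apply: le_Int; [by apply: integrZ; exact: integr_chi|exact: integrD|move=> t].
  case: (boolP (x < t <= x + 1)) => [|tx]; last first.
    rewrite chi_out ?lerDl// !mulr0 addr0.
    by rewrite mulr_ge0// -expr2 sqr_ge0.
  move=> tx; rewrite chi_in// !mulr1; have /andP[t1 t2] := tx.
  have H := AC_holder t x A.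
  have N0 := n2_ge0 du.
  have K : `|u x - u t| <= n2 du.
    apply: (le_trans H); rewrite ler_piMr// -sqrtr1 ler_wsqrtr//.
    by rewrite ltr0_norm; lra.
  rewrite -n2_sqr; move: K; rewrite ler_norml => /andP[K1 K2].
  have : (u x - u t) ^+ 2 <= n2 du ^+ 2.
    by nra.
  have := sqr_ge0 (u x - u t - u t); nra.
rewrite IntD// !IntZ ?Int_chi; [|exact: integr_chi|exact: L2M].
by rewrite /ip le_eqVlt; apply/orP; left; apply/eqP; ring.
Qed.

Lemma eta_derive_bnd n (x : R) : `|derive1 (eta 0 n.+1%:R) x| <= 4 / n.+1%:R.
Proof.
have h0 : n.+1%:R != 0 :> R by rewrite pnatr_eq0.
rewrite derive1E (@derive_val _ _ _ _ _ _ _ (is_derive_eta 0 x h0)) subr0.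
have hp : (0 : R) < n.+1%:R by rewrite ltr0n.
move: n.+1%:R hp h0 => h hp h0.
case: (lerP h `|x|) => hx.
  rewrite (_ : Num.max 0 (paraboloid 0 h x) = 0).
    by rewrite mulr0 mul0r normr0 divr_ge0// ltW.
  apply/max_idPl; rewrite /paraboloid subr0 subr_le0 -real_normK ?num_real//.
  rewrite normrM normfV (gtr0_norm hp) expr_ge1 ?divr_ge0 ?(ltW hp)//.
  by rewrite ler_pdivlMr// mul1r.
rewrite normrM normrN (_ : 4 / h = 2 * (2 / h)); last by field.
apply: ler_pM => //.
  rewrite ger0_norm; last by rewrite mulr_ge0// le_max lexx.
  rewrite ler_piMr// ge_max ler01/= /paraboloid lerBlDl lerDr; exact: sqr_ge0.
rewrite !normrM normfV normrX (gtr0_norm hp) ger0_norm// -mulrA ler_pM2l//.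
rewrite ler_pdivrMr ?exprn_gt0// expr2 mulrA mulVf// mul1r; exact: ltW.
Qed.

Lemma eta_cvg x : eta 0 n.+1%:R x @[n --> \oo] --> (1 : R).
Proof.
have K : 1 - (x * n.+1%:R^-1) ^+ 2 @[n --> \oo] --> 1 - (x * (0 : R)) ^+ 2.
  apply: cvgB; first exact: cvg_cst.
  apply: (cvg_comp _ (fun y : R => y ^+ 2)); last exact: exprn_continuous.
  by apply: cvgM; [exact: cvg_cst|exact: cvg_harmonic].
have C : {for (1 - (x * (0 : R)) ^+ 2), continuous (@possq R)}.
  apply: differentiable_continuous; apply/derivable1_diffP.
  exact: (@ex_derive _ _ _ _ _ _ _ (is_derive_possq _)).
have := cvg_comp _ _ K C; rewrite mulr0 expr0n subr0 {2}/possq.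
rewrite (_ : Num.max 0 1 ^+ 2 = 1 :> R); last by rewrite (max_idPr _) ?ler01// expr1n.
apply: cvg_trans; rewrite (_ : (fun n : nat => eta 0 n.+1%:R x) = possq \o (fun n : nat => 1 - (x / n.+1%:R) ^+ 2))//.
by apply/funext => n; rewrite /eta /paraboloid subr0.
Qed.

(** The product [u * v] is tested against the wide bumps [eta 0 (n+1)], whose derivatives are
    [O(1/n)] while [u * v] is integrable; in the limit the boundary contribution disappears. *)
Lemma H1_parts u du v dv : AC u du -> AC v dv -> L2 u -> L2 v -> ip du v = - ip u dv.
Proof.
move=> Au Av Lu Lv; have Ldu := Au.1; have Ldv := Av.1.
have A := ACM Au Av (H1_bound Au Lu) (H1_bound Av Lv).
have E n := AC_parts A (eta_test 0 (ltr0Sn R n)).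
have i0 := L2M Lu Lv.
have iw : integr (fun x => v x * du x + u x * dv x) by apply: integrD; exact: L2M.
have C1 : \int[mu]_x (u x * v x * derive1 (eta 0 n.+1%:R) x) @[n --> \oo] --> (0 : R).
  apply: norm_cvg0; apply: (@cvg_harmonic_bound _ _ (4 * \int[mu]_x `|u x * v x|)) => n.
  have bn (t : R) : `|derive1 (eta 0 n.+1%:R) t| <= 4 / n.+1%:R by exact: eta_derive_bnd.
  have md : measurable_fun setT (derive1 (@eta R 0 n.+1%:R)).
    exact: L2_meas (test_dL2 (eta_test 0 (ltr0Sn R n))).
  rewrite normr_ge0/= mulrAC -IntZ; last exact: integr_norm.
  have i1 := integr_bndM i0 md bn.
  apply: (le_trans (norm_Int i1)); apply: le_Int.
  - exact: integr_norm.
  - by apply: integrZ; exact: integr_norm.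
  - by move=> t; rewrite normrM mulrC ler_wpM2r.
have C2 : \int[mu]_x ((v x * du x + u x * dv x) * eta 0 n.+1%:R x) @[n --> \oo] -->
    \int[mu]_x (v x * du x + u x * dv x).
  apply: (dct _ _ (integr_norm iw) _ _).2.
  - move=> n; apply: measurable_funM; first exact: integr_meas iw.
    exact: L2_meas (test_L2 (eta_test 0 (ltr0Sn R n))).
  - exact: integr_meas iw.
  - apply: aeW => x; rewrite -[X in _ --> X]mulr1; apply: cvgM; first exact: cvg_cst.
    exact: eta_cvg.
  - by move=> n x; rewrite normrM ler_piMr// ger0_norm ?eta_ge0// eta_le1.
have C3 : \int[mu]_x ((v x * du x + u x * dv x) * eta 0 n.+1%:R x) @[n --> \oo] --> - (0 : R).
  rewrite (_ : (fun n => _) = (fun n => - \int[mu]_x (u x * v x * derive1 (eta 0 n.+1%:R) x))).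
    exact: cvgN.
  by apply/funext => n; rewrite E opprK.
have := cvg_lim (@Rhausdorff R) C2; rewrite (cvg_lim (@Rhausdorff R) C3) oppr0.
have -> : \int[mu]_x (v x * du x + u x * dv x) = ip du v + ip u dv.
  rewrite (IntD (L2M Lv Ldu) (L2M Lu Ldv)); congr (_ + _).
  by apply: eq_Int => x; rewrite mulrC.
by move=> /(_ _) H; apply/eqP; rewrite -addr_eq0 -H.
Qed.

(** The derivative of [cas] is its own reflection, [cas' t = cas (- t)]. This is the source of
    [refl] in [Ha_AC] and of the argument [- xi] in [T_derive]. *)
Lemma cas_ftc a b xi : cas (b * xi) - cas (a * xi) = xi * \int[mu]_x (chi a b x * cas (- x * xi)).
Proof.
wlog ab : a b / a <= b.
  move=> W; case: (lerP a b) => [|/ltW] /W// E.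
  rewrite -[LHS]opprB E -mulrN -IntN; first by congr (_ * _); apply: eq_Int => x; rewrite chiN mulNr opprK.
  apply: (integr_bndM (integr_chi _ _) _ (fun x => cas_bnd _)).
  apply: (measurableT_comp (continuous_measurable_fun continuous_cas)).
  by apply: measurable_funM => //; exact: measurable_oppR.
have D x : is_derive x (1 : R) (fun x : R => cas (x * xi)) (xi * cas (- x * xi)).
  rewrite /cas.
  have L : is_derive x (1 : R) (fun x : R => x * xi) xi.
    by under eq_fun do rewrite mulrC; exact: is_derive_lin.
  have Ds := @is_derive1_comp _ sin (fun x : R => x * xi) x _ _ (is_derive_sin _) L.
  have Dc := @is_derive1_comp _ cos (fun x : R => x * xi) x _ _ (is_derive_cos _) L.
  apply: (is_derive_eq (is_deriveD Dc Ds)).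
  by rewrite [- x * xi]mulNr cosN sinN; ring.
have E : derive1 (fun x : R => cas (x * xi)) = (fun x => xi * cas (- x * xi)).
  by apply/funext => x; rewrite derive1E (@derive_val _ _ _ _ _ _ _ (D x)).
have [|i ->] := C1_ftc (fun x => @ex_derive _ _ _ _ _ _ _ (D x)) _ ab.
  rewrite E => x; apply: cvgM; first exact: cvg_cst.
  apply: (cvg_comp (fun x : R => - x * xi) cas _); last exact: continuous_cas.
  apply: cvgM; last exact: cvg_cst.
  exact: oppr_continuous.
rewrite E -IntZ; first by apply: eq_Int => x; rewrite mulrC mulrCA.
apply: (integr_bndM (integr_chi _ _) _ (fun x => cas_bnd _)).
apply: (measurableT_comp (continuous_measurable_fun continuous_cas)).
by apply: measurable_funM => //; exact: measurable_oppR.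
Qed.

Lemma test_mulX phi : test_function phi ->
  integr (fun xi => xi * phi xi) /\ L2 (fun xi => xi * phi xi).
Proof.
move=> tp; have [M [M0 sp _]] := test_supp tp.
have cp : continuous (fun xi => xi * phi xi).
  by move=> x; apply: cvgM; [exact: cvg_id|exact: test_continuous].
have sx : supp_in M (fun xi => xi * phi xi) by move=> x /sp ->; rewrite mulr0.
have [C HC] := continuous_supp_bounded cp sx.
have mp := continuous_measurable_fun cp.
by split; [exact: (bounded_supp_integr mp sx HC)|exact: (bounded_supp_L2 mp sx HC)].
Qed.

Lemma Ha_AC phi : test_function phi -> AC (Ha phi) (refl (Ha (fun xi => xi * phi xi))).
Proof.
move=> tp; have [xi_ xL] := test_mulX tp; have ip_ := test_integr tp; have Lp := test_L2 tp.
split; first by apply: refl_L2; exact: (Plancherel_integr xi_ xL).1.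
move=> a b; rewrite /Ha -IntB; [|exact: integr_cas|exact: integr_cas].
pose k (z : RR * RR) : R := cas (- z.1 * z.2).
have mk : measurable_fun setT k.
  apply: (measurableT_comp (continuous_measurable_fun continuous_cas)).
  apply: measurable_funM; last exact: measurable_snd.
  by apply: measurableT_comp; [exact: measurable_oppR|exact: measurable_fst].
have kb (z : RR * RR) : `|k z| <= 2 by exact: cas_bnd.
have [_ E] := Int_kernelC mk kb (integr_chi a b) xi_.
transitivity (\int[mu]_x (chi a b x * \int[mu]_y (y * phi y * k (x, y)))).
  rewrite [RHS]E; apply: eq_Int => y; rewrite -mulrBr cas_ftc.
  by rewrite mulrCA mulrA.
by apply: eq_Int => x; rewrite mulrC.
Qed.

Lemma eq_locint f g : f =1 g -> locally_integrable setT f -> locally_integrable setT g.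
Proof. by move=> /funext ->. Qed.

Lemma locint_mulX f : locally_integrable setT f -> locally_integrable setT (fun x => x * f x).
Proof.
move=> [mf oT H]; split => //; first exact: measurable_funM.
move=> K sK cK; have [M [_ HM]] := compact_bounded cK.
have KN x : K x -> `|x| <= `|M| + 1.
  by move=> Kx; apply: (HM (`|M| + 1)) => //; have := ler_norm M; rewrite /=; lra.
have mK : measurable K by exact: compact_measurable.
have mn : measurable_fun K (fun x => `|f x|%:E).
  by apply/measurable_EFinP; apply: measurableT_comp => //; exact: measurable_funTS.
have M0 : 0 <= `|M| + 1 by rewrite addr_ge0.
apply: (@le_lt_trans _ _ (\int[mu]_(x in K) ((`|M| + 1)%:E * `|f x|%:E))%E).
  apply: ge0_le_integral => //.
  - by apply/measurable_EFinP; apply: measurableT_comp => //; apply: measurable_funM => //; exact: measurable_funTS.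
  - by apply: emeasurable_funM.
  - by move=> x Kx; rewrite -EFinM lee_fin normrM ler_wpM2r// KN.
rewrite ge0_integralZl//.
by apply: lte_mul_pinfty => //; exact: H.
Qed.

(** The Fourier multiplier [i xi] takes this form because the factor [i] exchanges the even and odd
    parts of the Hartley transform. It is checked against test functions: [H1_parts] moves the
    derivative onto [Ha phi], and [Ha_AC] computes it there. *)
Lemma T_derive f df : L2 f -> AC f df ->
  aeq (T df) (fun xi => - xi * T f (- xi)).
Proof.
move=> Lf Af; have Ldf := Af.1; have LT := T_L2 Lf; have LTd := T_L2 Ldf.
have LTr := refl_L2 LT.
have ml : measurable_fun setT (fun xi => - xi * T f (- xi)).
  apply: measurable_funM; first exact: measurable_oppR.
  exact: (L2_meas LTr).
have Hloc : locally_integrable setT (fun xi => - xi * T f (- xi)).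
  apply: eq_locint (locint_mulX (L2_locint (L2N LTr))) => x.
  by rewrite /refl mulrN mulNr.
have Lfr := refl_L2 Lf.
apply: aeqB; apply: fundamental_lemma.
  exact: locally_integrableB (L2_locint LTd) Hloc.
move=> phi tp; have Lp := test_L2 tp; have [xi_ xL] := test_mulX tp.
have AH := Ha_AC tp; have LH := (Plancherel_integr (test_integr tp) Lp).1.
have LHx := (Plancherel_integr xi_ xL).1.
have i1 := L2M LTd Lp; have i2 := test_locint_mul Hloc tp.
transitivity (ip (T df) phi - \int[mu]_x (- x * T f (- x) * phi x)).
  by rewrite -(IntB i1 i2); apply: eq_Int => x; rewrite mulrBl.
rewrite (T_test Ldf tp) (H1_parts Af AH Lf LH).
suff -> : \int[mu]_x (- x * T f (- x) * phi x) = - ip f (refl (Ha (fun xi => xi * phi xi))).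
  by rewrite subrr.
rewrite -(ip_refl Lf LHx).
have -> : ip (refl f) (Ha (fun xi => xi * phi xi)) = ip (refl f) (T (fun xi => xi * phi xi)).
  apply: aeq_ip (aeq_refl _) (aeq_sym (T_Ha xi_ xL)); try exact: L2_meas.
  exact: (L2_meas (T_L2 xL)).
rewrite -(T_sym Lfr xL) -(ipNl (T_L2 Lfr) xL).
have -> : ip (fun x => - T (refl f) x) (fun xi => xi * phi xi) =
    ip (fun x => - refl (T f) x) (fun xi => xi * phi xi).
  have [mx _] := xL; have LTfr := T_L2 Lfr.
  apply: aeq_ip (aeq_refl _) => //; [exact: L2_meas (L2N LTfr)|exact: L2_meas (L2N LTr)|].
  by apply: filterS (T_refl Lf) => x ->.
by apply: eq_Int => x; rewrite /refl; ring.
Qed.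

Lemma T_absX_L2 f df : L2 f -> AC f df -> L2 (fun xi => `|xi| * T f xi).
Proof.
move=> Lf Af; have LT := T_L2 Lf; have Ldf := Af.1; have LTd := T_L2 Ldf.
have L : L2 (fun xi => - xi * T f (- xi)).
  apply: aeq_L2 (T_derive Lf Af) LTd; apply: measurable_funM; first exact: measurable_oppR.
  exact: (L2_meas (refl_L2 LT)).
apply: L2_le (refl_L2 L).
  apply: measurable_funM; last exact: L2_meas.
  by apply: continuous_measurable_fun; exact: norm_continuous.
by move=> x; rewrite /refl opprK !normrM normr_id.
Qed.

(** Interpolation between L^2 and H^1: the square of the function is the product of [|xi| * T f xi]
    and [T f xi], both in L^2. *)
Lemma T_sqrtX_L2 f df : L2 f -> AC f df -> L2 (fun xi => Num.sqrt `|xi| * T f xi).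
Proof.
move=> Lf Af; have LT := T_L2 Lf; have LX := T_absX_L2 Lf Af.
have m : measurable_fun setT (fun x : RR => Num.sqrt `|x| : R).
  apply: continuous_measurable_fun => x.
  exact: (cvg_comp _ _ (@norm_continuous _ _ x) (@sqrt_continuous _ _)).
split; first by apply: measurable_funM => //; exact: L2_meas.
apply: eq_integr (L2M LX LT) => x.
by rewrite exprMn sqr_sqrtr// expr2 mulrA.
Qed.

End HartleyDerivative.

(** * Complex-valued functions and the half derivative *)

Section ComplexNorms.
Context {R : realType}.
Local Notation mu := (@lebesgue_measure R).
Local Notation RR := (measurableTypeR R).
Local Notation cre f := (fun x => complex.Re (f x)).
Local Notation cim f := (fun x => complex.Im (f x)).
Implicit Types (f g : R -> R[i]) (r s : R -> R).

Lemma normc_sqr (z : R[i]) : normc z ^+ 2 = complex.Re z ^+ 2 + complex.Im z ^+ 2.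
Proof. by case: z => a b; rewrite /normc sqr_sqrtr// addr_ge0 ?sqr_ge0. Qed.

Lemma normc_ge0 (z : R[i]) : 0 <= normc z.
Proof. by case: z => a b; exact: sqrtr_ge0. Qed.

Lemma normcE (z : R[i]) : normc z = Num.sqrt (complex.Re z ^+ 2 + complex.Im z ^+ 2).
Proof. by case: z. Qed.

Lemma measurable_normc f : measurable_fun setT (cre f) -> measurable_fun setT (cim f) ->
  measurable_fun setT (fun x => normc (f x)).
Proof.
move=> mr mi; under eq_fun do rewrite normcE.
apply: (measurableT_comp (continuous_measurable_fun (@sqrt_continuous R))).
by apply: measurable_funD; exact: measurable_funX.
Qed.

Lemma cLnormE k f : (0 < k)%N ->
  cLnorm k%:R%:E f = ((\int[mu]_x ((normc (f x)) ^+ k)%:E) `^ k%:R^-1)%E.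
Proof.
move=> k0; rewrite /cLnorm unlock; congr poweR; apply: eq_integral => x _.
by rewrite poweR_EFin powR_mulrn// ger0_norm ?normc_ge0.
Qed.

Lemma cLp_integr k f : (0 < k)%N -> cLp k%:R%:E f -> integr (fun x => normc (f x) ^+ k).
Proof.
move=> k0 [mr mi]; rewrite cLnormE// => H.
have k1 : k%:R^-1 != 0 :> R by rewrite invr_eq0 pnatr_eq0 -lt0n.
apply: integrP; first by apply: measurable_funX; exact: measurable_normc.
under eq_integral => x _ do rewrite ger0_norm ?exprn_ge0 ?normc_ge0//.
rewrite ltey; apply/negP => /eqP E; move: H; rewrite E poweRyr//.
Qed.

Lemma integr_cLnorm k f : (0 < k)%N -> integr (fun x => normc (f x) ^+ k) ->
  cLnorm k%:R%:E f = ((\int[mu]_x (normc (f x) ^+ k)) `^ k%:R^-1)%:E.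
Proof. by move=> k0 i; rewrite cLnormE// EFin_Int// poweR_EFin. Qed.

Lemma integr_cLp k f : (0 < k)%N -> measurable_fun setT (cre f) -> measurable_fun setT (cim f) ->
  integr (fun x => normc (f x) ^+ k) -> cLp k%:R%:E f.
Proof. by move=> k0 mr mi i; split => //; rewrite integr_cLnorm ?ltry. Qed.

Definition c2 f : R := Num.sqrt (\int[mu]_x (normc (f x) ^+ 2)).

Definition c4 f : R := Num.sqrt (Num.sqrt (\int[mu]_x (normc (f x) ^+ 4))).

Lemma cLnorm2 f : cLp 2%:E f -> cLnorm 2%:E f = (c2 f)%:E.
Proof.
move=> H; rewrite (integr_cLnorm _ (cLp_integr _ H))// powR12_sqrt//.
by apply: Int_ge0 => x; rewrite exprn_ge0 ?normc_ge0.
Qed.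

Lemma cLnorm4 f : cLp 4%:E f -> cLnorm 4%:E f = (c4 f)%:E.
Proof.
move=> H; rewrite (integr_cLnorm _ (cLp_integr _ H))//.
have I0 : 0 <= \int[mu]_x (normc (f x) ^+ 4).
  by apply: Int_ge0 => x; rewrite exprn_ge0 ?normc_ge0.
rewrite (_ : 4%:R^-1 = 2^-1 * 2^-1 :> R); last by rewrite -invfM -natrM.
by rewrite powRrM !powR12_sqrt ?sqrtr_ge0.
Qed.

Lemma cLp2P f : cLp 2%:E f <-> L2 (cre f) /\ L2 (cim f).
Proof.
split=> [H|[Lr Li]].
  have i := cLp_integr (ltn0Sn 1) H; have [mr mi _] := H.
  by split; split => //; apply: le_integr i => [|x]; rewrite ?normc_sqr;
    [exact: measurable_funX| rewrite ger0_norm ?sqr_ge0// ?lerDl ?lerDr sqr_ge0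
    |exact: measurable_funX| rewrite ger0_norm ?sqr_ge0// ?lerDl ?lerDr sqr_ge0].
apply: (integr_cLp (ltn0Sn 1)) Lr.1 Li.1 _.
by apply: eq_integr (integrD Lr.2 Li.2) => x; rewrite normc_sqr.
Qed.

Lemma c2_sqr f : L2 (cre f) -> L2 (cim f) -> c2 f ^+ 2 = n2 (cre f) ^+ 2 + n2 (cim f) ^+ 2.
Proof.
move=> Lr Li; rewrite sqr_sqrtr; last by apply: Int_ge0 => x; rewrite sqr_ge0.
rewrite !n2_sqr /ip -(IntD (L2M Lr Lr) (L2M Li Li)); apply: eq_Int => x.
by rewrite normc_sqr !expr2.
Qed.

Lemma c2_ge0 f : 0 <= c2 f. Proof. exact: sqrtr_ge0. Qed.

Lemma c2_le f : L2 (cre f) -> L2 (cim f) -> c2 f <= n2 (cre f) + n2 (cim f).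
Proof.
move=> Lr Li; rewrite -(@ler_pXn2r _ 2)// ?nnegrE ?addr_ge0 ?n2_ge0 ?c2_ge0//.
by rewrite c2_sqr// sqrrD -addrA [leRHS]addrCA; have := n2_ge0 (cre f); have := n2_ge0 (cim f); nra.
Qed.

Lemma n2_cre_le f : L2 (cre f) -> L2 (cim f) -> n2 (cre f) <= c2 f.
Proof.
move=> Lr Li; rewrite -(@ler_pXn2r _ 2)// ?nnegrE ?n2_ge0 ?c2_ge0//.
by rewrite c2_sqr// lerDl sqr_ge0.
Qed.

Lemma n2_cim_le f : L2 (cre f) -> L2 (cim f) -> n2 (cim f) <= c2 f.
Proof.
move=> Lr Li; rewrite -(@ler_pXn2r _ 2)// ?nnegrE ?n2_ge0 ?c2_ge0//.
by rewrite c2_sqr// lerDr sqr_ge0.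
Qed.

Definition ev r x : R := 2^-1 * (r x + r (- x)).
Definition od r x : R := 2^-1 * (r x - r (- x)).

Lemma ev_L2 r : L2 r -> L2 (ev r).
Proof. by move=> Lr; apply: L2Z; apply: L2D => //; exact: refl_L2. Qed.

Lemma od_L2 r : L2 r -> L2 (od r).
Proof. by move=> Lr; apply: L2Z; apply: L2B => //; exact: refl_L2. Qed.

Lemma n2_refl r : L2 r -> n2 (refl r) = n2 r.
Proof.
move=> Lr; rewrite /n2 (ip_refl Lr (refl_L2 Lr)); congr Num.sqrt.
by apply: eq_ip => // x; rewrite /refl opprK.
Qed.

Lemma n2_ev r : L2 r -> n2 (ev r) <= n2 r.
Proof.
move=> Lr; have Lf := refl_L2 Lr; rewrite (n2Z _ (L2D Lr Lf)) ger0_norm//.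
by have := n2D Lr Lf; rewrite (n2_refl Lr); lra.
Qed.

Lemma n2_od r : L2 r -> n2 (od r) <= n2 r.
Proof.
move=> Lr; have Lf := refl_L2 Lr; rewrite (n2Z _ (L2B Lr Lf)) ger0_norm//.
by have := n2B Lr Lf; rewrite (n2_refl Lr); lra.
Qed.

Lemma evod r x : ev r x + od r x = r x.
Proof. by rewrite /ev /od; field. Qed.

Lemma tr_patch n r (h : R -> R) :
  \int[mu]_(x in `[- n%:R, n%:R]) (h x * r x) = \int[mu]_x (tr n r x * h x).
Proof.
rewrite Rintegral_mkcond; apply: eq_Int => x; rewrite patchE /tr mem_setE in_itv/= -ler_norml.
by case: (_ <= n%:R); rewrite ?mulr1 ?mulr0 ?mul0r// mulrC.
Qed.

Lemma trunc_re n r xi : L2 r ->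
  complex.Re (truncated_fourier n (fun x => (r x)%:C) xi) = ev (Ha (tr n r)) xi.
Proof.
move=> Lr; have ti := tr_integr n Lr; rewrite /truncated_fourier /cintegral /ev /Ha /=.
under eq_Rintegral do rewrite mulr0 oppr0 addr0.
rewrite tr_patch -(IntD (integr_cas xi ti) (integr_cas (- xi) ti)) -IntZ.
  by apply: eq_Int => x; rewrite /cas mulNr cosN sinN [xi * x]mulrC; field.
by apply: integrD; exact: integr_cas.
Qed.

Lemma trunc_im n r xi : L2 r ->
  complex.Im (truncated_fourier n (fun x => (r x)%:C) xi) = - od (Ha (tr n r)) xi.
Proof.
move=> Lr; have ti := tr_integr n Lr; rewrite /truncated_fourier /cintegral /od /Ha /=.
under eq_Rintegral do rewrite mulr0 add0r.
rewrite tr_patch -(IntB (integr_cas xi ti) (integr_cas (- xi) ti)) -IntZ -?IntN.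
- by apply: eq_Int => x; rewrite /cas mulNr cosN sinN [xi * x]mulrC; field.
- by apply: integrZ; apply: integrB; exact: integr_cas.
- by apply: integrB; exact: integr_cas.
Qed.

(** The dictionary between the Fourier transform of the specification and [T]. Parity projections
    are contractions of L^2, so convergence of the truncated Hartley transforms passes to the real
    and imaginary parts, and uniqueness of L^2 limits identifies [F]. *)
Lemma is_fourierP r F :
  is_fourier (fun x => (r x)%:C) F <->
  [/\ L2 r, L2 (cre F), L2 (cim F), aeq (cre F) (ev (T r)) & aeq (cim F) (fun x => - od (T r) x)].
Proof.

have L2r0 : L2 (fun=> 0 : R) by exact: L20.
pose G n xi : R[i] := truncated_fourier n (fun x => (r x)%:C) xi - F xi.
have GreE n : L2 r -> cre (G n) = (fun x => ev (Ha (tr n r)) x - complex.Re (F x)).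
  by move=> Lr; apply/funext => x; rewrite -trunc_re// /G; case: (truncated_fourier _ _ _) (F x) => ? ? [].
have GimE n : L2 r -> cim (G n) = (fun x => - od (Ha (tr n r)) x - complex.Im (F x)).
  by move=> Lr; apply/funext => x; rewrite -trunc_im// /G; case: (truncated_fourier _ _ _) (F x) => ? ? [].
have evc : L2 r -> n2 (fun x => ev (Ha (tr n r)) x - ev (T r) x) @[n --> \oo] --> (0 : R).
  move=> Lr; apply: squeeze_cvgr (cvg_cst 0) (T_cvg Lr); apply: nearW => n; rewrite n2_ge0/=.
  have := n2_ev (L2B (Ha_tr_L2 n Lr) (T_L2 Lr)); congr (_ <= _); congr n2.
  by apply/funext => x; rewrite /ev; ring.
have odc : L2 r -> n2 (fun x => - od (Ha (tr n r)) x - - od (T r) x) @[n --> \oo] --> (0 : R).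
  move=> Lr; apply: squeeze_cvgr (cvg_cst 0) (T_cvg Lr); apply: nearW => n; rewrite n2_ge0/=.
  have := n2_od (L2B (Ha_tr_L2 n Lr) (T_L2 Lr)); rewrite -n2N; congr (_ <= _); congr n2.
  by apply/funext => x; rewrite /od; ring.
split.
- move=> [/cLp2P[Lr _] /cLp2P[LFr LFi]].
  have Lre n : L2 (cre (G n)).
    by rewrite GreE//; apply: L2B => //; apply: ev_L2; exact: Ha_tr_L2.
  have Lim n : L2 (cim (G n)).
    by rewrite GimE//; apply: L2B => //; apply: L2N; apply: od_L2; exact: Ha_tr_L2.
  rewrite (_ : (fun n => _) = (fun n => (c2 (G n))%:E)); last first.
    by apply/funext => n; rewrite -cLnorm2//; apply/cLp2P.
  move=> /fine_cvgP[_ C].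
  have LT := T_L2 Lr; split => //.
  + apply: (L2_lim_unique (h := fun n => ev (Ha (tr n r)))) => //.
    * by move=> n; apply: ev_L2; exact: Ha_tr_L2.
    * exact: ev_L2.
    * apply: squeeze_cvgr (cvg_cst 0) C; apply: nearW => n; rewrite n2_ge0/= -GreE//.
      exact: n2_cre_le.
    * exact: evc.
  + apply: (L2_lim_unique (h := fun n x => - od (Ha (tr n r)) x)) => //.
    * by move=> n; apply: L2N; apply: od_L2; exact: Ha_tr_L2.
    * by apply: L2N; exact: od_L2.
    * apply: squeeze_cvgr (cvg_cst 0) C; apply: nearW => n; rewrite n2_ge0/= -GimE//.
      exact: n2_cim_le.
    * exact: odc.
- move=> [Lr LFr LFi Er Ei]; have LT := T_L2 Lr.
  have Lre n : L2 (cre (G n)).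
    by rewrite GreE//; apply: L2B => //; apply: ev_L2; exact: Ha_tr_L2.
  have Lim n : L2 (cim (G n)).
    by rewrite GimE//; apply: L2B => //; apply: L2N; apply: od_L2; exact: Ha_tr_L2.
  split; [exact/cLp2P|exact/cLp2P|].
  rewrite (_ : (fun n => _) = (fun n => (c2 (G n))%:E)); last first.
    by apply/funext => n; rewrite -cLnorm2//; apply/cLp2P.
  apply: cvg_EFin; first exact: nearW.
  have C : n2 (cre (G n)) + n2 (cim (G n)) @[n --> \oo] --> (0 : R).
    rewrite -[X in _ --> X]addr0; apply: cvgD.
      rewrite (_ : (fun n => _) = (fun n => n2 (fun x => ev (Ha (tr n r)) x - ev (T r) x))); first exact: evc.
      apply/funext => n; rewrite GreE//; apply: aeq_n2.
      + by have := L2_meas (Lre n); rewrite GreE.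
      + by apply: L2_meas; apply: L2B; apply: ev_L2 => //; exact: Ha_tr_L2.
      + by apply: filterS Er => x ->.
    rewrite (_ : (fun n => _) = (fun n => n2 (fun x => - od (Ha (tr n r)) x - - od (T r) x))); first exact: odc.
    apply/funext => n; rewrite GimE//; apply: aeq_n2.
    + by have := L2_meas (Lim n); rewrite GimE.
    + by apply: L2_meas; apply: L2B; apply: L2N; apply: od_L2 => //; exact: Ha_tr_L2.
    + by apply: filterS Ei => x ->.
  apply: squeeze_cvgr (cvg_cst 0) C; apply: nearW => n; rewrite c2_ge0/=.
  exact: c2_le.
Qed.

End ComplexNorms.

(** * The operator |D| and its square root *)

Section HalfDerivative.
Context {R : realType}.
Local Notation mu := (@lebesgue_measure R).
Local Notation RR := (measurableTypeR R).
Implicit Types (f g df dg h r : R -> R) (a b e x y z xi : R).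

Let pi2_gt0 : (0 : R) < 2 * pi. Proof. by rewrite mulr_gt0// pi_gt0. Qed.
Let pi2_neq0 : (2 * pi : R) != 0. Proof. by rewrite gt_eqF. Qed.

Lemma measurable_sqrt_norm : measurable_fun setT (fun x : RR => Num.sqrt `|x| : R).
Proof.
apply: continuous_measurable_fun => x.
exact: (cvg_comp _ _ (@norm_continuous _ _ x) (@sqrt_continuous _ _)).
Qed.

(* The operator |D| on H^1. *)
Definition Dabs f x : R := (2 * pi)^-1 * T (fun xi => `|xi| * T f xi) x.

Lemma Dabs_L2 f df : L2 f -> AC f df -> L2 (Dabs f).
Proof. by move=> Lf Af; apply: L2Z; apply: T_L2; exact: T_absX_L2 Lf Af. Qed.

Lemma ip_Dabs f df g : L2 f -> AC f df -> L2 g ->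
  ip (Dabs f) g = (2 * pi)^-1 * ip (fun xi => `|xi| * T f xi) (T g).
Proof.
move=> Lf Af Lg; have LX := T_absX_L2 Lf Af.
by rewrite (ipZl _ (T_L2 LX) Lg) (T_sym LX Lg).
Qed.

Lemma Dabs_sym f df g dg : L2 f -> AC f df -> L2 g -> AC g dg -> ip (Dabs f) g = ip f (Dabs g).
Proof.
move=> Lf Af Lg Ag; rewrite (ip_Dabs Lf Af Lg) ipC (ipC f) (ip_Dabs Lg Ag Lf); congr (_ * _).
by rewrite ipC; apply: eq_Int => x; ring.
Qed.

Lemma ip_Dabs_sqrt f df : L2 f -> AC f df ->
  ip (Dabs f) f = (2 * pi)^-1 * n2 (fun xi => Num.sqrt `|xi| * T f xi) ^+ 2.
Proof.
move=> Lf Af; rewrite (ip_Dabs Lf Af Lf) n2_sqr; congr (_ * _); apply: eq_Int => x.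
by rewrite mulrACA -expr2 sqr_sqrtr// mulrA.
Qed.

Lemma Dabs_ge0 f df : L2 f -> AC f df -> 0 <= ip (Dabs f) f.
Proof.
by move=> Lf Af; rewrite (ip_Dabs_sqrt Lf Af) mulr_ge0 ?sqr_ge0// invr_ge0 ltW.
Qed.

Lemma Dabs_lin c f df g dg h : L2 f -> AC f df -> L2 g -> AC g dg -> L2 h ->
  ip (Dabs (fun x => c * f x + g x)) h = c * ip (Dabs f) h + ip (Dabs g) h.
Proof.
move=> Lf Af Lg Ag Lh.
have Lfg : L2 (fun x => c * f x + g x) by apply: L2D Lg; exact: L2Z.
have Afg := ACD (ACZ c Af) Ag.
have LX := T_absX_L2 Lf Af; have LY := T_absX_L2 Lg Ag; have LZ := T_absX_L2 Lfg Afg.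
have LTh := T_L2 Lh; have LcX := L2Z c LX.
rewrite (ip_Dabs Lfg Afg Lh) (ip_Dabs Lf Af Lh) (ip_Dabs Lg Ag Lh).
rewrite mulrCA -mulrDr -(ipZl c LX LTh) -(ipDl LcX LY LTh); congr (_ * _).
apply: aeq_ip (aeq_refl _) => //; [exact: L2_meas LZ|exact: L2_meas (L2D LcX LY)|exact: L2_meas|exact: L2_meas|].
by apply: filterS (T_lin c Lf Lg) => x ->; ring.
Qed.

(** By [TT] and [T_derive], the transforms of [Dabs f] and of [df] have the same modulus up to
    reflection. Bounds on the derivative of a density thus control the nonlocal term in L^2. *)
Lemma n2_Dabs f df : L2 f -> AC f df -> n2 (Dabs f) = n2 df.
Proof.
move=> Lf Af; have LX := T_absX_L2 Lf Af; have LT := T_L2 Lf; have Ldf := Af.1.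
rewrite /n2; congr Num.sqrt; rewrite (ip_Dabs Lf Af (Dabs_L2 Lf Af)).
have -> : ip (fun xi => `|xi| * T f xi) (T (Dabs f)) = ip (fun xi => `|xi| * T f xi) (fun xi => `|xi| * T f xi).
  apply: aeq_ip (aeq_refl _) _; [exact: L2_meas|exact: L2_meas|exact: L2_meas (T_L2 (Dabs_L2 Lf Af))|exact: L2_meas|].
  have L0 := @L20 R; have LTX := T_L2 LX.
  apply: aeq_trans (_ : aeq _ (T (fun x => (2 * pi)^-1 * T (fun xi => `|xi| * T f xi) x + 0))) _.
    apply: T_aeq; [exact: Dabs_L2 Lf Af|by apply: L2D L0; exact: L2Z|].
    by apply: aeW => x; rewrite addr0.
  have T0 : aeq (T (fun=> 0 : R)) (fun=> 0).
    by apply: ip_orth_eq0; [exact: T_L2|move=> g Lg; rewrite (T_sym L0 Lg) ip0l].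
  apply: filterS3 (T_lin (2 * pi)^-1 LTX L0) T0 (TT LX) => x -> -> ->.
  by rewrite addr0 mulrA mulVf// mul1r.
rewrite -[ip df df](mulKf pi2_neq0) -(T_polar Ldf Ldf); congr (_ * _).
have LTd := T_L2 Ldf; have LTr := refl_L2 LTd.
transitivity (ip (refl (T df)) (refl (T df))); last first.
  by rewrite -!n2_sqr n2_refl.
have E : aeq (fun x => (refl (T df)) x * (refl (T df)) x) (fun xi => `|xi| * T f xi * (`|xi| * T f xi)).
  have LM : L2 (fun xi => - xi * T f (- xi)).
    apply: aeq_L2 (T_derive Lf Af) LTd; apply: measurable_funM; first exact: measurable_oppR.
    exact: (L2_meas (refl_L2 LT)).
  apply: filterS (refl_aeq LTd LM (T_derive Lf Af)) => x ->.
  by rewrite /refl !opprK mulrACA -expr2 -real_normK ?num_real// expr2 -mulrACA.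
apply: aeq_Int (aeq_sym E); [exact: integr_meas (L2M LX LX)|exact: integr_meas (L2M LTr LTr)].
Qed.

Lemma T_scale c f : L2 f -> aeq (T (fun x => c * f x)) (fun x => c * T f x).
Proof.
move=> Lf; have LT := T_L2 Lf.
apply: aeq_ip_orth; [by apply: T_L2; exact: L2Z|exact: L2Z|].
by move=> h Lh; rewrite (T_sym (L2Z c Lf) Lh) (ipZl c Lf (T_L2 Lh)) (ipZl c LT Lh) (T_sym Lf Lh).
Qed.

Lemma ev_aeq r s : L2 r -> L2 s -> aeq r s -> aeq (ev r) (ev s).
Proof.
move=> Lr Ls rs; apply: filterS2 rs (refl_aeq Lr Ls rs) => x.
by rewrite /refl /ev => -> ->.
Qed.

Lemma od_aeq r s : L2 r -> L2 s -> aeq r s -> aeq (od r) (od s).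
Proof.
move=> Lr Ls rs; apply: filterS2 rs (refl_aeq Lr Ls rs) => x.
by rewrite /refl /od => -> ->.
Qed.

Lemma half_derivativeP r g : L2 r -> is_half_derivative r g ->
  L2 g /\ aeq (T g) (fun xi => Num.sqrt `|xi| * T r xi).
Proof.
move=> Lr [F [/is_fourierP[_ LFr LFi Er Ei] /is_fourierP[Lg _ _ Gr Gi]]]; split => //.
apply: filterS2 (filterI Er Ei) (filterI Gr Gi) => x [er ei] [gr gi].
rewrite -(evod (T g)) -(evod (T r)) -gr -er -[od _ _]opprK -gi -[in RHS](opprK (od _ _)) -ei /=.
by case: (F x) => a b /=; ring.
Qed.

Lemma half_derivative_ex r : L2 r -> L2 (fun xi => Num.sqrt `|xi| * T r xi) ->
  exists g, is_half_derivative r g.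
Proof.
move=> Lr LS; have LT := T_L2 Lr.
pose S := fun xi => Num.sqrt `|xi| * T r xi; pose g x := (2 * pi)^-1 * T S x.
have Lg : L2 g by apply: L2Z; exact: T_L2.
exists g; pose F xi : R[i] := ev (T r) xi +i* (- od (T r) xi).
have ES : aeq (T g) S.
  apply: aeq_trans (T_scale _ (T_L2 LS)) _; apply: filterS (TT LS) => x ->.
  by rewrite mulrA mulVf// mul1r.
have EV := aeq_sym (ev_aeq (T_L2 Lg) LS ES); have OD := aeq_sym (od_aeq (T_L2 Lg) LS ES).
(* The multiplier is even, so it commutes with taking even and odd parts. *)
have re : (fun x => complex.Re ((Num.sqrt `|x|)%:C * F x)) = ev S.
  by apply/funext => x; rewrite /= /ev /S normrN; ring.
have im : (fun x => complex.Im ((Num.sqrt `|x|)%:C * F x)) = (fun x => - od S x).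
  by apply/funext => x; rewrite /= /od /S normrN; ring.
exists F; split; apply/is_fourierP; split => //=.
- exact: ev_L2.
- by apply: L2N; exact: od_L2.
- exact: aeq_refl.
- exact: aeq_refl.
- by rewrite re; exact: ev_L2.
- by rewrite im; apply: L2N; exact: od_L2.
- by rewrite re.
- by rewrite im; apply: filterS OD => x ->.
Qed.

(** [half_derivative] is a choice among many functions, but [half_derivativeP] fixes its transform
    almost everywhere, hence its L^2 norm. The function [r] is allowed to differ from [f] on a null
    set because it will be the density of an arbitrary representative. *)
Lemma half_derivative_energy r f df : L2 f -> AC f df -> measurable_fun setT r -> aeq r f ->
  integr (fun x => half_derivative r x ^+ 2) /\
  \int[mu]_x (half_derivative r x ^+ 2) = ip (Dabs f) f.
Proof.
move=> Lf Af mr rf; have Lr : L2 r by apply: aeq_L2 (aeq_sym rf) Lf.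
have LS := T_sqrtX_L2 Lf Af; have ET := T_aeq Lr Lf rf.
have ES : aeq (fun xi => Num.sqrt `|xi| * T r xi) (fun xi => Num.sqrt `|xi| * T f xi).
  by apply: filterS ET => x ->.
have LSr : L2 (fun xi => Num.sqrt `|xi| * T r xi).
  apply: aeq_L2 (aeq_sym ES) LS; apply: measurable_funM; first exact: measurable_sqrt_norm.
  exact: L2_meas (T_L2 Lr).
have [g0 Hg0] := half_derivative_ex Lr LSr.
have := @xgetPex _ (fun=> 0) [set g | is_half_derivative r g] (ex_intro _ g0 Hg0).
rewrite /= -/(half_derivative r) => /(half_derivativeP Lr)[Lg Eg].
split; first exact: Lg.2.
have -> : \int[mu]_x half_derivative r x ^+ 2 = ip (half_derivative r) (half_derivative r).
  by apply: eq_Int => x; rewrite expr2.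
rewrite (ip_Dabs_sqrt Lf Af) -[LHS](mulKf pi2_neq0) -(T_polar Lg Lg) -n2_sqr; congr (_ * _ ^+ 2).
by apply: aeq_n2; [exact: L2_meas (T_L2 Lg)|exact: L2_meas LS|exact: aeq_trans Eg ES].
Qed.

End HalfDerivative.

(** * The Hilbert transform *)

Section Hilbert.
Context {R : realType}.
Local Notation mu := (@lebesgue_measure R).
Local Notation RR := (measurableTypeR R).
Implicit Types (f g df dg h r : R -> R) (a b e x y z xi : R).

(** Inversion is the pointwise limit of [z / (e^2 + z^2)] as [e] tends to 0, also at the origin,
    where the convention [0^-1 = 0] agrees with the limit. *)
Lemma measurable_inv : measurable_fun setT (fun z : RR => z^-1 : R).
Proof.
apply: (@measurable_fun_cvg _ _ R setT (fun n z => z * (n.+1%:R^-1 ^+ 2 + z ^+ 2)^-1)).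
  move=> n; have e0 : 0 < n.+1%:R^-1 :> R by rewrite invr_gt0.
  by apply: measurable_funM => //; exact: (continuous_measurable_fun (continuous_PQ_denom e0)).
move=> z _; have [->|z0] := eqVneq z 0.
  by rewrite invr0; under eq_fun do rewrite mul0r; exact: cvg_cst.
rewrite (_ : z^-1 = z * (0 ^+ 2 + z ^+ 2)^-1); last by rewrite expr0n add0r; field.
apply: cvgM; first exact: cvg_cst.
apply: cvgV; first by rewrite expr0n add0r sqrf_eq0.
apply: cvgD; last exact: cvg_cst.
by apply: (cvg_comp _ (fun y : R => y ^+ 2)); [exact: cvg_harmonic|exact: exprn_continuous].
Qed.

(** A smooth replacement for the primitive [2 * sqrt x] of [x^(-1/2)]. Letting [e] tend to 0, Fatou
    yields the integrability of the singular weight [isq] from the uniform bound on [F 1 - F 0]. *)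
Lemma sqrt_primitive e : 0 < e -> exists F : R -> R, [/\ forall x, derivable F x 1,
  continuous (derive1 F),
  forall x, derive1 F x = x / (Num.sqrt (x ^+ 2 + e ^+ 2) * Num.sqrt (Num.sqrt (x ^+ 2 + e ^+ 2))) &
  forall x, F x = 2 * Num.sqrt (Num.sqrt (x ^+ 2 + e ^+ 2))].
Proof.
move=> e0; pose s x : R := Num.sqrt (x ^+ 2 + e ^+ 2).
have p0 x : 0 < x ^+ 2 + e ^+ 2 by rewrite ltr_wpDl ?sqr_ge0// exprn_gt0.
have s0 x : 0 < s x by rewrite sqrtr_gt0.
have D1 x : is_derive x (1 : R) (fun x : R => x ^+ 2 + e ^+ 2) (2 * x).
  have -> : (fun x : R => x ^+ 2 + e ^+ 2) = (id * id + cst (e ^+ 2))%R.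
    by apply/funext => y; rewrite expr2.
  have d := is_deriveM (is_derive_id x (1 : R)) (is_derive_id x (1 : R)).
  apply: (is_derive_eq (is_deriveD d (is_derive_cst (e ^+ 2) x (1 : R)))).
  by rewrite /GRing.scale/= addr0; ring.
have D2 x : is_derive x (1 : R) s (x / s x).
  have := @is_derive1_comp _ Num.sqrt (fun x : R => x ^+ 2 + e ^+ 2) x _ _ (is_derive1_sqrt (p0 x)) (D1 x).
  move=> d; apply: (is_derive_eq d); rewrite -/(s x); field; exact: (lt0r_neq0 (s0 x)).
have D3 x : is_derive x (1 : R) (fun x => 2 * Num.sqrt (s x)) (x / (s x * Num.sqrt (s x))).
  have d := @is_derive1_comp _ Num.sqrt s x _ _ (is_derive1_sqrt (s0 x)) (D2 x).
  apply: (is_derive_eq (is_deriveZ 2 d)).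
  rewrite /GRing.scale/=; have := s0 x; have : 0 < Num.sqrt (s x) by rewrite sqrtr_gt0.
  by move=> a0 b0; field; rewrite !gt_eqF.
have cs : continuous s.
  by move=> x; apply: differentiable_continuous; apply/derivable1_diffP; exact: (@ex_derive _ _ _ _ _ _ _ (D2 x)).
exists (fun x => 2 * Num.sqrt (s x)).
have E : derive1 (fun x => 2 * Num.sqrt (s x)) = (fun x => x / (s x * Num.sqrt (s x))).
  by apply/funext => x; rewrite derive1E (@derive_val _ _ _ _ _ _ _ (D3 x)).
split; [by move=> x; exact: (@ex_derive _ _ _ _ _ _ _ (D3 x))| |by move=> x; rewrite E|by []].
rewrite E => x; apply: cvgM; first exact: cvg_id.
apply: cvgV; first by rewrite gt_eqF// mulr_gt0// sqrtr_gt0.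
by apply: cvgM; [exact: cs|exact: (cvg_comp _ _ (cs x) (@sqrt_continuous R _))].
Qed.

Definition isq x : R := (Num.sqrt `|x|)^-1 * chi 0 1 `|x|.

Lemma half_isq_integr : integr (fun x => (Num.sqrt `|x|)^-1 * chi 0 1 x).
Proof.
pose e n : R := n.+1%:R^-1; have e0 n : 0 < e n by rewrite invr_gt0.
have e1 n : e n <= 1 by rewrite invf_le1// ler1n.
pose s n x : R := Num.sqrt (x ^+ 2 + e n ^+ 2).
pose h n x : R := x / (s n x * Num.sqrt (s n x)) * chi 0 1 x.
have c01 : (0 : R) <= 1 by [].
have H n : integr (h n) /\ \int[mu]_x h n x <= 4.
  have [F [dF cF EF FE]] := sqrt_primitive (e0 n).
  have [i I] := C1_ftc dF cF c01; split; first by apply: eq_integr i => x; rewrite EF.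
  have -> : \int[mu]_x h n x = F 1 - F 0 by rewrite I; apply: eq_Int => x; rewrite EF.
  have l4 : Num.sqrt (Num.sqrt (1 ^+ 2 + e n ^+ 2)) <= 2.
    have l2 : Num.sqrt (1 ^+ 2 + e n ^+ 2) <= 2.
      rewrite -[leRHS]ger0_norm// -sqrtr_sqr ler_wsqrtr// expr1n.
      by have := e0 n; have := e1 n; move: (e n) => t; nra.
    rewrite -[leRHS]ger0_norm// -sqrtr_sqr ler_wsqrtr// (le_trans l2)//.
    by rewrite expr2; lra.
  rewrite !FE; have := sqrtr_ge0 (Num.sqrt (0 ^+ 2 + e n ^+ 2)); lra.
have cq : measurable_fun setT (fun x : RR => (Num.sqrt `|x|)^-1 * chi 0 1 x : R).
  apply: measurable_funM; last exact: measurable_chi.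
  exact: (measurableT_comp measurable_inv measurable_sqrt_norm).
apply: (@fatou_integr R h _ 4 _ _ cq _ _ (fun n => (H n).2)).1.
- by move=> n; exact: (H n).1.
- move=> n x; case: (boolP (0 < x <= 1)) => x01; last by rewrite /h chi_out// mulr0.
  rewrite /h chi_in// mulr1 divr_ge0// ?mulr_ge0 ?sqrtr_ge0//.
  by case/andP: x01 => /ltW.
- move=> x; case: (boolP (0 < x <= 1)) => x01; last by rewrite chi_out// mulr0.
  by rewrite chi_in// mulr1 invr_ge0 sqrtr_ge0.
- apply: aeW => x; case: (boolP (0 < x <= 1)) => x01; last first.
    rewrite /h chi_out// mulr0; under eq_fun do rewrite mulr0; exact: cvg_cst.
  rewrite /h chi_in// mulr1; under eq_fun do rewrite mulr1.
  have x0 : 0 < x by case/andP: x01.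
  have S : s n x @[n --> \oo] --> x.
    have K : x ^+ 2 + e n ^+ 2 @[n --> \oo] --> x ^+ 2 + 0 ^+ 2.
      apply: cvgD; first exact: cvg_cst.
      by apply: (cvg_comp _ (fun y : R => y ^+ 2)); [exact: cvg_harmonic|exact: exprn_continuous].
    have := cvg_comp _ _ K (@sqrt_continuous R _).
    by rewrite expr0n addr0 sqrtr_sqr gtr0_norm.
  have SS : Num.sqrt (s n x) @[n --> \oo] --> Num.sqrt x.
    exact: (cvg_comp _ _ S (@sqrt_continuous R _)).
  have q0 : Num.sqrt x != 0 by rewrite gt_eqF// sqrtr_gt0.
  rewrite gtr0_norm// (_ : (Num.sqrt x)^-1 = x / (x * Num.sqrt x)); last first.
    by rewrite invfM mulrA divff ?mul1r ?gt_eqF.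
  apply: cvgM; first exact: cvg_cst.
  by apply: cvgV; [rewrite mulf_neq0// gt_eqF|exact: cvgM].
Qed.

Lemma measurable_isq : measurable_fun setT isq.
Proof.
apply: measurable_funM.
  exact: (measurableT_comp measurable_inv measurable_sqrt_norm).
by apply: (measurableT_comp (measurable_chi 0 1)); exact: (continuous_measurable_fun (@norm_continuous _ _)).
Qed.

Lemma isq_integr : integr isq.
Proof.
have [] := @Int_even R isq measurable_isq _ _ => //.
  by move=> x; rewrite /isq normrN.
apply: le_integr (half_isq_integr).
  by apply: measurable_funM measurable_pos01; exact: measurable_isq.
move=> x; rewrite /isq /pos01; case: (ltP 0 x) => x0; last first.
  rewrite mulr0 normr0; case: (boolP (0 < x <= 1)) => x01; last by rewrite chi_out// mulr0.
  by rewrite chi_in// mulr1 invr_ge0 sqrtr_ge0.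
rewrite mulr1 (gtr0_norm x0) ger0_norm.
  by [].
case: (boolP (0 < x <= 1)) => x01; last by rewrite chi_out// mulr0.
by rewrite chi_in// mulr1 invr_ge0 sqrtr_ge0.
Qed.

(* The symmetrised integrand of the principal value. *)
Definition Dq f x z : R := (f (x - z) - f (x + z)) / z.

(** Near 0 the Hölder exponent 1/2 leaves the integrable singularity [|z|^(-1/2)]. For [|z| > 1] the
    product of the values of [f] with [1 / z] is split by Young's inequality, using
    [z^(-2) <= pker z]. The integral of this majorant does not depend on [x], which bounds the
    Hilbert transform uniformly. *)
Definition Dq_dom f df x z : R :=
  n2 df * Num.sqrt 2 * isq z + (f (x - z) ^+ 2 + f (x + z) ^+ 2) + pker z.

Lemma Dq_le f df x z : AC f df -> `|Dq f x z| <= Dq_dom f df x z.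
Proof.
move=> Af; rewrite /Dq_dom.
have P0 := pker_ge0 z; have N0 := n2_ge0 df; have S0 := sqrtr_ge0 (2 : R).
have I0 : 0 <= isq z.
  rewrite /isq mulr_ge0 ?invr_ge0 ?sqrtr_ge0// chi_itv//.
have A0 : 0 <= f (x - z) ^+ 2 + f (x + z) ^+ 2 by rewrite addr_ge0 ?sqr_ge0.
have NSI : 0 <= n2 df * Num.sqrt 2 * isq z by rewrite mulr_ge0// mulr_ge0.
have [z0|z0] := eqVneq z 0; first by rewrite /Dq {3}z0 invr0 mulr0 normr0 addr_ge0// addr_ge0.
have nz : 0 < `|z| by rewrite normr_gt0.
rewrite /Dq normrM normfV; case: (lerP `|z| 1) => z1.
  apply: (@le_trans _ _ (n2 df * Num.sqrt 2 * isq z)); last by rewrite -addrA lerDl addr_ge0.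
  rewrite /isq chi_in ?nz// mulr1 ler_pdivrMr//.
  have H := AC_holder (x + z) (x - z) Af; apply: (le_trans H).
  rewrite -!mulrA ler_wpM2l// (_ : x - z - (x + z) = - (2 * z)); last by ring.
  rewrite normrN normrM (ger0_norm (ler0n _ 2)) sqrtrM// ler_wpM2l//.
  by rewrite -[X in _ <= _ * X](sqr_sqrtr (ltW nz)) expr2 mulKf// gt_eqF// sqrtr_gt0.
have nz2 : 1 < `|z| ^+ 2 by rewrite exprn_egt1.
have PK : (`|z|^-1) ^+ 2 <= pker z.
  rewrite /pker -[X in 1 + X]real_normK ?num_real//.
  rewrite ler_pdivlMr ?ltr_pwDl ?sqr_ge0// mulrDr mulr1 exprVn mulVf; last by rewrite gt_eqF// exprn_gt0.
  by rewrite -[2]/(1 + 1) lerD2r invf_le1 ?ltW// exprn_gt0.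
apply: (@le_trans _ _ (f (x - z) ^+ 2 + f (x + z) ^+ 2 + (`|z|^-1) ^+ 2)); last by lra.
apply: (@le_trans _ _ ((`|f (x - z)| + `|f (x + z)|) * `|z|^-1)).
  by rewrite ler_wpM2r ?invr_ge0// ler_normB.
rewrite -[f (x - z) ^+ 2]real_normK ?num_real// -[f (x + z) ^+ 2]real_normK ?num_real//.
move: `|f (x - z)| `|f (x + z)| (`|z|^-1) => p q t.
by have := sqr_ge0 (p - t / 2); have := sqr_ge0 (q - t / 2); have := sqr_ge0 t; nra.
Qed.

Lemma Dq_dom_integr f df x : L2 f -> integr (Dq_dom f df x) /\
  \int[mu]_z Dq_dom f df x z = n2 df * Num.sqrt 2 * \int[mu]_z isq z + 2 * ip f f + 2 * pi.
Proof.
move=> Lf; have [pi_i pi_I] := @pker_Int R; have ff := L2M Lf Lf.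
have E1 : (fun z => f (x - z) ^+ 2) = (fun z => f (-1 * z + x) * f (-1 * z + x)).
  by apply/funext => z; rewrite mulN1r addrC expr2.
have E2 : (fun z => f (x + z) ^+ 2) = (fun z => f (1 * z + x) * f (1 * z + x)).
  by apply/funext => z; rewrite mul1r addrC expr2.
have i1 : integr (fun z => f (x - z) ^+ 2) by rewrite E1; exact: (integr_affine x (@N1_neq0 R) ff).
have i2 : integr (fun z => f (x + z) ^+ 2) by rewrite E2; exact: (integr_affine x (oner_neq0 R) ff).
have i12 := integrD i1 i2; have i0 := integrZ (n2 df * Num.sqrt 2) isq_integr.
have i012 := integrD i0 i12.
split; first exact: (integrD i012 pi_i).
rewrite (IntD i012 pi_i) (IntD i0 i12) (IntD i1 i2) (IntZ _ isq_integr) pi_I E1 E2.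
have := Int_affine x (oner_neq0 R) ff; rewrite normr1 mul1r => <-.
have := Int_affine x (@N1_neq0 R) ff; rewrite normrN1 mul1r => <-.
by rewrite -/(ip f f); ring.
Qed.

Lemma measurable_refl_affine f x : measurable_fun setT f -> measurable_fun setT (fun z => f (x - z)).
Proof.
move=> mf; have := measurable_comp_affine (-1) x mf.
by under eq_fun do rewrite mulN1r addrC.
Qed.

Lemma measurable_shift f x : measurable_fun setT f -> measurable_fun setT (fun z => f (x + z)).
Proof.
move=> mf; have := measurable_comp_affine 1 x mf.
by under eq_fun do rewrite mul1r addrC.
Qed.

Lemma Dq_meas f x : measurable_fun setT f -> measurable_fun setT (Dq f x).
Proof.
move=> mf; apply: measurable_funM measurable_inv; apply: measurable_funB.
  exact: measurable_refl_affine.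
exact: measurable_shift.
Qed.

(** Averaging the substitutions [y = x - z] and [y = x + z] brings an odd kernel onto [Dq]. The
    truncated kernel of the principal value and the conjugate Poisson kernel are both of this kind,
    and in both cases [z * k z] stays bounded and converges away from 0, so that they have a common
    limit up to a constant. *)
Lemma odd_conv f k x : L2 f -> L2 k -> (forall z, k (- z) = - k z) ->
  \int[mu]_y (f y * k (x - y)) = 2^-1 * \int[mu]_z (Dq f x z * (z * k z)).
Proof.
move=> Lf Lk ok.
have k0 : k 0 = 0 by have := ok 0; rewrite oppr0; lra.
have Lkx : L2 (fun y => k (x - y)).
  split; first exact: measurable_refl_affine Lk.1.
  have := integr_affine x (@N1_neq0 R) Lk.2.
  by under eq_fun do rewrite mulN1r addrC.
have i := L2M Lf Lkx.
have E1 : \int[mu]_y (f y * k (x - y)) = \int[mu]_z (f (x - z) * k z).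
  rewrite (Int_affine x (@N1_neq0 R) i) normrN1 mul1r; apply: eq_Int => z.
  by rewrite mulN1r [- z + x]addrC subKr.
have E2 : \int[mu]_y (f y * k (x - y)) = \int[mu]_z (- (f (x + z) * k z)).
  rewrite (Int_affine x (oner_neq0 R) i) normr1 mul1r; apply: eq_Int => z.
  by rewrite mul1r [z + x]addrC (_ : x - (x + z) = - z) ?ok ?mulrN//; ring.
have i1 : integr (fun z => f (x - z) * k z).
  have := integr_affine x (@N1_neq0 R) i; apply: eq_integr => z.
  by rewrite mulN1r [- z + x]addrC subKr.
have i2 : integr (fun z => - (f (x + z) * k z)).
  have := integr_affine x (oner_neq0 R) i; apply: eq_integr => z.
  by rewrite mul1r [z + x]addrC (_ : x - (x + z) = - z) ?ok ?mulrN//; ring.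
have -> : \int[mu]_z (Dq f x z * (z * k z)) = \int[mu]_z (f (x - z) * k z + - (f (x + z) * k z)).
  apply: eq_Int => z; have [->|z0] := eqVneq z 0; first by rewrite k0 !mulr0 subr0.
  by rewrite /Dq mulrA divfK// mulrBl.
by rewrite (IntD i1 i2) -E1 -E2; field.
Qed.

Definition hilb f x : R := (2 * pi)^-1 * \int[mu]_z Dq f x z.

Lemma Dq_integr f df x : L2 f -> AC f df -> integr (Dq f x).
Proof.
move=> Lf Af; apply: le_integr (Dq_dom_integr df x Lf).1.
  exact: Dq_meas (AC_meas Af).
by move=> z; exact: Dq_le.
Qed.

Lemma Dq_bnd f df : L2 f -> AC f df -> exists C, forall x, \int[mu]_z `|Dq f x z| <= C.
Proof.
move=> Lf Af; exists (n2 df * Num.sqrt 2 * \int[mu]_z isq z + 2 * ip f f + 2 * pi) => x.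
have [i I] := Dq_dom_integr df x Lf; rewrite -I; apply: le_Int => //.
  by apply: integr_norm; exact: Dq_integr Lf Af.
by move=> z; exact: Dq_le.
Qed.

Definition kcut e z : R := z^-1 * (e < `|z|)%R%:R.

Lemma kcut_L2 e : 0 < e -> L2 (kcut e).
Proof.
move=> e0; have mk : measurable_fun setT (kcut e).
  apply: measurable_funM measurable_inv _.
  apply: (measurableT_comp (f := fun b : bool => b%:R : R)) => //.
  by apply: measurable_fun_ltr => //; exact: (continuous_measurable_fun (@norm_continuous _ _)).
split => //; apply: le_integr (integrZ ((1 + (e ^+ 2)^-1) / 2) (@pker_Int R).1).
  exact: measurable_funX.
move=> z; rewrite ger0_norm ?sqr_ge0// /kcut /pker.
have D : 0 < 1 + z ^+ 2 by rewrite ltr_pwDl ?sqr_ge0.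
have e2 : 0 < e ^+ 2 by rewrite exprn_gt0.
case: (ltP e `|z|) => ez; last first.
  rewrite mulr0 expr0n/=; apply: mulr_ge0; apply: divr_ge0 => //; last exact: ltW.
  by apply: addr_ge0 => //; rewrite invr_ge0 ltW.
rewrite mulr1 mulrA mulrVK ?unitfE// ler_pdivlMr// exprVn.
have z2 : e ^+ 2 <= z ^+ 2 by rewrite -[z ^+ 2]real_normK ?num_real// ler_pXn2r ?nnegrE// ltW.
have zp : 0 < z ^+ 2 by exact: lt_le_trans z2.
rewrite mulrDr mulr1 mulVf ?gt_eqF// addrC lerD2l lef_pV2 ?posrE//.
Qed.

Lemma kcut_odd e z : kcut e (- z) = - kcut e z.
Proof. by rewrite /kcut normrN invrN mulNr. Qed.

Lemma hilbert_cut f e x : 0 < e -> L2 f ->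
  \int[mu]_(y in [set y | e < `|x - y|]) (f y / (x - y)) =
  2^-1 * \int[mu]_z (Dq f x z * (z * kcut e z)).
Proof.
move=> e0 Lf; rewrite -(odd_conv x Lf (kcut_L2 e0) (kcut_odd e)) Rintegral_mkcond.
apply: eq_Int => y; rewrite patchE /kcut.
case: ifPn => [|/negP]; rewrite inE/= => H; first by rewrite H mulr1.
by rewrite (negbTE (introN idP H)) !mulr0.
Qed.

(** For nonzero [z] the factor [z * kcut e z] is the indicator of [e < |z|], so the truncated
    integrals are dominated by the integrable [Dq f x] and the principal value is its plain
    integral. *)
Lemma hilbertE f df : L2 f -> AC f df -> hilbert f = hilb f.
Proof.
move=> Lf Af; apply/funext => x; rewrite /hilbert /hilb.
suff C : (fun e : R => \int[mu]_(y in [set y | e < `|x - y|]) (f y / (x - y))) @ 0^'+ -->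
    2^-1 * \int[mu]_z Dq f x z.
  by rewrite (cvg_lim (@Rhausdorff R) C) mulrA -invfM [pi * 2]mulrC.
apply/cvg_at_rightP => u [u0 cu].
have -> : (fun n => \int[mu]_(y in [set y | u n < `|x - y|]) (f y / (x - y))) =
    (fun n => 2^-1 * \int[mu]_z (Dq f x z * (z * kcut (u n) z))).
  by apply/funext => n; exact: hilbert_cut.
apply: cvgM; first exact: cvg_cst.
have mD := Dq_meas x (AC_meas Af).
apply: (dct _ mD (integr_norm (Dq_integr x Lf Af)) _ _).2.
- move=> n; apply: measurable_funM => //; apply: measurable_funM => //.
  exact: L2_meas (kcut_L2 (u0 n)).
- apply: aeW => z; have [->|z0] := eqVneq z 0.
    by rewrite /Dq invr0 !mulr0; under eq_fun do rewrite mul0r; exact: cvg_cst.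
  apply: cvg_near_cst; move/cvgrPdist_lt: cu => /(_ `|z|); rewrite normr_gt0 => /(_ z0).
  apply: filterS => n; rewrite sub0r normrN gtr0_norm// => H.
  by rewrite /kcut H mulr1 divff// mulr1.
- move=> n z; rewrite normrM ler_piMr// /kcut; have [->|z0] := eqVneq z 0.
    by rewrite mul0r normr0.
  by case: (u n < _); rewrite ?mulr1 ?mulr0 ?normr0// divff// normr1.
Qed.

(** The conjugate Poisson integral times [2 * pi]. Unlike the truncated kernel it has an explicit
    symbol, the weight [ew e * sgw], and this is why the derivative is computed through it. *)
Definition conjP e f x : R := \int[mu]_y (f y * Qe e (x - y)).

Lemma Qe_odd e z : Qe e (- z) = - Qe e z.
Proof. by rewrite /Qe sqrrN mulrN mulNr. Qed.

Lemma Qe_L2 e : 0 < e -> L2 (@Qe R e).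
Proof.
move=> e0; have mq := continuous_measurable_fun (continuous_Qe e0); split => //.
have e1 : e != 0 by rewrite gt_eqF.
have iP : integr (Pe e).
  have := integr_affine 0 (invr_neq0 e1) (@pker_Int R).1 => /(integrZ e^-1).
  apply: eq_integr => z; rewrite addr0 /pker /Pe.
  have D : 1 + z ^+ 2 != 0 by rewrite gt_eqF// ltr_pwDl ?sqr_ge0.
  have D' : e ^+ 2 + z ^+ 2 != 0 by rewrite gt_eqF// PQ_denom.
  by field; rewrite e1 D'.
apply: le_integr (integrZ (2 / e) iP); first exact: measurable_funX.
move=> z; have D := PQ_denom z e0; rewrite ger0_norm ?sqr_ge0// /Qe /Pe.
have -> : 2 / e * (2 * e / (e ^+ 2 + z ^+ 2)) = 4 / (e ^+ 2 + z ^+ 2).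
  by field; rewrite e1 gt_eqF.
rewrite exprMn exprVn expr2 ler_pdivrMr ?mulr_gt0//.
have -> : 4 / (e ^+ 2 + z ^+ 2) * (e ^+ 2 + z ^+ 2) ^+ 2 = 4 * (e ^+ 2 + z ^+ 2).
  by field; exact: lt0r_neq0.
by have := sqr_ge0 e; lra.
Qed.

Lemma conjPE e f x : 0 < e -> L2 f -> conjP e f x = 2^-1 * \int[mu]_z (Dq f x z * (z * Qe e z)).
Proof. by move=> e0 Lf; rewrite /conjP (odd_conv x Lf (Qe_L2 e0) (Qe_odd e)). Qed.

Lemma zQe_bnd e z : 0 < e -> `|z * Qe e z| <= 2.
Proof.
move=> e0; have D := PQ_denom z e0; rewrite /Qe.
have -> : z * (2 * z / (e ^+ 2 + z ^+ 2)) = 2 * z ^+ 2 / (e ^+ 2 + z ^+ 2) by ring.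
have P : 0 <= 2 * z ^+ 2 / (e ^+ 2 + z ^+ 2).
  by apply: divr_ge0; [rewrite mulr_ge0 ?sqr_ge0|exact: ltW].
rewrite (ger0_norm P) ler_pdivrMr//.
by have := sqr_ge0 e; lra.
Qed.

Lemma conjP_meas e f : 0 < e -> L2 f -> measurable_fun setT (conjP e f).
Proof.
move=> e0 Lf; apply: (@measurable_Int1 R (fun z : RR * RR => f z.2 * Qe e (z.1 - z.2))).
apply: measurable_funM; first exact: (measurableT_comp Lf.1 measurable_snd).
apply: (measurableT_comp (continuous_measurable_fun (continuous_Qe e0))).
by apply: measurable_funB; [exact: measurable_fst|exact: measurable_snd].
Qed.

Lemma conjP_cvg f df x : L2 f -> AC f df -> conjP n.+1%:R^-1 f x @[n --> \oo] --> 2 * pi * hilb f x.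
Proof.
move=> Lf Af; rewrite /hilb mulrA mulfV ?mul1r; last by rewrite mulf_neq0// gt_eqF// pi_gt0.
pose e n : R := n.+1%:R^-1; have e0 n : 0 < e n by rewrite invr_gt0.
rewrite (_ : (fun n => _) = (fun n => \int[mu]_z (Dq f x z * (2^-1 * (z * Qe (e n) z))))); last first.
  apply/funext => n; rewrite (conjPE x (e0 n) Lf) -IntZ; first by apply: eq_Int => z; ring.
  apply: (integr_bndM (Dq_integr x Lf Af)) (fun z => zQe_bnd z (e0 n)).
  by apply: measurable_funM => //; exact: L2_meas (Qe_L2 (e0 n)).
have mD := Dq_meas x (AC_meas Af).
apply: (dct _ mD (integr_norm (Dq_integr x Lf Af)) _ _).2.
- move=> n; apply: measurable_funM => //; apply: measurable_funM => //; apply: measurable_funM => //.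
  exact: L2_meas (Qe_L2 (e0 n)).
- apply: aeW => z; have [->|z0] := eqVneq z 0.
    by rewrite /Dq invr0 !mulr0; under eq_fun do rewrite mul0r; exact: cvg_cst.
  rewrite -[X in _ --> X]mulr1; apply: cvgM; first exact: cvg_cst.
  have K : (e n) ^+ 2 + z ^+ 2 @[n --> \oo] --> 0 ^+ 2 + z ^+ 2.
    apply: cvgD; last exact: cvg_cst.
    by apply: (cvg_comp _ (fun y : R => y ^+ 2)); [exact: cvg_harmonic|exact: exprn_continuous].
  rewrite [X in _ --> X](_ : 1 = z ^+ 2 * (0 ^+ 2 + z ^+ 2)^-1); last first.
    by rewrite expr0n add0r mulfV// sqrf_eq0.
  have K2 : z ^+ 2 * (e n ^+ 2 + z ^+ 2)^-1 @[n --> \oo] --> z ^+ 2 * (0 ^+ 2 + z ^+ 2)^-1.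
    by apply: cvgM; [exact: cvg_cst|apply: cvgV K; rewrite expr0n add0r sqrf_eq0].
  rewrite [X in X @ _ --> _](_ : _ = (fun n => z ^+ 2 * (e n ^+ 2 + z ^+ 2)^-1))//.
  by apply/funext => n; rewrite /Qe; have := PQ_denom z (e0 n) => D; field; rewrite gt_eqF.
- move=> n z; rewrite normrM ler_piMr// normrM ger0_norm// -ler_pdivlMl// invrK mulr1.
  exact: zQe_bnd.
Qed.

Lemma conjP_bnd f df : L2 f -> AC f df -> exists C, forall e x, 0 < e -> `|conjP e f x| <= C.
Proof.
move=> Lf Af; have [C HC] := Dq_bnd Lf Af; exists C => e x e0.
rewrite (conjPE x e0 Lf) normrM ger0_norm// mulrC ler_pdivrMr//.
have i := Dq_integr x Lf Af.
have mQ : measurable_fun setT (fun z => z * Qe e z) by apply: measurable_funM => //; exact: L2_meas (Qe_L2 e0).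
have i1 := integr_bndM i mQ (fun z => zQe_bnd z e0).
apply: (le_trans (norm_Int i1)); rewrite (le_trans _ (ler_wpM2r _ (HC x)))//.
rewrite mulrC -IntZ; last exact: integr_norm.
apply: le_Int; [exact: integr_norm|by apply: integrZ; exact: integr_norm|move=> z].
by rewrite normrM mulrC ler_wpM2r// zQe_bnd.
Qed.

Lemma hilb_meas_bnd f df : L2 f -> AC f df ->
  measurable_fun setT (hilb f) /\ exists C, forall x, `|hilb f x| <= C.
Proof.
move=> Lf Af; split.
  have m2 : measurable_fun setT (fun x => 2 * pi * hilb f x).
    apply: (@measurable_fun_cvg _ _ R setT (fun n => conjP n.+1%:R^-1 f)).
      by move=> n; apply: conjP_meas => //; rewrite invr_gt0.
    by move=> x _; exact: conjP_cvg Lf Af.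
  rewrite (_ : hilb f = (fun x => (2 * pi)^-1 * (2 * pi * hilb f x))); first exact: measurable_funM.
  by apply/funext => x; rewrite mulrA mulVf ?mul1r// mulf_neq0// gt_eqF// pi_gt0.
have [C HC] := Dq_bnd Lf Af; exists ((2 * pi)^-1 * C) => x.
have p : 0 <= (2 * pi)^-1 :> R by rewrite invr_ge0 mulr_ge0// pi_ge0.
rewrite /hilb normrM (ger0_norm p) ler_wpM2l//.
by apply: le_trans (HC x); apply: norm_Int; exact: Dq_integr Lf Af.
Qed.

Lemma test_dintegr (phi : R -> R) : test_function phi -> integr (derive1 phi).
Proof.
move=> t; have [M [_ _ s]] := test_supp t; have [_ c _] := t.
have [C HC] := continuous_supp_bounded c s.
exact: bounded_supp_integr (continuous_measurable_fun c) s HC.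
Qed.

Lemma bounded_locint f C : measurable_fun setT f -> (forall x, `|f x| <= C) ->
  locally_integrable setT f.
Proof.
move=> mf fC; have [_ oT H] := @continuous_locint R (fun=> C) (fun x => cvg_cst _).
split => // K sK cK; apply: le_lt_trans (H K sK cK); apply: ge0_le_integral => //.
- exact: compact_measurable.
- by apply/measurable_EFinP; apply: measurableT_comp => //; exact: measurable_funTS.
- by move=> x _; rewrite lee_fin (le_trans (fC x))// ler_norm.
Qed.

Lemma conjP_fubini e f phi : 0 < e -> L2 f -> test_function phi ->
  \int[mu]_x (conjP e f x * derive1 phi x) =
  \int[mu]_y (f y * \int[mu]_x (derive1 phi x * Qe e (x - y))).
Proof.
move=> e0 Lf tp; have Ld := test_dL2 tp; have LQ := Qe_L2 e0.
have di := test_dintegr tp.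
pose F (z : RR * RR) : R := derive1 phi z.1 * (f z.2 * Qe e (z.1 - z.2)).
have mF : measurable_fun setT F.
  apply: measurable_funM; first exact: (measurableT_comp Ld.1 measurable_fst).
  apply: measurable_funM; first exact: (measurableT_comp Lf.1 measurable_snd).
  apply: (measurableT_comp (continuous_measurable_fun (continuous_Qe e0))).
  by apply: measurable_funB; [exact: measurable_fst|exact: measurable_snd].
have LQx x : L2 (fun y => Qe e (x - y)).
  split; first exact: measurable_refl_affine LQ.1.
  have := integr_affine x (@N1_neq0 R) LQ.2.
  by under eq_fun do rewrite mulN1r addrC.
have nQx x : n2 (fun y => Qe e (x - y)) = n2 (@Qe R e).
  congr Num.sqrt; rewrite /ip (Int_affine x (@N1_neq0 R) (L2M LQ LQ)) normrN1 mul1r.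
  by apply: eq_Int => y; rewrite mulN1r addrC.
have fin : (\int[mu]_x \int[mu]_y `|F (x, y)|%:E < +oo)%E.
  apply: (@le_lt_trans _ _ (\int[mu]_x (n2 f * n2 (@Qe R e) * `|derive1 phi x|)%:E)%E); last first.
    by rewrite EFin_Int ?ltry//; apply: integrZ; exact: integr_norm.
  apply: ge0_le_integral => //.
  - by move=> x _; apply: integral_ge0 => y _; rewrite lee_fin.
  - have := @measurable_fun_fubini_tonelli_F _ _ RR RR R mu (EFin \o (fun z : RR * RR => `|F z|)).
    apply; first by apply/measurable_EFinP; exact: measurableT_comp.
    by move=> z /=; rewrite lee_fin.
  - apply/measurable_EFinP; apply: measurable_funM => //.
    exact: (measurableT_comp _ Ld.1).
  move=> x _; have LfQ := L2M (L2_norm Lf) (L2_norm (LQx x)).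
  have E y : `|F (x, y)| = `|derive1 phi x| * (`|f y| * `|Qe e (x - y)|) by rewrite /F !normrM.
  under eq_integral do rewrite E.
  rewrite (EFin_Int (integrZ _ LfQ)) (IntZ _ LfQ) lee_fin mulrC ler_wpM2r//.
  have := ip_le (L2_norm Lf) (L2_norm (LQx x)).
  have nn (g : R -> R) : L2 g -> n2 (fun x => `|g x|) = n2 g.
    move=> Lg; congr Num.sqrt; apply: eq_Int => y.
    by rewrite -expr2 real_normK ?num_real// expr2.
  rewrite (nn f Lf) (nn _ (LQx x)) nQx; apply: le_trans; exact: ler_norm.
have [_ E] := Int_fubini mF fin.
transitivity (\int[mu]_x \int[mu]_y F (x, y)).
  apply: eq_Int => x; rewrite /F/= IntZ; last exact: L2M.
  by rewrite mulrC.
rewrite E; apply: eq_Int => y; rewrite -IntZ; first by apply: eq_Int => x; rewrite /F/=; ring.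
apply: (integr_bndM di) (fun x => Qe_bnd _ e0).
have := measurable_shift (- y) (continuous_measurable_fun (continuous_Qe e0)).
by under eq_fun do rewrite addrC.
Qed.

(** On the transform side the kernel is the weight [ew e * sgw], and differentiating the test
    function brings a factor [xi]; since [sgw xi * xi = |xi|], the product is the damped symbol of
    |D|. The reflections coming from the Hartley form are absorbed by a final substitution of [- xi]
    for [xi]. *)
Lemma conjP_spectral e f df phi : 0 < e -> L2 f -> AC f df -> test_function phi ->
  \int[mu]_x (conjP e f x * derive1 phi x) =
  - \int[mu]_xi (ew e xi * (`|xi| * T f xi * Ha phi xi)).
Proof.
move=> e0 Lf Af tp; have Ld := test_dL2 tp; have Lp := test_L2 tp; have LTf := T_L2 Lf.
have LX := T_absX_L2 Lf Af; have Lfr := refl_L2 Lf; have LTr := refl_L2 LTf.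
have di := test_dintegr tp.
have LH := (Plancherel_integr (test_integr tp) Lp).1.
have LHd := (Plancherel_integr di Ld).1.
pose m xi : R := ew e xi * sgw xi; have mi : integr m := sgew_integr e0.
have mm := integr_meas mi.
have mb xi : `|m xi| <= 1.
  rewrite /m normrM (ger0_norm (ew_ge0 _ _)) -[leRHS]mulr1 ler_pM ?ew_ge0//; last exact: sgw_bnd.
  by rewrite ew_le1// ltW.
have Lm : L2 (fun xi => m xi * Ha (derive1 phi) xi) by exact: L2_Ml mm mb LHd.
have Im : integr (fun xi => m xi * Ha (derive1 phi) xi).
  exact: (integr_bndM mi LHd.1 (fun xi => Ha_bnd xi di)).
have LHm := (Plancherel_integr Im Lm).1.
rewrite (conjP_fubini e0 Lf tp).
transitivity (ip f (refl (Ha (fun xi => m xi * Ha (derive1 phi) xi)))).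
  apply: eq_Int => y; congr (_ * _); rewrite /refl HaHa//; apply: eq_Int => x; congr (_ * _).
  by rewrite conj_Poisson_kernel// /Qe [- y + x]addrC.
rewrite -(ip_refl Lf LHm).
transitivity (ip (refl f) (T (fun xi => m xi * Ha (derive1 phi) xi))).
  apply: aeq_ip (aeq_refl _) (aeq_sym (T_Ha Im Lm)); try exact: L2_meas.
  exact: L2_meas (T_L2 Lm).
rewrite -(T_sym Lfr Lm).
have Ed : aeq (Ha (derive1 phi)) (fun xi => - xi * Ha phi (- xi)).
  have LTp := T_L2 Lp.
  apply: aeq_trans (aeq_sym (T_Ha di Ld)) _; apply: aeq_trans (T_derive Lp (test_AC tp)) _.
  apply: filterS (refl_aeq LTp LH (T_Ha (test_integr tp) Lp)) => x.
  by rewrite /refl => ->.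
have iR : integr (fun xi => ew e xi * (`|xi| * T f xi * Ha phi xi)).
  have eb (x : R) : `|ew e x| <= 1 by rewrite ger0_norm ?ew_ge0// ew_le1// ltW.
  by apply: eq_integr (integr_bndM (L2M LX LH) (measurable_ew e) eb) => x; rewrite mulrC.
rewrite -(IntN iR) (Int_affine 0 (@N1_neq0 R) (integrN iR)) normrN1 mul1r.
apply: aeq_Int.
- exact: integr_meas (L2M (T_L2 Lfr) Lm).
- have := integr_meas (integr_affine 0 (@N1_neq0 R) (integrN iR)); exact.
apply: filterS2 (T_refl Lf) Ed => x -> ->.
rewrite mulN1r addr0 /refl ew_even normrN /m -(sgwM x); ring.
Qed.

(** Both sides of [conjP_spectral] have a limit as the damping disappears: the left one by the
    uniform bound on [conjP], the right one by integrability of its undamped form. The Hilbert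
    transform enters only as a bounded measurable function, and its own transform is never
    formed. *)
Lemma hilb_weak f df : L2 f -> AC f df -> is_weak_derivative (hilb f) (Dabs f).
Proof.
move=> Lf Af; have LW := Dabs_L2 Lf Af; have [mh [C HC]] := hilb_meas_bnd Lf Af.
split; [exact: bounded_locint mh HC|exact: L2_locint|move=> phi tp].
have Lp := test_L2 tp; have Ld := test_dL2 tp; have LX := T_absX_L2 Lf Af.
have di := test_dintegr tp.
have LH := (Plancherel_integr (test_integr tp) Lp).1.
pose e n : R := n.+1%:R^-1; have e0 n : 0 < e n by rewrite invr_gt0.
have [C' HC'] := conjP_bnd Lf Af.
have pi0 : 2 * pi != 0 :> R by rewrite mulf_neq0// gt_eqF// pi_gt0.
have C1 : \int[mu]_x (conjP (e n) f x * derive1 phi x) @[n --> \oo] -->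
    \int[mu]_x (2 * pi * hilb f x * derive1 phi x).
  apply: (dct _ _ (integrZ C' (integr_norm di)) _ _).2.
  - by move=> n; apply: measurable_funM Ld.1; exact: conjP_meas.
  - by apply: measurable_funM Ld.1; exact: measurable_funM.
  - by apply: aeW => x; apply: cvgM; [exact: conjP_cvg Lf Af|exact: cvg_cst].
  - by move=> n x; rewrite normrM ler_wpM2r// HC'.
have iX := L2M LX LH.
have C2 : \int[mu]_xi (ew (e n) xi * (`|xi| * T f xi * Ha phi xi)) @[n --> \oo] -->
    \int[mu]_xi (`|xi| * T f xi * Ha phi xi).
  apply: (dct _ (integr_meas iX) (integr_norm iX) _ _).2.
  - by move=> n; apply: measurable_funM (integr_meas iX); exact: measurable_ew.
  - by apply: aeW => x; rewrite -[X in _ --> X]mul1r; apply: cvgM; [exact: ew_cvg|exact: cvg_cst].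
  - move=> n x; rewrite normrM ler_piMl// ger0_norm ?ew_ge0// ew_le1//; exact: ltW.
have C3 : \int[mu]_x (conjP (e n) f x * derive1 phi x) @[n --> \oo] -->
    - \int[mu]_xi (`|xi| * T f xi * Ha phi xi).
  rewrite (_ : (fun n => _) = (fun n => - \int[mu]_xi (ew (e n) xi * (`|xi| * T f xi * Ha phi xi)))).
    exact: cvgN.
  by apply/funext => n; exact: conjP_spectral Af tp.
have := cvg_lim (@Rhausdorff R) C1; rewrite (cvg_lim (@Rhausdorff R) C3) => /(_ _) E.
have ih : integr (fun x => hilb f x * derive1 phi x).
  by apply: eq_integr (integr_bndM di mh HC) => x; rewrite mulrC.
have E1 : \int[mu]_x (2 * pi * hilb f x * derive1 phi x) = 2 * pi * \int[mu]_x (hilb f x * derive1 phi x).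
  by rewrite -(IntZ _ ih); apply: eq_Int => x; rewrite mulrA.
have E2 : \int[mu]_xi (`|xi| * T f xi * Ha phi xi) = 2 * pi * ip (Dabs f) phi.
  rewrite (ip_Dabs Lf Af Lp) mulrA mulfV// mul1r.
  apply: aeq_ip (aeq_refl _) (aeq_sym (T_Ha (test_integr tp) Lp)); try exact: L2_meas.
  exact: L2_meas (T_L2 Lp).
apply: (mulfI pi0); rewrite -E1 -E E2 mulrN //.
Qed.

End Hilbert.

(** * Behaviour under affine substitutions *)

Section Affine.
Context {R : realType}.
Local Notation mu := (@lebesgue_measure R).
Local Notation RR := (measurableTypeR R).
Implicit Types (f g df dg h w phi : R -> R) (a b c e x y z xi : R).

Lemma aeq_continuous f g : continuous f -> continuous g -> aeq f g -> f = g.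
Proof.
move=> cf cg [N [mN N0 sub]]; apply/funext => x; apply/eqP; apply: contrapT => /negP neq.
have ch : continuous (fun y => `|f y - g y|).
  move=> y; apply: (cvg_comp (fun y => f y - g y) (fun y : R => `|y|)); last exact: norm_continuous.
  by apply: cvgB; [exact: cf|exact: cg].
have h0 : 0 < `|f x - g x| by rewrite normr_gt0 subr_eq0.
have /cvgrPdist_lt/(_ _ h0)[d /= d0 Hd] := ch x.
have sB : ball x d `<=` N.
  move=> y By; apply: sub => /= E; have := Hd y By.
  by rewrite /= E subrr normr0 subr0 normr_id ltxx.
have : (mu (ball x d) <= mu N)%E by apply: le_measure; rewrite ?inE//; exact: measurable_ball.
by rewrite N0 lebesgue_measure_ball ?(ltW d0)// lee_fin leNgt mulrn_wgt0.
Qed.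

Lemma aeq_comp_affine f g a b : a != 0 -> measurable_fun setT f -> measurable_fun setT g ->
  aeq f g -> aeq (fun x => f (a * x + b)) (fun x => g (a * x + b)).
Proof.
move=> a0 mf mg fg.
(* Truncating [|f - g|] at 1 and damping it by [ew 1] gives an L^2 function with the same zero set,
   to which the L^2 version applies. *)
pose d x := Num.min 1 `|f x - g x| * ew 1 x.
have m1 : measurable_fun setT (fun x => Num.min 1 `|f x - g x|).
  apply: measurable_minr => //.
  by apply: (measurableT_comp (continuous_measurable_fun (@norm_continuous _ _))); exact: measurable_funB.
have Lew : L2 (@ew R 1).
  split; first exact: measurable_ew.
  apply: le_integr (ew_integr (ltr01 : 0 < (1 : R))); first exact: measurable_funX (measurable_ew _).
  move=> x; rewrite ger0_norm ?sqr_ge0// expr2 ler_piMr ?ew_ge0// ew_le1//.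
have b1 x : `|Num.min 1 `|f x - g x| | <= 1.
  by rewrite ger0_norm ?ge_min ?lexx// le_min ler01 normr_ge0.
have Ld : L2 d by exact: L2_Ml m1 b1 Lew.
have d0 : aeq d (fun=> 0).
  apply: filterS fg => x E; rewrite /d E subrr normr0 (min_idPr _) ?mul0r//.
have := aeq_affine b a0 Ld (@L20 R) d0; apply: filterS => x /eqP.
rewrite /d mulf_eq0 [X in _ || X]gt_eqF ?expR_gt0// orbF => /eqP.
rewrite /Num.min; case: ifP => _ E; first by move: (oner_neq0 R); rewrite E eqxx.
by apply/eqP; rewrite -subr_eq0 -normr_eq0 E.
Qed.

Lemma L2_affine f a b : a != 0 -> L2 f -> L2 (fun x => f (a * x + b)).
Proof.
by move=> a0 [mf fi]; split; [exact: measurable_comp_affine|exact: (integr_affine b a0 fi)].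
Qed.

Lemma test_affine phi a b : a != 0 -> test_function phi ->
  test_function (fun x => phi (a * x + b)) /\
  derive1 (fun x => phi (a * x + b)) = (fun x => a * derive1 phi (a * x + b)).
Proof.
move=> a0 [dphi cphi [M HM]].
have L x : is_derive x (1 : R) (fun x : R => a * x + b) a.
  have -> : (fun x : R => a * x + b) = ((fun x => a * x) + cst b)%R by [].
  by apply: (is_derive_eq (is_deriveD (is_derive_lin a x) (is_derive_cst b x (1 : R)))); rewrite addr0.
have D x : is_derive x (1 : R) (fun x : R => phi (a * x + b)) (a * derive1 phi (a * x + b)).
  have d0 : is_derive (a * x + b) (1 : R) phi (derive1 phi (a * x + b)).
    by rewrite derive1E; apply/derivableP; exact: dphi.
  have d := @is_derive1_comp _ phi (fun x : R => a * x + b) x _ _ d0 (L x).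
  by apply: (is_derive_eq d); rewrite mulrC.
have E : derive1 (fun x => phi (a * x + b)) = (fun x => a * derive1 phi (a * x + b)).
  by apply/funext => x; rewrite derive1E (@derive_val _ _ _ _ _ _ _ (D x)).
split; last exact: E.
split=> [x||]; first exact: (@ex_derive _ _ _ _ _ _ _ (D x)).
  rewrite E => x; apply: cvgM; first exact: cvg_cst.
  apply: (cvg_comp (fun x : R => a * x + b) (derive1 phi)); last exact: cphi.
  by apply: cvgD; [exact: continuous_lin|exact: cvg_cst].
exists ((`|M| + `|b|) / `|a|) => x; rewrite ler_pdivrMr ?normr_gt0// => H; apply: HM.
have := ler_normB (a * x + b) b; rewrite addrK normrM mulrC => H'.
by have := ler_norm M; move: H H'; move: (`|x| * `|a|) => t; lra.
Qed.

Lemma weak_affine h w c b : 0 < c -> is_weak_derivative h w ->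
  locally_integrable setT (fun x => h (c * x + b)) ->
  locally_integrable setT (fun x => c * w (c * x + b)) ->
  is_weak_derivative (fun x => h (c * x + b)) (fun x => c * w (c * x + b)).
Proof.
move=> c0 [lh lw H] lh' lw'; split => // phi tp.
have c1 : c != 0 by rewrite gt_eqF.
have [tq Eq] := test_affine (- (b / c)) (invr_neq0 c1) tp.
have X x : c^-1 * (c * x + b) + - (b / c) = x by field.
have := H _ tq; rewrite Eq.
have i1 := test_locint_dmul lh tq; rewrite Eq in i1; have i2 := test_locint_mul lw tq.
rewrite (Int_affine b c1 i1) (Int_affine b c1 i2) gtr0_norm// -!IntZ.
- under eq_Int do rewrite X mulrCA (mulrA c) mulfV// mul1r.
  under [X in - X]eq_Int do rewrite X mulrA.
  by [].
- exact: (integr_affine b c1 i2).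
- exact: (integr_affine b c1 i1).
Qed.

Lemma hilb_affine f df c b x : 0 < c -> L2 f -> AC f df ->
  hilb (fun x => f (c * x + b)) x = hilb f (c * x + b).
Proof.
move=> c0 Lf Af; have c1 : c != 0 by rewrite gt_eqF.
have i := Dq_integr (c * x + b) Lf Af.
rewrite /hilb; congr (_ * _); rewrite [RHS](Int_affine 0 c1 i) gtr0_norm// -(IntZ _ (integr_affine 0 c1 i)).
apply: eq_Int => z; rewrite /Dq addr0.
have -> : c * (x - z) + b = c * x + b - c * z by ring.
have -> : c * (x + z) + b = c * x + b + c * z by ring.
by rewrite mulrCA invfM mulVKf.
Qed.

(** Obtained on the physical side: [hilb] visibly commutes with dilations and translations, its weak
    derivative scales by the chain rule, and weak derivatives are unique. No scaling law for [T]
    enters. *)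
Lemma Dabs_affine f df c b : 0 < c -> L2 f -> AC f df ->
  aeq (Dabs (fun x => f (c * x + b))) (fun x => c * Dabs f (c * x + b)).
Proof.
move=> c0 Lf Af; have c1 : c != 0 by rewrite gt_eqF.
have LfA := L2_affine b c1 Lf; have AfA := AC_affine b c0 Af.
have LD := L2Z c (L2_affine b c1 (Dabs_L2 Lf Af)).
have [mh [C HC]] := hilb_meas_bnd Lf Af.
have E : hilb (fun x => f (c * x + b)) = (fun x => hilb f (c * x + b)).
  by apply/funext => x; exact: hilb_affine c0 Lf Af.
have W := hilb_weak LfA AfA; rewrite E in W.
apply: weak_unique W _; apply: weak_affine => //; first exact: hilb_weak Lf Af.
  by apply: (bounded_locint (C := C)) => [|x]; [exact: measurable_comp_affine|exact: HC].
exact: L2_locint.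
Qed.

Lemma ip_Dabs_affine f df c b : 0 < c -> L2 f -> AC f df ->
  ip (Dabs (fun x => f (c * x + b))) (fun x => f (c * x + b)) = ip (Dabs f) f.
Proof.
move=> c0 Lf Af; have c1 : c != 0 by rewrite gt_eqF.
have LfA := L2_affine b c1 Lf; have AfA := AC_affine b c0 Af.
have LD := Dabs_L2 Lf Af; have LDA := L2_affine b c1 LD.
transitivity (ip (fun x => c * Dabs f (c * x + b)) (fun x => f (c * x + b))).
  apply: aeq_ip (Dabs_affine b c0 Lf Af) (aeq_refl _); try exact: L2_meas.
    exact: L2_meas (Dabs_L2 LfA AfA).
  exact: L2_meas (L2Z c LDA).
rewrite (ipZl _ LDA LfA) [RHS](Int_affine b c1 (L2M LD Lf)) gtr0_norm//.
Qed.

End Affine.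

(** * The variational functional *)

Section Profiles.
Context {R : realType}.
Local Notation mu := (@lebesgue_measure R).
Local Notation RR := (measurableTypeR R).
Implicit Types (f g df dg h : R -> R) (a b c e t x y z l B gamma q I : R).

(* Real and imaginary parts of a continuous representative, with their
   derivatives. *)
Record profile := Profile { re : R -> R; im : R -> R; dre : R -> R; dim : R -> R }.

Implicit Types p : profile.

Definition rho p x : R := re p x ^+ 2 + im p x ^+ 2.

Definition drho p x : R := 2 * (re p x * dre p x + im p x * dim p x).

Definition inX p := [/\ AC (re p) (dre p), AC (im p) (dim p) & L2 (rho p)].

Definition kin p : R := ip (dre p) (dre p) + ip (dim p) (dim p).

Definition cub p : R := \int[mu]_x (rho p x ^+ 3).

Definition nl p : R := ip (Dabs (rho p)) (rho p).

Definition en B gamma p : R := 2^-1 * kin p + B / 6 * cub p + gamma / 4 * nl p.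

Definition ch p : R := 4^-1 * ip (rho p) (rho p).

Lemma rho_ge0 p x : 0 <= rho p x. Proof. by rewrite addr_ge0 ?sqr_ge0. Qed.

Lemma kin_ge0 p : 0 <= kin p. Proof. by rewrite addr_ge0 ?ip_ge0. Qed.

Lemma ch_ge0 p : 0 <= ch p. Proof. by rewrite mulr_ge0 ?ip_ge0. Qed.

(** Average over [t] in []x, x + l]] of a fourth-power form of Hölder continuity. The length [l]
    stays free: a small [l] makes the share of the kinetic energy small, as [coercive] requires, and
    [l = 1] gives the plain bound [supb]. *)
Lemma rho_sup p l x : inX p -> 0 < l ->
  l * rho p x ^+ 2 <= 16 * ip (rho p) (rho p) + 16 * l ^+ 3 * kin p ^+ 2.
Proof.
move=> [Au Av Lr] l0; have K0 := kin_ge0 p.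
have pt t : x < t <= x + l -> rho p x ^+ 2 <= 16 * (rho p t * rho p t) + 16 * l ^+ 2 * kin p ^+ 2.
  case/andP=> t1 t2.
  have hold f df : AC f df -> f x ^+ 4 <= 8 * f t ^+ 4 + 8 * (l ^+ 2 * ip df df ^+ 2).
    move=> A; have H : (f x - f t) ^+ 2 <= l * ip df df.
      have := AC_holder t x A; rewrite -n2_sqr => H.
      rewrite -[(f x - f t) ^+ 2]real_normK ?num_real//.
      apply: (@le_trans _ _ ((n2 df * Num.sqrt `|x - t|) ^+ 2)).
        by rewrite ler_pXn2r ?nnegrE ?mulr_ge0 ?n2_ge0 ?sqrtr_ge0.
      rewrite exprMn (sqr_sqrtr (normr_ge0 (x - t))) [l * _]mulrC ler_wpM2l ?sqr_ge0//.
      by rewrite ler0_norm; lra.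
    have N0 := ip_ge0 df.
    have H2 : (f x - f t) ^+ 4 <= l ^+ 2 * ip df df ^+ 2.
      rewrite -exprMn -[4%N]/(2 * 2)%N exprM ler_pXn2r ?nnegrE ?sqr_ge0//.
      by rewrite mulr_ge0// ltW.
    apply: (@le_trans _ _ (8 * f t ^+ 4 + 8 * (f x - f t) ^+ 4)); last by lra.
    move: (f x) (f t) => X Y.
    have := sqr_ge0 (X - 2 * Y); have := sqr_ge0 (X ^+ 2 - 2 * X * Y) => S1 S2.
    (* Convexity of the fourth power, with equality at [X = 2 * Y]: the double root factors out and
       leaves a positive definite quadratic form. *)
    have : 8 * Y ^+ 4 + 8 * (X - Y) ^+ 4 - X ^+ 4 = (X - 2 * Y) ^+ 2 * (7 * X ^+ 2 - 4 * X * Y + 4 * Y ^+ 2) by ring.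
    have : 0 <= (X - 2 * Y) ^+ 2 * (7 * X ^+ 2 - 4 * X * Y + 4 * Y ^+ 2).
      by apply: mulr_ge0 => //; have := sqr_ge0 (X - 2 * Y); have := sqr_ge0 X; nra.
    lra.
  have Hu := hold _ _ Au; have Hv := hold _ _ Av.
  have k1 := ip_ge0 (dre p); have k2 := ip_ge0 (dim p).
  have l2 : 0 <= l ^+ 2 by rewrite sqr_ge0.
  rewrite /rho; set X := re p x in Hu *; set Y := im p x in Hv *.
  set A := re p t in Hu *; set C := im p t in Hv *.
  have e1 : (X ^+ 2 + Y ^+ 2) ^+ 2 <= 2 * (X ^+ 4 + Y ^+ 4).
    have := sqr_ge0 (X ^+ 2 - Y ^+ 2); lra.
  have e2 : A ^+ 4 + C ^+ 4 <= (A ^+ 2 + C ^+ 2) * (A ^+ 2 + C ^+ 2).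
    have : 0 <= A ^+ 2 * C ^+ 2 by rewrite mulr_ge0 ?sqr_ge0.
    lra.
  have e3 : l ^+ 2 * ip (dre p) (dre p) ^+ 2 + l ^+ 2 * ip (dim p) (dim p) ^+ 2 <= l ^+ 2 * kin p ^+ 2.
    rewrite -mulrDr ler_wpM2l// /kin; move: (ip (dre p) _) (ip (dim p) _) k1 k2 => a b a0 b0.
    have : 0 <= a * b by rewrite mulr_ge0.
    lra.
  lra.
have -> : l * rho p x ^+ 2 = \int[mu]_t (rho p x ^+ 2 * chi x (x + l) t).
  by rewrite IntZ ?Int_chi; [ring|exact: integr_chi].
have xl : x <= x + l by rewrite lerDl ltW.
have i1 : integr (fun t => 16 * (rho p t * rho p t)) by apply: integrZ; exact: L2M.
have i2 : integr (fun t => 16 * l ^+ 2 * kin p ^+ 2 * chi x (x + l) t) by apply: integrZ; exact: integr_chi.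
apply: (@le_trans _ _ (\int[mu]_t (16 * (rho p t * rho p t) + 16 * l ^+ 2 * kin p ^+ 2 * chi x (x + l) t))).
  apply: le_Int; [by apply: integrZ; exact: integr_chi|exact: integrD|move=> t].
  case: (boolP (x < t <= x + l)) => tx; last first.
    rewrite chi_out// !mulr0 addr0.
    by rewrite mulr_ge0// -expr2 sqr_ge0.
  by rewrite chi_in// !mulr1; exact: pt.
rewrite (IntD i1 i2) (IntZ _ (L2M Lr Lr)) (IntZ _ (integr_chi _ _)) Int_chi.
by rewrite le_eqVlt; apply/orP; left; apply/eqP; rewrite /ip; ring.
Qed.

Lemma rho_sup_lin p l x : inX p -> 0 < l ->
  rho p x <= 4 * n2 (rho p) / Num.sqrt l + 4 * l * kin p.
Proof.
move=> Xp l0; have H := rho_sup x Xp l0; have K0 := kin_ge0 p; have N0 := n2_ge0 (rho p).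
have s0 : 0 < Num.sqrt l by rewrite sqrtr_gt0.
have Q0 : 0 <= 4 * n2 (rho p) / Num.sqrt l by rewrite divr_ge0 ?mulr_ge0// ltW.
have P0 : 0 <= 4 * l * kin p by rewrite !mulr_ge0// ltW.
rewrite -(@ler_pXn2r _ 2)// ?nnegrE ?rho_ge0 ?addr_ge0// -(ler_pM2l l0) (le_trans H)//.
rewrite -n2_sqr.
have E : l * (4 * n2 (rho p) / Num.sqrt l) ^+ 2 = 16 * n2 (rho p) ^+ 2.
  by rewrite exprMn exprVn sqr_sqrtr ?(ltW l0)// mulrCA mulfV ?gt_eqF// mulr1; ring.
have E2 : l * (4 * l * kin p) ^+ 2 = 16 * l ^+ 3 * kin p ^+ 2 by ring.
rewrite -E -E2; move: (4 * n2 _ / _) (4 * l * kin p) Q0 P0 => a b a0 b0.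
have : 0 <= l * (a * b) by rewrite !mulr_ge0// ltW.
have -> : l * (a + b) ^+ 2 = l * a ^+ 2 + l * b ^+ 2 + 2 * (l * (a * b)) by ring.
lra.
Qed.

Definition supb p : R := 4 * n2 (rho p) + 4 * kin p.

Lemma supb_ge0 p : 0 <= supb p.
Proof. by rewrite addr_ge0// mulr_ge0 ?n2_ge0 ?kin_ge0. Qed.

Lemma rho_bnd p x : inX p -> rho p x <= supb p.
Proof. by move=> Xp; have := rho_sup_lin x Xp ltr01; rewrite sqrtr1 divr1 mulr1. Qed.

Lemma re_bnd p x : inX p -> `|re p x| <= Num.sqrt (supb p).
Proof.
move=> Xp; rewrite -sqrtr_sqr ler_wsqrtr// (le_trans _ (rho_bnd x Xp))//.
by rewrite lerDl sqr_ge0.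
Qed.

Lemma im_bnd p x : inX p -> `|im p x| <= Num.sqrt (supb p).
Proof.
move=> Xp; rewrite -sqrtr_sqr ler_wsqrtr// (le_trans _ (rho_bnd x Xp))//.
by rewrite lerDr sqr_ge0.
Qed.

Lemma n2_dre p : n2 (dre p) <= Num.sqrt (kin p).
Proof. by apply: ler_wsqrtr; rewrite lerDl ip_ge0. Qed.

Lemma n2_dim p : n2 (dim p) <= Num.sqrt (kin p).
Proof. by apply: ler_wsqrtr; rewrite lerDr ip_ge0. Qed.

Lemma n2_Ml h f c : measurable_fun setT h -> (forall x, `|h x| <= c) -> L2 f ->
  n2 (fun x => h x * f x) <= c * n2 f.
Proof.
move=> mh hc Lf; have c0 : 0 <= c := le_trans (normr_ge0 _) (hc 0).
rewrite -[X in X * _](ger0_norm c0) -n2Z//; apply: n2_le; [exact: L2_Ml mh hc Lf|exact: L2Z|].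
by move=> x; rewrite !normrM ler_wpM2r// (ger0_norm c0).
Qed.

Lemma AC_rho p : inX p -> AC (rho p) (drho p).
Proof.
move=> Xp; have [Au Av Lr] := Xp.
have bu x := re_bnd x Xp; have bv x := im_bnd x Xp.
apply: eq_AC (ACD (ACM Au Au bu bu) (ACM Av Av bv bv)) => x; rewrite /rho /drho ?expr2//.
by ring.
Qed.

Lemma n2_drho p : inX p -> n2 (drho p) <= 4 * Num.sqrt (supb p) * Num.sqrt (kin p).
Proof.
move=> Xp; have [Au Av Lr] := Xp.
have bu x := re_bnd x Xp; have bv x := im_bnd x Xp.
have mu_ := AC_meas Au; have mv_ := AC_meas Av.
have L1 := L2_Ml mu_ bu Au.1; have L3 := L2_Ml mv_ bv Av.1.
rewrite /drho (n2Z 2 (L2D L1 L3)) ger0_norm//.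
have := n2D L1 L3; have := n2_Ml mu_ bu Au.1; have := n2_Ml mv_ bv Av.1.
have S0 := sqrtr_ge0 (supb p).
have := ler_wpM2l S0 (n2_dre p); have := ler_wpM2l S0 (n2_dim p).
set A := n2 (fun x => re p x * _ x + _); lra.
Qed.

Lemma rho3_integr p : inX p -> integr (fun x => rho p x ^+ 3).
Proof.
move=> Xp; have [Au Av Lr] := Xp.
apply: le_integr (integrZ (supb p) Lr.2); first exact: measurable_funX Lr.1.
move=> x; rewrite ger0_norm ?exprn_ge0 ?rho_ge0// exprS ler_wpM2r ?sqr_ge0//.
exact: rho_bnd.
Qed.

Lemma cub_ge0 p : 0 <= cub p.
Proof. by apply: Int_ge0 => x; rewrite exprn_ge0 ?rho_ge0. Qed.

Lemma cub_le p c : inX p -> (forall x, rho p x <= c) -> cub p <= c * (4 * ch p).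
Proof.
move=> Xp H; have [_ _ Lr] := Xp; rewrite /ch mulVKf// -(IntZ _ (L2M Lr Lr)).
apply: le_Int; [exact: rho3_integr|by apply: integrZ; exact: L2M|move=> x].
by rewrite exprS expr2 ler_wpM2r// mulr_ge0 ?rho_ge0.
Qed.

Lemma nl_ge0 p : inX p -> 0 <= nl p.
Proof. by move=> Xp; have [_ _ Lr] := Xp; exact: Dabs_ge0 Lr (AC_rho Xp). Qed.

Lemma n2_rho_ch p : n2 (rho p) = Num.sqrt (4 * ch p).
Proof. by rewrite /n2 /ch mulrA mulfV// mul1r. Qed.

Lemma coercive B gamma q : B < 0 -> 0 <= gamma -> 0 < q ->
  exists C : R, forall p, inX p -> ch p = q -> kin p <= 3 * (en B gamma p + C).
Proof.
(* With this [l] the sextic term costs at most [kin p / 6] besides a constant. One third of the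
   kinetic energy is left, hence the factor 3. *)
move=> B0 g0 q0; pose l := (16 * - B * q)^-1.
have l0 : 0 < l by rewrite invr_gt0 mulr_gt0// mulr_gt0// oppr_gt0.
pose S := 4 * Num.sqrt (4 * q) / Num.sqrt l.
exists (- B / 6 * (S * (4 * q))) => p Xp Q.
have H := cub_le Xp (fun x => rho_sup_lin x Xp l0).
rewrite n2_rho_ch Q -/S in H; have N0 := nl_ge0 Xp; have K0 := kin_ge0 p.
have B6 : 0 <= - B / 6 by rewrite divr_ge0// oppr_ge0 ltW.
have H2 := ler_wpM2l B6 H.
have E : - B / 6 * ((S + 4 * l * kin p) * (4 * q)) = - B / 6 * (S * (4 * q)) + kin p / 6.
  by rewrite /l; field; rewrite (ltr0_neq0 B0) (lt0r_neq0 q0).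
rewrite E in H2.
have g4 : 0 <= gamma / 4 * nl p by rewrite mulr_ge0// divr_ge0.
rewrite /en; move: H2 g4; rewrite !mulNr; move: (gamma / 4 * _) (B / 6 * _) (B / 6 * _) => ? ? ?; lra.
Qed.

(** Amplitude, dilation and translation in one family: the charge-changing scaling is [t = sqrt s],
    [c = s], and the pure dilation of [negative_energy] and the translations [ptau] are the other
    instances. *)
Definition paff t c b p := Profile
  (fun x => t * re p (c * x + b)) (fun x => t * im p (c * x + b))
  (fun x => t * (c * dre p (c * x + b))) (fun x => t * (c * dim p (c * x + b))).

Lemma rho_paff t c b p x : rho (paff t c b p) x = t ^+ 2 * rho p (c * x + b).
Proof. by rewrite /rho/= !exprMn -mulrDr. Qed.

Lemma Dabs_scale k f df : L2 f -> AC f df ->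
  ip (Dabs (fun x => k * f x)) (fun x => k * f x) = k ^+ 2 * ip (Dabs f) f.
Proof.
move=> Lf Af; have Lk := L2Z k Lf.
have L0 := @L20 R; have A0 := @AC_cst R 0.
have E : (fun x => k * f x) = (fun x => k * f x + (fun=> 0) x) by apply/funext => x; rewrite addr0.
have E0 h : L2 h -> ip (Dabs (fun=> 0 : R)) h = 0.
  move=> Lh; have H := Dabs_lin (-1) L0 A0 L0 A0 Lh.
  by move: H; rewrite (_ : (fun x => _) = (fun=> 0 : R)); [lra|apply/funext => x; ring].
rewrite {1}E (Dabs_lin k Lf Af L0 A0 Lk) (E0 _ Lk) (ipZr k Lf (Dabs_L2 Lf Af)); ring.
Qed.

Lemma paffP t c b p : 0 < c -> inX p ->
  [/\ inX (paff t c b p), kin (paff t c b p) = t ^+ 2 * c * kin p,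
   cub (paff t c b p) = t ^+ 6 / c * cub p, nl (paff t c b p) = t ^+ 4 * nl p &
   ch (paff t c b p) = t ^+ 4 / c * ch p].
Proof.
move=> c0 Xp; have [Au Av Lr] := Xp; have c1 : c != 0 by rewrite gt_eqF.
have Er : rho (paff t c b p) = (fun x => t ^+ 2 * rho p (c * x + b)).
  by apply/funext => x; rewrite rho_paff.
have LrA := L2_affine b c1 Lr; have ArA := AC_affine b c0 (AC_rho Xp).
split.
- split; [exact: (ACZ t (AC_affine b c0 Au))|exact: (ACZ t (AC_affine b c0 Av))|].
  by rewrite Er; exact: L2Z.
- have K f : L2 f -> ip (fun x => t * (c * f (c * x + b))) (fun x => t * (c * f (c * x + b))) = t ^+ 2 * c * ip f f.
    move=> Lf; rewrite {2}/ip (Int_affine b c1 (L2M Lf Lf)) gtr0_norm//.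
    rewrite mulrA -(IntZ _ (integr_affine b c1 (L2M Lf Lf))).
    by apply: eq_Int => x; ring.
  by rewrite /kin /= (K _ Au.1) (K _ Av.1) -mulrDr.
- rewrite /cub Er (Int_affine b c1 (rho3_integr Xp)) gtr0_norm// mulrA divfK//.
  rewrite -(IntZ _ (integr_affine b c1 (rho3_integr Xp))).
  by apply: eq_Int => x; ring.
- rewrite /nl Er (Dabs_scale (t ^+ 2) LrA ArA) (ip_Dabs_affine b c0 Lr (AC_rho Xp)).
  by rewrite -exprM.
- rewrite /ch Er {2}/ip (Int_affine b c1 (L2M Lr Lr)) gtr0_norm// mulrCA; congr (_ * _).
  rewrite mulrA divfK// -(IntZ _ (integr_affine b c1 (L2M Lr Lr))).
  by apply: eq_Int => x; ring.
Qed.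

Lemma ch_eq0 p : inX p -> ch p = 0 -> forall x, rho p x = 0.
Proof.
move=> Xp c0 x; have [_ _ Lr] := Xp.
suff -> : rho p = (fun=> 0) by [].
apply: aeq_continuous; [exact: AC_continuous (AC_rho Xp)|by move=> ?; exact: cvg_cst|].
apply: n2_eq0 => //; rewrite n2_rho_ch c0 mulr0 sqrtr0//.
Qed.

Lemma en_lower B gamma q I : 0 < q -> 0 <= gamma ->
  (forall p, inX p -> ch p = q -> I <= en B gamma p) ->
  forall p, inX p -> I / q ^+ 2 * ch p ^+ 2 <= en B gamma p.
Proof.
(* A profile of zero charge cannot be rescaled to charge [q]; there the sextic term vanishes and the
   energy is nonnegative. *)
move=> q0 g0 HI p Xp; have [Q|Q] := eqVneq (ch p) 0.
  rewrite Q expr0n mulr0 /en.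
  have -> : cub p = 0.
    have E : rho p = (fun=> 0) by apply/funext => x; exact: ch_eq0.
    by rewrite /cub; under eq_Int do rewrite (ch_eq0 Xp Q) expr0n; exact: Int0.
  rewrite mulr0 addr0 addr_ge0// mulr_ge0 ?kin_ge0 ?nl_ge0//.
  by rewrite divr_ge0.
have Q0 : 0 < ch p by rewrite lt_def Q ch_ge0.
pose s := q / ch p; have s0 : 0 < s by rewrite divr_gt0.
have [X' K' C' N' Q'] := paffP (Num.sqrt s) 0 s0 Xp.
have t2 : Num.sqrt s ^+ 2 = s by rewrite sqr_sqrtr ?(ltW s0).
have t4 : Num.sqrt s ^+ 4 = s ^+ 2 by rewrite -[4%N]/(2 * 2)%N exprM t2.
have t6 : Num.sqrt s ^+ 6 = s ^+ 3 by rewrite -[6%N]/(2 * 3)%N exprM t2.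
have s1 : s != 0 by rewrite gt_eqF.
have Eq : ch (paff (Num.sqrt s) s 0 p) = q.
  by rewrite Q' t4 /s; field; rewrite Q !gt_eqF.
have := HI _ X' Eq.
have -> : en B gamma (paff (Num.sqrt s) s 0 p) = s ^+ 2 * en B gamma p.
  by rewrite /en K' C' N' t2 t4 t6; field.
move=> H; rewrite -(ler_pM2l (exprn_gt0 2 s0)); apply: le_trans H.
by rewrite /s le_eqVlt; apply/orP; left; apply/eqP; field; rewrite Q gt_eqF.
Qed.

Lemma negative_energy B gamma q : B < 0 -> 0 < q ->
  exists p, [/\ inX p, ch p = q & en B gamma p < 0].
Proof.
move=> B0 q0; have t1 := eta_test (0 : R) ltr01; pose p0 := Profile (eta 0 1) (fun=> 0) (derive1 (eta 0 1)) (fun=> 0).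
have X0 : inX p0.
  split; [exact: test_AC|exact: AC_cst|].
  have b1 x : `|@eta R 0 1 x| <= 1 by rewrite ger0_norm ?eta_ge0// eta_le1.
  have Le := test_L2 t1; have := L2_Ml Le.1 b1 Le.
  by congr L2; apply/funext => x; rewrite /rho/= expr0n addr0 expr2.
have r1 x : `|x| <= 2^-1 -> 4^-1 <= rho p0 x.
  move=> hx; have : 2^-1 <= eta (0 : R) 1 x by apply: eta_in => //; rewrite subr0 div1r.
  by rewrite /rho/= expr0n addr0; nra.
have Q0 : 0 < ch p0.
  rewrite lt_def ch_ge0 andbT; apply/negP => /eqP Q.
  have := r1 0; rewrite (ch_eq0 X0 Q) normr0 => /(_ _); lra.
have C0 : 0 < cub p0.
  rewrite lt_def cub_ge0 andbT; apply/negP => /eqP C.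
  have : aeq (fun x => rho p0 x ^+ 3) (fun=> 0).
    by apply: Int_eq0 C => [|x]; [exact: rho3_integr|rewrite exprn_ge0 ?rho_ge0].
  move=> /aeq_continuous => /(_ _ _)/(congr1 (fun f => f 0)).
  have : 4^-1 <= rho p0 0 by apply: r1; rewrite normr0.
  move=> H E; have : rho p0 0 ^+ 3 = 0.
    apply: E; last by move=> ?; exact: cvg_cst.
    move=> x; apply: (cvg_comp (rho p0) (fun y : R => y ^+ 3)); last exact: exprn_continuous.
    exact: (AC_continuous (AC_rho X0)).
  by move/eqP; rewrite expf_eq0/= => /eqP E0; move: H; rewrite E0; lra.
(* Spreading the bump by the factor [L] divides the kinetic term by [L], multiplies the negative
   sextic term by [L] and keeps the nonlocal one. The witness makes the sextic term equal to
   [-(k + D)], where [D] bounds the two others for [L >= 1]. *)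
have [L L0 HL] : exists2 L : R, 0 < L & 2^-1 * (kin p0 / L) + B / 6 * (cub p0 * L) + gamma / 4 * nl p0 < 0.
  pose k := - B / 6 * cub p0; have k0 : 0 < k by rewrite mulr_gt0// divr_gt0// oppr_gt0.
  pose D := kin p0 + `|gamma / 4 * nl p0|.
  have D0 : 0 <= D by rewrite addr_ge0 ?kin_ge0.
  exists (1 + D / k); first by rewrite ltr_wpDr ?divr_ge0// ltW.
  set L := 1 + D / k; have L1 : 1 <= L by rewrite lerDl divr_ge0// ltW.
  have kL : kin p0 / L <= kin p0 by rewrite ler_pdivrMr ?(lt_le_trans ltr01)// ler_peMr ?kin_ge0.
  have -> : B / 6 * (cub p0 * L) = - (k + D) by rewrite /L /k; field; rewrite (ltr0_neq0 B0) (lt0r_neq0 C0).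
  have := ler_norm (gamma / 4 * nl p0); have := kin_ge0 p0; rewrite /D; lra.
have Li : 0 < L^-1 by rewrite invr_gt0.
have [X1 K1 C1 N1 Q1] := paffP 1 0 Li X0; set p1 := paff 1 L^-1 0 p0 in X1 K1 C1 N1 Q1 *.
have E1 : en B gamma p1 < 0.
  by rewrite /en K1 C1 N1 !expr1n !mul1r invrK [_^-1 * kin _]mulrC [L * _]mulrC.
have Q1p : 0 < ch p1 by rewrite Q1 expr1n div1r invrK mulr_gt0.
(* Adjusting the charge to [q] multiplies the energy by [s^2], so its sign is kept. *)
pose s := q / ch p1; have s0 : 0 < s by rewrite divr_gt0.
have [X' K' C' N' Q'] := paffP (Num.sqrt s) 0 s0 X1.
have t2 : Num.sqrt s ^+ 2 = s by rewrite sqr_sqrtr ?(ltW s0).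
have t4 : Num.sqrt s ^+ 4 = s ^+ 2 by rewrite -[4%N]/(2 * 2)%N exprM t2.
have t6 : Num.sqrt s ^+ 6 = s ^+ 3 by rewrite -[6%N]/(2 * 3)%N exprM t2.
have s1 : s != 0 by rewrite gt_eqF.
exists (paff (Num.sqrt s) s 0 p1); split => //.
  by rewrite Q' t4 /s; field; rewrite !gt_eqF.
rewrite (_ : en _ _ _ = s ^+ 2 * en B gamma p1); first by rewrite pmulr_rlt0// exprn_gt0.
by rewrite /en K' C' N' t2 t4 t6; field.
Qed.

End Profiles.

(** * First variation and the Euler-Lagrange identity *)

Section Expansion.
Context {R : realType}.
Local Notation mu := (@lebesgue_measure R).
Local Notation RR := (measurableTypeR R).
Local Notation profile := (@profile R).
Implicit Types (f g df dg h : R -> R) (a b c e t x y z l B gamma q I : R).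
Implicit Types p r : profile.

Definition padd p r := Profile (fun x => re p x + re r x) (fun x => im p x + im r x)
  (fun x => dre p x + dre r x) (fun x => dim p x + dim r x).

(** The real part of the product of one function with the conjugate of the other. *)
Definition crs p r x : R := re p x * re r x + im p x * im r x.

Definition dcrs p r x : R :=
  (re r x * dre p x + re p x * dre r x) + (im r x * dim p x + im p x * dim r x).

(** [lE] and [lQ] are the first variations of [en] and [ch] at [p]; they arise by replacing the
    increment of the density by its linear part [2 * crs p r]. *)
Definition lE B gamma p r : R := ip (dre p) (dre r) + ip (dim p) (dim r) +
  B * ip (fun x => rho p x ^+ 2) (crs p r) + gamma * ip (Dabs (rho p)) (crs p r).

Definition lQ p r : R := ip (rho p) (crs p r).

(** The second summand is the L^4 norm of the function, so this is [normX] in terms of profiles. *)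
Definition nrm r : R := Num.sqrt (kin r) + Num.sqrt (n2 (rho r)).

Lemma rho_padd p r x : rho (padd p r) x = rho p x + (2 * crs p r x + rho r x).
Proof. by rewrite /rho /crs /=; ring. Qed.

Lemma crs_sqr p r x : crs p r x ^+ 2 <= rho p x * rho r x.
Proof.
rewrite /crs /rho; move: (re p x) (im p x) (re r x) (im r x) => a b c d.
by have := sqr_ge0 (a * d - b * c); nra.
Qed.

Lemma crs_le p r x : `|2 * crs p r x| <= rho p x + rho r x.
Proof.
rewrite /crs /rho; move: (re p x) (im p x) (re r x) (im r x) => a b c d.
rewrite ler_norml; apply/andP; split.
  by have := sqr_ge0 (a + c); have := sqr_ge0 (b + d); nra.
by have := sqr_ge0 (a - c); have := sqr_ge0 (b - d); nra.
Qed.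

Lemma crs_meas p r : inX p -> inX r -> measurable_fun setT (crs p r).
Proof.
move=> [/AC_meas a /AC_meas b _] [/AC_meas c /AC_meas d _].
by apply: measurable_funD; exact: measurable_funM.
Qed.

Lemma L2_crs p r : inX p -> inX r -> L2 (crs p r).
Proof.
move=> Xp Xr; have [_ _ Lp] := Xp; have [_ _ Lr] := Xr; have m := crs_meas Xp Xr; split => //.
apply: le_integr (L2M Lp Lr); first exact: measurable_funX.
by move=> x; rewrite ger0_norm ?sqr_ge0// crs_sqr.
Qed.

Lemma n2_crs p r : inX p -> inX r -> n2 (crs p r) ^+ 2 <= ip (rho p) (rho r).
Proof.
move=> Xp Xr; have [_ _ Lp] := Xp; have [_ _ Lr] := Xr; have L := L2_crs Xp Xr.
rewrite n2_sqr; apply: le_Int; [exact: L2M|exact: L2M|move=> x].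
by rewrite -expr2 crs_sqr.
Qed.

Lemma AC_crs p r : inX p -> inX r -> AC (crs p r) (dcrs p r).
Proof.
move=> Xp Xr; have [Ap Bp _] := Xp; have [Ar Br _] := Xr.
exact: ACD (ACM Ap Ar (fun x => re_bnd x Xp) (fun x => re_bnd x Xr))
           (ACM Bp Br (fun x => im_bnd x Xp) (fun x => im_bnd x Xr)).
Qed.

Lemma n2_dcrs p r : inX p -> inX r ->
  n2 (dcrs p r) <= 2 * Num.sqrt (supb r) * Num.sqrt (kin p) + 2 * Num.sqrt (supb p) * Num.sqrt (kin r).
Proof.
move=> Xp Xr; have [Ap Bp _] := Xp; have [Ar Br _] := Xr.
have bp1 x := re_bnd x Xp; have br1 x := re_bnd x Xr.
have bp2 x := im_bnd x Xp; have br2 x := im_bnd x Xr.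
have L1 := L2_Ml (AC_meas Ar) br1 Ap.1; have L3 := L2_Ml (AC_meas Ap) bp1 Ar.1.
have L4 := L2_Ml (AC_meas Br) br2 Bp.1; have L5 := L2_Ml (AC_meas Bp) bp2 Br.1.
have := n2D (L2D L1 L3) (L2D L4 L5); have := n2D L1 L3; have := n2D L4 L5.
have := n2_Ml (AC_meas Ar) br1 Ap.1; have := n2_Ml (AC_meas Ap) bp1 Ar.1.
have := n2_Ml (AC_meas Br) br2 Bp.1; have := n2_Ml (AC_meas Bp) bp2 Br.1.
have Sp := sqrtr_ge0 (supb p); have Sr := sqrtr_ge0 (supb r).
have := ler_wpM2l Sp (n2_dre r); have := ler_wpM2l Sp (n2_dim r).
have := ler_wpM2l Sr (n2_dre p); have := ler_wpM2l Sr (n2_dim p).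
rewrite -/(dcrs p r); move: (n2 (dcrs p r)) (n2 _) (n2 _) (n2 _) (n2 _) (n2 _) (n2 _).
by move=> n a1 a2 a3 a4 a5 a6; lra.
Qed.

Lemma inX_padd p r : inX p -> inX r -> inX (padd p r).
Proof.
move=> Xp Xr; have [Ap Bp Lp] := Xp; have [Ar Br Lr] := Xr.
split; [exact: ACD|exact: ACD|].
rewrite (_ : rho (padd p r) = (fun x => rho p x + (2 * crs p r x + rho r x))).
  by apply: L2D Lp _; apply: L2D Lr; apply: L2Z; exact: L2_crs.
by apply/funext => x; exact: rho_padd.
Qed.

Lemma DabsD f df g dg h : L2 f -> AC f df -> L2 g -> AC g dg -> L2 h ->
  ip (Dabs (fun x => f x + g x)) h = ip (Dabs f) h + ip (Dabs g) h.
Proof.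
move=> Lf Af Lg Ag Lh; have := Dabs_lin 1 Lf Af Lg Ag Lh; rewrite mul1r => <-.
by congr (ip (Dabs _) _); apply/funext => x; rewrite mul1r.
Qed.

Lemma nl_expand f df g dg : L2 f -> AC f df -> L2 g -> AC g dg ->
  ip (Dabs (fun x => f x + g x)) (fun x => f x + g x) =
  ip (Dabs f) f + 2 * ip (Dabs f) g + ip (Dabs g) g.
Proof.
move=> Lf Af Lg Ag; rewrite (DabsD Lf Af Lg Ag (L2D Lf Lg)).
rewrite (ipDr Lf Lg (Dabs_L2 Lf Af)) (ipDr Lf Lg (Dabs_L2 Lg Ag)).
by rewrite (Dabs_sym Lg Ag Lf Af) (ipC g); ring.
Qed.

Lemma ip_expand f g : L2 f -> L2 g ->
  ip (fun x => f x + g x) (fun x => f x + g x) = ip f f + 2 * ip f g + ip g g.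
Proof.
move=> Lf Lg; rewrite (ipDl Lf Lg (L2D Lf Lg)) (ipDr Lf Lg Lf) (ipDr Lf Lg Lg) (ipC g f); ring.
Qed.

Lemma kin_padd p r : inX p -> inX r ->
  kin (padd p r) = kin p + 2 * (ip (dre p) (dre r) + ip (dim p) (dim r)) + kin r.
Proof.
move=> [Ap Bp _] [Ar Br _]; rewrite /kin /= (ip_expand Ap.1 Ar.1) (ip_expand Bp.1 Br.1); ring.
Qed.

Lemma nrm_ge0 r : 0 <= nrm r. Proof. by rewrite addr_ge0 ?sqrtr_ge0. Qed.

Lemma nrm_kin r : Num.sqrt (kin r) <= nrm r.
Proof. by rewrite lerDl sqrtr_ge0. Qed.

Lemma nrm_kin2 r : kin r <= nrm r ^+ 2.
Proof.
by rewrite -[leLHS](sqr_sqrtr (kin_ge0 r)) ler_pXn2r ?nnegrE ?sqrtr_ge0 ?nrm_ge0// nrm_kin.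
Qed.

Lemma nrm_rho r : n2 (rho r) <= nrm r ^+ 2.
Proof.
rewrite -[leLHS](sqr_sqrtr (n2_ge0 (rho r))) ler_pXn2r ?nnegrE ?sqrtr_ge0 ?nrm_ge0//.
by rewrite lerDr sqrtr_ge0.
Qed.

Lemma nrm_supb r : Num.sqrt (supb r) <= 3 * nrm r.
Proof.
have k0 := nrm_ge0 r.
rewrite -[leRHS]ger0_norm ?mulr_ge0// -sqrtr_sqr ler_wsqrtr//.
by have := nrm_kin2 r; have := nrm_rho r; rewrite /supb exprMn; have := sqr_ge0 (nrm r); lra.
Qed.

Lemma nrm_crs p r : inX p -> inX r -> n2 (crs p r) <= Num.sqrt (n2 (rho p)) * nrm r.
Proof.
move=> Xp Xr; have [_ _ Lp] := Xp; have [_ _ Lr] := Xr.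
rewrite -(@ler_pXn2r _ 2)// ?nnegrE ?n2_ge0 ?mulr_ge0 ?sqrtr_ge0 ?nrm_ge0//.
rewrite (le_trans (n2_crs Xp Xr))// (le_trans (ler_norm _))// (le_trans (ip_le Lp Lr))//.
by rewrite exprMn (sqr_sqrtr (n2_ge0 (rho p))) ler_wpM2l ?n2_ge0// nrm_rho.
Qed.

(** The increment [e] of the density and its derivative are [O(nrm r)] in L^2, so every term of
    degree two in [e] is [O(nrm r ^+ 2)]; for the nonlocal one this rests on [n2_Dabs]. The part
    [rho r] of the increment is of second order by itself and joins the remainder even where it
    appears linearly. *)
Lemma remainder B gamma p : inX p -> exists2 C : R, 0 <= C & forall r, inX r -> nrm r <= 1 ->
  `|en B gamma (padd p r) - en B gamma p - lE B gamma p r| <= C * nrm r ^+ 2 /\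
  `|ch (padd p r) - ch p - lQ p r| <= C * nrm r ^+ 2.
Proof.
move=> Xp; have [Ap Bp Lp] := Xp; have Arho := AC_rho Xp; have LD := Dabs_L2 Lp Arho.
(* [E1] and [D2] bound the L^2 norms of the increment and of its derivative per unit of [nrm r]. In
   [Se] below, 16 is twice the bound 8 on [supb r] valid for [nrm r <= 1]. *)
pose A := Num.sqrt (n2 (rho p)); pose E1 := 2 * A + 1.
pose D2 := 2 * (6 * Num.sqrt (kin p) + 2 * Num.sqrt (supb p)) + 12.
pose S := supb p; pose Se := S + 16.
have A0 : 0 <= A by exact: sqrtr_ge0.
have S0 : 0 <= S by exact: supb_ge0.
have E0 : 0 <= E1 by rewrite addr_ge0// mulr_ge0.
have D0 : 0 <= D2.
  by apply: addr_ge0 => //; apply: mulr_ge0 => //; apply: addr_ge0; apply: mulr_ge0 => //; exact: sqrtr_ge0.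
have N0 := n2_ge0 (rho p); have ND := n2_ge0 (Dabs (rho p)).
pose CC := 3 * S * n2 (rho p) + (3 * S + Se) * E1 ^+ 2.
pose CN := 2 * n2 (Dabs (rho p)) + D2 * E1.
pose CQ := 4^-1 * (2 * n2 (rho p) + E1 ^+ 2).
have Se0 : 0 <= Se by rewrite addr_ge0.
have CC0 : 0 <= CC.
  by apply: addr_ge0; apply: mulr_ge0; rewrite ?sqr_ge0//; [rewrite mulr_ge0|rewrite addr_ge0// mulr_ge0].
have CN0 : 0 <= CN by rewrite addr_ge0 ?mulr_ge0.
have CQ0 : 0 <= CQ by rewrite mulr_ge0 ?addr_ge0 ?mulr_ge0 ?sqr_ge0.
have CB : 0 <= `|B / 6| * CC by rewrite mulr_ge0.
have CG : 0 <= `|gamma / 4| * CN by rewrite mulr_ge0.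
exists (1 + `|B / 6| * CC + `|gamma / 4| * CN + CQ); first by rewrite !addr_ge0.
move=> r Xr k1; have [Ar Br Lr] := Xr; have k0 := nrm_ge0 r; set k := nrm r in k0 k1 *.
have Lc := L2_crs Xp Xr; have Acrs := AC_crs Xp Xr; have Arr := AC_rho Xr.
pose e x := 2 * crs p r x + rho r x; pose de x := 2 * dcrs p r x + drho r x.
have L2c := L2Z 2 Lc; have Le : L2 e by exact: L2D.
have Ae : AC e de by apply: ACD => //; exact: ACZ.
have kk : k ^+ 2 <= k by rewrite expr2 ler_piMl.
have nr : n2 (rho r) <= k ^+ 2 := nrm_rho r.
have nc : n2 (crs p r) <= A * k := nrm_crs Xp Xr.
have ne : n2 e <= E1 * k.
  apply: (le_trans (n2D L2c Lr)); rewrite n2Z// ger0_norm// /E1; lra.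
have nde : n2 de <= D2 * k.
  apply: (le_trans (n2D (L2Z 2 Acrs.1) Arr.1)); rewrite (n2Z 2 Acrs.1) ger0_norm//.
  have h1 := n2_dcrs Xp Xr; have h2 := n2_drho Xr.
  have s1 := nrm_supb r; have s2 := nrm_kin r; rewrite -/k in s1 s2.
  have t1 := sqrtr_ge0 (kin p); have t2 := sqrtr_ge0 (supb p).
  have u1 := ler_wpM2r t1 s1; have u2 := ler_wpM2l t2 s2.
  have u3 : Num.sqrt (supb r) * Num.sqrt (kin r) <= 3 * k * k.
    by apply: ler_pM => //; exact: sqrtr_ge0.
  rewrite /D2; move: (Num.sqrt (supb r)) (Num.sqrt (kin r)) (Num.sqrt (supb p)) (Num.sqrt (kin p)) (n2 (dcrs p r)) (n2 (drho r)) h1 h2 u1 u2 u3 => *; nra.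
have ee : ip e e <= E1 ^+ 2 * k ^+ 2.
  by rewrite -n2_sqr -exprMn ler_pXn2r ?nnegrE ?n2_ge0 ?mulr_ge0.
have se x : `|e x| <= Se.
  apply: (le_trans (ler_normD _ _)); have := crs_le p r x.
  rewrite (ger0_norm (rho_ge0 r x)) /Se /S; have := rho_bnd x Xp.
  have := rho_bnd x Xr; have : supb r <= 8.
    have := nrm_kin2 r; rewrite /supb -/k; lra.
  lra.
have Er : rho (padd p r) = (fun x => rho p x + e x) by apply/funext => x; exact: rho_padd.
have ipr : `|ip (rho p) (rho r)| <= n2 (rho p) * k ^+ 2.
  by apply: (le_trans (ip_le Lp Lr)); rewrite ler_wpM2l.
have HQ : ch (padd p r) - ch p - lQ p r = 4^-1 * (2 * ip (rho p) (rho r) + ip e e).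
  by rewrite /ch Er (ip_expand Lp Le) /lQ {1}/e (ipDr L2c Lr Lp) (ipZr 2 Lc Lp); field.
have bQ : `|ch (padd p r) - ch p - lQ p r| <= CQ * k ^+ 2.
  rewrite HQ normrM ger0_norm// /CQ -mulrA ler_wpM2l// (le_trans (ler_normD _ _))//.
  rewrite normrM (ger0_norm (ip_ge0 e)) (ger0_norm (ler0n _ 2)) [leRHS]mulrDl lerD//.
  by rewrite -mulrA ler_wpM2l.
have HN : nl (padd p r) - nl p - 4 * ip (Dabs (rho p)) (crs p r) =
    2 * ip (Dabs (rho p)) (rho r) + ip (Dabs e) e.
  rewrite /nl Er (nl_expand Lp Arho Le Ae) {1}/e (ipDr L2c Lr LD) (ipZr 2 Lc LD); ring.
have bN : `|nl (padd p r) - nl p - 4 * ip (Dabs (rho p)) (crs p r)| <= CN * k ^+ 2.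
  rewrite HN (le_trans (ler_normD _ _))// /CN [leRHS]mulrDl lerD//.
    rewrite normrM (ger0_norm (ler0n _ 2)) -!mulrA ler_wpM2l//.
    by apply: (le_trans (ip_le LD Lr)); rewrite ler_wpM2l.
  apply: (le_trans (ip_le (Dabs_L2 Le Ae) Le)); rewrite (n2_Dabs Le Ae).
  have -> : D2 * E1 * k ^+ 2 = (D2 * k) * (E1 * k) by ring.
  by apply: ler_pM; rewrite ?n2_ge0.
have mp := Lp.1; have me := Le.1; have mr := Lr.1.
have b_p x : `|rho p x| <= S by rewrite ger0_norm ?rho_ge0// rho_bnd.
have Lpp : L2 (fun x => rho p x * rho p x) by exact: L2_Ml mp b_p Lp.
have Lpe : L2 (fun x => rho p x * e x) by exact: L2_Ml mp b_p Le.
have Lee : L2 (fun x => e x * e x) by exact: L2_Ml me se Le.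
have i1 := L2M Lpp Lr; have i2 := L2M Lpe Le; have i3 := L2M Lee Le; have i4 := L2M Lpp Lc.
have HC : cub (padd p r) - cub p - 6 * ip (fun x => rho p x ^+ 2) (crs p r) =
    3 * \int[mu]_x (rho p x * rho p x * rho r x) + 3 * \int[mu]_x (rho p x * e x * e x)
    + \int[mu]_x (e x * e x * e x).
  have -> : ip (fun x => rho p x ^+ 2) (crs p r) = \int[mu]_x (rho p x * rho p x * crs p r x).
    by apply: eq_Int => x; rewrite expr2.
  rewrite -(IntZ 6 i4) -(IntZ 3 i1) -(IntZ 3 i2).
  rewrite -(IntB (rho3_integr (inX_padd Xp Xr)) (rho3_integr Xp)).
  rewrite -(IntB (integrB (rho3_integr (inX_padd Xp Xr)) (rho3_integr Xp)) (integrZ 6 i4)).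
  rewrite -(IntD (integrZ 3 i1) (integrZ 3 i2)) -(IntD (integrD (integrZ 3 i1) (integrZ 3 i2)) i3).
  by apply: eq_Int => x; rewrite Er /e; ring.
have nM f g c : measurable_fun setT f -> (forall x, `|f x| <= c) -> L2 f -> L2 g ->
    `|\int[mu]_x (f x * f x * g x)| <= c * n2 f * n2 g.
  move=> mf fc Lf Lg; have Lff := L2_Ml mf fc Lf.
  by apply: (le_trans (ip_le Lff Lg)); rewrite ler_wpM2r ?n2_ge0// n2_Ml.
have bC : `|cub (padd p r) - cub p - 6 * ip (fun x => rho p x ^+ 2) (crs p r)| <= CC * k ^+ 2.
  have c1 : `|\int[mu]_x (rho p x * rho p x * rho r x)| <= S * n2 (rho p) * k ^+ 2.
    by apply: (le_trans (nM _ _ _ mp b_p Lp Lr)); rewrite ler_wpM2l ?mulr_ge0.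
  have n22 : n2 e * n2 e <= E1 ^+ 2 * k ^+ 2 by rewrite -expr2 n2_sqr.
  have c2 : `|\int[mu]_x (rho p x * e x * e x)| <= S * (E1 ^+ 2 * k ^+ 2).
    apply: (le_trans (ip_le Lpe Le)); apply: (@le_trans _ _ (S * n2 e * n2 e)).
      by rewrite ler_wpM2r ?n2_ge0// n2_Ml.
    by rewrite -mulrA ler_wpM2l.
  have c3 : `|\int[mu]_x (e x * e x * e x)| <= Se * (E1 ^+ 2 * k ^+ 2).
    apply: (le_trans (nM _ _ _ me se Le Le)); rewrite -mulrA ler_wpM2l// addr_ge0//.
  rewrite HC (le_trans (ler_normD _ _))//.
  have := ler_normD (3 * \int[mu]_x (rho p x * rho p x * rho r x)) (3 * \int[mu]_x (rho p x * e x * e x)).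
  rewrite !normrM (ger0_norm (ler0n _ 3)) /CC.
  move: (\int[mu]_x _) (\int[mu]_x _) (\int[mu]_x _) c1 c2 c3 => I1 I2 I3 c1 c2 c3 H; lra.
split; last first.
  apply: (le_trans bQ); rewrite ler_wpM2r ?sqr_ge0//; lra.
have -> : en B gamma (padd p r) - en B gamma p - lE B gamma p r =
   2^-1 * kin r + B / 6 * (cub (padd p r) - cub p - 6 * ip (fun x => rho p x ^+ 2) (crs p r))
   + gamma / 4 * (nl (padd p r) - nl p - 4 * ip (Dabs (rho p)) (crs p r)).
  by rewrite /en /lE kin_padd//; field.
have h1 : `|B / 6 * (cub (padd p r) - cub p - 6 * ip (fun x => rho p x ^+ 2) (crs p r))| <= `|B / 6| * CC * k ^+ 2.
  by rewrite normrM -mulrA ler_wpM2l.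
have h2 : `|gamma / 4 * (nl (padd p r) - nl p - 4 * ip (Dabs (rho p)) (crs p r))| <= `|gamma / 4| * CN * k ^+ 2.
  by rewrite normrM -mulrA ler_wpM2l.
have h3 : `|2^-1 * kin r| <= k ^+ 2.
  rewrite ger0_norm ?mulr_ge0 ?kin_ge0//; have := nrm_kin2 r; have := kin_ge0 r; rewrite -/k; lra.
have tri (a b c : R) : `|a + b + c| <= `|a| + `|b| + `|c|.
  by rewrite (le_trans (ler_normD _ _))// lerD2r ler_normD.
apply: (le_trans (tri _ _ _)); apply: (le_trans (lerD (lerD h3 h1) h2)).
have h4 : 0 <= CQ * k ^+ 2 by rewrite mulr_ge0 ?sqr_ge0.
have -> : (1 + `|B / 6| * CC + `|gamma / 4| * CN + CQ) * k ^+ 2 =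
  k ^+ 2 + `|B / 6| * CC * k ^+ 2 + `|gamma / 4| * CN * k ^+ 2 + CQ * k ^+ 2 by ring.
by rewrite lerDl.
Qed.

Lemma lE_bnd B gamma p : inX p -> exists C : R, forall r, inX r -> `|lE B gamma p r| <= C * nrm r.
Proof.
move=> Xp; have [Ap Bp Lp] := Xp; have Arho := AC_rho Xp; have LD := Dabs_L2 Lp Arho.
have b_p x : `|rho p x| <= supb p by rewrite ger0_norm ?rho_ge0// rho_bnd.
have L2r : L2 (fun x => rho p x ^+ 2).
  have := L2_Ml Lp.1 b_p Lp; congr L2; apply/funext => x; exact: expr2.
pose A := Num.sqrt (n2 (rho p)).
exists (n2 (dre p) + n2 (dim p) + `|B| * (n2 (fun x => rho p x ^+ 2) * A) + `|gamma| * (n2 (Dabs (rho p)) * A)).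
move=> r Xr; have [Ar Br Lr] := Xr; have Lc := L2_crs Xp Xr; have nc := nrm_crs Xp Xr.
have k0 := nrm_ge0 r; have s2 := nrm_kin r.
have h1 : `|ip (dre p) (dre r)| <= n2 (dre p) * nrm r.
  apply: (le_trans (ip_le Ap.1 Ar.1)); rewrite ler_wpM2l ?n2_ge0//; exact: le_trans (n2_dre r) s2.
have h2 : `|ip (dim p) (dim r)| <= n2 (dim p) * nrm r.
  apply: (le_trans (ip_le Bp.1 Br.1)); rewrite ler_wpM2l ?n2_ge0//; exact: le_trans (n2_dim r) s2.
have h3 : `|B * ip (fun x => rho p x ^+ 2) (crs p r)| <= `|B| * (n2 (fun x => rho p x ^+ 2) * A) * nrm r.
  rewrite normrM -2!mulrA ler_wpM2l//; apply: (le_trans (ip_le L2r Lc)); by rewrite ler_wpM2l ?n2_ge0.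
have h4 : `|gamma * ip (Dabs (rho p)) (crs p r)| <= `|gamma| * (n2 (Dabs (rho p)) * A) * nrm r.
  rewrite normrM -2!mulrA ler_wpM2l//; apply: (le_trans (ip_le LD Lc)); by rewrite ler_wpM2l ?n2_ge0.
rewrite /lE !mulrDl.
by do 3 (apply: (le_trans (ler_normD _ _)); apply: lerD => //).
Qed.

Lemma lQ_bnd p : inX p -> exists C : R, forall r, inX r -> `|lQ p r| <= C * nrm r.
Proof.
move=> Xp; have [Ap Bp Lp] := Xp.
exists (n2 (rho p) * Num.sqrt (n2 (rho p))) => r Xr; have Lc := L2_crs Xp Xr.
by apply: (le_trans (ip_le Lp Lc)); rewrite -mulrA ler_wpM2l ?n2_ge0// nrm_crs.
Qed.

Definition pscale t p := Profile (fun x => t * re p x) (fun x => t * im p x)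
  (fun x => t * dre p x) (fun x => t * dim p x).

Lemma rho_pscale t p x : rho (pscale t p) x = t ^+ 2 * rho p x.
Proof. by rewrite /rho/=; ring. Qed.

Lemma inX_pscale t p : inX p -> inX (pscale t p).
Proof.
move=> [A1 A2 L]; split; [exact: ACZ|exact: ACZ|].
by rewrite (_ : rho _ = (fun x => t ^+ 2 * rho p x)); [exact: L2Z|apply/funext => x; exact: rho_pscale].
Qed.

Lemma nrm_pscale t p : inX p -> nrm (pscale t p) = `|t| * nrm p.
Proof.
move=> [A1 A2 L]; rewrite /nrm mulrDr; congr (_ + _).
  rewrite -sqrtr_sqr -sqrtrM ?sqr_ge0//; congr Num.sqrt.
  rewrite /kin/= (ipZl t A1.1 (L2Z t A1.1)) (ipZr t A1.1 A1.1).
  by rewrite (ipZl t A2.1 (L2Z t A2.1)) (ipZr t A2.1 A2.1); ring.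
rewrite (_ : rho _ = (fun x => t ^+ 2 * rho p x)); last by apply/funext => x; exact: rho_pscale.
by rewrite (n2Z _ L) ger0_norm ?sqr_ge0// sqrtrM ?sqr_ge0// sqrtr_sqr.
Qed.

Lemma crs_pscale t p r x : crs p (pscale t r) x = t * crs p r x.
Proof. by rewrite /crs/=; ring. Qed.

Lemma lE_lin B gamma p t r s : inX p -> inX r -> inX s ->
  lE B gamma p (padd (pscale t r) s) = t * lE B gamma p r + lE B gamma p s.
Proof.
move=> Xp Xr Xs; have [Ap Bp Lp] := Xp; have [Ar Br Lr] := Xr; have [As Bs Ls] := Xs.
have LD := Dabs_L2 Lp (AC_rho Xp).
have b_p x : `|rho p x| <= supb p by rewrite ger0_norm ?rho_ge0// rho_bnd.
have L2r : L2 (fun x => rho p x ^+ 2).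
  have := L2_Ml Lp.1 b_p Lp; congr L2; apply/funext => x; exact: expr2.
have Lc := L2_crs Xp Xr; have Ld := L2_crs Xp Xs.
have Ec : crs p (padd (pscale t r) s) = (fun x => t * crs p r x + crs p s x).
  by apply/funext => x; rewrite /crs/=; ring.
have lin h f g : L2 h -> L2 f -> L2 g -> ip h (fun x => t * f x + g x) = t * ip h f + ip h g.
  by move=> Lh Lf Lg; rewrite (ipDr (L2Z t Lf) Lg Lh) (ipZr t Lf Lh).
rewrite /lE Ec /= (lin _ _ _ Ap.1 Ar.1 As.1) (lin _ _ _ Bp.1 Br.1 Bs.1).
rewrite (lin _ _ _ L2r Lc Ld) (lin _ _ _ LD Lc Ld); ring.
Qed.

Lemma lQ_lin p t r s : inX p -> inX r -> inX s ->
  lQ p (padd (pscale t r) s) = t * lQ p r + lQ p s.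
Proof.
move=> Xp Xr Xs; have [_ _ Lp] := Xp; have Lc := L2_crs Xp Xr; have Ld := L2_crs Xp Xs.
have Ec : crs p (padd (pscale t r) s) = (fun x => t * crs p r x + crs p s x).
  by apply/funext => x; rewrite /crs/=; ring.
by rewrite /lQ Ec (ipDr (L2Z t Lc) Ld Lp) (ipZr t Lc Lp).
Qed.

Definition p0 : profile := Profile (fun=> 0) (fun=> 0) (fun=> 0) (fun=> 0).

Lemma inX_p0 : inX p0.
Proof.
split; [exact: AC_cst|exact: AC_cst|].
by rewrite (_ : rho p0 = (fun=> 0)); [exact: L20|apply/funext => x; rewrite /rho/= expr0n addr0].
Qed.

Lemma padd_p0 r : padd r p0 = r.
Proof. by case: r => a b c d; rewrite /padd/=; congr Profile; apply/funext => x; rewrite addr0. Qed.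

Lemma lE_scale B gamma p t r : inX p -> inX r -> lE B gamma p (pscale t r) = t * lE B gamma p r.
Proof.
move=> Xp Xr; have E0 := lE_lin B gamma 1 Xp inX_p0 inX_p0; rewrite !padd_p0 in E0.
have z : pscale 1 p0 = p0 by rewrite /pscale /p0/=; congr Profile; apply/funext => x; rewrite mulr0.
have := lE_lin B gamma t Xp Xr inX_p0; rewrite padd_p0 => ->; rewrite z in E0; lra.
Qed.

Lemma lQ_scale p t r : inX p -> inX r -> lQ p (pscale t r) = t * lQ p r.
Proof.
move=> Xp Xr; have [_ _ Lp] := Xp; have Lc := L2_crs Xp Xr.
rewrite /lQ -(ipZr t Lc Lp); apply: eq_ip => // x; exact: crs_pscale.
Qed.

Lemma first_order_eq0 (a C d : R) : 0 < d -> (forall t, `|t| <= d -> 0 <= t * a + C * t ^+ 2) -> a = 0.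
Proof.
move=> d0 H; apply/eqP; apply: contrapT => /negP a0.
have na : 0 < `|a| by rewrite normr_gt0.
pose C1 := `|C| + 1; have C0 : 0 < C1 by rewrite ltr_wpDl.
pose s := Num.min d (`|a| / (2 * C1)).
have s0 : 0 < s by rewrite lt_min d0 divr_gt0// mulr_gt0.
have sd : s <= d by rewrite ge_min lexx.
have sa : s * (2 * C1) <= `|a| by rewrite -ler_pdivlMr ?mulr_gt0// ge_min lexx orbT.
have key t : `|t| = s -> t * a = - (s * `|a|) -> False.
  move=> ts ta; have := H t; rewrite ts ta => /(_ sd).
  have -> : t ^+ 2 = s ^+ 2 by rewrite -[t ^+ 2]real_normK ?num_real// ts.
  have : C * s ^+ 2 <= C1 * s ^+ 2.
    by rewrite ler_wpM2r ?sqr_ge0// /C1; have := ler_norm C; lra.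
  have : C1 * s ^+ 2 <= s * `|a| / 2.
    have -> : C1 * s ^+ 2 = s * (s * (2 * C1)) / 2 by field.
    by rewrite ler_pM2r ?invr_gt0// ler_pM2l.
  have : 0 < s * `|a| by rewrite mulr_gt0.
  lra.
case: (ltP 0 a) => ha.
  by apply: (key (- s)); [rewrite normrN gtr0_norm|rewrite (gtr0_norm ha) mulNr].
by apply: (key s); [exact: gtr0_norm|rewrite (ler0_norm ha) mulrN opprK].
Qed.

(** By [en_lower] the difference [en - I / q^2 * ch^2] is nonnegative, and it vanishes at [p]; its
    first-order term along [t * r] must be zero. The factor [2 * I / q] is the derivative of
    [I / q^2 * Q^2] at [Q = q]. *)
Lemma lagrange B gamma q I p : 0 < q -> 0 <= gamma ->
  (forall p, inX p -> ch p = q -> I <= en B gamma p) ->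
  inX p -> ch p = q -> en B gamma p = I ->
  forall r, inX r -> lE B gamma p r = 2 * I / q * lQ p r.
Proof.
move=> q0 g0 HI Xp Qp Ep r Xr; have low := en_lower q0 g0 HI.
have [C C0 HC] := remainder B gamma Xp; have [D HD] := lQ_bnd Xp.
pose k := nrm r + 1; have k0 : 0 < k by rewrite ltr_wpDl ?nrm_ge0.
have q1 : q != 0 by rewrite gt_eqF.
pose c := I / q ^+ 2.
suff : lE B gamma p r - 2 * I / q * lQ p r = 0 by move/eqP; rewrite subr_eq0 => /eqP.
(* Three quadratic errors: the remainder of the energy, that of the charge multiplied by the slope
   [2 * c * q], and the squared increment of the charge. The radius taken for [t] just below keeps
   [|t| <= 1] and [nrm (pscale t r) <= 1]. *)
pose M := C * k ^+ 2 + 2 * `|c| * q * (C * k ^+ 2) + `|c| * (`|lQ p r| + C * k ^+ 2) ^+ 2.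
apply: (@first_order_eq0 _ M (Num.min 1 k^-1)); first by rewrite lt_min ltr01 invr_gt0.
move=> t; rewrite le_min => /andP[t1 tk].
have Xt := inX_pscale t Xr; have Xpt := inX_padd Xp Xt.
have nt := nrm_pscale t Xr.
have nt1 : nrm (pscale t r) <= 1.
  rewrite nt (le_trans (_ : _ <= k^-1 * k))//; last by rewrite mulVf// gt_eqF.
  by apply: ler_pM => //; [exact: nrm_ge0|rewrite /k; lra].
have [HE HQ] := HC _ Xt nt1.
rewrite (lE_scale _ _ _ Xp Xr) Ep in HE; rewrite (lQ_scale _ Xp Xr) Qp in HQ.
have nk : C * nrm (pscale t r) ^+ 2 <= C * k ^+ 2 * t ^+ 2.
  rewrite nt exprMn real_normK ?num_real// -mulrA [k ^+ 2 * _]mulrC ler_wpM2l// ler_wpM2l ?sqr_ge0//.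
  by rewrite ler_pXn2r ?nnegrE ?nrm_ge0 ?(ltW k0)// /k; lra.
have := low _ Xpt; rewrite -/c => HJ.
have {}HE := le_trans HE nk; have {}HQ := le_trans HQ nk.
set W := C * k ^+ 2 in HE HQ M *.
have W0 : 0 <= W by rewrite mulr_ge0 ?sqr_ge0.
move: HE HQ HJ; set E' := en _ _ _; set Q' := ch _; set le := lE _ _ _ _; set lq := lQ _ _.
pose dl := Q' - q - t * lq; move=> HE HQ HJ.
have t0 := sqr_ge0 t; have tt : t ^+ 2 <= 1 by rewrite -[t ^+ 2]real_normK ?num_real// exprn_ile1.
have Q'E : Q' ^+ 2 = q ^+ 2 + 2 * q * (t * lq) + (2 * q * dl + (t * lq + dl) ^+ 2) by rewrite /dl; ring.
have b1 : `|2 * q * dl| <= 2 * q * (W * t ^+ 2).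
  by rewrite normrM ger0_norm ?mulr_ge0 ?(ltW q0)// ler_wpM2l// mulr_ge0// ltW.
have b2 : (t * lq + dl) ^+ 2 <= (`|lq| + W) ^+ 2 * t ^+ 2.
  rewrite -[t ^+ 2]real_normK ?num_real// -exprMn -[leLHS]real_normK ?num_real//.
  rewrite ler_pXn2r ?nnegrE ?mulr_ge0 ?addr_ge0//.
  apply: (le_trans (ler_normD _ _)); rewrite normrM mulrDl [`|lq| * _]mulrC lerD2l.
  apply: (le_trans HQ); rewrite ler_wpM2l// -[t ^+ 2]real_normK ?num_real// expr2 ler_piMl//.
have b3 : `|c * (2 * q * dl + (t * lq + dl) ^+ 2)| <= (2 * `|c| * q * W + `|c| * (`|lq| + W) ^+ 2) * t ^+ 2.
  rewrite normrM (_ : (_ + _) * t ^+ 2 = `|c| * (2 * q * (W * t ^+ 2) + (`|lq| + W) ^+ 2 * t ^+ 2)); last by ring.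
  by rewrite ler_wpM2l// (le_trans (ler_normD _ _))// lerD// ger0_norm ?sqr_ge0.
have cq : c * q ^+ 2 = I by rewrite /c divfK// sqrf_eq0.
have cq2 : c * (2 * q * (t * lq)) = t * (2 * I / q * lq) by rewrite /c; field.
have QQ : c * Q' ^+ 2 = I + t * (2 * I / q * lq) + c * (2 * q * dl + (t * lq + dl) ^+ 2).
  by rewrite Q'E mulrDr mulrDr cq cq2.
move: b3 QQ; move: (c * (2 * q * dl + (t * lq + dl) ^+ 2)) => X b3 QQ.
rewrite QQ in HJ; move: HE b3 HJ; rewrite !ler_norml /M -/lq => /andP[? ?] /andP[? ?] ?; lra.
Qed.

End Expansion.

(** * Compactness of minimizing sequences *)

Section UltraSubsequence.
Context {R : realType}.
Implicit Types (a b c e t x y z l : R) (U V : nat -> R -> R).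

(** Bounded sequences converge along an ultrafilter, so a single [G] gives limits at all points [x]
    simultaneously and no diagonal extraction over a dense set is made. The limit is the supremum of
    the levels that lie below [a] on a set of [G]. *)
Lemma ultra_lim (G : set_system nat) (a : nat -> R) (M : R) : UltraFilter G ->
  (forall n, `|a n| <= M) -> exists l, forall e, 0 < e -> G [set n | `|a n - l| <= e].
Proof.
move=> UG aM; have PG : ProperFilter G by exact: ultra_proper.
pose E := [set c | G [set n | c <= a n]].
have E0 : E (- M - 1).
  rewrite /E/=; apply: (filterS (P := setT)) => [n _|]; last exact: filterT.
  by have := aM n; rewrite /= ler_norml => /andP[? ?]; lra.
have Eub : has_ubound E.
  exists (M + 1) => c Ec; rewrite leNgt; apply/negP => Mc.
  have [n /=] := @filter_ex _ _ PG _ Ec; have := aM n; rewrite ler_norml => /andP[? ?]; lra.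
have sE : has_sup E by split => //; exists (- M - 1).
exists (sup E) => e e0.
have G1 : G [set n | sup E - e <= a n].
  have [c Ec lc] := sup_adherent e0 sE; apply: filterS Ec => n /=; lra.
have G2 : G [set n | a n <= sup E + e].
  case: (in_ultra_setVsetC [set n | a n <= sup E + e] UG) => // H.
  have : E (sup E + e) by apply: filterS H => n /= /negP; rewrite -ltNge => /ltW.
  by move=> /(ub_le_sup Eub); lra.
apply: filterS2 G1 G2 => n /= ? ?; rewrite ler_norml; apply/andP; split; lra.
Qed.

Lemma grid_approx (k d : R) : 0 < d -> exists (J : nat) (g : nat -> R), forall x, `|x| <= k ->
  exists2 j, (j < J)%N & `|x - g j| <= d.
Proof.
move=> d0; exists (Num.truncn (2 * k / d)).+1, (fun j => - k + j%:R * d) => x.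
rewrite ler_norml => /andP[x1 x2].
have y0 : 0 <= (x + k) / d by rewrite divr_ge0 ?(ltW d0)//; lra.
exists (Num.truncn ((x + k) / d)).
  rewrite ltnS le_truncn// ler_pM2r ?invr_gt0//; lra.
have /andP[t1 t2] := truncn_itv y0; rewrite ler_pdivlMr// in t1.
rewrite ltr_pdivrMr// -[_.+1]addn1 natrD mulrDl mul1r in t2.
by rewrite ler_norml; apply/andP; split; lra.
Qed.

(** Arzela-Ascoli along the ultrafilter: pointwise limits inherit the common Hölder modulus, and a
    finite grid makes the convergence uniform on bounded sets. *)
Lemma ultra_uniform (G : set_system nat) U (M C : R) : UltraFilter G -> 0 <= C ->
  (forall n x, `|U n x| <= M) -> (forall n x y, `|U n x - U n y| <= C * Num.sqrt `|x - y|) ->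
  exists u : R -> R, (forall x y, `|u x - u y| <= C * Num.sqrt `|x - y|) /\
    forall k e, 0 < e -> G [set n | forall x, `|x| <= k -> `|U n x - u x| <= e].
Proof.
move=> UG C0 UM UC; have PG : ProperFilter G by exact: ultra_proper.
have /choice[u Hu] : forall x, exists l, forall e, 0 < e -> G [set n | `|U n x - l| <= e].
  by move=> x; exact: (ultra_lim UG (fun n => UM n x)).
have uC x y : `|u x - u y| <= C * Num.sqrt `|x - y|.
  apply/ler_addgt0Pr => e e0; have e2 : 0 < e / 2 by rewrite divr_gt0.
  have [n [/= h1 h2]] := @filter_ex _ _ PG _ (filterI (Hu x _ e2) (Hu y _ e2)).
  have h3 := UC n x y; have -> : u x - u y = (U n x - U n y) - (U n x - u x) + (U n y - u y) by ring.
  apply: (le_trans (ler_normD _ _)); have := ler_normB (U n x - U n y) (U n x - u x); lra.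
exists u; split => // k e e0.
(* The mesh at which the Hölder modulus is at most [e / 3]; the remaining third is spent at the
   finitely many grid points. *)
pose d := (e / (3 * (C + 1))) ^+ 2.
have e3 : 0 < e / (3 * (C + 1)) by rewrite divr_gt0// mulr_gt0// ltr_wpDl.
have d0 : 0 < d by rewrite exprn_gt0.
have Cd x y : `|x - y| <= d -> C * Num.sqrt `|x - y| <= e / 3.
  move=> xy; apply: (@le_trans _ _ (C * (e / (3 * (C + 1))))).
    by rewrite ler_wpM2l// -[leRHS]ger0_norm ?(ltW e3)// -(sqrtr_sqr (e / _)) ler_wsqrtr.
  rewrite invfM !mulrA ler_pdivrMr ?ltr_wpDl//.
  have -> : e / 3 * (C + 1) = C * e / 3 + e / 3 by field.
  by rewrite lerDl divr_ge0// ltW.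
have [J [g Hg]] := grid_approx k d0.
have GJ : G [set n | forall j, (j < J)%N -> `|U n (g j) - u (g j)| <= e / 3].
  elim: J {Hg} => [|J IH]; first by apply: (filterS (P := setT)) => [n _ j //|]; exact: filterT.
  have e30 : 0 < e / 3 by rewrite divr_gt0.
  apply: filterS2 IH (Hu (g J) _ e30) => n /= H1 H2 j; rewrite ltnS leq_eqVlt => /orP[/eqP ->//|].
  exact: H1.
apply: filterS GJ => n /= Hn x /Hg[j jJ xj].
have h1 := Hn _ jJ; have h2 := le_trans (UC n x (g j)) (Cd _ _ xj); have h3 := le_trans (uC x (g j)) (Cd _ _ xj).
have -> : U n x - u x = (U n x - U n (g j)) + (U n (g j) - u (g j)) - (u x - u (g j)) by ring.
apply: (le_trans (ler_normB _ _)); have := ler_normD (U n x - U n (g j)) (U n (g j) - u (g j)); lra.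
Qed.

(** Every set of an ultrafilter finer than [\oo] contains arbitrarily large indices, so a true
    subsequence with prescribed rates can be drawn from it. Treating [U] and [V] along the same
    ultrafilter gives one subsequence for real and imaginary parts. *)
Lemma ultra_subsequence U V (M C : R) : 0 <= C ->
  (forall n x, `|U n x| <= M) -> (forall n x y, `|U n x - U n y| <= C * Num.sqrt `|x - y|) ->
  (forall n x, `|V n x| <= M) -> (forall n x y, `|V n x - V n y| <= C * Num.sqrt `|x - y|) ->
  exists (u v : R -> R) (s : nat -> nat),
    [/\ forall x y, `|u x - u y| <= C * Num.sqrt `|x - y|,
        forall x y, `|v x - v y| <= C * Num.sqrt `|x - y|,
        {homo s : j k / (j < k)%N >-> (j < k)%N},
        forall k x, `|x| <= k%:R -> `|U (s k) x - u x| <= k.+1%:R^-1 &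
        forall k x, `|x| <= k%:R -> `|V (s k) x - v x| <= k.+1%:R^-1].
Proof.
move=> C0 UM UC VM VC.
have [G [UG sG]] := @ultraFilterLemma nat \oo _.
have PG : ProperFilter G by exact: ultra_proper.
have [u [uC Hu]] := ultra_uniform UG C0 UM UC; have [v [vC Hv]] := ultra_uniform UG C0 VM VC.
have /choice[f Hf] : forall kN : nat * nat, exists n, [/\ (kN.2 <= n)%N,
    forall x, `|x| <= kN.1%:R -> `|U n x - u x| <= kN.1.+1%:R^-1 &
    forall x, `|x| <= kN.1%:R -> `|V n x - v x| <= kN.1.+1%:R^-1].
  move=> [k N] /=; have e0 : 0 < k.+1%:R^-1 :> R by rewrite invr_gt0.
  have GN : G [set n | (N <= n)%N] by apply: sG; exists N.
  have [n [[/= h1 h2] h3]] := @filter_ex _ _ PG _ (filterI (filterI GN (Hu k%:R _ e0)) (Hv k%:R _ e0)).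
  by exists n.
(* The second component forces each index past the previous one; the first asks for accuracy
   [1/(k+1)] on [[-k, k]]. *)
pose s := fix s k := if k is k'.+1 then f (k, (s k').+1) else f (0%N, 0%N).
exists u, v, s; split => //.
- by apply: homo_ltn => [j i k|i]; [exact: ltn_trans|have [] := Hf (i.+1, (s i).+1)].
- by case=> [|k] x; [have [_ H _] := Hf (0%N, 0%N); exact: H|have [_ H _] := Hf (k.+1, (s k).+1); exact: H].
- by case=> [|k] x; [have [_ _ H] := Hf (0%N, 0%N); exact: H|have [_ _ H] := Hf (k.+1, (s k).+1); exact: H].
Qed.

End UltraSubsequence.

(** * Weak limits of derivatives *)

Section WeakLimits.
Context {R : realType}.
Local Notation mu := (@lebesgue_measure R).
Local Notation RR := (measurableTypeR R).
Implicit Types (f g df dg h w u du phi : R -> R) (a b c e t x y z l : R).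

Lemma holder_continuous u (C : R) : 0 <= C ->
  (forall x y, `|u x - u y| <= C * Num.sqrt `|x - y|) -> continuous u.
Proof.
move=> C0 H x; apply/cvgrPdist_le => e e0.
pose d := (e / (C + 1)) ^+ 2.
have e1 : 0 < e / (C + 1) by rewrite divr_gt0// ltr_wpDl.
have d0 : 0 < d by rewrite exprn_gt0.
exists d => //= y xy; apply: (le_trans (H x y)).
apply: (@le_trans _ _ (C * (e / (C + 1)))).
  by rewrite ler_wpM2l// -[leRHS]ger0_norm ?(ltW e1)// -(sqrtr_sqr (e / _)) ler_wsqrtr// ltW.
rewrite mulrA ler_pdivrMr ?ltr_wpDl// mulrC ler_wpM2l ?(ltW e0)//; lra.
Qed.

(** Local uniform convergence of [U] gives convergence of [dU] against test functions. The uniform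
    bound [K] makes the limit a bounded functional, hence an L^2 function by [riesz], and extends
    the convergence to all of L^2 by density. *)
Lemma weak_limit (U dU : nat -> R -> R) u (C K : R) : 0 <= C ->
  (forall n, AC (U n) (dU n)) -> (forall n, n2 (dU n) <= K) ->
  (forall x y, `|u x - u y| <= C * Num.sqrt `|x - y|) ->
  (forall k x, `|x| <= k%:R -> `|U k x - u x| <= k.+1%:R^-1) ->
  exists2 du, AC u du & forall g, L2 g -> ip (dU n) g @[n --> \oo] --> ip du g.
Proof.
move=> C0 AU KU uC Uu; have cu := holder_continuous C0 uC; have lu := continuous_locint cu.
have K0 : 0 <= K := le_trans (n2_ge0 _) (KU 0%N).
have cvt phi : test_function phi ->
    ip (dU n) phi @[n --> \oo] --> - \int[mu]_x (u x * derive1 phi x).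
  move=> tp; have di := test_dintegr tp; have [M [_ _ sM]] := test_supp tp.
  have -> : (fun n => ip (dU n) phi) = (fun n => - \int[mu]_x (U n x * derive1 phi x)).
    by apply/funext => n; rewrite (AC_parts (AU n) tp) opprK.
  apply: cvgN; apply/cvgrPdist_le => e e0.
  have i0 := test_locint_dmul lu tp.
  have cD : (\int[mu]_x `|derive1 phi x|) * n.+1%:R^-1 @[n --> \oo] --> (\int[mu]_x `|derive1 phi x|) * (0 : R).
    by apply: cvgM; [exact: cvg_cst|exact: cvg_harmonic].
  rewrite mulr0 in cD; move/cvgrPdist_le: cD => /(_ _ e0)[N1 _ HN1].
  (* Past [N2] the interval [[-n, n]] contains the support of [derive1 phi], so the local bound
     holds wherever the integrand is nonzero. *)
  have [N2 HN2] := nat_ub M.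
  exists (maxn N1 N2) => // n; rewrite /= geq_max => /andP[n1 n2_].
  have i1 := test_locint_dmul (AC_locint (AU n)) tp.
  rewrite -(IntB i0 i1).
  have P : 0 <= (\int[mu]_x `|derive1 phi x|) * n.+1%:R^-1.
    by rewrite mulr_ge0 ?invr_ge0// Int_ge0.
  have := HN1 n n1; rewrite /= sub0r normrN (ger0_norm P); apply: le_trans.
  rewrite mulrC -(IntZ _ (integr_norm di)).
  apply: (le_trans (norm_Int (integrB i0 i1))); apply: le_Int.
  - by apply: integr_norm; exact: integrB.
  - by apply: integrZ; exact: integr_norm.
  move=> x; rewrite -mulrBl normrM; case: (lerP `|x| n%:R) => xn.
    by rewrite ler_wpM2r// distrC Uu.
  rewrite (sM x) ?normr0 ?mulr0//; apply: le_trans (ltW xn); exact: HN2.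
have [|||||du [Ldu Hdu _]] := @riesz R (@test_function R) (fun phi => - \int[mu]_x (u x * derive1 phi x)) K.
- exact: test0.
- exact: test_L2.
- by move=> c f g tf tg; exact: testD.
- move=> c f g tf tg; have i1 := test_locint_dmul lu tf; have i2 := test_locint_dmul lu tg.
  rewrite (derive1_lin c tf tg) mulrN -opprD -(IntZ c i1) -(IntD (integrZ c i1) i2); congr (- _).
  by apply: eq_Int => x; ring.
- move=> f tf; apply: (@cvgr_to_le _ _ _ _ _ _ _ (cvg_norm (cvt f tf))); apply: nearW => n.
  apply: (le_trans (ip_le (AU n).1 (test_L2 tf))); rewrite ler_wpM2r ?n2_ge0//; exact: KU.
have Wu : is_weak_derivative u du.
  by split; [exact: lu|exact: L2_locint|move=> phi tp; rewrite -[LHS]opprK (Hdu _ tp)].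
have [v Av uv] := weak_AC Wu Ldu.
have Euv : u = v by apply: aeq_continuous => //; exact: AC_continuous Av.
exists du; first by rewrite Euv.
move=> g Lg; apply/cvgrPdist_le => e e0.
pose D := K + n2 du + 1; have D0 : 0 < D by rewrite ltr_wpDl// addr_ge0 ?n2_ge0.
have eD : 0 < e / 2 / D by rewrite !divr_gt0.
have e2 : 0 < e / 2 by rewrite divr_gt0.
have [phi tp Hp] := n2_small Lg eD; have Lp := test_L2 tp.
have := cvt _ tp; rewrite (Hdu _ tp) => /cvgrPdist_le/(_ _ e2).
apply: filterS => n Hn; have Ld := L2B Ldu (AU n).1; have Lh := L2B Lg Lp.
rewrite -(ipBl Ldu (AU n).1 Lg); rewrite -(ipBl Ldu (AU n).1 Lp) in Hn.
have -> : ip (fun x => du x - dU n x) g = ip (fun x => du x - dU n x) phi +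
    ip (fun x => du x - dU n x) (fun x => g x - phi x).
  by rewrite (ipBr Lg Lp Ld); ring.
apply: (le_trans (ler_normD _ _)).
have : `|ip (fun x => du x - dU n x) (fun x => g x - phi x)| <= D * (e / 2 / D).
  apply: (le_trans (ip_le Ld Lh)); apply: ler_pM; rewrite ?n2_ge0//.
  apply: (le_trans (n2B Ldu (AU n).1)); have := KU n; rewrite /D; lra.
have -> : D * (e / 2 / D) = e / 2 by field; rewrite gt_eqF.
lra.
Qed.

(** The fixed function [w] is cut into a compactly supported part, on which the uniform smallness of
    [s n] acts, and a tail small in L^2, for which the bound [C] suffices. *)
Lemma ip_local_small w (s : nat -> R -> R) (C : R) : L2 w -> (forall n, L2 (s n)) ->
  (forall n, n2 (s n) <= C) ->
  (forall k x, `|x| <= k%:R -> `|s k x| <= 2 / k.+1%:R) ->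
  ip w (s n) @[n --> \oo] --> (0 : R).
Proof.
move=> Lw Ls nC sl; apply/cvgrPdist_le => e e0.
have C0 : 0 <= C := le_trans (n2_ge0 _) (nC 0%N).
have C1 : 0 < C + 1 by rewrite ltr_wpDl.
have eC : 0 < e / 2 / (C + 1) by rewrite !divr_gt0.
have e2 : 0 < e / 2 by rewrite divr_gt0.
move/cvgrPdist_le: (tr_cvg Lw) => /(_ _ eC)[m _ Hm].
have {Hm} := Hm m (leqnn m); rewrite /= sub0r normrN ger0_norm ?n2_ge0// => Hm.
have Lt := tr_L2 m Lw; have it := tr_integr m Lw.
have cD : (\int[mu]_x `|tr m w x|) * (2 * n.+1%:R^-1) @[n --> \oo] --> (\int[mu]_x `|tr m w x|) * (2 * (0 : R)).
  by apply: cvgM; [exact: cvg_cst|apply: cvgM; [exact: cvg_cst|exact: cvg_harmonic]].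
move/cvgrPdist_le: cD => /(_ _ e2)[N _ HN].
exists (maxn N m) => // n; rewrite /= geq_max => /andP[nN nm].
have P : 0 <= (\int[mu]_x `|tr m w x|) * (2 * n.+1%:R^-1).
  by rewrite mulr_ge0 ?mulr_ge0 ?invr_ge0// Int_ge0.
have {HN} := HN n nN; rewrite /= !mulr0 !sub0r !normrN (ger0_norm P) => HN.
have -> : ip w (s n) = ip (fun x => w x - tr m w x) (s n) + ip (tr m w) (s n).
  by rewrite (ipBl Lw Lt (Ls n)); ring.
apply: (le_trans (ler_normD _ _)).
have h1 : `|ip (fun x => w x - tr m w x) (s n)| <= e / 2.
  apply: (le_trans (ip_le (L2B Lw Lt) (Ls n))).
  apply: (@le_trans _ _ (e / 2 / (C + 1) * (C + 1))); last by rewrite divfK// gt_eqF.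
  apply: ler_pM; rewrite ?n2_ge0//; first by rewrite n2BC.
  by apply: (le_trans (nC n)); rewrite lerDl.
have h2 : `|ip (tr m w) (s n)| <= e / 2.
  apply: le_trans HN; rewrite mulrC -(IntZ _ (integr_norm it)).
  apply: (le_trans (norm_Int (L2M Lt (Ls n)))); apply: le_Int.
  - by apply: integr_norm; exact: L2M.
  - by apply: integrZ; exact: integr_norm.
  move=> x; rewrite normrM mulrC; case: (lerP `|x| m%:R) => xm; last first.
    have -> : tr m w x = 0 by rewrite /tr lt_geF// mulr0.
    by rewrite normr0 !mulr0.
  by rewrite ler_wpM2r// sl// (le_trans xm)// ler_nat.
lra.
Qed.

End WeakLimits.

(** * Splitting of the functionals and strong convergence *)

Section Compactness.
Context {R : realType}.
Local Notation mu := (@lebesgue_measure R).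
Local Notation RR := (measurableTypeR R).
Local Notation profile := (@profile R).
Implicit Types (a b c e t x y z l B gamma q I S : R).
Implicit Types p r : profile.

Lemma supb_n2 p : n2 (rho p) <= supb p.
Proof. by rewrite /supb; have := n2_ge0 (rho p); have := kin_ge0 p; lra. Qed.

Lemma supb_kin p : kin p <= supb p.
Proof. by rewrite /supb; have := n2_ge0 (rho p); have := kin_ge0 p; lra. Qed.

(* Brezis-Lieb splitting: the interaction terms are controlled by quantities
   that vanish when [r] tends to 0 weakly. *)
Lemma split_bound p r S : inX p -> inX r -> supb p <= S -> supb r <= S -> supb (padd p r) <= S ->
  let c := n2 (crs p r) in let d := ip (rho p) (rho r) in
  [/\ `|ch (padd p r) - ch p - ch r| <= 2 * d + 6 * S * c,
      `|cub (padd p r) - cub p - cub r| <= 14 * S ^+ 2 * c + 6 * S * d &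
      `|nl (padd p r) - nl p - nl r| <= 24 * S * c + 2 * `|ip (Dabs (rho p)) (rho r)|].
Proof.
move=> Xp Xr Sp Sr Spr /=; have Xs := inX_padd Xp Xr.
have [_ _ Lp] := Xp; have [_ _ Lr] := Xr; have [_ _ LR] := Xs.
have S0 : 0 <= S := le_trans (supb_ge0 p) Sp.
have Lc := L2_crs Xp Xr; have c0 := n2_ge0 (crs p r); have Le := L2Z 2 Lc.
have d0 : 0 <= ip (rho p) (rho r) by apply: Int_ge0 => x; rewrite mulr_ge0 ?rho_ge0.
(* The comparison goes in two moves: from the density of the sum to [s], at L^2 distance
   [2 * n2 (crs p r)], and from [s] to the two separate densities, where only products of [rho p]
   and [rho r], or their |D| pairing, appear. *)
pose s x := rho p x + rho r x; have Ls : L2 s by exact: L2D.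
pose Rh := rho (padd p r); have LRh : L2 Rh by [].
have Es : (fun x => 2 * crs p r x) = (fun x => Rh x - s x).
  by apply/funext => x; rewrite /Rh rho_padd /s; ring.
have bs x : `|s x| <= 2 * S.
  have sx : 0 <= s x by rewrite addr_ge0 ?rho_ge0.
  by rewrite (ger0_norm sx) /s; have := rho_bnd x Xp; have := rho_bnd x Xr; lra.
have bR x : `|Rh x| <= S by rewrite ger0_norm ?rho_ge0// (le_trans (rho_bnd x Xs)).
have ns : n2 s <= 2 * S.
  by apply: (le_trans (n2D Lp Lr)); have := supb_n2 p; have := supb_n2 r; lra.
have nR : n2 Rh <= S := le_trans (supb_n2 _) Spr.
have ne : n2 (fun x => Rh x - s x) = 2 * n2 (crs p r) by rewrite -Es n2Z// ger0_norm.
have Lrs := L2B LRh Ls.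
have ds : ip s s = ip (rho p) (rho p) + 2 * ip (rho p) (rho r) + ip (rho r) (rho r).
  exact: ip_expand.
split.
- have E : 4 * (ch (padd p r) - ch p - ch r) = ip (fun x => Rh x - s x) (fun x => Rh x + s x) + 2 * ip (rho p) (rho r).
    by rewrite (ipBl LRh Ls (L2D LRh Ls)) (ipDr LRh Ls LRh) (ipDr LRh Ls Ls) (ipC s Rh) ds /ch -/Rh; field.
  have h1 : `|ip (fun x => Rh x - s x) (fun x => Rh x + s x)| <= 2 * n2 (crs p r) * (3 * S).
    apply: (le_trans (ip_le Lrs (L2D LRh Ls))); rewrite ne; apply: ler_wpM2l; first by rewrite mulr_ge0.
    apply: (le_trans (n2D LRh Ls)); lra.
  have := ler_normD (ip (fun x => Rh x - s x) (fun x => Rh x + s x)) (2 * ip (rho p) (rho r)).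
  rewrite -E normrM [`|4|]ger0_norm// [`|2 * _|]ger0_norm ?mulr_ge0//.
  have := normr_ge0 (ch (padd p r) - ch p - ch r); have : 0 <= S * n2 (crs p r) by rewrite mulr_ge0.
  lra.
- have LRR : L2 (fun x => Rh x * Rh x) by exact: L2_Ml LRh.1 bR LRh.
  have Lss : L2 (fun x => s x * s x) by exact: L2_Ml Ls.1 bs Ls.
  have LRs : L2 (fun x => s x * Rh x) by exact: L2_Ml Ls.1 bs LRh.
  have Lq := L2D (L2D LRR LRs) Lss.
  have ipp : integr (fun x => s x * (rho p x * rho r x)).
    have := L2M (L2_Ml Ls.1 bs Lp) Lr; by apply: eq_integr => x; rewrite mulrA.
  have i1 := L2M Lrs Lq.
  have E : cub (padd p r) - cub p - cub r = ip (fun x => Rh x - s x) (fun x => Rh x * Rh x + s x * Rh x + s x * s x)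
      + 3 * \int[mu]_x (s x * (rho p x * rho r x)).
    rewrite /cub -/Rh -(IntZ 3 ipp) /ip -(IntD i1 (integrZ 3 ipp)).
    rewrite -(IntB (rho3_integr Xs) (rho3_integr Xp)) -(IntB (integrB (rho3_integr Xs) (rho3_integr Xp)) (rho3_integr Xr)).
    by apply: eq_Int => x; rewrite /Rh /s; ring.
  have h1 : `|ip (fun x => Rh x - s x) (fun x => Rh x * Rh x + s x * Rh x + s x * s x)| <= 2 * n2 (crs p r) * (7 * S ^+ 2).
    apply: (le_trans (ip_le Lrs Lq)); rewrite ne; apply: ler_wpM2l; first by rewrite mulr_ge0.
    have a1 : n2 (fun x => Rh x * Rh x) <= S * S.
      by apply: (le_trans (n2_Ml LRh.1 bR LRh)); rewrite ler_wpM2l.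
    have a2 : n2 (fun x => s x * Rh x) <= 2 * S * S.
      by apply: (le_trans (n2_Ml Ls.1 bs LRh)); rewrite ler_wpM2l ?mulr_ge0.
    have a3 : n2 (fun x => s x * s x) <= 2 * S * (2 * S).
      by apply: (le_trans (n2_Ml Ls.1 bs Ls)); rewrite ler_wpM2l ?mulr_ge0.
    have := n2D (L2D LRR LRs) Lss; have := n2D LRR LRs; rewrite expr2.
    by move: (n2 (fun x => _ + _)) (n2 (fun x => _ + _)) a1 a2 a3 => ? ? *; lra.
  have h2 : `|3 * \int[mu]_x (s x * (rho p x * rho r x))| <= 6 * S * ip (rho p) (rho r).
    rewrite normrM (ger0_norm (ler0n _ 3)) -[6]/(3 * 2)%:R natrM -!mulrA ler_wpM2l// mulrA.
    rewrite -(IntZ _ (L2M Lp Lr)) ger0_norm; last first.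
      by apply: Int_ge0 => x; rewrite mulr_ge0 ?mulr_ge0 ?rho_ge0// addr_ge0 ?rho_ge0.
    apply: le_Int => //; first by apply: integrZ; exact: L2M.
    move=> x; apply: ler_wpM2r; first by rewrite mulr_ge0 ?rho_ge0.
    by have := bs x; rewrite ger0_norm// addr_ge0 ?rho_ge0.
  rewrite E (le_trans (ler_normD _ _))//; lra.
- have AR := AC_rho Xs; have Ap := AC_rho Xp; have Ar := AC_rho Xr; have As := ACD Ap Ar.
  have LDR := Dabs_L2 LRh AR; have LDs := Dabs_L2 Ls As.
  have E : nl (padd p r) - nl p - nl r = ip (Dabs Rh) (fun x => Rh x - s x) + ip (Dabs s) (fun x => Rh x - s x)
      + 2 * ip (Dabs (rho p)) (rho r).
    rewrite /nl -/Rh (ipBr LRh Ls LDR) (ipBr LRh Ls LDs) (Dabs_sym Ls As LRh AR) (ipC s).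
    have -> : ip (Dabs s) s = nl p + 2 * ip (Dabs (rho p)) (rho r) + nl r by exact: (nl_expand Lp Ap Lr Ar).
    by rewrite /nl; ring.
  have sq p' : supb p' <= S -> Num.sqrt (supb p') * Num.sqrt (kin p') <= S.
    move=> H; apply: (@le_trans _ _ (Num.sqrt S * Num.sqrt S)).
      by apply: ler_pM; rewrite ?sqrtr_ge0 ?ler_wsqrtr// (le_trans (supb_kin _)).
    by rewrite -expr2 sqr_sqrtr.
  have dn p' : inX p' -> supb p' <= S -> n2 (drho p') <= 4 * S.
    move=> X' H; apply: (le_trans (n2_drho X')); rewrite -mulrA ler_wpM2l//; exact: sq.
  have h1 : `|ip (Dabs Rh) (fun x => Rh x - s x)| <= 4 * S * (2 * n2 (crs p r)).
    apply: (le_trans (ip_le LDR Lrs)); rewrite ne (n2_Dabs LRh AR) ler_wpM2r ?mulr_ge0//; exact: dn.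
  have h2 : `|ip (Dabs s) (fun x => Rh x - s x)| <= 8 * S * (2 * n2 (crs p r)).
    apply: (le_trans (ip_le LDs Lrs)); rewrite ne (n2_Dabs Ls As) ler_wpM2r ?mulr_ge0//.
    apply: (le_trans (n2D Ap.1 Ar.1)); have := dn _ Xp Sp; have := dn _ Xr Sr; lra.
  rewrite E (le_trans (ler_normD _ _))// normrM (ger0_norm (ler0n _ 2)) lerD2r.
  rewrite (le_trans (ler_normD _ _))//; lra.
Qed.

Definition ptau y p := Profile (fun x => re p (x + y)) (fun x => im p (x + y))
  (fun x => dre p (x + y)) (fun x => dim p (x + y)).

Lemma ptauE y p : ptau y p = paff 1 1 y p.
Proof. by rewrite /ptau /paff; congr Profile; apply/funext => x; rewrite !mul1r. Qed.

Lemma ptauP y p B gamma : inX p ->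
  [/\ inX (ptau y p), ch (ptau y p) = ch p & en B gamma (ptau y p) = en B gamma p].
Proof.
move=> Xp; rewrite ptauE; have [X' K' C' N' Q'] := paffP 1 y ltr01 Xp; split => //.
  by rewrite Q' expr1n divr1 mul1r.
by rewrite /en K' C' N' !expr1n divr1 !mul1r.
Qed.

Definition psub p r := padd p (pscale (-1) r).

Lemma inX_psub p r : inX p -> inX r -> inX (psub p r).
Proof. by move=> Xp Xr; apply: inX_padd => //; exact: inX_pscale. Qed.

Lemma padd_psub p r : padd p (psub r p) = r.
Proof.
by case: r => a b c d; rewrite /psub /padd /pscale/=; congr Profile; apply/funext => x; ring.
Qed.

Lemma rho_psub_le p r x : rho (psub p r) x <= 2 * (rho p x + rho r x).
Proof.
rewrite /rho/=; have := sqr_ge0 (re p x + re r x); have := sqr_ge0 (im p x + im r x); lra.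
Qed.

Lemma kin_psub_le p r : inX p -> inX r -> kin (psub p r) <= 2 * (kin p + kin r).
Proof.
move=> [Ap Bp _] [Ar Br _].
have H f g : L2 f -> L2 g -> ip (fun x => f x + -1 * g x) (fun x => f x + -1 * g x) <= 2 * (ip f f + ip g g).
  move=> Lf Lg; have Ln := L2Z (-1) Lg.
  rewrite (ip_expand Lf Ln) (ipZr _ Lg Lf) (ipZr _ Lg Ln) (ipZl _ Lg Lg).
  have := ip_expand Lf Lg; have := ip_ge0 (fun x => f x + g x); lra.
rewrite /kin/=; have := H _ _ Ap.1 Ar.1; have := H _ _ Bp.1 Br.1; lra.
Qed.

Lemma n2_psub_le p r : inX p -> inX r -> n2 (rho (psub p r)) <= 2 * (n2 (rho p) + n2 (rho r)).
Proof.
move=> Xp Xr; have [_ _ Lp] := Xp; have [_ _ Lr] := Xr; have [_ _ Ls] := inX_psub Xp Xr.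
have L := L2Z 2 (L2D Lp Lr).
apply: (@le_trans _ _ (n2 (fun x => 2 * (rho p x + rho r x)))).
  apply: n2_le => // x; rewrite !ger0_norm ?rho_ge0 ?rho_psub_le//.
  by rewrite mulr_ge0// addr_ge0 ?rho_ge0.
by rewrite (n2Z 2 (L2D Lp Lr)) ger0_norm// ler_wpM2l// n2D.
Qed.

Lemma supb_psub p r : inX p -> inX r -> supb (psub p r) <= 2 * (supb p + supb r).
Proof.
by move=> Xp Xr; rewrite /supb; have := kin_psub_le Xp Xr; have := n2_psub_le Xp Xr; lra.
Qed.


Lemma cvg_subseq (a : nat -> R) (s : nat -> nat) l : (forall k, (k <= s k)%N) ->
  a @ \oo --> l -> a (s k) @[k --> \oo] --> l.
Proof.
move=> hk ca A /ca[N _ HN]; exists N => // k Nk; apply: HN => /=.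
exact: leq_trans Nk (hk k).
Qed.

Lemma sqr_theta (I q t : R) : I < 0 -> 0 < q -> 0 < t -> t <= q ->
  I / q ^+ 2 * t ^+ 2 + I / q ^+ 2 * (q - t) ^+ 2 <= I -> t = q.
Proof.
move=> I0 q0 t0 tq H; apply/eqP; rewrite eq_le tq/= leNgt; apply/negP => lt.
have q2 : 0 < q ^+ 2 by rewrite exprn_gt0.
have E : I = I / q ^+ 2 * q ^+ 2 by rewrite divfK// gt_eqF.
have c0 : I / q ^+ 2 < 0 by rewrite pmulr_llt0// invr_gt0.
move: H; rewrite -mulrDr {2}E ler_nM2l// => H.
have : 0 < t * (q - t) by rewrite mulr_gt0// subr_gt0.
lra.
Qed.

(** A low profile has a small sextic integral, at most its maximum times [4 * q], whereas energy
    below [I / 2] forces [cub p >= 3 * I / B]. The threshold is half the level at which the two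
    would meet, so a profile below it everywhere is contradictory. *)
Lemma high_peak B gamma q I p : B < 0 -> 0 <= gamma -> 0 < q -> I < 0 -> inX p -> ch p = q ->
  en B gamma p <= I / 2 -> exists x, 3 * I / B / (8 * q) <= rho p x.
Proof.
move=> B0 g0 q0 I0 Xp Qp Ep; apply: contrapT => H.
have {}H x : rho p x <= 3 * I / B / (8 * q).
  by rewrite leNgt; apply/negP => lt; apply: H; exists x; exact: ltW.
have := cub_le Xp H; rewrite Qp.
have -> : 3 * I / B / (8 * q) * (4 * q) = 3 * I / B / 2 by field; rewrite (ltr0_neq0 B0) (lt0r_neq0 q0).
have N0 := nl_ge0 Xp; have K0 := kin_ge0 p.
have gN : 0 <= gamma / 4 * nl p by rewrite mulr_ge0// divr_ge0.
have BC : B / 6 * cub p <= I / 2.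
  by move: Ep gN K0; rewrite /en; move: (gamma / 4 * _) (B / 6 * _) => ? ? ? ? ?; lra.
have IB : 0 < I / B by rewrite nmulr_rgt0// invr_lt0.
have : 3 * (I / B) <= cub p.
  have B6 : B / 6 < 0 by rewrite pmulr_llt0.
  rewrite -(ler_nM2l B6); apply: (le_trans BC).
  by rewrite le_eqVlt; apply/orP; left; apply/eqP; field; exact: ltr0_neq0.
rewrite -mulrA; lra.
Qed.

Theorem compactness B gamma q I (P : nat -> profile) : B < 0 -> 0 <= gamma -> 0 < q -> I < 0 ->
  (forall p, inX p -> ch p = q -> I <= en B gamma p) ->
  (forall n, inX (P n) /\ ch (P n) = q) -> en B gamma (P n) @[n --> \oo] --> I ->
  exists (p : profile) (y : nat -> R) (s : nat -> nat),
    [/\ inX p, {homo s : j k / (j < k)%N >-> (j < k)%N},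
        nrm (psub (ptau (y (s k)) (P (s k))) p) @[k --> \oo] --> (0 : R),
        ch p = q & en B gamma p = I].
Proof.
move=> B0 g0 q0 I0 HI HP cE.
have low := en_lower q0 g0 HI.
(* Dropping the first [N0] terms makes the peak height and the kinetic bound uniform over all
   remaining indices. *)
have [N0 HN0] : exists N0, forall n, (N0 <= n)%N -> en B gamma (P n) <= I / 2.
  have I2 : 0 < - I / 2 by rewrite divr_gt0// oppr_gt0.
  move/cvgrPdist_le: cE => /(_ _ I2)[N _ HN]; exists N => n /HN /=.
  by rewrite ler_norml => /andP[h1 h2]; lra.
pose c1 := 3 * I / B / (8 * q).
have c10 : 0 < c1.
  have IB : 0 < I / B by rewrite nmulr_rgt0// invr_lt0.
  by rewrite /c1 -(mulrA 3); apply: divr_gt0; rewrite mulr_gt0.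
have /choice[y0 Hy0] : forall n, exists x, c1 <= rho (P (n + N0)%N) x.
  move=> n; have [Xn Qn] := HP (n + N0)%N; apply: (high_peak B0 g0 q0 I0 Xn Qn); exact: HN0 (leq_addl _ _).
pose W n := ptau (y0 n) (P (n + N0)%N).
have HW n : [/\ inX (W n), ch (W n) = q & en B gamma (W n) = en B gamma (P (n + N0)%N)].
  by have [Xn Qn] := HP (n + N0)%N; have [? -> ?] := ptauP (y0 n) B gamma Xn.
have XW n : inX (W n) by have [] := HW n.
have QW n : ch (W n) = q by have [] := HW n.
have cW n : c1 <= rho (W n) 0 by rewrite /rho/= add0r; exact: Hy0.
have cEW : en B gamma (W n) @[n --> \oo] --> I.
  rewrite (_ : (fun n => _) = (fun n => en B gamma (P (n + N0)%N))); first exact: (cvg_subseq (fun n => leq_addr N0 n) cE).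
  by apply/funext => n; have [] := HW n.
have [C HC] := coercive B0 g0 q0.
pose K := Num.max 0 (3 * (I / 2 + C)).
have K0 : 0 <= K by rewrite le_max lexx.
have KW n : kin (W n) <= K.
  rewrite le_max; apply/orP; right; apply: (le_trans (HC _ (XW n) (QW n))).
  by have [_ _ ->] := HW n; rewrite ler_wpM2l// lerD2r; exact: HN0 (leq_addl _ _).
pose S1 := 4 * Num.sqrt (4 * q) + 4 * K.
have S10 : 0 <= S1 by rewrite addr_ge0// mulr_ge0// sqrtr_ge0.
have SW n : supb (W n) <= S1.
  by rewrite /supb n2_rho_ch QW /S1 lerD2l ler_wpM2l.
have sKW n : Num.sqrt (kin (W n)) <= Num.sqrt K by rewrite ler_wsqrtr.
have bU n x : `|re (W n) x| <= Num.sqrt S1.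
  by apply: (le_trans (re_bnd x (XW n))); rewrite ler_wsqrtr.
have bV n x : `|im (W n) x| <= Num.sqrt S1.
  by apply: (le_trans (im_bnd x (XW n))); rewrite ler_wsqrtr.
have hU n x y : `|re (W n) x - re (W n) y| <= Num.sqrt K * Num.sqrt `|x - y|.
  have [A _ _] := XW n; apply: (le_trans (AC_holder y x A)); rewrite ler_wpM2r ?sqrtr_ge0//.
  exact: le_trans (n2_dre _) (sKW n).
have hV n x y : `|im (W n) x - im (W n) y| <= Num.sqrt K * Num.sqrt `|x - y|.
  have [_ A _] := XW n; apply: (le_trans (AC_holder y x A)); rewrite ler_wpM2r ?sqrtr_ge0//.
  exact: le_trans (n2_dim _) (sKW n).
have [u [v [s [uC vC hs cu cv]]]] := ultra_subsequence (sqrtr_ge0 K) bU hU bV hV.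
pose Z k := W (s k).
have AZ k : AC (re (Z k)) (dre (Z k)) by have [] := XW (s k).
have BZ k : AC (im (Z k)) (dim (Z k)) by have [] := XW (s k).
have [du Au wu] := weak_limit (sqrtr_ge0 K) AZ (fun k => le_trans (n2_dre _) (sKW (s k))) uC cu.
have [dv Av wv] := weak_limit (sqrtr_ge0 K) BZ (fun k => le_trans (n2_dim _) (sKW (s k))) vC cv.
pose p := Profile u v du dv.
have pt (f : nat -> R -> R) (g : R -> R) : (forall k x, `|x| <= k%:R -> `|f k x - g x| <= k.+1%:R^-1) ->
    forall x, f k x @[k --> \oo] --> g x.
  move=> H x; apply/cvgrPdist_le => e e0; have [N HN] := nat_ub `|x|.
  have /cvgrPdist_le/(_ _ e0)[N1 _ HN1] := @cvg_harmonic R.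
  exists (maxn N N1) => // k; rewrite /= geq_max => /andP[k1 k2]; rewrite distrC.
  apply: (le_trans (H k x (HN k k1))); have := HN1 k k2; rewrite /= sub0r normrN; exact/le_trans/ler_norm.
have crho x : rho (Z k) x @[k --> \oo] --> rho p x.
  have := pt _ _ cu x; have := pt _ _ cv x => cvx cux.
  rewrite /rho; under eq_fun do rewrite !expr2; rewrite !expr2.
  by apply: cvgD; apply: cvgM.
(* Fatou only places the limit density in L^2; whether charge escapes to infinity is decided by the
   splitting below. *)
have [Lp _] : L2 (rho p) /\ n2 (rho p) <= Num.sqrt (4 * q).
  apply: (@L2_fatou R (fun k => rho (Z k))).
  - by move=> k; have [] := XW (s k).
  - by apply: measurable_funD; apply: measurable_funX; [exact: AC_meas Au|exact: AC_meas Av].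
  - by apply: aeW => x; exact: crho.
  - exact: sqrtr_ge0.
  - by move=> k; rewrite n2_rho_ch QW.
have Xp : inX p by split.
pose r k := psub (Z k) p.
have Xr k : inX (r k) := inX_psub (XW (s k)) Xp.
have Ez k : padd p (r k) = Z k by exact: padd_psub.
pose S := 2 * (S1 + supb p).
have sp0 := supb_ge0 p.
have Sp : supb p <= S by rewrite /S; lra.
have Sr k : supb (r k) <= S.
  by apply: (le_trans (supb_psub (XW (s k)) Xp)); rewrite /S ler_wpM2l// lerD2r.
have SZ k : supb (padd p (r k)) <= S by rewrite Ez; have := SW (s k); rewrite /S; lra.
have loc k x : `|x| <= k%:R -> `|rho (r k) x| <= 2 / k.+1%:R.
  move=> xk; rewrite (ger0_norm (rho_ge0 _ _)) /rho /=.
  have := cu k x xk; have := cv k x xk; rewrite !mulN1r.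
  have i1 : k.+1%:R^-1 <= 1 :> R by rewrite invf_le1// ler1n.
  have i0 : 0 <= k.+1%:R^-1 :> R by rewrite invr_ge0.
  have sq (a b : R) : 0 <= b -> b <= 1 -> `|a| <= b -> a ^+ 2 <= b.
    move=> b0 b1 ab; rewrite -[a ^+ 2]real_normK ?num_real//.
    by apply: (@le_trans _ _ (b ^+ 2)); [rewrite ler_pXn2r ?nnegrE|rewrite expr2 ler_piMl].
  move=> /(sq _ _ i0 i1) h1 /(sq _ _ i0 i1) h2.
  by move: h1 h2; rewrite /Z; move: (k.+1%:R^-1) => a; lra.
have Lr k : L2 (rho (r k)) by have [] := Xr k.
have nr k : n2 (rho (r k)) <= S := le_trans (supb_n2 _) (Sr k).
have cd w : L2 w -> ip w (rho (r k)) @[k --> \oo] --> (0 : R).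
  by move=> Lw; exact: ip_local_small Lw Lr nr loc.
have cd1 := cd _ Lp; have cd2 := cd _ (Dabs_L2 Lp (AC_rho Xp)).
(* Here weak decay becomes strong: the squared L^2 norm of [crs p (r k)] is at most the pairing of
   [rho p] with [rho (r k)], which tends to 0. *)
have cc : n2 (crs p (r k)) @[k --> \oo] --> (0 : R).
  have : Num.sqrt (ip (rho p) (rho (r k))) @[k --> \oo] --> Num.sqrt (0 : R).
    exact: (cvg_comp _ _ cd1 (@sqrt_continuous R _)).
  rewrite sqrtr0; apply: squeeze_cvgr (cvg_cst 0); apply: nearW => k; rewrite n2_ge0/=.
  by rewrite -[leLHS]ger0_norm ?n2_ge0// -sqrtr_sqr ler_wsqrtr// n2_crs.
have ck : ip (dre p) (dre (r k)) + ip (dim p) (dim (r k)) @[k --> \oo] --> (0 : R).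
  have H (d : nat -> R -> R) (f : R -> R) : (forall k, L2 (d k)) -> L2 f ->
      ip (d k) f @[k --> \oo] --> ip f f -> ip f (fun x => d k x + -1 * f x) @[k --> \oo] --> (0 : R).
    move=> Ld Lf c; rewrite -(subrr (ip f f)).
    rewrite (_ : (fun k => _) = (fun k => ip (d k) f - ip f f)); first by apply: cvgB => //; exact: cvg_cst.
    by apply/funext => k; rewrite (ipDr (Ld k) (L2Z (-1) Lf) Lf) (ipZr (-1) Lf Lf) (ipC f (d k)) mulN1r.
  rewrite -[X in _ --> X]addr0; apply: cvgD.
    exact: (H (fun k => dre (Z k)) du (fun k => (AZ k).1) Au.1 (wu _ Au.1)).
  exact: (H (fun k => dim (Z k)) dv (fun k => (BZ k).1) Av.1 (wv _ Av.1)).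
have sp1 k : `|ch (padd p (r k)) - ch p - ch (r k)| <=
    2 * ip (rho p) (rho (r k)) + 6 * S * n2 (crs p (r k)).
  by have [] := split_bound Xp (Xr k) Sp (Sr k) (SZ k).
have sp2 k : `|cub (padd p (r k)) - cub p - cub (r k)| <=
    14 * S ^+ 2 * n2 (crs p (r k)) + 6 * S * ip (rho p) (rho (r k)).
  by have [] := split_bound Xp (Xr k) Sp (Sr k) (SZ k).
have sp3 k : `|nl (padd p (r k)) - nl p - nl (r k)| <=
    24 * S * n2 (crs p (r k)) + 2 * `|ip (Dabs (rho p)) (rho (r k))|.
  by have [] := split_bound Xp (Xr k) Sp (Sr k) (SZ k).
have small (f g : nat -> R) : (forall k, `|f k| <= g k) -> g k @[k --> \oo] --> (0 : R) -> f k @[k --> \oo] --> (0 : R).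
  move=> fg g0'; apply: norm_cvg0; apply: squeeze_cvgr (cvg_cst 0) g0'.
  by apply: nearW => k; rewrite normr_ge0 fg.
have c1d : 2 * ip (rho p) (rho (r k)) + 6 * S * n2 (crs p (r k)) @[k --> \oo] --> (0 : R).
  rewrite (_ : 0 = 2 * 0 + 6 * S * 0); last by rewrite !mulr0 addr0.
  by apply: cvgD; apply: cvgM => //; exact: cvg_cst.
have cch : ch (r k) @[k --> \oo] --> q - ch p.
  have := small _ _ sp1 c1d.
  move=> H; have := cvgB (cvg_cst (q - ch p)) H; rewrite subr0 => /(_ _ _); apply: cvg_trans.
  rewrite (_ : (fun k => ch (r k)) = (fun k => (q - ch p) - (ch (padd p (r k)) - ch p - ch (r k))))//.
  by apply/funext => k; rewrite Ez QW; ring.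
have ccub : cub (padd p (r k)) - cub p - cub (r k) @[k --> \oo] --> (0 : R).
  apply: (small _ _ sp2).
  rewrite (_ : 0 = 14 * S ^+ 2 * 0 + 6 * S * 0); last by rewrite !mulr0 addr0.
  by apply: cvgD; apply: cvgM => //; exact: cvg_cst.
have cnl : nl (padd p (r k)) - nl p - nl (r k) @[k --> \oo] --> (0 : R).
  apply: (small _ _ sp3).
  have z : 24 * S * 0 + 2 * `|0 : R| = 0 by rewrite normr0 !mulr0 addr0.
  rewrite -[X in _ --> X]z; apply: cvgD; (apply: cvgM; first exact: cvg_cst).
    exact: cc.
  exact: (cvg_norm cd2).
have cen : en B gamma (r k) @[k --> \oo] --> I - en B gamma p.
  have cEZ : en B gamma (Z k) @[k --> \oo] --> I.
    have hk k : (k <= s k)%N by elim: k => // k IH; apply: leq_ltn_trans IH _; exact: hs.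
    exact: (cvg_subseq hk cEW).
  have -> : I - en B gamma p = I - en B gamma p - 0 - B / 6 * 0 - gamma / 4 * 0 by ring.
  rewrite (_ : (fun k => en B gamma (r k)) = (fun k => en B gamma (Z k) - en B gamma p
     - (ip (dre p) (dre (r k)) + ip (dim p) (dim (r k)))
     - B / 6 * (cub (padd p (r k)) - cub p - cub (r k)) - gamma / 4 * (nl (padd p (r k)) - nl p - nl (r k)))).
    apply: cvgB; last by apply: cvgM => //; exact: cvg_cst.
    apply: cvgB; last by apply: cvgM => //; exact: cvg_cst.
    by apply: cvgB => //; apply: cvgB => //; exact: cvg_cst.
  by apply/funext => k; rewrite -(Ez k) /en (kin_padd Xp (Xr k)); field.
(* The translations put a peak of height [c1] at the origin, and it survives in the limit at that
   point, so [p] is not zero. *)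
have th0 : 0 < ch p.
  rewrite lt_def ch_ge0 andbT; apply/negP => /eqP Q; have := crho 0; rewrite (ch_eq0 Xp Q) => H.
  have : c1 <= 0 by apply: (@cvgr_to_ge _ _ _ _ _ _ _ H); apply: nearW => k; exact: cW.
  lra.
have thq : ch p <= q.
  by rewrite -subr_ge0; apply: (@cvgr_to_ge _ _ _ _ _ _ _ cch); apply: nearW => k; exact: ch_ge0.
have lowr : I / q ^+ 2 * (q - ch p) ^+ 2 <= I - en B gamma p.
  rewrite -subr_ge0.
  have H : en B gamma (r k) - I / q ^+ 2 * (ch (r k) * ch (r k)) @[k --> \oo] -->
      I - en B gamma p - I / q ^+ 2 * ((q - ch p) * (q - ch p)).
    by apply: cvgB => //; apply: cvgM; [exact: cvg_cst|exact: cvgM].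
  rewrite expr2; apply: (@cvgr_to_ge _ _ _ _ _ _ _ H); apply: nearW => k.
  by rewrite subr_ge0 -expr2; exact: low.
have lowp := low _ Xp.
(* The lower bounds for [p] and for the remainder add up to [theta^2 + (q - theta)^2 >= q^2], the
   negative factor [I / q^2] reversing the inequality; with [0 < theta <= q] only [theta = q] is
   possible. *)
have Qp : ch p = q by apply: (sqr_theta I0 q0 th0 thq); lra.
have Ep : en B gamma p = I.
  apply/eqP; rewrite eq_le HI// andbT -subr_ge0.
  by move: lowr; rewrite Qp subrr expr0n mulr0.
(* The working sequence was shifted by [N0]; the translations are reindexed so that the one at
   [s k + N0] is [y0 (s k)]. *)
exists p, (fun n => y0 (n - N0)%N), (fun k => (s k + N0)%N); split => //.
  by move=> j k /hs; rewrite ltn_add2r.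
rewrite (_ : (fun k => _) = (fun k => nrm (r k))); last by apply/funext => k; rewrite addnK.
rewrite Qp subrr in cch; rewrite Ep subrr in cen.
(* The nonlocal term is nonnegative and the sextic one is at most a multiple of the charge, so
   vanishing energy and charge force the kinetic part to vanish. *)
have ckin : kin (r k) @[k --> \oo] --> (0 : R).
  apply: (small _ (fun k => 2 * (en B gamma (r k) + - B / 6 * (S * (4 * ch (r k)))))).
    move=> k; rewrite (ger0_norm (kin_ge0 _)).
    have H := cub_le (Xr k) (fun x => le_trans (rho_bnd x (Xr k)) (Sr k)).
    have B6 : 0 <= - B / 6 by rewrite divr_ge0// oppr_ge0 ltW.
    have := ler_wpM2l B6 H; have : 0 <= gamma / 4 * nl (r k) by rewrite mulr_ge0 ?nl_ge0// divr_ge0.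
    rewrite /en !mulNr; move: (gamma / 4 * _) (B / 6 * _) (B / 6 * _) => ? ? ?; lra.
  rewrite (_ : 0 = 2 * (0 + - B / 6 * (S * (4 * 0)))); last by rewrite !mulr0 addr0 mulr0.
  apply: cvgM; first exact: cvg_cst.
  apply: cvgD => //; apply: cvgM; first exact: cvg_cst.
  by apply: cvgM; [exact: cvg_cst|apply: cvgM => //; exact: cvg_cst].
rewrite /nrm (_ : 0 = Num.sqrt 0 + Num.sqrt (Num.sqrt (4 * 0))); last by rewrite mulr0 !sqrtr0 addr0.
apply: cvgD; first exact: (cvg_comp _ _ ckin (@sqrt_continuous R _)).
have c4 : 4 * ch (r k) @[k --> \oo] --> 4 * (0 : R) by apply: cvgM => //; exact: cvg_cst.
have c5 := cvg_comp _ _ c4 (@sqrt_continuous R _).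
have := cvg_comp _ _ c5 (@sqrt_continuous R _); apply: cvg_trans.
rewrite (_ : (fun k => Num.sqrt (n2 (rho (r k)))) =
  (fun k => Num.sqrt (Num.sqrt (4 * ch (r k)))))//.
by apply/funext => k; rewrite -n2_rho_ch.
Qed.

End Compactness.

(** * Continuous representatives *)

Section Representatives.
Context {R : realType}.
Local Notation mu := (@lebesgue_measure R).
Local Notation RR := (measurableTypeR R).
Local Notation profile := (@profile R).
Local Notation cre f := (fun x => complex.Re (f x)).
Local Notation cim f := (fun x => complex.Im (f x)).
Implicit Types (a b c e t x y z l B gamma q I : R).
Implicit Types p r : profile.
Implicit Types psi phi chi : R -> R[i].

(** The link between a function of the specification and a continuous representative. Measurability
    is recorded separately because almost everywhere equality with a Borel function does not imply
    it. *)
Definition rep psi p := [/\ inX p, measurable_fun setT (cre psi), measurable_fun setT (cim psi),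
  aeq (cre psi) (re p) & aeq (cim psi) (im p)].

Lemma rep_rho psi p : rep psi p -> measurable_fun setT (density psi) /\ aeq (density psi) (rho p).
Proof.
move=> [_ mr mi er ei]; split; first by apply: measurable_funX; exact: measurable_normc.
by apply: filterS2 er ei => x er ei; rewrite /density normc_sqr er ei.
Qed.

Lemma spaceX_rep psi : spaceX psi -> exists p, rep psi p.
Proof.
move=> [L4 [dpsi [[Wr Wi] /cLp2P[Lr Li]]]].
have [u Au eu] := weak_AC Wr Lr; have [v Av ev_] := weak_AC Wi Li.
have [mr mi _] := L4; exists (Profile u v (cre dpsi) (cim dpsi)); split => //; split => //.
have L2d : L2 (density psi).
  split; first by apply: measurable_funX; exact: measurable_normc.
  by apply: eq_integr (cLp_integr (ltn0Sn 3) L4) => x; rewrite /density -exprM.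
apply: aeq_L2 L2d; first by apply: measurable_funD; apply: measurable_funX; [exact: AC_meas Au|exact: AC_meas Av].
by apply: filterS2 eu ev_ => x er ei; rewrite /density normc_sqr er ei.
Qed.

Lemma rep_weak psi p : rep psi p -> is_weak_derivative (cre psi) (dre p) /\ is_weak_derivative (cim psi) (dim p).
Proof.
move=> [[Au Av _] mr mi er ei]; split.
  by apply: aeq_weak (AC_weak Au) => //; [exact: L2_meas Au.1|exact: aeq_sym|exact: aeq_refl].
by apply: aeq_weak (AC_weak Av) => //; [exact: L2_meas Av.1|exact: aeq_sym|exact: aeq_refl].
Qed.

Lemma rep_normc psi p k : rep psi p -> measurable_fun setT (fun x => normc (psi x) ^+ (2 * k)) /\
  aeq (fun x => normc (psi x) ^+ (2 * k)) (fun x => rho p x ^+ k).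
Proof.
move=> H; have [md ed] := rep_rho H; have [_ mr mi _ _] := H; split.
  by apply: measurable_funX; exact: measurable_normc.
by apply: filterS ed => x <-; rewrite exprM.
Qed.

Lemma rep_spaceX psi p : rep psi p -> spaceX psi.
Proof.
move=> H; have [[Au Av Lr] mr mi er ei] := H; have [Wr Wi] := rep_weak H.
have [m4 e4] := rep_normc 2 H; split.
  apply: (integr_cLp (ltn0Sn 3)) => //; apply: aeq_integr (aeq_sym e4) Lr.2; exact: m4.
exists (fun x => dre p x +i* dim p x); split; first by split.
by apply/cLp2P; split; [exact: Au.1|exact: Av.1].
Qed.

Lemma weak_derivative_spec (f g : R -> R) : is_weak_derivative f g ->
  measurable_fun setT (weak_derivative f) /\ aeq (weak_derivative f) g.
Proof.
move=> W; have := @xgetPex _ (fun=> 0) [set g | is_weak_derivative f g] (ex_intro _ g W).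
rewrite /= -/(weak_derivative f) => W'; split; last exact: weak_unique W' W.
by have [_ [] ] := W'.
Qed.

Lemma rep_cwd psi p : rep psi p ->
  [/\ measurable_fun setT (cre (cweak_derivative psi)), measurable_fun setT (cim (cweak_derivative psi)),
      aeq (cre (cweak_derivative psi)) (dre p) & aeq (cim (cweak_derivative psi)) (dim p)].
Proof.
move=> /rep_weak[/weak_derivative_spec[m1 e1] /weak_derivative_spec[m2 e2]]; by split.
Qed.

Lemma rep_kin psi p : rep psi p ->
  integr (fun x => normc (cweak_derivative psi x) ^+ 2) /\
  \int[mu]_x (normc (cweak_derivative psi x) ^+ 2) = kin p.
Proof.
move=> H; have [m1 m2 e1 e2] := rep_cwd H; have [[Au Av _] _ _ _ _] := H.
have m : measurable_fun setT (fun x => normc (cweak_derivative psi x) ^+ 2).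
  by apply: measurable_funX; exact: measurable_normc.
have e : aeq (fun x => normc (cweak_derivative psi x) ^+ 2) (fun x => dre p x * dre p x + dim p x * dim p x).
  by apply: filterS2 e1 e2 => x h1 h2; rewrite normc_sqr h1 h2 !expr2.
have i := integrD (L2M Au.1 Au.1) (L2M Av.1 Av.1); split.
  exact: aeq_integr m (aeq_sym e) i.
by rewrite (aeq_Int m (integr_meas i) e) (IntD (L2M Au.1 Au.1) (L2M Av.1 Av.1)).
Qed.

Lemma energy_rep B gamma psi p : rep psi p -> energy B gamma psi = en B gamma p.
Proof.
move=> H; have [ik Ik] := rep_kin H; have [Xp _ _ _ _] := H; have [_ _ Lr] := Xp.
have [m6 e6] := rep_normc 3 H; have [md ed] := rep_rho H.
have [ih Ih] := half_derivative_energy Lr (AC_rho Xp) md ed.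
have i6 := aeq_integr m6 (aeq_sym e6) (rho3_integr Xp).
rewrite /energy (IntD (integrD (integrZ _ ik) (integrZ _ i6)) (integrZ _ ih)).
rewrite (IntD (integrZ _ ik) (integrZ _ i6)) !IntZ// Ik Ih /en; congr (_ + _ * _ + _).
exact: aeq_Int m6 (integr_meas (rho3_integr Xp)) e6.
Qed.

Lemma charge_rep psi p : rep psi p -> charge4 psi = ch p.
Proof.
move=> H; have [[_ _ Lr] _ _ _ _] := H; have [m4 e4] := rep_normc 2 H.
rewrite /charge4 /ch; congr (_ * _); rewrite (aeq_Int m4 (integr_meas Lr.2) e4).
by apply: eq_Int => x; rewrite expr2.
Qed.

Lemma normX_rep psi p : rep psi p -> normX psi = (nrm p)%:E.
Proof.
move=> H; have [ik Ik] := rep_kin H; have [m1 m2 e1 e2] := rep_cwd H.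
have [L4 _] := rep_spaceX H.
have L2' : cLp 2%:E (cweak_derivative psi) by exact: (integr_cLp (ltn0Sn 1) m1 m2 ik).
rewrite /normX (cLnorm2 L2') (cLnorm4 L4) -EFinD; congr _%:E; congr (_ + _).
  by rewrite /c2 Ik.
have f4 : 4^-1 != 0 :> R by rewrite invr_eq0 pnatr_eq0.
by have := charge_rep H; rewrite /charge4 /ch /c4 => /(mulfI f4) ->.
Qed.

Lemma rep_add psi phi p r : rep psi p -> rep phi r -> rep (psi \+ phi) (padd p r).
Proof.
move=> [Xp mr mi er ei] [Xp' mr' mi' er' ei'].
have E1 : cre (psi \+ phi) = (fun x => complex.Re (psi x) + complex.Re (phi x)).
  by apply/funext => x /=; case: (psi x) (phi x) => ? ? [].
have E2 : cim (psi \+ phi) = (fun x => complex.Im (psi x) + complex.Im (phi x)).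
  by apply/funext => x /=; case: (psi x) (phi x) => ? ? [].
split; [exact: inX_padd|by rewrite E1; exact: measurable_funD|by rewrite E2; exact: measurable_funD| |].
  by rewrite E1; apply: filterS2 er er' => x /= -> ->.
by rewrite E2; apply: filterS2 ei ei' => x /= -> ->.
Qed.

Lemma rep_scale a psi p : rep psi p -> rep (fun x => a%:C * psi x) (pscale a p).
Proof.
move=> [Xp mr mi er ei].
have E1 : cre (fun x => a%:C * psi x) = (fun x => a * complex.Re (psi x)).
  by apply/funext => x /=; case: (psi x) => ? ? /=; ring.
have E2 : cim (fun x => a%:C * psi x) = (fun x => a * complex.Im (psi x)).
  by apply/funext => x /=; case: (psi x) => ? ? /=; ring.
split; [exact: inX_pscale|by rewrite E1; exact: measurable_funM|by rewrite E2; exact: measurable_funM| |].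
  by rewrite E1; apply: filterS er => x /= ->.
by rewrite E2; apply: filterS ei => x /= ->.
Qed.

Lemma rep_tau y psi p : rep psi p -> rep (fun x => psi (x + y)) (ptau y p).
Proof.
move=> [Xp mr mi er ei]; have [Au Av _] := Xp.
have [X' _ _] := ptauP y 0 0 Xp; have o := oner_neq0 R.
split => //.
- by have := measurable_comp_affine 1 y mr; under eq_fun do rewrite mul1r.
- by have := measurable_comp_affine 1 y mi; under eq_fun do rewrite mul1r.
- by have := aeq_comp_affine y o mr (AC_meas Au) er; apply: filterS => x; rewrite mul1r.
- by have := aeq_comp_affine y o mi (AC_meas Av) ei; apply: filterS => x; rewrite mul1r.
Qed.

Definition cfun p : R -> R[i] := fun x => re p x +i* im p x.

Lemma rep_cfun p : inX p -> rep (cfun p) p.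
Proof.
move=> Xp; have [Au Av _] := Xp.
by split => //; [exact: AC_meas Au|exact: AC_meas Av|exact: aeq_refl|exact: aeq_refl].
Qed.

Lemma rep_sub psi phi p r : rep psi p -> rep phi r -> rep (fun x => psi x - phi x) (psub p r).
Proof.
move=> H H'; have := rep_add H (rep_scale (-1) H'); congr rep; apply/funext => x /=.
by case: (psi x) (phi x) => ? ? [? ?]; apply/eqP; rewrite eq_complex /=; apply/andP; split; apply/eqP; ring.
Qed.

(** Fréchet derivatives are functionals of functions, whereas [lE] and [lQ] act on profiles, hence a
    choice, with the default [p0] outside the space. Derivatives are determined only almost
    everywhere, so [lE_rep] has to make the result independent of the choice. *)
Definition prof phi : profile :=
  if pselect (exists r, rep phi r) is left H then projT1 (cid H) else p0.

Lemma prof_rep phi : spaceX phi -> rep phi (prof phi).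
Proof.
move=> /spaceX_rep H; rewrite /prof; case: pselect => // H'.
by case: (cid H').
Qed.

Lemma lE_rep B gamma p phi r s : inX p -> rep phi r -> rep phi s ->
  lE B gamma p r = lE B gamma p s /\ lQ p r = lQ p s.
Proof.
move=> Xp Hr Hs; have [Ap Bp _] := Xp.
have [[Ar Br _] _ _ er ei] := Hr; have [[As Bs _] _ _ er' ei'] := Hs.
have Ere : re r = re s.
  by apply: aeq_continuous; [exact: AC_continuous Ar|exact: AC_continuous As|exact: aeq_trans (aeq_sym er) er'].
have Eim : im r = im s.
  by apply: aeq_continuous; [exact: AC_continuous Br|exact: AC_continuous Bs|exact: aeq_trans (aeq_sym ei) ei'].
have Ec : crs p r = crs p s by rewrite /crs Ere Eim.
have [W1 W2] := rep_weak Hr; have [W1' W2'] := rep_weak Hs.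
have E1 : ip (dre p) (dre r) = ip (dre p) (dre s).
  by apply: aeq_ip (aeq_refl _) (weak_unique W1 W1'); [exact: Ap.1.1|exact: Ap.1.1|exact: Ar.1.1|exact: As.1.1].
have E2 : ip (dim p) (dim r) = ip (dim p) (dim s).
  by apply: aeq_ip (aeq_refl _) (weak_unique W2 W2'); [exact: Bp.1.1|exact: Bp.1.1|exact: Br.1.1|exact: Bs.1.1].
by rewrite /lE /lQ E1 E2 Ec.
Qed.

(** Shared by energy and charge: a remainder quadratic in [nrm] on the unit ball is [o(normX)], with
    [delta = min 1 (eps / (C + 1))]. *)
Lemma frechet_of_remainder (F : (R -> R[i]) -> R) (G l : profile -> R) p (C D : R) : inX p ->
  (forall psi r, rep psi r -> F psi = G r) ->
  (forall phi r s, rep phi r -> rep phi s -> l r = l s) ->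
  (forall t r s, inX r -> inX s -> l (padd (pscale t r) s) = t * l r + l s) ->
  (forall r, inX r -> `|l r| <= D * nrm r) -> 0 <= C ->
  (forall r, inX r -> nrm r <= 1 -> `|G (padd p r) - G p - l r| <= C * nrm r ^+ 2) ->
  frechet_derivative F (cfun p) (fun phi => l (prof phi)).
Proof.
move=> Xp HF Hl Hlin HD C0 HC; have Rp := rep_cfun Xp; split.
- move=> a phi chi Sp Sc; have H1 := prof_rep Sp; have H2 := prof_rep Sc.
  have H3 := rep_add (rep_scale a H1) H2; have [X1 _ _ _ _] := H1; have [X2 _ _ _ _] := H2.
  rewrite -(Hlin _ _ _ X1 X2); exact: (Hl _ _ _ (prof_rep (rep_spaceX H3)) H3).
- exists D => phi Sp; have H1 := prof_rep Sp; have [X1 _ _ _ _] := H1.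
  by rewrite (normX_rep H1) -EFinM lee_fin HD.
- move=> eps e0; pose d := Num.min 1 (eps / (C + 1)).
  have C1 : 0 < C + 1 by rewrite ltr_wpDl.
  exists d; first by rewrite lt_min ltr01 divr_gt0.
  move=> phi Sp; have H1 := prof_rep Sp; have [X1 _ _ _ _] := H1.
  rewrite (normX_rep H1) lte_fin lt_min => /andP[n1 n2_]; rewrite -EFinM lee_fin.
  rewrite (HF _ _ (rep_add Rp H1)) (HF _ _ Rp); apply: (le_trans (HC _ X1 (ltW n1))).
  have k0 := nrm_ge0 (prof phi); rewrite expr2 mulrA ler_wpM2r//.
  have := ltW n2_; rewrite ler_pdivlMr// => h; apply: le_trans h.
  by rewrite mulrC ler_wpM2l// lerDl.
Qed.

Lemma L2_Lfun (w : R -> R) : L2 w -> w \in Lfun mu 2%:E.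
Proof.
move=> [mw iw]; rewrite inE; apply/andP; split; rewrite inE//=.
rewrite /finite_norm unlock /=; apply: poweR_lty.
rewrite (_ : (\int[mu]_x _)%E = (\int[mu]_x (w x ^+ 2)%:E)%E); first by rewrite EFin_Int ?ltry.
apply: eq_integral => x _; rewrite /= powR_mulrn// real_normK ?num_real//.
Qed.

Lemma Re_weak (a b c d : R[i]) (k : R) : complex.Re (a * conjc b + k%:C * c * conjc d) =
  complex.Re a * complex.Re b + complex.Im a * complex.Im b
  + k * (complex.Re c * complex.Re d + complex.Im c * complex.Im d).
Proof. by case: a b c d => ? ? [? ?] [? ?] [? ?] /=; ring. Qed.

Lemma Im_weak (a b c d : R[i]) (k : R) : complex.Im (a * conjc b + k%:C * c * conjc d) =
  complex.Re a * - complex.Im b + complex.Im a * complex.Re b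
  + k * (complex.Re c * - complex.Im d + complex.Im c * complex.Re d).
Proof. by case: a b c d => ? ? [? ?] [? ?] [? ?] /=; ring. Qed.

(** Multiplication by [i]. The imaginary part of the complex weak equation tested with [r] is its
    real part tested with [prot r], so the real identity for all [r] yields both components. *)
Definition prot p := Profile (fun x => - im p x) (re p) (fun x => - dim p x) (dre p).

Lemma inX_prot p : inX p -> inX (prot p).
Proof.
move=> [Au Av Lr]; split; [exact: ACN|exact: Au|].
by rewrite (_ : rho (prot p) = rho p)//; apply/funext => x; rewrite /rho/= sqrrN addrC.
Qed.

Lemma weak_form A B gamma p r : inX p -> inX r ->
  integr (fun x => dre p x * dre r x + dim p x * dim r x
    + (A * rho p x + B * rho p x ^+ 2 + gamma * Dabs (rho p) x) * crs p r x) /\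
  \int[mu]_x (dre p x * dre r x + dim p x * dim r x
    + (A * rho p x + B * rho p x ^+ 2 + gamma * Dabs (rho p) x) * crs p r x) =
  lE B gamma p r + A * lQ p r.
Proof.
move=> Xp Xr; have [Ap Bp Lp] := Xp; have [Ar Br Lr] := Xr.
have LD := Dabs_L2 Lp (AC_rho Xp); have Lc := L2_crs Xp Xr.
have b_p x : `|rho p x| <= supb p by rewrite ger0_norm ?rho_ge0// rho_bnd.
have L2r : L2 (fun x => rho p x ^+ 2).
  have := L2_Ml Lp.1 b_p Lp; congr L2; apply/funext => x; exact: expr2.
have i1 := L2M Ap.1 Ar.1; have i2 := L2M Bp.1 Br.1.
have i3 := integrZ A (L2M Lp Lc); have i4 := integrZ B (L2M L2r Lc); have i5 := integrZ gamma (L2M LD Lc).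
have i := integrD (integrD i1 i2) (integrD (integrD i3 i4) i5).
have E x : dre p x * dre r x + dim p x * dim r x + (A * (rho p x * crs p r x)
   + B * (rho p x ^+ 2 * crs p r x) + gamma * (Dabs (rho p) x * crs p r x)) =
  dre p x * dre r x + dim p x * dim r x
    + (A * rho p x + B * rho p x ^+ 2 + gamma * Dabs (rho p) x) * crs p r x by ring.
split; first exact: eq_integr E i.
rewrite -(eq_Int E) (IntD (integrD i1 i2) (integrD (integrD i3 i4) i5)) (IntD i1 i2).
rewrite (IntD (integrD i3 i4) i5) (IntD i3 i4).
rewrite (IntZ A (L2M Lp Lc)) (IntZ B (L2M L2r Lc)) (IntZ gamma (L2M LD Lc)) /lE /lQ /ip; ring.
Qed.

Lemma weak_solution_profile m B gamma p : inX p ->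
  (forall r, inX r -> lE B gamma p r = m * lQ p r) -> weak_solution (- m) B gamma (cfun p).
Proof.
move=> Xp H; have [Ap Bp Lp] := Xp; have Arho := AC_rho Xp; have LD := Dabs_L2 Lp Arho.
have Rp := rep_cfun Xp; have Ed : density (cfun p) = rho p.
  by apply/funext => x; rewrite /density normc_sqr.
exists (Dabs (rho p)); split; first by rewrite Ed (hilbertE Lp Arho); exact: hilb_weak Lp Arho.
  exact: L2_Lfun.
move=> phi Sphi; have [r Rr] := spaceX_rep Sphi.
have [Xr mr mi er ei] := Rr; have [Ar Br Lr] := Xr.
have [d1 d2 e1 e2] := rep_cwd Rp; have [d1' d2' e1' e2'] := rep_cwd Rr.
pose K x := - m * rho p x + B * rho p x ^+ 2 + gamma * Dabs (rho p) x.
have mK : measurable_fun setT K.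
  apply: measurable_funD; last by apply: measurable_funM => //; exact: L2_meas LD.
  apply: measurable_funD; apply: measurable_funM => //; [exact: Lp.1|].
  by apply: measurable_funX; exact: Lp.1.
have KE x : - m * normc (cfun p x) ^+ 2 + B * normc (cfun p x) ^+ 4 + gamma * Dabs (rho p) x = K x.
  by rewrite /K -[normc _ ^+ 4]/(normc _ ^+ (2 * 2)) exprM normc_sqr.
have mre := AC_meas Ap; have mim := AC_meas Bp.
have zero s : inX s -> lE B gamma p s + - m * lQ p s = 0 by move=> Xs; rewrite H// mulNr subrr.
have cz (a b : R) : a = 0 -> b = 0 -> a +i* b = 0 by move=> -> ->.
rewrite /cintegral; apply: cz.
- transitivity (\int[mu]_x (dre p x * dre r x + dim p x * dim r x + K x * crs p r x)).
    apply: aeq_Int.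
    + under eq_fun do rewrite KE Re_weak.
      by apply: measurable_funD; [|apply: measurable_funM => //]; apply: measurable_funD; exact: measurable_funM.
    + exact: integr_meas (weak_form (- m) B gamma Xp Xr).1.
    + apply: filterS2 (filterI e1 e2) (filterI (filterI e1' e2') (filterI er ei)) => x [h1 h2] [[h1' h2'] [h3 h4]].
      by rewrite KE Re_weak h1 h2 h1' h2' h3 h4.
  by rewrite (weak_form (- m) B gamma Xp Xr).2 zero.
- have Xs := inX_prot Xr.
  transitivity (\int[mu]_x (dre p x * dre (prot r) x + dim p x * dim (prot r) x + K x * crs p (prot r) x)).
    apply: aeq_Int.
    + under eq_fun do rewrite KE Im_weak.
      have mN (f : R -> R) : measurable_fun setT f -> measurable_fun setT (fun x => - f x).
        by move=> mf; exact: (measurableT_comp (@measurable_oppR R) mf).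
      by apply: measurable_funD; [|apply: measurable_funM => //]; apply: measurable_funD; apply: measurable_funM => //; exact: mN.
    + exact: integr_meas (weak_form (- m) B gamma Xp Xs).1.
    + apply: filterS2 (filterI e1 e2) (filterI (filterI e1' e2') (filterI er ei)) => x [h1 h2] [[h1' h2'] [h3 h4]].
      by rewrite KE Im_weak h1 h2 h1' h2' h3 h4.
  by rewrite (weak_form (- m) B gamma Xp Xs).2 zero.
Qed.

Lemma inf_energyP B gamma q : B < 0 -> 0 <= gamma -> 0 < q -> exists I,
  [/\ inf_energy B gamma q = I%:E, I < 0 & forall p, inX p -> ch p = q -> I <= en B gamma p].
Proof.
move=> B0 g0 q0; have [C HC] := coercive B0 g0 q0.
have [p1 [X1 Q1 E1]] := negative_energy gamma B0 q0.
have lb p : inX p -> ch p = q -> (inf_energy B gamma q <= (en B gamma p)%:E)%E.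
  move=> Xp Qp; apply: ereal_inf_lbound; exists (cfun p); last by rewrite (energy_rep _ _ (rep_cfun Xp)).
  by split; [exact: rep_spaceX (rep_cfun Xp)|rewrite (charge_rep (rep_cfun Xp))].
have ge : ((- C)%:E <= inf_energy B gamma q)%E.
  apply: le_ereal_inf_tmp => _ [psi [/spaceX_rep[p Hp] Qp] <-].
  rewrite (charge_rep Hp) in Qp; rewrite (energy_rep _ _ Hp) lee_fin.
  by have [Xp _ _ _ _] := Hp; have := HC _ Xp Qp; have := kin_ge0 p; lra.
have le1 := lb _ X1 Q1.
have fin : inf_energy B gamma q \is a fin_num.
  by rewrite fin_numE -ltNye -ltey (lt_le_trans (ltNyr _) ge) (le_lt_trans le1 (ltry _)).
exists (fine (inf_energy B gamma q)); rewrite fineK//; split => //.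
  by rewrite -lte_fin fineK// (le_lt_trans le1)// lte_fin.
by move=> p Xp Qp; rewrite -lee_fin fineK// lb.
Qed.

End Representatives.

Theorem theorem6p7 (R : realType) (B gamma q : R)
    (hB : B < 0) (hgamma : 0 <= gamma) (hq : 0 < q) :
  exists m : R, forall psi_ : nat -> R -> R[i],
    minimizing_sequence B gamma q psi_ ->
    exists (psi : R -> R[i]) (y : nat -> R) (s : nat -> nat),
      [/\ spaceX psi,
          {homo s : j k / (j < k)%N >-> (j < k)%N},
          (fun k => normX (fun x => psi_ (s k) (x + y (s k)) - psi x))
            @ \oo --> 0%E,
          minimizer B gamma q psi &
          lagrange_multiplier B gamma psi m /\
          weak_solution (- m) B gamma psi].
Proof.
have [I [EI I0 HI]] := inf_energyP hB hgamma hq.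
exists (2 * I / q) => psi_ [Hpsi cpsi].
have /choice[P HP] : forall n, exists p, rep (psi_ n) p by move=> n; exact: spaceX_rep (Hpsi n).1.
have XP n : inX (P n) /\ ch (P n) = q.
  by rewrite -(charge_rep (HP n)); split; [have [] := HP n|exact: (Hpsi n).2].
have cE : en B gamma (P n) @[n --> \oo] --> I.
  move: cpsi; rewrite EI (_ : (fun n => _) = (fun n => (en B gamma (P n))%:E)).
    by move=> /fine_cvgP[].
  by apply/funext => n; rewrite (energy_rep _ _ (HP n)).
have [p [y [s [Xp hs cn Qp Ep]]]] := compactness hB hgamma hq I0 HI XP cE.
have Rp := rep_cfun Xp; have LL := lagrange hq hgamma HI Xp Qp Ep.
have [C C0 HC] := remainder B gamma Xp.
have [DE HDE] := lE_bnd B gamma Xp; have [DQ HDQ] := lQ_bnd Xp.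
exists (cfun p), y, s; split => //.
- exact: rep_spaceX Rp.
- rewrite (_ : (fun k => _) = (fun k => (nrm (psub (ptau (y (s k)) (P (s k))) p))%:E)).
    by apply: cvg_EFin => //; exact: nearW.
  by apply/funext => k; exact: (normX_rep (rep_sub (rep_tau (y (s k)) (HP (s k))) Rp)).
- split; [exact: rep_spaceX Rp|by rewrite (charge_rep Rp)|].
  by rewrite (energy_rep _ _ Rp) Ep EI.
split; last exact: weak_solution_profile Xp LL.
exists (fun phi => lE B gamma p (prof phi)), (fun phi => lQ p (prof phi)); split.
- apply: (frechet_of_remainder (C := C) (D := DE) Xp (energy_rep B gamma)) => //.
  + by move=> phi r t Hr Ht; have [] := lE_rep B gamma Xp Hr Ht.
  + by move=> t r u Xr Xu; exact: lE_lin.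
  + by move=> r Xr k1; have [] := HC r Xr k1.
- apply: (frechet_of_remainder (C := C) (D := DQ) Xp charge_rep) => //.
  + by move=> phi r t Hr Ht; have [] := lE_rep B gamma Xp Hr Ht.
  + by move=> t r u Xr Xu; exact: lQ_lin.
  + by move=> r Xr k1; have [] := HC r Xr k1.
- by move=> phi /prof_rep[Xr _ _ _ _]; exact: LL.
Qed.
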